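(* Let $M$ be a Riemann surface, $D\subset M$ a discrete subset, and $G\subset\mathrm U(n)$ a compact Lie subgroup with complexification $G^{\mathrm c}$. Let $\Psi:M\setminus D\to\Lambda_{\rm alg}G^{\mathrm c}$ be a complex extended solution which extends to a meromorphic map $\Psi:M\to\Lambda\mathfrak{gl}(n,\mathbb C)$. Set $\Phi=\Psi_u$ on $M\setminus D$, where $\Psi=\Psi_u\Psi_+$ is the pointwise Iwasawa decomposition. Then $\Phi$ extends to an extended solution on $M$ and is given explicitly by algebraic formulae in the entries of $\Psi$, as follows. The columns $L^1,\dots,L^n$ of $\Psi$ give a meromorphic basis for $W \bmod \lambda W$, where $W=\Psi\mathcal H_+$. Use any one of the following formulae (for $W$ with values in $Gr_r$) to obtain unitons $\alpha_1,\dots,\alpha_r$ successively: (a) (Segal) $\displaystyle \alpha_i=\mathrm{span}\Bigl\{\sum_{s=0}^{i-1}S^{i-1}_s(L^j_{s-k})^{(k)}\ :\ 0\le k\le i-1\Bigr\}$; (b) (mixed) $\displaystyle \alpha_i=\mathrm{span}\Bigl\{\sum_{s=0}^{i-1}S^{i-1}_s(L^j_{s-k+u})^{(k)}\ :\ 0\le o(j)+k-u\le i-1\Bigr\}+\mathrm{span}\Bigl\{\sum_{s=0}^{i-1}S^{i-1}_s(\widehat L^j_s)^{(k)}\ :\ o(j)+k-u<0\Bigr\}$, where $u=u_i$ is the number of Uhlenbeck steps among the $r-i$ Uhlenbeck and Segal steps, performed in any chosen order, leading from $W$ to $W_i$; (c) (Uhlenbeck) $\displaystyle \alpha_i=\mathrm{span}\Bigl\{\sum_{s=0}^{i-1}S^{i-1}_s(\widehat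 L^j_s)^{(k)}\ :\ o(j)+k\le r-i\Bigr\}$. Then $\Phi$ is given by the product $$\Phi=(\pi_{\alpha_1}+\lambda\pi_{\alpha_1}^\perp)\cdots(\pi_{\alpha_r}+\lambda\pi_{\alpha_r}^\perp).$$ If $\Psi$ is polynomial in $\lambda$, then this gives $\Phi$ polynomial of the same or lesser degree.
   Context: $\mathcal H=L^2(S^1,\mathbb C^n)$, and $\mathcal H_+$ is the closed span of $\lambda^ie_j$, $i\ge0$, $1\le j\le n$. $Gr_r$ is the set of $\lambda$-closed subspaces $W$ with $\lambda^r\mathcal H_+\subset W\subset\mathcal H_+$. The bundle $W=\Psi\mathcal H_+$, defined on $M\setminus D$, extends over $M$ as a holomorphic subbundle of $M\times\mathcal H$ by filling out zeros; a meromorphic basis for $W\bmod\lambda W$ means meromorphic sections of $W$ whose cosets form a basis of the fibres of $W/\lambda W$ off a discrete set. $\Lambda G^{\mathrm c}$ is the group of smooth loops $S^1\to G^{\mathrm c}$, and $\Omega G$ the group of smooth loops $\gamma:S^1\to G$ with $\gamma(1)=e$. $\Lambda\mathfrak{gl}(n,\mathbb C)$ denotes the smooth loops in $\mathfrak{gl}(n,\mathbb C)$. $\Lambda^+G^{\mathrm c}$ (resp. $\Lambda^*G^{\mathrm c}$) is the subgroup of loops in $\Lambda G^{\mathrm c}$ which extend holomorphically, with values in $G^{\mathrm c}$, to $|\lambda|<1$ (resp. $0<|\lambda|<1$); $\Lambda^+\mathfrak g^{\mathrm c}$ is the Lie algebra of $\Lambda^+G^{\mathrm c}$. $\Lambda_{\rm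 alg}G^{\mathrm c}$ and $\Omega_{\rm alg}G$ consist of the loops in $\Lambda G^{\mathrm c}$ and $\Omega G$ given by finite Laurent series in $\lambda$, and $\Lambda^+_{\rm alg}G^{\mathrm c}$ of the loops in $\Lambda^+G^{\mathrm c}$ given by polynomials in $\lambda$. A complex extended solution on an open subset $U$ of $M$ is a holomorphic map $\Psi:U\to\Lambda^*G^{\mathrm c}$ with $\lambda\Psi^{-1}\Psi_z\in\Lambda^+\mathfrak g^{\mathrm c}$ for any local complex coordinate $z$. By the Iwasawa decomposition $\Lambda_{\rm alg}G^{\mathrm c}=\Omega_{\rm alg}G\cdot\Lambda^+_{\rm alg}G^{\mathrm c}$ (with $\Omega_{\rm alg}G\cap\Lambda^+_{\rm alg}G^{\mathrm c}=\{e\}$), $\Psi$ can be written uniquely at each point of $M\setminus D$ as $\Psi=\Psi_u\Psi_+$ with $\Psi_u\in\Omega_{\rm alg}G$ and $\Psi_+\in\Lambda^+_{\rm alg}G^{\mathrm c}$. An extended solution is a smooth map $\Phi:M\to\Omega G$ such that, for any local holomorphic coordinate $z$, $\Phi^{-1}\Phi_z=(1-\lambda^{-1})A$ for some $\lambda$-independent map $A$ into $\mathfrak g\otimes\mathbb C$. Notation in the formulae: $L^j=\sum_i\lambda^iL^j_i$ with $L^j_i=0$ for $i<0$; the order $o(j)$ of $L^j$ is the least $i$ with $L^j_i\not\equiv0$, and $\widehat L^j=\lambda^{-o(j)}L^j=\sum_{i\ge0}\lambda^i\widehat L^j_i$; $k\geq 0$ is an integer, and $(\cdot)^{(k)}$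 is the $k$-th derivative with respect to a local complex coordinate on $M$. Put $\Phi_0=I$ and $\Phi_i=\Phi_{i-1}(\pi_{\alpha_i}+\lambda\pi_{\alpha_i}^\perp)$, where $\pi_\alpha,\pi_\alpha^\perp$ are the orthogonal projections onto $\alpha,\alpha^\perp$; the matrices $S^{i-1}_s$ are defined by $\Phi_{i-1}^{-1}=\sum_{s=0}^{i-1}\lambda^{-s}S^{i-1}_s$. Spans of sections are taken off a discrete set and extended over it as subbundles of $M\times\mathbb C^n$. A uniton for an extended solution $\Phi$ is a subbundle $\alpha$ of $M\times\mathbb C^n$ such that $\Phi(\pi_\alpha+\lambda\pi_\alpha^\perp)$ is again an extended solution. For $W_i$ with values in $Gr_i$, the Uhlenbeck step is $W_i\mapsto(\lambda^{-1}W_i)\cap\mathcal H_+$ and the Segal step is $W_i\mapsto W_i+\lambda^{i-1}\mathcal H_+$.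
   Formalization: The last sentence is false as written (constant Ψ with rows (λ,1),(0,λ) has degree 1 but Φ has degree 2); it is proved as: if Ψ is polynomial of degree ≤ d then Φ is polynomial, and of degree ≤ d when W has values in Gr_d. *)

(* Defs.v *)
From HB Require Import structures.
From mathcomp Require Import all_boot all_order all_algebra.
From mathcomp Require Import sesquilinear spectral.
From mathcomp Require Import complex.
From mathcomp Require Import all_classical all_reals all_analysis.

Set Implicit Arguments.
Unset Strict Implicit.
Unset Printing Implicit Defensive.

Import Order.TTheory GRing.Theory Num.Theory.
Import numFieldNormedType.Exports.

Local Open Scope classical_set_scope.
Local Open Scope ring_scope.
Local Open Scope sesquilinear_scope.

(* R[i] packaged as an abstract numClosedFieldType, so that the canonical
   topology and normed-module structures of numFieldNormedType apply to it. *)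
Definition cplx (R : realType) : numClosedFieldType := R[i]%C.

Section ComplexNumbers.
Variable R : realType.
Local Notation C := (cplx R).

Definition re (z : C) : R := complex.Re z.
Definition im (z : C) : R := complex.Im z.
Definition mkC (x y : R) : C := Complex x y.
Definition imagI : C := mkC 0 1.
Definition cis (t : R) : C := mkC (cos t) (sin t).
Definition circle : set C := [set l | `|l| = 1].

End ComplexNumbers.

Section Smoothness.
Variable R : realType.
Local Notation C := (cplx R).

(* For U open in a finite-dimensional V this is the usual class C^k. *)
Fixpoint Ck (V : normedModType R) (k : nat) (U : set V) (f : V -> R) : Prop :=
  (forall x, U x -> {for x, continuous f}) /\
  (if k is k'.+1 then
     forall v : V, (forall x, U x -> derivable f x v) /\ Ck k' U ('D_v f)
   else True).

Definition smooth_on (V : normedModType R) (U : set V) (m p : nat)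
    (f : V -> 'M[C]_(m, p)) : Prop :=
  forall a b k, Ck k U (fun x => re (f x a b)) /\
                Ck k U (fun x => im (f x a b)).

Definition holomorphic_on (U : set C) (f : C -> C) : Prop :=
  forall w, U w -> derivable f w 1.

Definition real_deriv (g : R -> C) (t : R) : C :=
  mkC (derive1 (fun s => re (g s)) t) (derive1 (fun s => im (g s)) t).

(* d/dw = (d/dx - i d/dy) / 2 *)
Definition wirtinger (f : C -> C) (w : C) : C :=
  2^-1 * (real_deriv (fun h => f (w + mkC h 0)) 0
          - imagI R * real_deriv (fun h => f (w + mkC 0 h)) 0).

End Smoothness.

(* Only the values of cmap on cdom, and of cinv on cmap @` cdom, matter. *)
Record chart (R : realType) (M : topologicalType) := Chart {
  cdom : set M;
  cmap :> M -> cplx R;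
  cinv : cplx R -> M }.

Section RiemannSurfaces.
Variable R : realType.
Local Notation C := (cplx R).

Definition chart_image (M : topologicalType) (z : chart R M) (U : set M) :
    set C := z @` (cdom z `&` U).

Definition is_chart (M : topologicalType) (z : chart R M) : Prop :=
  [/\ open (cdom z),
      open (chart_image z setT),
      (forall p, cdom z p -> {for p, continuous z}),
      (forall w, chart_image z setT w -> {for w, continuous (cinv z)}) &
      (forall p, cdom z p -> cinv z (z p) = p)].

Definition holomorphic_transition (M : topologicalType) (z1 z2 : chart R M) :=
  holomorphic_on (chart_image z1 (cdom z2)) (fun w => z2 (cinv z1 w)).

(* The holomorphic atlas is maximal: its members are exactly the local complex
   coordinates of the surface. *)
Record riemann_surface := RiemannSurface {
  rs_space :> topologicalType;
  coords : set (chart R rs_space);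
  rs_hausdorff : hausdorff_space rs_space;
  rs_connected : connected [set: rs_space];
  rs_charts : forall z, coords z -> is_chart z;
  rs_cover : forall p, exists2 z, coords z & cdom z p;
  rs_compatible : forall z1 z2, coords z1 -> coords z2 ->
    holomorphic_transition z1 z2;
  rs_maximal : forall z, is_chart z ->
    (forall z', coords z' ->
       holomorphic_transition z z' /\ holomorphic_transition z' z) ->
    coords z }.

(* No accumulation points in M, i.e. closed and discrete. *)
Definition discrete_subset (M : topologicalType) (D : set M) : Prop :=
  forall p : M, \forall q \near p^', ~ D q.

Variable M : riemann_surface.

Definition smooth_map (U : set M) (m p : nat) (f : M -> 'M[C]_(m, p)) : Prop :=
  forall z, coords z ->
    smooth_on [set x : (R * R)%type | chart_image z U (mkC x.1 x.2)]
      (fun x => f (cinv z (mkC x.1 x.2))).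

(* (L)^(k) in the local coordinate z, entrywise, for L holomorphic near p. *)
Definition zderiv (z : chart R M) (k m p : nat) (f : M -> 'M[C]_(m, p))
    (x : M) : 'M[C]_(m, p) :=
  \matrix_(a, b) derive1n k (fun w => f (cinv z w) a b) (z x).

(* f_z for f smooth *)
Definition zwirtinger (z : chart R M) (m p : nat) (f : M -> 'M[C]_(m, p))
    (x : M) : 'M[C]_(m, p) :=
  \matrix_(a, b) wirtinger (fun w => f (cinv z w) a b) (z x).

(* Families of loops f p : S^1 -> 'M_(m, p), p in U. Smoothness (holomorphy)
   of U -> C^oo(S^1, 'M_(m, p)) amounts to joint smoothness on U x S^1 (and
   holomorphy in p for each l on S^1). *)
Definition smooth_family (U : set M) (m p : nat)
    (f : M -> C -> 'M[C]_(m, p)) : Prop :=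
  forall z, coords z ->
    smooth_on [set x : (R * R * R)%type | chart_image z U (mkC x.1.1 x.1.2)]
      (fun x => f (cinv z (mkC x.1.1 x.1.2)) (cis x.2)).

Definition holomorphic_family (U : set M) (m p : nat)
    (f : M -> C -> 'M[C]_(m, p)) : Prop :=
  smooth_family U f /\
  forall z, coords z -> forall l, circle l -> forall a b,
    holomorphic_on (chart_image z U) (fun w => f (cinv z w) l a b).

(* f, given off D, is meromorphic on M as a map into the smooth loops. *)
Definition meromorphic_family (D : set M) (m p : nat)
    (f : M -> C -> 'M[C]_(m, p)) : Prop :=
  forall x : M, exists (z : chart R M) (V : set M) (k : nat)
      (g : M -> C -> 'M[C]_(m, p)),
    [/\ coords z, open V, V x, V `<=` cdom z &
        holomorphic_family V g /\
        forall q l, V q -> ~ D q -> circle l ->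
          g q l = (z q - z x) ^+ k *: f q l].

End RiemannSurfaces.

Section Groups.
Variables (R : realType) (n : nat).
Local Notation C := (cplx R).
Local Notation mx := 'M[cplx R]_n.

Definition unitary_group : set mx := [set A | A \is unitarymx].

(* Closed subgroups of U(n) are automatically Lie subgroups. *)
Definition compact_subgroup (G : set mx) : Prop :=
  [/\ G `<=` unitary_group,
      G 1%:M,
      (forall A B, G A -> G B -> G (A *m B)),
      (forall A, G A -> G (invmx A)) &
      compact G].

Definition is_expmx (X E : mx) : Prop :=
  forall a b, (fun N : nat => (\sum_(k < N) (k`!%:R^-1 *: X ^+ k)) a b)
                @ \oo --> E a b.

Definition lie_algebra (G : set mx) : set mx :=
  [set X | forall t : R, exists2 E, is_expmx (mkC t 0 *: X) E & G E].

(* g^c = g + i g *)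
Definition complex_lie_algebra (G : set mx) : set mx :=
  [set Z | exists X Y, [/\ lie_algebra G X, lie_algebra G Y &
                           Z = X + imagI R *: Y]].

(* G^c = G exp(i g) *)
Definition complexification (G : set mx) : set mx :=
  [set Z | exists g X E, [/\ G g, lie_algebra G X,
                             is_expmx (imagI R *: X) E & Z = g *m E]].

(* A loop is given by a function on C of which only the values on the unit
   circle are relevant. *)
Definition loop := C -> mx.

Definition smooth_loop (g : loop) : Prop :=
  smooth_on [set: R^o] (fun t : R^o => g (cis t)).

Definition loops_in (S : set mx) (g : loop) : Prop :=
  smooth_loop g /\ forall l, circle l -> S (g l).

(* The boundary values of a map which is continuous on A and holomorphic on
   the interior B of A, with values in S. *)
Definition extends_holomorphically (A B : set C) (S : set mx) (g : loop) :=
  exists F : C -> mx,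
    [/\ (forall l, circle l -> F l = g l),
        (forall l, A l -> S (F l)),
        (forall a b, {within A, continuous (fun l => F l a b)}) &
        (forall a b, holomorphic_on B (fun l => F l a b))].

Definition Lambda_plus (S : set mx) (g : loop) : Prop :=
  loops_in S g /\
  extends_holomorphically [set l | `|l| <= 1] [set l | `|l| < 1] S g.

Definition Lambda_star (S : set mx) (g : loop) : Prop :=
  loops_in S g /\
  extends_holomorphically [set l | 0 < `|l| <= 1] [set l | 0 < `|l| < 1] S g.

Definition laurent_expansion (g : loop) (c : int -> mx) : Prop :=
  exists N : nat,
    (forall i : int, c i != 0 -> - N%:Z <= i <= N%:Z) /\
    forall l, circle l ->
      g l = \sum_(k < N.*2.+1) l ^ (k%:Z - N%:Z) *: c (k%:Z - N%:Z).

(* Polynomial in l of degree at most d. *)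
Definition poly_loop (d : nat) (g : loop) : Prop :=
  exists c : nat -> mx, forall l, circle l ->
    g l = \sum_(k < d.+1) l ^+ k *: c k.

Definition Lambda_alg (S : set mx) (g : loop) : Prop :=
  loops_in S g /\ exists c, laurent_expansion g c.

Definition Lambda_alg_plus (S : set mx) (g : loop) : Prop :=
  Lambda_plus S g /\ exists d, poly_loop d g.

Definition Omega (G : set mx) (g : loop) : Prop :=
  loops_in G g /\ g 1 = 1%:M.

Definition Omega_alg (G : set mx) (g : loop) : Prop :=
  Omega G g /\ exists c, laurent_expansion g c.

(* psi = psi_u psi_+ is the Iwasawa decomposition of psi. *)
Definition iwasawa_unitary_part (G : set mx) (psi psi_u : loop) : Prop :=
  Omega_alg G psi_u /\
  exists2 psi_p, Lambda_alg_plus (complexification G) psi_p &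
    forall l, circle l -> psi l = psi_u l *m psi_p l.

End Groups.

Section Grassmannian.
Variables (R : realType) (n : nat).
Local Notation C := (cplx R).
Local Notation vec := 'cV[cplx R]_n.
Local Notation mu := (@lebesgue_measure R).
Local Notation I := (`[0, 2 * pi]%classic : set R).

(* Elements of L^2(S^1, C^n) are represented by functions modulo equality
   almost everywhere on the circle, l = cis t with 0 <= t <= 2 pi. *)
Definition normsq (f : C -> vec) : \bar R :=
  (\int[mu]_(t in I)
     (\sum_a (re (f (cis t) a 0) ^+ 2 + im (f (cis t) a 0) ^+ 2))%:E)%E.

Definition L2 : set (C -> vec) :=
  [set f : C -> vec | (forall a, measurable_fun I (fun t => re (f (cis t) a 0)) /\
                      measurable_fun I (fun t => im (f (cis t) a 0))) /\
           (normsq f < +oo)%E].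

Definition ae_circle (f g : C -> vec) : Prop :=
  {ae mu, forall t : R, I t -> f (cis t) = g (cis t)}.

(* The closed span of the l^i e_j, i >= 0. *)
Definition Hplus : set (C -> vec) :=
  [set f : C -> vec | L2 f /\ forall e : R, 0 < e ->
     exists (N : nat) (v : nat -> vec),
       (normsq (fun l => f l - \sum_(i < N) l ^+ i *: v i)%R < e%:E)%E].

(* g X, for g a loop of matrices and X a subspace of L^2. *)
Definition loop_image (g : loop R n) (X : set (C -> vec)) : set (C -> vec) :=
  [set f : C -> vec | L2 f /\ exists2 h, X h & ae_circle f (fun l => g l *m h l)].

Definition shift_by (r : nat) (X : set (C -> vec)) : set (C -> vec) :=
  loop_image (fun l => (l ^+ r)%:M) X.

Definition Wspace (psi : loop R n) : set (C -> vec) := loop_image psi Hplus.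

Definition Gr (r : nat) (X : set (C -> vec)) : Prop :=
  [/\ X (fun=> 0),
      (forall (a : C) f g, X f -> X g -> X (fun l => a *: f l + g l)),
      shift_by 1 X `<=` X,
      shift_by r Hplus `<=` X &
      X `<=` Hplus].

Variable M : riemann_surface R.

(* The columns of Psi are meromorphic sections of W = Psi H_+ whose cosets form
   a basis of W / l W off a discrete set. *)
Definition columns_meromorphic_basis (D : set M) (Psi : M -> loop R n) : Prop :=
  (forall j : 'I_n,
     meromorphic_family D (fun p l => col j (Psi p l)) /\
     forall p, ~ D p -> Wspace (Psi p) (fun l => col j (Psi p l))) /\
  exists2 E, discrete_subset E & forall p, ~ D p -> ~ E p ->
    forall f, Wspace (Psi p) f ->
      exists! a : vec,
        shift_by 1 (Wspace (Psi p))
          (fun l => f l - \sum_(j < n) a j 0 *: col j (Psi p l)).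

End Grassmannian.

Section ExtendedSolutions.
Variables (R : realType) (n : nat) (M : riemann_surface R).
Local Notation C := (cplx R).
Local Notation mx := 'M[cplx R]_n.
Local Notation vec := 'cV[cplx R]_n.

Definition complex_extended_solution (G : set mx) (U : set M)
    (Psi : M -> loop R n) : Prop :=
  [/\ (forall p, U p -> Lambda_star (complexification G) (Psi p)),
      holomorphic_family U Psi &
      (forall z p, coords z -> cdom z p -> U p ->
         Lambda_plus (complex_lie_algebra G)
           (fun l => l *: (invmx (Psi p l) *m
                           zderiv z 1 (fun q => Psi q l) p)))].

Definition extended_solution (G : set mx) (Phi : M -> loop R n) : Prop :=
  [/\ (forall p, Omega G (Phi p)),
      smooth_family setT Phi &
      (forall z, coords z -> exists A : M -> mx,
         forall p, cdom z p ->
           complex_lie_algebra G (A p) /\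
           forall l, circle l ->
             invmx (Phi p l) *m zwirtinger z (fun q => Phi q l) p
             = (1 - l^-1) *: A p)].

Definition is_orthogonal_projection (A : {vspace vec}) (P : mx) : Prop :=
  [/\ P *m P = P, P^t* = P & forall v : vec, v \in A <-> P *m v = v].

Definition oproj (A : {vspace vec}) : mx :=
  xget 0 [set P | is_orthogonal_projection A P].

(* pi_A + l pi_A^perp *)
Definition uniton_factor (A : {vspace vec}) (l : C) : mx :=
  oproj A + l *: (1%:M - oproj A).

Definition subbundle (A : M -> {vspace vec}) : Prop :=
  forall p, exists (V : set M) (k : nat) (s : 'I_k -> M -> vec),
    [/\ open V, V p, (forall a, smooth_map V (s a)) &
        forall q, V q -> basis_of (A q) [seq s a q | a <- enum 'I_k]].

Definition uniton (Phi : M -> loop R n) (A : M -> {vspace vec}) : Prop :=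
  [/\ extended_solution (@unitary_group R n) Phi,
      subbundle A &
      extended_solution (@unitary_group R n)
        (fun p l => Phi p l *m uniton_factor (A p) l)].

(* Phi_i = (pi_1 + l pi_1^perp) ... (pi_i + l pi_i^perp); al 0 is unused. *)
Fixpoint partial_product (al : nat -> M -> {vspace vec}) (i : nat) (p : M)
    (l : C) : mx :=
  if i is i'.+1 then
    partial_product al i' p l *m uniton_factor (al i p) l
  else 1%:M.

Definition vspan (X : set vec) : {vspace vec} :=
  xget 0%VS [set A : {vspace vec} | (forall v, X v -> v \in A) /\
                     forall B : {vspace vec}, (forall v, X v -> v \in B) ->
                       (A <= B)%VS].

Section Formulae.
Variables (D : set M) (c : M -> int -> mx).

(* (L^j_i)^(k), where c p i is the coefficient of l^i in Psi p. *)
Definition Lder (j : 'I_n) (i : int) (k : nat) (z : chart R M) (p : M) : vec :=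
  zderiv z k (fun q => col j (c q i)) p.

(* o(j), for a column L^j whose coefficients of negative index vanish. *)
Definition column_order (j : 'I_n) : nat :=
  xget 0%N [set o : nat |
    (exists2 p, ~ D p & col j (c p o%:Z) != 0) /\
    forall i : nat, (i < o)%N -> forall p, ~ D p -> col j (c p i%:Z) = 0].

(* In the formulae, S s is the value at p of S^(i-1)_s. *)
Definition segal_formula (i : nat) (S : nat -> mx) (z : chart R M) (p : M) :=
  vspan [set v | exists (j : 'I_n) (k : nat), (k <= i.-1)%N /\
    v = \sum_(s < i) S s *m Lder j (s%:Z - k%:Z) k z p].

Definition mixed_formula (u : nat -> nat) (i : nat) (S : nat -> mx)
    (z : chart R M) (p : M) :=
  let X1 := [set v | exists (j : 'I_n) (k : nat),
    0 <= (column_order j)%:Z + k%:Z - (u i)%:Z <= i%:Z - 1 /\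
    v = \sum_(s < i) S s *m Lder j (s%:Z - k%:Z + (u i)%:Z) k z p] in
  let X2 := [set v | exists (j : 'I_n) (k : nat),
    (column_order j)%:Z + k%:Z - (u i)%:Z < 0 /\
    v = \sum_(s < i) S s *m Lder j (s%:Z + (column_order j)%:Z) k z p] in
  (vspan X1 + vspan X2)%VS.

Definition uhlenbeck_formula (r : nat) (i : nat) (S : nat -> mx)
    (z : chart R M) (p : M) :=
  vspan [set v | exists (j : 'I_n) (k : nat), (column_order j + k <= r - i)%N /\
    v = \sum_(s < i) S s *m Lder j (s%:Z + (column_order j)%:Z) k z p].

(* The formula F yields successively unitons al 1, ..., al r, whose product
   is Phi. *)
Definition unitons_from (r : nat)
    (F : nat -> (nat -> mx) -> chart R M -> M -> {vspace vec})
    (Phi : M -> loop R n) : Prop :=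
  exists (al : nat -> M -> {vspace vec}) (S : nat -> nat -> M -> mx),
    [/\ (forall i p l, (i < r)%N -> circle l ->
           invmx (partial_product al i p l)
           = \sum_(s < i.+1) l ^- s *: S i s p),
        (forall i, (1 <= i <= r)%N ->
           uniton (partial_product al i.-1) (al i) /\
           exists2 E, discrete_subset E &
             forall p z, ~ D p -> ~ E p -> coords z -> cdom z p ->
               al i p = F i (fun s => S i.-1 s p) z p) &
        (forall p l, circle l -> Phi p l = partial_product al r p l)].

End Formulae.
End ExtendedSolutions.

Variant filtration_step := UhlenbeckStep | SegalStep.

Definition is_uhlenbeck (s : filtration_step) : bool :=
  if s is UhlenbeckStep then true else false.

(* u_i, for the filtration W = W_r, W_(r-1), ..., W_0 in which step m is the
   one performed from W_m to W_(m-1). *)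
Definition uhlenbeck_count (step : nat -> filtration_step) (r i : nat) : nat :=
  \sum_(i.+1 <= m < r.+1) is_uhlenbeck (step m).

(* Main.v *)
(* Modulo [l^(r+1) H_+] the subspace W = Psi H_+ becomes a shift-invariant subspace
   of C^((r+1) n), and Phi is recovered from the orthogonal projection P onto it: Phi is
   built from the wandering projection of P (the part orthogonal to the shifted subspace).
   Near a point of D the subspace is spanned by finitely many meromorphic vectors, hence,
   after dividing out zeros, is the image of a holomorphic idempotent E; Kerzman-Stein
   gives P = E (E + E^* - 1)^-1, smooth across the point, and holomorphy of E with the
   complex extended solution equation yields that of Phi. Nested subspaces
   l W_i < W_(i+1) < W_i differ by one factor pi + l pi^perp. The Segal, mixed and
   Uhlenbeck filtrations are all W_i = span of l^m l^e L_hat^j^(k), m >= 0,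
   e = max(0, o(j) + k - u_i), plus l^i H_+, with u_i = 0, the count of Uhlenbeck steps,
   and r - i; alpha_i is the image of W_i under evaluation of Phi_(i-1)^-1 at order 0. *)

Require Import Defs.
From mathcomp Require Import all_boot all_order all_algebra.
From mathcomp Require Import sesquilinear spectral complex.
From mathcomp Require Import all_classical all_reals all_analysis.
From mathcomp Require Import measurable_realfun.
From mathcomp Require Import zify ring lra.

Set Implicit Arguments.
Unset Strict Implicit.
Unset Printing Implicit Defensive.

Import Order.TTheory GRing.Theory Num.Theory.
Import numFieldNormedType.Exports.

Local Open Scope classical_set_scope.
Local Open Scope ring_scope.
Local Open Scope sesquilinear_scope.

(** * Complex numbers and path integrals *)

Section Complex.
Variable R : realType.
Local Notation C := (cplx R).

(** Three obstacles shape the proof. Each loop [Psi p] has a Laurent degree of its own; a degree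
    valid near a point comes from Baire's theorem on a segment and the identity theorem, and only
    then do finitely many meromorphic coefficients describe [Psi]. The truncation order must bound
    the degree of Phi in advance: after multiplication by a power of l the unitary factor is a
    polynomial loop whose determinant is unimodular on the circle, hence a monomial, and it divides
    that of [Psi]; so degree times n suffices. Finally, the idempotents are known to describe W only
    off the centre of a chart. That they also do so at a centre outside D is a separate statement,
    resting on a lower bound for determinants that is uniform near the centre. The mean value
    property on the disc turns holomorphic extension of loops into vanishing of Fourier
    coefficients; Cauchy theory also supplies the factorisation at zeros and the holomorphy of
    derivatives. *)

Lemma cplxP (z w : C) : re z = re w -> im z = im w -> z = w.
Proof. by case: z => a b; case: w => c d; rewrite /re /im /= => -> ->. Qed.

Lemma mkC_eta (z : C) : mkC (re z) (im z) = z.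
Proof. by case: z. Qed.

Lemma reD (z w : C) : re (z + w) = re z + re w.
Proof. by case: z => a b; case: w. Qed.
Lemma imD (z w : C) : im (z + w) = im z + im w.
Proof. by case: z => a b; case: w. Qed.
Lemma reN (z : C) : re (- z) = - re z.
Proof. by case: z. Qed.
Lemma imN (z : C) : im (- z) = - im z.
Proof. by case: z. Qed.
Lemma reB (z w : C) : re (z - w) = re z - re w.
Proof. by rewrite reD reN. Qed.
Lemma imB (z w : C) : im (z - w) = im z - im w.
Proof. by rewrite imD imN. Qed.
Lemma reM (z w : C) : re (z * w) = re z * re w - im z * im w.
Proof. by case: z => a b; case: w. Qed.
Lemma imM (z w : C) : im (z * w) = re z * im w + im z * re w.
Proof. by case: z => a b; case: w => c d. Qed.

Definition toC (x : R) : C := mkC x 0.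
Definition nrm (z : C) : R := Num.sqrt (re z ^+ 2 + im z ^+ 2).

Lemma normE (z : C) : `|z| = toC (nrm z).
Proof. by case: z. Qed.

Lemma toC_le (x y : R) : (toC x <= toC y) = (x <= y).
Proof. exact: lecR. Qed.
Lemma toC_lt (x y : R) : (toC x < toC y) = (x < y).
Proof. exact: ltcR. Qed.
Lemma toCD (x y : R) : toC (x + y) = toC x + toC y.
Proof. by apply: cplxP; rewrite /re /im //= addr0. Qed.
Lemma toCM (x y : R) : toC (x * y) = toC x * toC y.
Proof. by apply: cplxP; rewrite ?reM ?imM /re /im /= ?mulr0 ?mul0r ?subr0 ?addr0. Qed.
Lemma toCN (x : R) : toC (- x) = - toC x.
Proof. by apply: cplxP; rewrite /re /im //= oppr0. Qed.
Lemma toC0 : toC 0 = 0. Proof. by []. Qed.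
Lemma toC1 : toC 1 = 1. Proof. by []. Qed.
Lemma toC_inj : injective toC. Proof. by move=> x y []. Qed.

Lemma C_gt0P (e : C) : 0 < e -> exists2 x : R, 0 < x & e = toC x.
Proof.
rewrite ltcE /= => /andP[/eqP ie re0]; exists (re e) => //.
by apply: cplxP => //; rewrite /im ie.
Qed.

Lemma toC_gt0 (x : R) : (0 < toC x) = (0 < x).
Proof. by rewrite -toC0 toC_lt. Qed.

Lemma nrm_ge0 z : 0 <= nrm z. Proof. exact: sqrtr_ge0. Qed.
Lemma nrmE (z : C) (x : R) : `|z| = toC x -> nrm z = x.
Proof. by rewrite normE => /toC_inj. Qed.
Lemma nrm0 : nrm 0 = 0. Proof. by apply: nrmE; rewrite normr0. Qed.
Lemma nrm1 : nrm 1 = 1. Proof. by apply: nrmE; rewrite normr1. Qed.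
Lemma nrmM z w : nrm (z * w) = nrm z * nrm w.
Proof. by apply: nrmE; rewrite normrM !normE toCM. Qed.
Lemma nrmN z : nrm (- z) = nrm z.
Proof. by apply: nrmE; rewrite normrN normE. Qed.
Lemma nrmD z w : nrm (z + w) <= nrm z + nrm w.
Proof. by rewrite -toC_le toCD -!normE ler_normD. Qed.
Lemma nrmB z w : nrm (z - w) <= nrm z + nrm w.
Proof. by rewrite -(nrmN w) nrmD. Qed.
Lemma nrm_distC z w : nrm (z - w) = nrm (w - z).
Proof. by rewrite -nrmN opprB. Qed.
Lemma nrm_eq0 z : (nrm z == 0) = (z == 0).
Proof. by rewrite -[in RHS]normr_eq0 normE -(inj_eq toC_inj). Qed.
Lemma nrm_gt0 z : (0 < nrm z) = (z != 0).
Proof. by rewrite lt_def nrm_ge0 andbT nrm_eq0. Qed.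
Lemma nrmX z k : nrm (z ^+ k) = nrm z ^+ k.
Proof. by elim: k => [|k IH]; rewrite ?expr0 ?nrm1 // !exprS nrmM IH. Qed.
Lemma nrmV z : nrm z^-1 = (nrm z)^-1.
Proof.
have [->|z0] := eqVneq z 0; first by rewrite invr0 nrm0 invr0.
have nz : nrm z != 0 by rewrite nrm_eq0.
by apply: (mulfI nz); rewrite mulfV // -nrmM mulfV // nrm1.
Qed.
Lemma nrm_toC x : nrm (toC x) = `|x|.
Proof. by rewrite /nrm /re /im /= expr0n /= addr0 sqrtr_sqr. Qed.
Lemma nrm_sum (I : Type) (s : seq I) (P : pred I) (F : I -> C) :
  nrm (\sum_(i <- s | P i) F i) <= \sum_(i <- s | P i) nrm (F i).
Proof.
elim/big_ind2: _ => [|x a y b xa yb|//]; first by rewrite nrm0.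
by apply: le_trans (nrmD _ _) _; apply: lerD.
Qed.
Lemma re_le_nrm z : `|re z| <= nrm z.
Proof. by rewrite -sqrtr_sqr ler_wsqrtr // lerDl sqr_ge0. Qed.
Lemma im_le_nrm z : `|im z| <= nrm z.
Proof. by rewrite -sqrtr_sqr ler_wsqrtr // lerDr sqr_ge0. Qed.
Lemma nrm_le_reim z : nrm z <= `|re z| + `|im z|.
Proof.
rewrite -(@ler_pXn2r _ 2) // ?nnegrE ?addr_ge0 ?nrm_ge0 //.
rewrite sqr_sqrtr ?addr_ge0 ?sqr_ge0 // sqrrD !real_normK ?num_real //.
by rewrite lerD2r lerDl mulrn_wge0 // mulr_ge0.
Qed.

Lemma ballCP (x y : C) (e : R) : ball x (toC e) y <-> nrm (x - y) < e.
Proof. by rewrite -ball_normE /ball_ /= normE toC_lt. Qed.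

Lemma nbhsCP (x : C) (P : set C) :
  nbhs x P <-> exists2 d : R, 0 < d & forall y, nrm (y - x) < d -> P y.
Proof.
split.
- case/nbhs_ballP => e /= /C_gt0P[d d0 ->] H; exists d => // y yx.
  by apply: H; apply/ballCP; rewrite nrm_distC.
- case=> d d0 H; apply/nbhs_ballP; exists (toC d) => /=; first by rewrite toC_gt0.
  by move=> y /ballCP yx; apply: H; rewrite nrm_distC.
Qed.

Lemma cvgCP (T : Type) (F : set_system T) (FF : Filter F) (f : T -> C) (l : C) :
  f @ F --> l <-> forall e : R, 0 < e -> \forall t \near F, nrm (f t - l) < e.
Proof.
split=> [fl e e0|H].
- have := fl [set y | nrm (y - l) < e]; apply.
  by apply/nbhsCP; exists e.
- move=> P /nbhsCP[d d0 HP]; have := H d d0.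
  by apply: filterS => t; apply: HP.
Qed.

Lemma cvgC_reim (T : Type) (F : set_system T) (FF : Filter F) (f : T -> C) (l : C) :
  f @ F --> l <-> ((fun t => re (f t)) @ F --> re l /\ (fun t => im (f t)) @ F --> im l).
Proof.
split.
- move/cvgCP => H; split; apply/cvgrPdist_lt => e e0;
  have := H e e0; apply: filterS => t; apply: le_lt_trans; rewrite distrC.
  + by rewrite -reB re_le_nrm.
  + by rewrite -imB im_le_nrm.
- case=> /cvgrPdist_lt Hr /cvgrPdist_lt Hi; apply/cvgCP => e e0.
  have e2 : 0 < e / 2 by rewrite divr_gt0.
  apply: filterS2 (Hr _ e2) (Hi _ e2) => t h1 h2.
  apply: le_lt_trans (nrm_le_reim _) _; rewrite (splitr e) reB imB.
  by apply: ltrD; rewrite distrC.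
Qed.

Lemma continuous_re : continuous (@re R).
Proof. by move=> z; have [] := (cvgC_reim (nbhs_filter z) id z).1 (@cvg_id _ _). Qed.
Lemma continuous_im : continuous (@im R).
Proof. by move=> z; have [] := (cvgC_reim (nbhs_filter z) id z).1 (@cvg_id _ _). Qed.
Lemma continuous_nrm : continuous nrm.
Proof.
move=> z; apply: (@cvgrPdist_lt _ _ _ _ (nbhs_filter z) _ _).2 => e e0.
apply/nbhsCP; exists e => // y yz.
have h1 := nrmD (z - y) y; have h2 := nrmD (y - z) z.
rewrite subrK nrm_distC in h1; rewrite subrK in h2; rewrite ltr_norml; apply/andP; split; lra.
Qed.

Lemma continuous_mkC : continuous (fun x : R * R => mkC x.1 x.2).
Proof.
by move=> x; apply/cvgC_reim; split; [exact: (@cvg_fst _ _ _ _ (nbhs_filter x.2)) | exact: (@cvg_snd _ _ (nbhs x.1))].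
Qed.

Lemma continuous_toC : continuous toC.
Proof.
by move=> x; apply/cvgC_reim; split; [exact: cvg_id | exact: cvg_cst].
Qed.

Lemma re_cis t : re (cis t) = cos t :> R. Proof. by []. Qed.
Lemma im_cis t : im (cis t) = sin t :> R. Proof. by []. Qed.

Lemma continuous_cis : continuous (@cis R).
Proof.
move=> t; apply/cvgC_reim; split; [exact: continuous_cos | exact: continuous_sin].
Qed.

Lemma nrm_cis t : nrm (cis t) = 1.
Proof. by rewrite /nrm re_cis im_cis cos2Dsin2 sqrtr1. Qed.

Lemma circleE (l : C) : circle l <-> nrm l = 1.
Proof. by rewrite /circle /= normE; split=> [/toC_inj|->]. Qed.

Lemma circle_cis t : circle (cis t : C).
Proof. by apply/circleE/nrm_cis. Qed.

Lemma cisD s t : cis (s + t) = cis s * cis t :> C.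
Proof. by apply: cplxP; rewrite ?reM ?imM !re_cis !im_cis ?cosD ?sinD // addrC. Qed.

Lemma cis0 : cis 0 = 1 :> C.
Proof. by apply: cplxP; rewrite ?re_cis ?im_cis ?cos0 ?sin0. Qed.

Lemma cis2pi : cis (2 * pi) = 1 :> C.
Proof. by rewrite mulrC mulr_natr; apply: cplxP; rewrite ?re_cis ?im_cis ?cos2pi ?sin2pi. Qed.

Lemma cisX t k : cis t ^+ k = cis (t *+ k) :> C.
Proof. by elim: k => [|k IH]; rewrite ?mulr0n ?cis0 // exprS mulrS cisD IH. Qed.

Lemma circle_neq0 (l : C) : circle l -> l != 0.
Proof. by move=> /circleE ll; rewrite -nrm_gt0 ll. Qed.

Lemma circle_cisP (l : C) : circle l -> exists2 t, 0 <= t <= 2 * pi & l = cis t.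
Proof.
move=> /circleE ll.
have H : re l ^+ 2 + im l ^+ 2 = 1.
  by rewrite -[LHS]sqr_sqrtr ?addr_ge0 ?sqr_ge0 // -/(nrm l) ll expr1n.
have r1 : -1 <= re l <= 1.
  by rewrite -ler_norml; apply: le_trans (re_le_nrm _) _; rewrite ll.
have ca := acosK r1; have a0 := acos_ge0 r1; have ap := acos_lepi r1.
have s2 : sin (acos (re l)) ^+ 2 = im l ^+ 2.
  by rewrite sin2cos2 ca -H addrAC subrr add0r.
have pi0 : 0 < pi :> R := pi_gt0 R.
have [/eqP e|/eqP e] : (sin (acos (re l)) == im l) \/ (sin (acos (re l)) == - im l).
  by apply/orP; rewrite -eqf_sqr s2.
- exists (acos (re l)); first by rewrite a0 /=; lra.
  by apply: cplxP; rewrite ?re_cis ?im_cis.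
- exists (2 * pi - acos (re l)); first by apply/andP; split; lra.
  rewrite cisD cis2pi mul1r; apply: cplxP.
  + by rewrite re_cis cosN ca.
  + by rewrite im_cis sinN e opprK.
Qed.

End Complex.

Section RealIntegral.
Variable R : realType.
Local Notation mu := (@lebesgue_measure R).
Implicit Types (f g : R -> R) (a b c : R).

Definition RI a b f : R := (\int[mu]_(x in `[a, b]) f x)%R.

(** Continuity is two-sided even at the endpoints: the integrands are functions on the whole line,
    and restriction to subsegments is then immediate. *)
Definition con a b f := forall x, a <= x <= b -> {for x, continuous f}.

Lemma con_within a b f : con a b f -> {within `[a, b], continuous f}.
Proof.
move=> H; apply: continuous_in_subspaceT => x; rewrite inE /= in_itv /=.
exact: H.
Qed.

Lemma con_integrable a b f : con a b f -> mu.-integrable `[a, b] (EFin \o f).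
Proof.
move=> /con_within H; apply: continuous_compact_integrable => //.
exact: segment_compact.
Qed.

Lemma RID a b f g : con a b f -> con a b g ->
  RI a b (fun x => f x + g x) = RI a b f + RI a b g.
Proof. by move=> hf hg; rewrite /RI RintegralD //; exact: con_integrable. Qed.

Lemma RIZ a b k f : con a b f -> RI a b (fun x => k * f x) = k * RI a b f.
Proof. by move=> hf; rewrite /RI RintegralZl //; exact: con_integrable. Qed.

Lemma RI_eq a b f g : (forall x, a <= x <= b -> f x = g x) -> RI a b f = RI a b g.
Proof.
by move=> H; apply: eq_Rintegral => x; rewrite inE /= in_itv /=; apply: H.
Qed.

Lemma RI_cst a b k : a <= b -> RI a b (fun=> k) = k * (b - a).
Proof.
move=> ab; rewrite /RI Rintegral_cst //= lebesgue_measure_itv /= lte_fin.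
by move: ab; rewrite le_eqVlt => /predU1P[->|->] //=; rewrite ltxx subrr mulr0.
Qed.

Lemma RI_le a b f g : con a b f -> con a b g ->
  (forall x, a <= x <= b -> f x <= g x) -> RI a b f <= RI a b g.
Proof.
move=> hf hg H; apply: le_Rintegral => //; try exact: con_integrable.
all: by move=> x; rewrite /= in_itv /=; apply: H.
Qed.

Lemma con_cst a b k : con a b (fun=> k).
Proof. by move=> x _; exact: cvg_cst. Qed.

Lemma RI_norm a b f B : a <= b -> con a b f ->
  (forall x, a <= x <= b -> `|f x| <= B) -> `|RI a b f| <= B * (b - a).
Proof.
move=> ab hf H; rewrite ler_norml -mulNr -!(RI_cst _ ab).
apply/andP; split; apply: RI_le => //; try exact: con_cst;
  by move=> x /H; rewrite ler_norml => /andP[].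
Qed.

Lemma RI_chasles a b c f : a <= b -> b <= c -> con a c f ->
  RI a c f = RI a b f + RI b c f.
Proof.
move=> ab bc hf; have := @Rintegral_itvB R f (BLeft a) (BRight c) b (con_integrable hf).
rewrite !bnd_simp => /(_ ab bc) H.
rewrite /RI; apply/eqP; rewrite addrC -subr_eq H Rintegral_itv_obnd_cbnd //.
apply: integrableS (con_integrable hf) => //.
by move=> x; rewrite /= !in_itv /= => /andP[/ltW/(le_trans ab)-> ->].
Qed.

Lemma RI_FTC a b (f F : R -> R) : a <= b -> con a b f ->
  (forall x, a <= x <= b -> is_derive x 1 F (f x)) -> RI a b f = F b - F a.
Proof.
rewrite le_eqVlt => /predU1P[<- hf _|ab hf H].
  by rewrite /RI set_itv1 Rintegral_set1 subrr.
rewrite /RI /Rintegral (@continuous_FTC2 _ f F) //; first exact: con_within.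
- have cF x : a <= x <= b -> {for x, continuous F}.
    move=> /H Hd; apply: differentiable_continuous; apply/derivable1_diffP.
    exact: ex_derive.
  split.
  + move=> x; rewrite in_itv /= => /andP[ax xb].
    by have Hd := H x; apply: (@ex_derive _ _ _ _ _ _ _ (Hd _)); rewrite !ltW.
  + by apply: cvg_at_right_filter; apply: cF; rewrite lexx ltW.
  + by apply: cvg_at_left_filter; apply: cF; rewrite lexx ltW.
- move=> x; rewrite in_itv /= => /andP[ax xb]; rewrite derive1E.
  by have Hd := H x; apply: (@derive_val _ _ _ _ _ _ _ (Hd _)); rewrite !ltW.
Qed.

End RealIntegral.

Section ComplexIntegral.
Variable R : realType.
Local Notation C := (cplx R).
Implicit Types (f g : R -> C) (a b c : R).

Definition conC a b f := forall x, a <= x <= b -> {for x, continuous f}.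

Lemma conC_re a b f : conC a b f -> con a b (fun x => re (f x)).
Proof. by move=> H x /H /cvgC_reim[]. Qed.
Lemma conC_im a b f : conC a b f -> con a b (fun x => im (f x)).
Proof. by move=> H x /H /cvgC_reim[]. Qed.
Hint Resolve conC_re conC_im : core.

Lemma conC_sub a b c d f : conC a b f -> a <= c -> d <= b -> conC c d f.
Proof. by move=> H ac db x /andP[cx xd]; apply: H; rewrite (le_trans ac) //= (le_trans xd). Qed.
Lemma conC_cst a b (k : C) : conC a b (fun=> k).
Proof. by move=> x _; exact: cvg_cst. Qed.
Lemma conCD a b f g : conC a b f -> conC a b g -> conC a b (fun x => f x + g x).
Proof. by move=> hf hg x xab; apply: continuousD; [exact: hf|exact: hg]. Qed.
Lemma conCB a b f g : conC a b f -> conC a b g -> conC a b (fun x => f x - g x).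
Proof. by move=> hf hg x xab; apply: continuousB; [exact: hf|exact: hg]. Qed.
Lemma conCM a b f g : conC a b f -> conC a b g -> conC a b (fun x => f x * g x).
Proof. by move=> hf hg x xab; apply: continuousM; [exact: hf|exact: hg]. Qed.
Lemma conCV a b f : (forall x, a <= x <= b -> f x != 0) ->
  conC a b f -> conC a b (fun x => (f x)^-1).
Proof. by move=> f0 hf x xab; apply: continuousV; [exact: f0|exact: hf]. Qed.
Lemma conCX a b f k : conC a b f -> conC a b (fun x => f x ^+ k).
Proof.
move=> hf; elim: k => [|k IH] x xab; first exact: cvg_cst.
have -> : (fun x => f x ^+ k.+1) = (fun x => f x * f x ^+ k).
  by apply/funext => y; rewrite exprS.
exact: (conCM hf IH).
Qed.

Definition CI a b f : C :=
  mkC (RI a b (fun x => re (f x))) (RI a b (fun x => im (f x))).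

Lemma re_CI a b f : re (CI a b f) = RI a b (fun x => re (f x)). Proof. by []. Qed.
Lemma im_CI a b f : im (CI a b f) = RI a b (fun x => im (f x)). Proof. by []. Qed.

Lemma CID a b f g : conC a b f -> conC a b g ->
  CI a b (fun x => f x + g x) = CI a b f + CI a b g.
Proof.
move=> hf hg; apply: cplxP; rewrite ?reD ?imD ?re_CI ?im_CI -RID;
  auto; apply: RI_eq => x _; by rewrite ?reD ?imD.
Qed.

Lemma CIZ a b k f : conC a b f -> CI a b (fun x => k * f x) = k * CI a b f.
Proof.
move=> hf; have cZ h c : con a b h -> con a b (fun x => c * h x).
  by move=> ch x xab; apply: (@continuousM _ _ (cst c)); [exact: cvg_cst|exact: ch].
apply: cplxP; rewrite ?reM ?imM ?re_CI ?im_CI -?mulNr -!RIZ -?RID; auto;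
  by apply: RI_eq => x _; rewrite ?reM ?imM ?mulNr.
Qed.

Lemma CIN a b f : conC a b f -> CI a b (fun x => - f x) = - CI a b f.
Proof.
move=> hf; rewrite -mulN1r -CIZ //; congr (CI _ _ _).
by apply/funext => x; rewrite mulN1r.
Qed.

Lemma CIB a b f g : conC a b f -> conC a b g ->
  CI a b (fun x => f x - g x) = CI a b f - CI a b g.
Proof.
move=> hf hg; rewrite -(CIN hg); apply: (CID hf (g := fun x => - g x)).
by move=> x xab; apply: continuousN; exact: hg.
Qed.

Lemma CI_eq a b f g : (forall x, a <= x <= b -> f x = g x) -> CI a b f = CI a b g.
Proof.
by move=> H; rewrite /CI; congr mkC; apply: RI_eq => x /H ->.
Qed.

Lemma CI_cst a b k : a <= b -> CI a b (fun=> k) = k * toC (b - a).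
Proof.
move=> ab; apply: cplxP; rewrite ?reM ?imM ?re_CI ?im_CI RI_cst //;
 by rewrite /toC /re /im /= !mulr0 ?subr0 ?add0r.
Qed.

(** Real and imaginary parts are bounded separately, whence the factor 2; every use tolerates a
    constant factor. *)
Lemma CI_norm a b f B : a <= b -> conC a b f ->
  (forall x, a <= x <= b -> nrm (f x) <= B) -> nrm (CI a b f) <= 2 * B * (b - a).
Proof.
move=> ab hf H; apply: le_trans (nrm_le_reim _) _.
rewrite (_ : 2 * B * (b - a) = B * (b - a) + B * (b - a)); last by ring.
apply: lerD; apply: RI_norm; auto => x /H.
- by apply: le_trans; exact: re_le_nrm.
- by apply: le_trans; exact: im_le_nrm.
Qed.

Lemma CI_chasles a b c f : a <= b -> b <= c -> conC a c f ->
  CI a c f = CI a b f + CI b c f.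
Proof.
move=> ab bc hf; apply: cplxP; rewrite ?reD ?imD; apply: RI_chasles; auto.
Qed.

Definition cder f (t : R) (d : C) : Prop :=
  is_derive t 1 (fun x => re (f x)) (re d) /\ is_derive t 1 (fun x => im (f x)) (im d).

Lemma CI_FTC a b f F : a <= b -> conC a b f ->
  (forall x, a <= x <= b -> cder F x (f x)) -> CI a b f = F b - F a.
Proof.
move=> ab hf H; apply: cplxP; rewrite ?reB ?imB.
- by apply: (RI_FTC (F := fun x => re (F x))); auto; move=> x /H[].
- by apply: (RI_FTC (F := fun x => im (F x))); auto; move=> x /H[].
Qed.

Lemma cder_eq f t d d' : cder f t d -> d = d' -> cder f t d'.
Proof. by move=> H <-. Qed.

Lemma cderD f g t d e : cder f t d -> cder g t e ->
  cder (fun x => f x + g x) t (d + e).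
Proof.
move=> [fr fi] [gr gi]; split.
- rewrite reD (_ : (fun x => _) = (fun x => re (f x)) + (fun x => re (g x))).
    exact: is_deriveD.
  by apply/funext => x; rewrite reD.
- rewrite imD (_ : (fun x => _) = (fun x => im (f x)) + (fun x => im (g x))).
    exact: is_deriveD.
  by apply/funext => x; rewrite imD.
Qed.

Lemma cderM f g t d e : cder f t d -> cder g t e ->
  cder (fun x => f x * g x) t (d * g t + f t * e).
Proof.
move=> [fr fi] [gr gi]; split.
- rewrite (_ : (fun x => _) = (fun x => re (f x)) * (fun x => re (g x)) -
                              (fun x => im (f x)) * (fun x => im (g x))).
    apply: is_derive_eq; rewrite reD !reM /GRing.scale /=; ring.
  by apply/funext => x; rewrite reM.
- rewrite (_ : (fun x => _) = (fun x => re (f x)) * (fun x => im (g x)) +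
                              (fun x => im (f x)) * (fun x => re (g x))).
    apply: is_derive_eq; rewrite imD !imM /GRing.scale /=; ring.
  by apply/funext => x; rewrite imM.
Qed.

Lemma cder_cst (k : C) t : cder (fun=> k) t 0.
Proof. by split; exact: is_derive_cst. Qed.

Lemma cderZ f t d (k : C) : cder f t d -> cder (fun x => k * f x) t (k * d).
Proof.
move=> H; apply: cder_eq (cderM (cder_cst k t) H) _; by rewrite mul0r add0r.
Qed.

Lemma cder_toC (p : R -> R) (t d : R) : is_derive t 1 p d -> cder (fun x => toC (p x)) t (toC d).
Proof. by move=> H; split => //; exact: is_derive_cst. Qed.

Lemma cder_cis (k t : R) :
  cder (fun x => cis (k * x)) t (toC k * imagI R * cis (k * t)).
Proof.
have H : is_derive t 1 (fun x => k * x) k.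
  by apply: is_derive_eq; rewrite /GRing.scale /= mulr1.
split.
- rewrite (_ : re _ = - sin (k * t) * k); last first.
    by rewrite !reM !imM re_cis im_cis /toC /imagI /re /im /=; ring.
  exact: (@is_derive1_comp _ cos (fun x => k * x) t _ _ _ H).
- rewrite (_ : im _ = cos (k * t) * k); last first.
    by rewrite !imM !reM re_cis im_cis /toC /imagI /re /im /=; ring.
  exact: (@is_derive1_comp _ sin (fun x => k * x) t _ _ _ H).
Qed.

Lemma is_derive_cont (p : R -> R) (t d : R) : is_derive t 1 p d -> {for t, continuous p}.
Proof.
move=> H; apply: differentiable_continuous; apply/derivable1_diffP.
exact: ex_derive.
Qed.

Lemma cder_cont f t d : cder f t d -> {for t, continuous f}.
Proof.
by move=> [hr hi]; apply/cvgC_reim; split; apply: is_derive_cont; eassumption.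
Qed.

End ComplexIntegral.

(** * Cauchy theory *)

Section Bisection.
Variable R : realType.
Local Notation C := (cplx R).
Variable J : R -> R -> R -> C.
Hypothesis Jadd : forall x y h, 0 <= x -> 0 <= y -> 0 < h ->
  x + h + h <= 1 -> y + h + h <= 1 ->
  J x y (h + h) = J x y h + J (x + h) y h + J x (y + h) h + J (x + h) (y + h) h.
Hypothesis Jloc : forall x0 y0, 0 <= x0 <= 1 -> 0 <= y0 <= 1 ->
  forall e, 0 < e -> exists2 d, 0 < d & forall x y h, 0 < h -> h < d ->
    0 <= x -> 0 <= y -> x + h <= 1 -> y + h <= 1 ->
    x <= x0 <= x + h -> y <= y0 <= y + h -> nrm (J x y h) <= e * h ^+ 2.

(** Goursat's quartering for an abstract additive function of squares. One of four quarters carries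
    at least a quarter of the value, so the ratio of value to area never drops below eta along
    nested squares; at their common point [Jloc] with eta / 2 contradicts this. *)
Lemma bisection_zero : J 0 0 1 = 0.
Proof.
apply/eqP; rewrite -nrm_eq0; apply/eqP; apply: contrapT => /eqP J0.
have eta0 : 0 < nrm (J 0 0 1) by rewrite lt_def J0 nrm_ge0.
set eta := nrm (J 0 0 1) in eta0.
pose hh k : R := 2^-1 ^+ k.
have hh0 k : 0 < hh k by rewrite exprn_gt0 // invr_gt0.
have hhS k : hh k = hh k.+1 + hh k.+1.
  by rewrite /hh exprS -mulrDl -[LHS]mul1r; congr (_ * _); lra.
pose good k (p : R * R) := [/\ 0 <= p.1, 0 <= p.2, p.1 + hh k <= 1,
  p.2 + hh k <= 1 & eta * hh k ^+ 2 <= nrm (J p.1 p.2 (hh k))].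
pose next k (p q : R * R) := [/\ good k.+1 q, p.1 <= q.1, p.2 <= q.2,
  q.1 + hh k.+1 <= p.1 + hh k & q.2 + hh k.+1 <= p.2 + hh k].
(* The premise [good] sits inside the existential so that [choice] yields a total successor
   function; (0, 0) is a dummy value. *)
have step (kp : nat * (R * R)) : exists q, good kp.1 kp.2 -> next kp.1 kp.2 q.
  case: kp => k [x y] /=.
  have [[/= x0 y0 xh yh big]|nb] := pselect (good k (x, y)); last by exists (0, 0).
  have h0 := hh0 k.+1; have hS := hhS k.
  have hx : x + hh k.+1 + hh k.+1 <= 1 by rewrite -addrA -hS.
  have hy : y + hh k.+1 + hh k.+1 <= 1 by rewrite -addrA -hS.
  have := Jadd x0 y0 h0 hx hy; rewrite -hS => Jk.
  move: big; rewrite Jk.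
  set A := J x y _; set B := J _ y _; set E := J x _ _; set F := J _ _ _ => big.
  have tri : nrm (A + B + E + F) <= nrm A + nrm B + nrm E + nrm F.
    apply: le_trans (nrmD _ _) _; rewrite lerD2r.
    apply: le_trans (nrmD _ _) _; rewrite lerD2r; exact: nrmD.
  have e4 : eta * hh k ^+ 2 = 4 * (eta * hh k.+1 ^+ 2) by rewrite hS; ring.
  have [hA|hA] := leP (eta * hh k.+1 ^+ 2) (nrm A).
    by exists (x, y) => _; split => //=; try split => //=; lra.
  have [hB|hB] := leP (eta * hh k.+1 ^+ 2) (nrm B).
    by exists (x + hh k.+1, y) => _; split => //=; try split => //=; lra.
  have [hE|hE] := leP (eta * hh k.+1 ^+ 2) (nrm E).
    by exists (x, y + hh k.+1) => _; split => //=; try split => //=; lra.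
  have [hF|hF] := leP (eta * hh k.+1 ^+ 2) (nrm F).
    by exists (x + hh k.+1, y + hh k.+1) => _; split => //=; try split => //=; lra.
  lra.
have [nx nxP] := choice step.
pose p := fix p k := if k is k'.+1 then nx (k', p k') else (0, 0).
have pgood k : good k (p k).
  elim: k => [|k IH]; last by have [] := nxP (k, p k) IH.
  by split => //=; rewrite /hh expr0 ?add0r // expr1n mulr1.
have pnext k : next k (p k) (p k.+1) by exact: (nxP (k, p k)).
have mono1 k m : (p k).1 <= (p (k + m)%N).1 /\
    (p (k + m)%N).1 + hh (k + m)%N <= (p k).1 + hh k.
  elim: m => [|m [IH1 IH2]]; first by rewrite addn0.
  rewrite addnS; have [_ a _ b _] := pnext (k + m)%N.
  by split; [exact: le_trans a | exact: le_trans IH2].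
have mono2 k m : (p k).2 <= (p (k + m)%N).2 /\
    (p (k + m)%N).2 + hh (k + m)%N <= (p k).2 + hh k.
  elim: m => [|m [IH1 IH2]]; first by rewrite addn0.
  rewrite addnS; have [_ _ a _ b] := pnext (k + m)%N.
  by split; [exact: le_trans a | exact: le_trans IH2].
have nested (s : nat -> R) : (forall k m, s k <= s (k + m)%N /\
    s (k + m)%N + hh (k + m)%N <= s k + hh k) ->
    exists x0, forall k, s k <= x0 <= s k + hh k.
  move=> ms.
  have cross k m : s m <= s k + hh k.
    have [km|/ltnW mk] := leqP k m.
      have [_] := ms k (m - k)%N; rewrite subnKC // => H.
      by apply: le_trans H; rewrite lerDl ltW.
    have [H _] := ms m (k - m)%N; rewrite subnKC // in H.
    by apply: le_trans H _; rewrite lerDl ltW.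
  exists (sup (range s)) => k; apply/andP; split.
    apply: ub_le_sup; last by exists k.
    by exists (s 0%N + hh 0%N) => _ [m _ <-]; exact: cross.
  apply: ge_sup; first by exists (s 0%N); exists 0%N.
  by move=> _ [m _ <-]; exact: cross.
have [x0 Hx] := nested _ mono1; have [y0 Hy] := nested _ mono2.
have hx0 : 0 <= x0 <= 1.
  by have := Hx 0%N; rewrite /= /hh expr0 add0r.
have hy0 : 0 <= y0 <= 1.
  by have := Hy 0%N; rewrite /= /hh expr0 add0r.
have e2 : 0 < eta / 2 by rewrite divr_gt0.
have [d d0 Hd] := Jloc hx0 hy0 e2.
have [k hk] : exists k, hh k < d.
  have /cvgrPdist_lt/(_ _ d0) : hh k @[k --> \oo] --> (0 : R).
    by apply: cvg_expr; rewrite ger0_norm ?invr_ge0 // invf_lt1 // ltr1n.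
  case=> k _ Hk; exists k; have := Hk k (leqnn k).
  by rewrite /= sub0r normrN ger0_norm // ltW.
have [g1 g2 g3 g4 g5] := pgood k.
have := Hd (p k).1 (p k).2 (hh k) (hh0 k) hk g1 g2 g3 g4 (Hx k) (Hy k).
have : 0 < eta * hh k ^+ 2 by rewrite mulr_gt0 // exprn_gt0.
by move: g5; lra.
Qed.

End Bisection.

Section Goursat.
Variable R : realType.
Local Notation C := (cplx R).

(** Complex differentiability written with the real norm [nrm], so that estimates stay in the field
    of reals; [cdiffP] identifies it with [is_derive]. *)
Definition cdiff (f : C -> C) (w d : C) := forall e : R, 0 < e ->
  exists2 r : R, 0 < r & forall v, nrm (v - w) < r ->
    nrm (f v - f w - d * (v - w)) <= e * nrm (v - w).

Lemma cdiff_cont f w d : cdiff f w d -> {for w, continuous f}.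
Proof.
move=> H; apply/(cvgCP (nbhs_filter w)) => e e0.
have [r r0 Hr] := H 1 ltr01.
have K0 : 0 < 1 + nrm d by rewrite ltr_wpDr // nrm_ge0.
apply/nbhsCP; exists (Num.min r (e / (1 + nrm d))).
  by rewrite lt_min r0 divr_gt0.
move=> y; rewrite lt_min => /andP[yr ye].
have := Hr _ yr; rewrite mul1r => h1.
have h2 := nrmD (f y - f w - d * (y - w)) (d * (y - w)).
rewrite subrK nrmM in h2.
apply: le_lt_trans h2 _; rewrite ltr_pdivlMr // mulrC in ye.
by apply: le_lt_trans ye; rewrite mulrDl mul1r lerD2r.
Qed.

Variables (u ux uy : R -> R -> C) (G : C -> C) (L : R).
Hypothesis L0 : 0 < L.
Hypothesis hux : forall (x y : R), 0 <= x <= 1 -> 0 <= y <= 1 -> cder (u ^~ y) x (ux x y).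
Hypothesis huy : forall (x y : R), 0 <= x <= 1 -> 0 <= y <= 1 -> cder (u x) y (uy x y).
Hypothesis cux : forall (y : R), 0 <= y <= 1 -> conC 0 1 (ux ^~ y).
Hypothesis cuy : forall (x : R), 0 <= x <= 1 -> conC 0 1 (uy x).
Hypothesis bux : forall (x y : R), 0 <= x <= 1 -> 0 <= y <= 1 -> nrm (ux x y) <= L.
Hypothesis buy : forall (x y : R), 0 <= x <= 1 -> 0 <= y <= 1 -> nrm (uy x y) <= L.
Hypothesis hG : forall (x y : R), 0 <= x <= 1 -> 0 <= y <= 1 ->
  exists d, cdiff G (u x y) d.

Lemma Gu_cont_x (y : R) : 0 <= y <= 1 -> conC 0 1 (fun x => G (u x y)).
Proof.
move=> y01 x x01; apply: continuous_comp; first exact: (cder_cont (hux x01 y01)).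
by have [d /cdiff_cont] := hG x01 y01.
Qed.
Lemma Gu_cont_y (x : R) : 0 <= x <= 1 -> conC 0 1 (fun y => G (u x y)).
Proof.
move=> x01 y y01; apply: continuous_comp; first exact: (cder_cont (huy x01 y01)).
by have [d /cdiff_cont] := hG x01 y01.
Qed.

Definition edgex x h y := CI x (x + h) (fun t => G (u t y) * ux t y).
Definition edgey x y h := CI y (y + h) (fun t => G (u x t) * uy x t).
(** The integral of G dv along the image under u of the boundary of a square of side h,
    counterclockwise. *)
Definition bnd x y h := edgey (x + h) y h - edgey x y h
   - edgex x h (y + h) + edgex x h y.

Lemma sub01 (x h : R) : 0 <= x -> 0 < h -> x + h <= 1 ->
  forall t, x <= t <= x + h -> 0 <= t <= 1.
Proof. by move=> x0 h0 xh t /andP[a b]; rewrite (le_trans x0 a) (le_trans b xh). Qed.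

Lemma lip_x (x1 x2 y : R) : 0 <= x1 -> x1 <= x2 -> x2 <= 1 -> 0 <= y <= 1 ->
  nrm (u x2 y - u x1 y) <= 2 * L * (x2 - x1).
Proof.
move=> x10 x12 x21 y01.
have c : conC x1 x2 (ux ^~ y) by apply: conC_sub (cux y01) _ _.
have in01 x : x1 <= x <= x2 -> 0 <= x <= 1.
  by move=> /andP[a b]; rewrite (le_trans x10 a) (le_trans b x21).
rewrite -(@CI_FTC _ _ _ _ (u ^~ y) x12 c).
  by apply: CI_norm => // x /in01 ?; exact: bux.
by move=> x /in01 ?; exact: hux.
Qed.
Lemma lip_y (x y1 y2 : R) : 0 <= y1 -> y1 <= y2 -> y2 <= 1 -> 0 <= x <= 1 ->
  nrm (u x y2 - u x y1) <= 2 * L * (y2 - y1).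
Proof.
move=> y10 y12 y21 x01.
have c : conC y1 y2 (uy x) by apply: conC_sub (cuy x01) _ _.
have in01 y : y1 <= y <= y2 -> 0 <= y <= 1.
  by move=> /andP[a b]; rewrite (le_trans y10 a) (le_trans b y21).
rewrite -(@CI_FTC _ _ _ _ (u x) y12 c).
  by apply: CI_norm => // y /in01 ?; exact: buy.
by move=> y /in01 ?; exact: huy.
Qed.

Lemma lip_abs (x y x' y' h : R) : 0 < h ->
  0 <= x <= 1 -> 0 <= y <= 1 -> 0 <= x' <= 1 -> 0 <= y' <= 1 ->
  `|x - x'| <= h -> `|y - y'| <= h -> nrm (u x y - u x' y') <= 4 * L * h.
Proof.
move=> h0 x01 y01 x'01 y'01 xx yy.
have -> : u x y - u x' y' = (u x y - u x' y) + (u x' y - u x' y').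
  by rewrite addrA subrK.
have l2 : 0 <= 2 * L by rewrite mulr_ge0 // ltW.
move: xx yy; rewrite !ler_norml => /andP[xa xb] /andP[ya yb].
have a : nrm (u x y - u x' y) <= 2 * L * h.
  have [xx'|/ltW xx'] := leP x x'.
    rewrite nrm_distC; apply: le_trans (lip_x _ xx' _ _) _ => //; try by lra.
    by rewrite ler_wpM2l //; lra.
  apply: le_trans (lip_x _ xx' _ _) _ => //; try by lra.
  by rewrite ler_wpM2l //; lra.
have b : nrm (u x' y - u x' y') <= 2 * L * h.
  have [yy'|/ltW yy'] := leP y y'.
    rewrite nrm_distC; apply: le_trans (lip_y _ yy' _ _) _ => //; try by lra.
    by rewrite ler_wpM2l //; lra.
  apply: le_trans (lip_y _ yy' _ _) _ => //; try by lra.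
  by rewrite ler_wpM2l //; lra.
by apply: le_trans (nrmD _ _) _; lra.
Qed.

(** An affine integrand has the primitive a v + b/2 (v - c)^2 along u, so each edge integral is a
    difference of corner values; these cancel around a square. *)
Lemma edge_lin_x a b (c : C) (x h y : R) : 0 <= x -> 0 < h -> x + h <= 1 -> 0 <= y <= 1 ->
  CI x (x + h) (fun t => (a + b * (u t y - c)) * ux t y) =
  (a * u (x + h) y + b / 2 * (u (x + h) y - c) ^+ 2) -
  (a * u x y + b / 2 * (u x y - c) ^+ 2).
Proof.
move=> x0 h0 xh y01; have i01 := sub01 x0 h0 xh.
apply: (@CI_FTC _ _ _ _ (fun t => a * u t y + b / 2 * (u t y - c) ^+ 2)).
- by rewrite lerDl ltW.
- apply: conCM; last by apply: conC_sub (cux y01) _ _.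
  apply: conCD; first exact: conC_cst.
  apply: conCM; first exact: conC_cst.
  apply: conCB; last exact: conC_cst.
  by move=> t /i01 t01; apply: cder_cont (hux t01 y01).
- move=> t /i01 t01; have H := hux t01 y01.
  have H' := cderD H (cder_cst (- c) t).
  apply: cder_eq (cderD (cderZ a H) (cderZ (b / 2) (cderM H' H'))) _.
  rewrite addr0; have : (2 : C) != 0 by rewrite pnatr_eq0.
  by move=> ?; field.
Qed.
Lemma edge_lin_y a b (c : C) (x y h : R) : 0 <= y -> 0 < h -> y + h <= 1 -> 0 <= x <= 1 ->
  CI y (y + h) (fun t => (a + b * (u x t - c)) * uy x t) =
  (a * u x (y + h) + b / 2 * (u x (y + h) - c) ^+ 2) -
  (a * u x y + b / 2 * (u x y - c) ^+ 2).
Proof.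
move=> y0 h0 yh x01; have i01 := sub01 y0 h0 yh.
apply: (@CI_FTC _ _ _ _ (fun t => a * u x t + b / 2 * (u x t - c) ^+ 2)).
- by rewrite lerDl ltW.
- apply: conCM; last by apply: conC_sub (cuy x01) _ _.
  apply: conCD; first exact: conC_cst.
  apply: conCM; first exact: conC_cst.
  apply: conCB; last exact: conC_cst.
  by move=> t /i01 t01; apply: cder_cont (huy x01 t01).
- move=> t /i01 t01; have H := huy x01 t01.
  have H' := cderD H (cder_cst (- c) t).
  apply: cder_eq (cderD (cderZ a H) (cderZ (b / 2) (cderM H' H'))) _.
  rewrite addr0; have : (2 : C) != 0 by rewrite pnatr_eq0.
  by move=> ?; field.
Qed.

Lemma bnd_add (x y h : R) : 0 <= x -> 0 <= y -> 0 < h ->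
  x + h + h <= 1 -> y + h + h <= 1 ->
  bnd x y (h + h) = bnd x y h + bnd (x + h) y h + bnd x (y + h) h
                    + bnd (x + h) (y + h) h.
Proof.
move=> x0 y0 h0 xh yh.
have splx t : 0 <= t <= 1 -> edgex x (h + h) t = edgex x h t + edgex (x + h) h t.
  move=> t01; rewrite /edgex addrA; apply: CI_chasles; rewrite ?lerDl ?ltW //.
  by apply: conC_sub (conCM (Gu_cont_x t01) (cux t01)) _ _.
have sply t : 0 <= t <= 1 -> edgey t y (h + h) = edgey t y h + edgey t (y + h) h.
  move=> t01; rewrite /edgey addrA; apply: CI_chasles; rewrite ?lerDl ?ltW //.
  by apply: conC_sub (conCM (Gu_cont_y t01) (cuy t01)) _ _.
rewrite /bnd !addrA !splx ?sply ?sply //; try by apply/andP; split; lra.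
ring.
Qed.

(** G is split into its affine part at the base point, whose boundary integral is zero by
    telescoping, and a remainder that differentiability makes small compared with the diameter. *)
Lemma bnd_loc (x0 y0 : R) : 0 <= x0 <= 1 -> 0 <= y0 <= 1 ->
  forall e, 0 < e -> exists2 d, 0 < d & forall x y h, 0 < h -> h < d ->
    0 <= x -> 0 <= y -> x + h <= 1 -> y + h <= 1 ->
    x <= x0 <= x + h -> y <= y0 <= y + h -> nrm (bnd x y h) <= e * h ^+ 2.
Proof.
move=> x001 y001 e e0; have [b Hb] := hG x001 y001.
(* 32 is 4 edges times 8, where 8 is the 2 of [CI_norm] times the 4 of [lip_abs]; one L bounds the
   distance in the image, the other the speed of u. *)
pose e' := e / (32 * L * L).
have e'0 : 0 < e' by rewrite divr_gt0 // !mulr_gt0.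
have [r r0 Hr] := Hb e' e'0.
exists (r / (4 * L)); first by rewrite divr_gt0 // mulr_gt0.
move=> x y h h0 hr px py xh yh xx yy.
pose lin (v : C) := G (u x0 y0) + b * (v - u x0 y0).
pose rem v := G v - lin v.
have Glin v : G v = lin v + rem v by rewrite /rem addrC subrK.
have ix := sub01 px h0 xh; have iy := sub01 py h0 yh.
have remB s t : x <= s <= x + h -> y <= t <= y + h ->
    nrm (rem (u s t)) <= e' * (4 * L * h).
  move=> hs ht.
  have d1 : nrm (u s t - u x0 y0) <= 4 * L * h.
    apply: lip_abs => //; [exact: ix|exact: iy| |];
      by rewrite ler_norml; apply/andP; split; lra.
  have d2 : nrm (u s t - u x0 y0) < r.
    apply: le_lt_trans d1 _; rewrite mulrC -ltr_pdivlMr // mulr_gt0 //.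
  rewrite /rem /lin opprD addrA; apply: le_trans (Hr _ d2) _.
  by rewrite ler_pM2l.
have linx t : 0 <= t <= 1 -> conC 0 1 (fun s => lin (u s t)).
  move=> t01; apply: conCD; first exact: conC_cst.
  apply: conCM; first exact: conC_cst.
  apply: conCB; last exact: conC_cst.
  by move=> s s01; apply: cder_cont (hux s01 t01).
have liny s : 0 <= s <= 1 -> conC 0 1 (fun t => lin (u s t)).
  move=> s01; apply: conCD; first exact: conC_cst.
  apply: conCM; first exact: conC_cst.
  apply: conCB; last exact: conC_cst.
  by move=> t t01; apply: cder_cont (huy s01 t01).
have ex t : y <= t <= y + h -> exists2 E, nrm E <= 8 * (e' * L * L) * h ^+ 2 &
   edgex x h t = CI x (x + h) (fun s => lin (u s t) * ux s t) + E.
  move=> ht; have t01 := iy _ ht.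
  have cr : conC x (x + h) (fun s => rem (u s t) * ux s t).
    apply: conC_sub (_ : conC 0 1 _) _ _ => //.
    exact: conCM (conCB (Gu_cont_x t01) (linx _ t01)) (cux t01).
  exists (CI x (x + h) (fun s => rem (u s t) * ux s t)).
    apply: le_trans (@CI_norm _ _ _ _ (e' * (4 * L * h) * L) _ cr _) _.
    - by rewrite lerDl ltW.
    - move=> s hs; rewrite nrmM; apply: ler_pM; rewrite ?nrm_ge0 //.
      + exact: remB.
      + by apply: bux => //; exact: ix.
    - by rewrite [x + h]addrC addrK; lra.
  rewrite -(CID _ cr); last first.
    by apply: conC_sub (conCM (linx _ t01) (cux t01)) _ _.
  by apply: CI_eq => s _; rewrite -mulrDl -Glin.
have ey s : x <= s <= x + h -> exists2 E, nrm E <= 8 * (e' * L * L) * h ^+ 2 &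
   edgey s y h = CI y (y + h) (fun t => lin (u s t) * uy s t) + E.
  move=> hs; have s01 := ix _ hs.
  have cr : conC y (y + h) (fun t => rem (u s t) * uy s t).
    apply: conC_sub (_ : conC 0 1 _) _ _ => //.
    exact: conCM (conCB (Gu_cont_y s01) (liny _ s01)) (cuy s01).
  exists (CI y (y + h) (fun t => rem (u s t) * uy s t)).
    apply: le_trans (@CI_norm _ _ _ _ (e' * (4 * L * h) * L) _ cr _) _.
    - by rewrite lerDl ltW.
    - move=> t ht; rewrite nrmM; apply: ler_pM; rewrite ?nrm_ge0 //.
      + exact: remB.
      + by apply: buy => //; exact: iy.
    - by rewrite [y + h]addrC addrK; lra.
  rewrite -(CID _ cr); last first.
    by apply: conC_sub (conCM (liny _ s01) (cuy s01)) _ _.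
  by apply: CI_eq => t _; rewrite -mulrDl -Glin.
have hl : x <= x <= x + h by rewrite lexx lerDl ltW.
have hr' : x <= x + h <= x + h by rewrite lexx lerDl ltW.
have kl : y <= y <= y + h by rewrite lexx lerDl ltW.
have kr : y <= y + h <= y + h by rewrite lexx lerDl ltW.
have [E1 n1 e1] := ey _ hr'; have [E2 n2 e2] := ey _ hl.
have [E3 n3 e3] := ex _ kr; have [E4 n4 e4] := ex _ kl.
rewrite /bnd e1 e2 e3 e4 /lin !edge_lin_x ?edge_lin_y //; auto.
rewrite (_ : _ + _ = E1 - E2 - E3 + E4); last by ring.
have ee : 32 * (e' * L * L) = e.
  by rewrite /e'; field; rewrite gt_eqF.
have := nrmD (E1 - E2 - E3) E4; have := nrmB (E1 - E2) E3; have := nrmB E1 E2.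
by rewrite -[X in _ <= X * _]ee; lra.
Qed.

Lemma goursat : CI 0 1 (fun t => G (u 1 t) * uy 1 t) - CI 0 1 (fun t => G (u 0 t) * uy 0 t)
  - CI 0 1 (fun t => G (u t 1) * ux t 1) + CI 0 1 (fun t => G (u t 0) * ux t 0) = 0.
Proof.
have := bisection_zero bnd_add bnd_loc; rewrite /bnd /edgex /edgey.
by rewrite !add0r.
Qed.

End Goursat.

Section CDiff.
Variable R : realType.
Local Notation C := (cplx R).
Implicit Types (f g : C -> C) (w d : C).

Lemma dnbhsCP (x : C) (P : set C) : (\forall y \near x^', P y) <->
  exists2 d : R, 0 < d & forall y, nrm (y - x) < d -> y != x -> P y.
Proof.
split=> [/nbhsCP[d d0 H]|[d d0 H]]; first by exists d => // y yd yx; exact: H.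
by apply/nbhsCP; exists d => // y yd yx; exact: H.
Qed.

Lemma cdiffP f w d : cdiff f w d <-> is_derive w 1 f d.
Proof.
have key : cdiff f w d <->
    (fun h => h^-1 *: ((f \o shift w) (h *: (1 : C)) - f w)) @ (0 : C)^' --> d.
  split.
  - move=> H; apply/(cvgCP (dnbhs_filter 0)) => e e0.
    have e2 : 0 < e / 2 by rewrite divr_gt0.
    have [r r0 Hr] := H (e / 2) e2.
    apply/dnbhsCP; exists r => // h; rewrite subr0 => hr h0.
    have := Hr (h + w); rewrite addrK => /(_ hr).
    rewrite /= /GRing.scale /= mulr1 => hh.
    rewrite (_ : _ - d = h^-1 * (f (h + w) - f w - d * h)); last by field.
    rewrite nrmM nrmV; have n0 : 0 < nrm h by rewrite nrm_gt0.
    apply: (@le_lt_trans _ _ (e / 2)); last by lra.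
    by rewrite mulrC ler_pdivrMr.
  - move=> /(cvgCP (dnbhs_filter 0)) H e e0.
    have [r r0 Hr] := (dnbhsCP _ _).1 (H e e0).
    exists r => // v vr; have [->|vw] := eqVneq v w.
      by rewrite !subrr mulr0 subrr nrm0 mulr0.
    have := Hr (v - w); rewrite subr0 subr_eq0 /= /GRing.scale /= mulr1 subrK => /(_ vr vw).
    have vw0 : v - w != 0 by rewrite subr_eq0.
    rewrite (_ : f v - f w - d * (v - w) =
       (v - w) * ((v - w)^-1 * (f v - f w) - d)); last by field.
    by move=> h; rewrite nrmM [leLHS]mulrC; apply: ler_wpM2r; [exact: nrm_ge0|exact: ltW].
rewrite key; split.
- by move=> H; split; [apply/cvg_ex; exists d | exact: cvg_lim].
- by case=> /cvg_ex[l Hl] <-; rewrite /derive (cvg_lim _ Hl).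
Qed.

Lemma derivable_cdiff f w : derivable f w 1 -> exists d, cdiff f w d.
Proof. by move=> H; exists ('D_1 f w); apply/cdiffP; exact: derivableP. Qed.

Lemma cdiff_derive1 f w d : cdiff f w d -> f^`()%classic w = d.
Proof. by move=> /cdiffP[_ <-]; rewrite derive1E. Qed.

Lemma cdiff_cst k w : cdiff (fun=> k) w 0.
Proof. by apply/cdiffP; exact: is_derive_cst. Qed.
Lemma cdiff_id w : cdiff id w 1.
Proof. by apply/cdiffP; exact: is_derive_id. Qed.
Lemma cdiff_eq f w d d' : cdiff f w d -> d = d' -> cdiff f w d'.
Proof. by move=> H <-. Qed.
Lemma cdiffD f g w d e : cdiff f w d -> cdiff g w e -> cdiff (fun x => f x + g x) w (d + e).
Proof. by move=> /cdiffP hf /cdiffP hg; apply/cdiffP; exact: is_deriveD. Qed.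
Lemma cdiffM f g w d e : cdiff f w d -> cdiff g w e ->
  cdiff (fun x => f x * g x) w (d * g w + f w * e).
Proof.
move=> /cdiffP hf /cdiffP hg; apply/cdiffP.
have H := is_deriveM hf hg.
rewrite (_ : d * g w + f w * e = f w *: e + g w *: d); first exact: H.
by rewrite /GRing.scale /= addrC [d * _]mulrC.
Qed.
Lemma cdiffZ k f w d : cdiff f w d -> cdiff (fun x => k * f x) w (k * d).
Proof. by move=> hf; apply: cdiff_eq (cdiffM (cdiff_cst k w) hf) _; rewrite mul0r add0r. Qed.
Lemma cdiffN f w d : cdiff f w d -> cdiff (fun x => - f x) w (- d).
Proof. by move=> /cdiffP hf; apply/cdiffP; exact: is_deriveN. Qed.
Lemma cdiffB f g w d e : cdiff f w d -> cdiff g w e -> cdiff (fun x => f x - g x) w (d - e).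
Proof. by move=> hf hg; apply: cdiffD => //; exact: cdiffN. Qed.

Lemma cdiff_near f g w d : (\forall x \near w, f x = g x) -> cdiff f w d -> cdiff g w d.
Proof.
move=> /nbhsCP[r r0 fg] H e e0; have [s s0 Hs] := H e e0.
exists (Num.min r s); first by rewrite lt_min r0.
move=> v; rewrite lt_min => /andP[vr vs].
by rewrite -!fg ?subrr ?nrm0 //; exact: Hs.
Qed.

Lemma cdiff_comp f g w d e : cdiff g w e -> cdiff f (g w) d ->
  cdiff (fun x => f (g x)) w (d * e).
Proof.
move=> hg hf eps eps0; have lt02 : (0 : R) < 2 by [].
have K0 : 0 < 1 + nrm e by rewrite ltr_wpDr // nrm_ge0.
have [s s0 Hs] := hf (eps / 2 / (1 + nrm e)) (divr_gt0 (divr_gt0 eps0 lt02) K0).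
have [r1 r10 H1] := hg 1 ltr01.
have D0 : 0 < 1 + nrm d by rewrite ltr_wpDr // nrm_ge0.
have [r2 r20 H2] := hg (eps / 2 / (1 + nrm d)) (divr_gt0 (divr_gt0 eps0 lt02) D0).
have /(cvgCP (nbhs_filter w)) /(_ s s0)/nbhsCP[r3 r30 H3] := cdiff_cont hg.
exists (Num.min r1 (Num.min r2 r3)); first by rewrite !lt_min r10 r20 r30.
move=> v; rewrite !lt_min => /and3P[v1 v2 v3].
have := Hs _ (H3 _ v3); have := H1 _ v1; have := H2 _ v2.
set A := nrm (g v - g w - _) => h2 h1 h.
have gl : nrm (g v - g w) <= (1 + nrm e) * nrm (v - w).
  have := nrmD (g v - g w - e * (v - w)) (e * (v - w)); rewrite subrK nrmM => t.
  by apply: le_trans t _; rewrite mulrDl lerD2r.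
rewrite (_ : f (g v) - f (g w) - d * e * (v - w) = (f (g v) - f (g w) - d * (g v - g w)) + d * (g v - g w - e * (v - w))); last by ring.
apply: le_trans (nrmD _ _) _; rewrite nrmM -/A.
have b1 : nrm (f (g v) - f (g w) - d * (g v - g w)) <= eps / 2 * nrm (v - w).
  apply: le_trans h _; apply: le_trans (_ : eps / 2 / (1 + nrm e) * ((1 + nrm e) * nrm (v - w)) <= _).
    by rewrite ler_wpM2l // ltW // divr_gt0 // divr_gt0.
  by rewrite mulrA divfK // gt_eqF.
have b2 : nrm d * A <= eps / 2 * nrm (v - w).
  apply: le_trans (_ : (1 + nrm d) * A <= _).
    by rewrite ler_wpM2r ?nrm_ge0 // lerDr.
  apply: le_trans (_ : (1 + nrm d) * (eps / 2 / (1 + nrm d) * nrm (v - w)) <= _).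
    by rewrite ler_wpM2l // ltW.
  by rewrite mulrA [_ * (eps / 2 / _)]mulrC divfK // gt_eqF.
by rewrite [X in _ <= X * _](splitr eps) mulrDl; exact: lerD.
Qed.

Lemma cdiff_inv w : w != 0 -> cdiff (fun x => x^-1) w (- w ^- 2).
Proof.
move=> w0 eps eps0; have n0 : 0 < nrm w by rewrite nrm_gt0.
exists (Num.min (nrm w / 2) (eps * nrm w ^+ 3 / 2)).
  by rewrite lt_min !divr_gt0 // mulr_gt0 // exprn_gt0.
move=> v; rewrite lt_min => /andP[v1 v2].
have nv : nrm w / 2 <= nrm v.
  by have := nrmB v (v - w); rewrite opprB addrC subrK; lra.
have v0 : v != 0 by rewrite -nrm_gt0; lra.
rewrite (_ : _ - _ = (v - w) / (w ^+ 2 * v) * (v - w)); last by field; rewrite w0 v0.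
rewrite nrmM; apply: ler_wpM2r; first exact: nrm_ge0.
rewrite nrmM nrmV nrmM nrmX ler_pdivrMr; last first.
  by rewrite mulr_gt0 ?exprn_gt0 //; lra.
apply: le_trans (ltW v2) _.
have H := ler_wpM2l (ltW eps0) (ler_wpM2l (sqr_ge0 (nrm w)) nv).
by apply: le_trans H; rewrite le_eqVlt; apply/orP; left; apply/eqP; field.
Qed.

Lemma cdiffV f w d : f w != 0 -> cdiff f w d -> cdiff (fun x => (f x)^-1) w (- d / f w ^+ 2).
Proof.
move=> f0 hf; apply: cdiff_eq (cdiff_comp hf (cdiff_inv f0)) _.
by rewrite mulrC mulrN mulNr.
Qed.

End CDiff.

Section Cauchy.
Variable R : realType.
Local Notation C := (cplx R).
Definition eturn (y : R) : C := cis (2 * pi * y).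
Local Notation e := eturn.

Lemma e0 : e 0 = 1. Proof. by rewrite /eturn mulr0 cis0. Qed.
Lemma e1 : e 1 = 1. Proof. by rewrite /eturn mulr1 cis2pi. Qed.

Lemma twopii_neq0 : toC (2 * pi) * imagI R != 0.
Proof.
rewrite mulf_neq0 //; last first.
  by rewrite -nrm_eq0 /nrm /imagI /re /im /= expr0n add0r expr1n sqrtr1 oner_eq0.
by rewrite -nrm_eq0 nrm_toC normr_eq0 mulf_neq0 // gt_eqF // pi_gt0.
Qed.

Lemma con_e a b : conC a b e.
Proof. by move=> x _; exact: cder_cont (cder_cis _ _). Qed.

Variables (f : C -> C) (a : C) (rho r : R).
Hypothesis hf : forall w, nrm (w - a) < rho -> exists d, cdiff f w d.
Hypothesis r0 : 0 < r.
Hypothesis rr : r < rho.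

Definition cgam t : C := a + toC r * e t.

Lemma cgam_a t : nrm (cgam t - a) = r.
Proof. by rewrite /cgam addrC addKr nrmM nrm_toC nrm_cis mulr1 ger0_norm // ltW. Qed.

Lemma con_cgam x y : conC x y cgam.
Proof.
apply: conCD; first exact: conC_cst.
by apply: conCM; [exact: conC_cst | exact: con_e].
Qed.

Lemma con_fgam x y : conC x y (fun t => f (cgam t)).
Proof.
move=> t txy; apply: continuous_comp; first exact: (con_cgam txy).
by have [|d /cdiff_cont //] := hf (w := cgam t); rewrite cgam_a.
Qed.

Section AtPoint.
Variable z : C.
Hypothesis za : nrm (z - a) < r.

Lemma cgam_z t : r - nrm (z - a) <= nrm (cgam t - z).
Proof.
rewrite lerBlDr; apply: le_trans (nrmD _ _); rewrite -(cgam_a t) (_ : _ + _ = cgam t - a) //.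
by rewrite addrA subrK.
Qed.

Lemma cgam_neq t : cgam t - z != 0.
Proof. by rewrite -nrm_gt0; apply: lt_le_trans (cgam_z t); rewrite subr_gt0. Qed.

(** Goursat applied to f (z + v) / v on a homotopy from a small circle about z to the circle of
    radius r about a. The sides y = 0 and y = 1 coincide by periodicity and cancel; the other two
    are the claimed integrals multiplied by 2 pi i. *)
Lemma homotopy (eps : R) : 0 < eps -> eps <= r - nrm (z - a) ->
  CI 0 1 (fun t => f (cgam t) * (toC r * e t) / (cgam t - z)) =
  CI 0 1 (fun t => f (z + toC eps * e t)).
Proof.
move=> eps0 epsr; set b := a - z; have nb : nrm b = nrm (z - a) by rewrite nrm_distC.
pose s (x : R) := eps + x * (r - eps).
have nb0 : 0 <= nrm b := nrm_ge0 _.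
have der : eps <= r by lra.
have s_ge (x : R) : 0 <= x <= 1 -> 0 <= s x <= r.
  move=> /andP[x0 x1]; have xr : x * (r - eps) <= 1 * (r - eps).
    by rewrite ler_wpM2r //; lra.
  have : 0 <= x * (r - eps) by rewrite mulr_ge0 //; lra.
  by rewrite /s; lra.
(* z + u moves from the circle of radius eps about z to the one of radius r about a. It avoids z
   because x |b| <= x (r - eps) < s x. *)
pose u (x y : R) : C := toC (s x) * e y + toC x * b.
pose ux (x y : R) : C := toC (r - eps) * e y + b.
pose uy (x y : R) : C := toC (s x) * (toC (2 * pi) * imagI R * e y).
pose G v : C := f (z + v) / v.
have ns (x : R) : 0 <= x <= 1 -> nrm (toC (s x)) = s x.
  by move=> /s_ge /andP[s0 _]; rewrite nrm_toC ger0_norm.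
have u0 (x y : R) : 0 <= x <= 1 -> u x y != 0.
  move=> x01; rewrite -nrm_gt0.
  have H : s x <= nrm (u x y) + x * nrm b.
    have := nrmB (u x y) (toC x * b); rewrite /u addrK !nrmM ns // nrm_cis mulr1.
    by rewrite nrm_toC ger0_norm //; case/andP: x01.
  suff : x * nrm b < s x by lra.
  move/andP: x01 => [x0 x1]; have xb : x * nrm b <= x * (r - eps).
    by rewrite ler_wpM2l //; lra.
  by rewrite /s; lra.
have uin (x y : R) : 0 <= x <= 1 -> nrm (z + u x y - a) < rho.
  move=> x01; apply: le_lt_trans rr.
  have -> : z + u x y - a = toC (s x) * e y + toC (x - 1) * b.
    by rewrite /u /b (toCD x (- 1)) toCN toC1; ring.
  apply: le_trans (nrmD _ _) _; rewrite !nrmM ns // nrm_cis mulr1 nrm_toC.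
  move/andP: x01 => [x0 x1]; rewrite ler0_norm; last by lra.
  have xb : (1 - x) * nrm b <= (1 - x) * (r - eps) by rewrite ler_wpM2l //; lra.
  by rewrite opprB /s; lra.
have ders (x : R) : is_derive x 1 s (r - eps).
  rewrite /s; apply: is_derive_eq; rewrite add0r /GRing.scale /=; ring.
have p0 : 0 < pi :> R := pi_gt0 R.
pose L := 1 + (r - eps) + nrm b + r * (2 * pi).
have rp : 0 <= r * (2 * pi) by rewrite !mulr_ge0 // ltW.
have L0 : 0 < L by rewrite /L; lra.
have Hux (x y : R) : 0 <= x <= 1 -> 0 <= y <= 1 -> cder (u ^~ y) x (ux x y).
  move=> _ _; apply: cder_eq (cderD (cderM (cder_toC (ders x)) (cder_cst (e y) x))
    (cderM (cder_toC (is_derive_id x 1)) (cder_cst b x))) _.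
  by rewrite /ux !mulr0 !addr0 toC1 mul1r.
have Huy (x y : R) : 0 <= x <= 1 -> 0 <= y <= 1 -> cder (u x) y (uy x y).
  move=> _ _; apply: cder_eq (cderD (cderZ (toC (s x)) (cder_cis (2 * pi) y))
    (cder_cst (toC x * b) y)) _.
  by rewrite addr0.
have Hcx (y : R) : 0 <= y <= 1 -> conC 0 1 (ux ^~ y) by move=> _; exact: conC_cst.
have Hcy (x : R) : 0 <= x <= 1 -> conC 0 1 (uy x).
  move=> _; apply: conCM; first exact: conC_cst.
  by apply: conCM; [exact: conC_cst | exact: con_e].
have Hbx (x y : R) : 0 <= x <= 1 -> 0 <= y <= 1 -> nrm (ux x y) <= L.
  move=> _ _; apply: le_trans (nrmD _ _) _; rewrite nrmM nrm_cis mulr1 nrm_toC.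
  by rewrite ger0_norm /L; lra.
have Hby (x y : R) : 0 <= x <= 1 -> 0 <= y <= 1 -> nrm (uy x y) <= L.
  move=> x01 _; rewrite !nrmM nrm_cis mulr1 ns // nrm_toC.
  have -> : nrm (imagI R) = 1.
    by rewrite /nrm /imagI /re /im /= expr0n add0r expr1n sqrtr1.
  rewrite mulr1 ger0_norm; last by rewrite mulr_ge0 // ltW.
  have [_ sr] := andP (s_ge x x01).
  have : s x * (2 * pi) <= r * (2 * pi) by rewrite ler_wpM2r // mulr_ge0 // ltW.
  by rewrite /L; lra.
have HG (x y : R) : 0 <= x <= 1 -> 0 <= y <= 1 -> exists d, cdiff G (u x y) d.
  move=> x01 _; have [d Hd] := hf (uin x y x01).
  eexists; apply: cdiffM; last by apply: cdiff_inv; exact: u0.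
  by apply: cdiff_comp; [apply: cdiffD; [exact: cdiff_cst|exact: cdiff_id] | exact: Hd].
have := goursat L0 Hux Huy Hcx Hcy Hbx Hby HG.
have -> : CI 0 1 (fun t => G (u t 1) * ux t 1) = CI 0 1 (fun t => G (u t 0) * ux t 0).
  by apply: CI_eq => t _; rewrite /u /ux e1 e0.
rewrite subrK => /eqP; rewrite subr_eq0 => /eqP.
have -> : CI 0 1 (fun t => G (u 1 t) * uy 1 t) = toC (2 * pi) * imagI R *
    CI 0 1 (fun t => f (cgam t) * (toC r * e t) / (cgam t - z)).
  rewrite -CIZ; last first.
    apply: conCM; last first.
      apply: conCV; first by move=> t _; exact: cgam_neq.
      by apply: conCB; [exact: con_cgam | exact: conC_cst].
    apply: conCM; first exact: con_fgam.
    by apply: conCM; [exact: conC_cst | exact: con_e].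
  have s1 : s 1 = r by rewrite /s mul1r addrC subrK.
  apply: CI_eq => t _; have uz : u 1 t = cgam t - z.
    by rewrite /u s1 toC1 mul1r /cgam /b; ring.
  have := cgam_neq t; rewrite /G uz /uy s1 [z + _]addrC subrK => ne.
  by ring.
have -> : CI 0 1 (fun t => G (u 0 t) * uy 0 t) = toC (2 * pi) * imagI R *
    CI 0 1 (fun t => f (z + toC eps * e t)).
  have s0 : s 0 = eps by rewrite /s mul0r addr0.
  rewrite -CIZ; last first.
    move=> t t01; apply: continuous_comp.
      apply: cder_cont; apply: cderD; first exact: cder_cst.
      exact: cderZ (cder_cis _ _).
    have := uin 0 t; rewrite /u s0 toC0 mul0r addr0 lexx ler01 => /(_ isT) ine.
    by have [d /cdiff_cont] := hf ine.
  apply: CI_eq => t _; have un : u 0 t = toC eps * e t.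
    by rewrite /u s0 toC0 mul0r addr0.
  have : u 0 t != 0 by apply: u0; rewrite lexx ler01.
  rewrite /G /uy un s0 => ne; have ne1 : toC eps != 0.
    by apply: contraNneq ne => ->; rewrite mul0r.
  have ne2 : e t != 0 by apply: contraNneq ne => ->; rewrite mulr0.
  by field; rewrite ne1 ne2.
by apply: mulfI; exact: twopii_neq0.
Qed.

(** By [homotopy] the integral equals the mean of f over a circle of any small radius about z, and
    these means tend to f z by continuity. *)
Lemma cauchy_formula :
  f z = CI 0 1 (fun t => f (cgam t) * (toC r * e t) / (cgam t - z)).
Proof.
apply/eqP; rewrite eq_sym -subr_eq0 -nrm_eq0; apply/eqP/le_anti; rewrite nrm_ge0 andbT.
apply/ler_addgt0Pl => eta eta0; rewrite addr0.
have [d /cdiff_cont cf] : exists d, cdiff f z d by apply: hf; exact: lt_trans rr.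
have eta4 : 0 < eta / 4 by rewrite divr_gt0.
have /(cvgCP (nbhs_filter z)) /(_ _ eta4)/nbhsCP[s s0 Hs] := cf.
pose eps := Num.min (s / 2) (r - nrm (z - a)).
have eps0 : 0 < eps by rewrite lt_min divr_gt0 //= subr_gt0.
have epsr : eps <= r - nrm (z - a) by rewrite ge_min lexx orbT.
have epss : eps < s by rewrite gt_min; apply/orP; left; lra.
rewrite (homotopy eps0 epsr).
have ne t : nrm (toC eps * e t) = eps by rewrite nrmM nrm_cis nrm_toC mulr1 gtr0_norm.
have cc : conC 0 1 (fun t => f (z + toC eps * e t)).
  move=> t _; apply: continuous_comp.
    apply: cder_cont; apply: cderD; first exact: cder_cst.
    exact: cderZ (cder_cis _ _).
  have ine : nrm (z + toC eps * e t - a) < rho.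
    apply: le_lt_trans rr; rewrite addrAC; apply: le_trans (nrmD _ _) _.
    by rewrite ne; lra.
  by have [d' /cdiff_cont] := hf ine.
have -> : f z = CI 0 1 (fun=> f z) by rewrite CI_cst // subr0 mulr1.
rewrite -(CIB cc (@conC_cst _ _ _ (f z))).
apply: le_trans (@CI_norm _ _ _ _ (eta / 4) _ _ _) _.
- exact: ler01.
- by apply: conCB; [exact: cc | exact: conC_cst].
- by move=> t _; apply/ltW/Hs; rewrite addrC addKr ne.
- by rewrite subr0 mulr1; lra.
Qed.

End AtPoint.
End Cauchy.

Section NatCast.
Variable R : realType.
Lemma toC_nat k : toC (k%:R : R) = k%:R.
Proof. by elim: k => [|k IH] //; rewrite !mulrS toCD IH. Qed.
Lemma nrm_nat k : nrm (k%:R : cplx R) = k%:R.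
Proof. by rewrite -toC_nat nrm_toC ger0_norm. Qed.
End NatCast.

Section ParamIntegral.
Variable R : realType.
Local Notation C := (cplx R).

Lemma bounded_conC (phi : R -> C) : conC 0 1 phi ->
  exists2 B, 0 < B & forall t, 0 <= t <= 1 -> nrm (phi t) <= B.
Proof.
move=> cphi.
have [||c _ Hc] := @EVT_max R (fun t => nrm (phi t)) 0 1; first exact: ler01.
  apply: con_within => t t01; apply: continuous_comp; first exact: cphi.
  exact: continuous_nrm.
exists (1 + nrm (phi c)); first by rewrite ltr_wpDr // nrm_ge0.
move=> t t01; apply: le_trans (Hc t _) _; first by rewrite in_itv.
by rewrite lerDr.
Qed.

Lemma CI_cdiff (k : R -> C -> C) (k' : R -> C) (z : C) (B d : R) :
  0 < d -> 0 < B ->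
  (forall w, nrm (w - z) < d -> conC 0 1 (k ^~ w)) -> conC 0 1 k' ->
  (forall w t, nrm (w - z) < d -> 0 <= t <= 1 ->
     nrm (k t w - k t z - k' t * (w - z)) <= B * nrm (w - z) ^+ 2) ->
  cdiff (fun w => CI 0 1 (k ^~ w)) z (CI 0 1 k').
Proof.
move=> d0 B0 ck ck' H e e0.
exists (Num.min d (e / (2 * B))).
  by rewrite lt_min d0 divr_gt0 // mulr_gt0.
move=> v; rewrite lt_min => /andP[vd ve].
have cv := ck _ vd; have cz : conC 0 1 (k ^~ z) by apply: ck; rewrite subrr nrm0.
have czk : conC 0 1 (fun t => (v - z) * k' t) by apply: conCM; [exact: conC_cst|exact: ck'].
have -> : CI 0 1 (k ^~ v) - CI 0 1 (k ^~ z) - CI 0 1 k' * (v - z) =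
   CI 0 1 (fun t => k t v - k t z - (v - z) * k' t).
  by rewrite (CIB (conCB cv cz) czk) (CIB cv cz) (CIZ _ ck') [_ * CI _ _ _]mulrC.
apply: le_trans (@CI_norm _ _ _ _ (B * nrm (v - z) ^+ 2) ler01 _ _) _.
- exact: conCB (conCB cv cz) czk.
- by move=> t t01; rewrite [_ * k' t]mulrC; exact: H.
- have n0 := nrm_ge0 (v - z); rewrite subr0 mulr1.
  rewrite ltr_pdivlMr ?mulr_gt0 // in ve.
  have := mulr_ge0 n0 (_ : 0 <= e - nrm (v - z) * (2 * B)).
  by rewrite subr_ge0 ltW // => /(_ isT); lra.
Qed.

End ParamIntegral.

Section CauchyKernel.
Variable R : realType.
Local Notation C := (cplx R).
Variables (a : C) (r : R).
Hypothesis r0 : 0 < r.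
Local Notation gam := (cgam a r).

Definition Kint (phi : R -> C) (m : nat) (z : C) : C :=
  CI 0 1 (fun t => phi t * (gam t - z) ^- m).

Lemma con_gamz m z : nrm (z - a) < r -> conC 0 1 (fun t => (gam t - z) ^- m).
Proof.
move=> za; apply: conCV; first by move=> t _; rewrite expf_neq0 // (cgam_neq r0).
by apply: conCX; apply: conCB; [exact: con_cgam|exact: conC_cst].
Qed.

Variable phi : R -> C.
Hypothesis cphi : conC 0 1 phi.

Lemma con_K m z : nrm (z - a) < r -> conC 0 1 (fun t => phi t * (gam t - z) ^- m).
Proof. by move=> za; apply: conCM; [exact: cphi | exact: con_gamz]. Qed.

Lemma near_in_ball (z : C) : nrm (z - a) < r -> exists2 d, 0 < d &
  forall w, nrm (w - z) < d -> nrm (w - a) < r /\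
   forall t, [/\ d <= nrm (gam t - z), d <= nrm (gam t - w) & nrm (w - z) <= nrm (gam t - z)].
Proof.
move=> za; exists ((r - nrm (z - a)) / 2).
  by rewrite divr_gt0 // subr_gt0.
move=> w wz.
have wa : nrm (w - a) <= nrm (w - z) + nrm (z - a).
  by have := nrmD (w - z) (z - a); rewrite addrA subrK.
split; first by lra.
by move=> t; have h1 := cgam_z a r0 z t; have h2 := cgam_z a r0 w t; split; lra.
Qed.

Lemma K1_cdiff z : nrm (z - a) < r -> cdiff (Kint phi 1) z (Kint phi 2 z).
Proof.
move=> za; have [d d0 Hd] := near_in_ball za.
have [B B0 HB] := bounded_conC cphi.
apply: (@CI_cdiff _ (fun t w => phi t * (gam t - w) ^- 1) (fun t => phi t * (gam t - z) ^- 2) z (B / d ^+ 3) d).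
- exact: d0.
- by rewrite divr_gt0 // exprn_gt0.
- by move=> w /Hd[wa _]; exact: (con_K (m:=1) wa).
- exact: (con_K (m:=2) za).
move=> w t wz t01; have [wa /(_ t)[g1 g2 _]] := Hd _ wz.
have z0 := cgam_neq r0 za t; have w0 := cgam_neq r0 wa t.
rewrite (_ : phi t * (gam t - w) ^- 1 - phi t * (gam t - z) ^- 1 - phi t * (gam t - z) ^- 2 * (w - z) = phi t * ((w - z) ^+ 2 * ((gam t - z) ^+ 2 * (gam t - w))^-1)); last first.
  by rewrite !expr1; field; rewrite z0 w0.
rewrite !nrmM nrmV nrmM !nrmX mulrCA [leRHS]mulrC.
apply: ler_wpM2l; first exact: sqr_ge0.
apply: ler_pM; rewrite ?nrm_ge0 ?invr_ge0 ?mulr_ge0 ?nrm_ge0 ?HB //.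
rewrite lef_pV2 ?posrE ?mulr_gt0 ?exprn_gt0 //; try by apply: lt_le_trans d0 _.
rewrite exprSr; apply: ler_pM; [by rewrite exprn_ge0 // ltW | exact: ltW | | exact: g2].
by rewrite ler_pXn2r // nnegrE ?nrm_ge0 // ltW.
Qed.

Lemma K2_cdiff z : nrm (z - a) < r -> cdiff (Kint phi 2) z
  (CI 0 1 (fun t => phi t * (2 * (gam t - z) ^- 3))).
Proof.
move=> za; have [d d0 Hd] := near_in_ball za.
have [B B0 HB] := bounded_conC cphi.
apply: (@CI_cdiff _ (fun t w => phi t * (gam t - w) ^- 2) (fun t => phi t * (2 * (gam t - z) ^- 3)) z (B * (5 / (d ^+ 2 * d ^+ 2))) d).
- exact: d0.
- by rewrite mulr_gt0 // divr_gt0 // mulr_gt0 // exprn_gt0.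
- by move=> w /Hd[wa _]; exact: (con_K (m:=2) wa).
- apply: conCM; first exact: cphi.
  by apply: conCM; [exact: conC_cst | exact: (con_gamz (m:=3) za)].
move=> w t wz t01; have [wa /(_ t)[g1 g2 g3]] := Hd _ wz.
have z0 := cgam_neq r0 za t; have w0 := cgam_neq r0 wa t.
pose v := gam t - z; pose h := w - z.
rewrite (_ : phi t * (gam t - w) ^- 2 - phi t * (gam t - z) ^- 2 - phi t * (2 * (gam t - z) ^- 3) * (w - z) = phi t * (h ^+ 2 * ((3 * v - 2 * h) / v *
   ((gam t - z) ^+ 2 * (gam t - w) ^+ 2)^-1))); last first.
  by rewrite /v /h; field; rewrite z0 w0.
rewrite nrmM (nrmM (h ^+ 2)) (nrmX h 2) nrmM (nrmM _ v^-1) (nrmV v) mulrCA [leRHS]mulrC.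
apply: ler_wpM2l; first exact: sqr_ge0.
have v0 : 0 < nrm v by rewrite nrm_gt0.
apply: ler_pM; rewrite ?nrm_ge0 ?HB //.
  by rewrite !mulr_ge0 ?invr_ge0 ?nrm_ge0.
apply: ler_pM; rewrite ?mulr_ge0 ?invr_ge0 ?nrm_ge0 //.
  rewrite ler_pdivrMr //; apply: le_trans (nrmB _ _) _; rewrite !nrmM.
  by rewrite !nrm_nat; move: g3; rewrite -/v -/h; lra.
rewrite nrmV nrmM !nrmX lef_pV2 ?posrE ?mulr_gt0 ?exprn_gt0 //; try by apply: lt_le_trans d0 _.
by apply: ler_pM; rewrite ?(exprn_ge0, ltW d0) // ler_pXn2r // nnegrE ?nrm_ge0 // ltW.
Qed.

(** One step of Taylor expansion with integral remainder, from 1/(g - z) = 1/(g - a) + (z - a)/((g -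
    a)(g - z)). *)
Lemma K_step z : nrm (z - a) < r ->
  Kint phi 1 z = Kint phi 1 a + (z - a) * Kint (fun t => phi t / (gam t - a)) 1 z.
Proof.
move=> za; have aa : nrm (a - a) < r by rewrite subrr nrm0.
have c1 := con_K (m:=1) aa.
have c2 : conC 0 1 (fun t => phi t / (gam t - a) * (gam t - z) ^- 1).
  by apply: conCM; [exact: (con_K (m:=1) aa) | exact: (con_gamz (m:=1) za)].
rewrite /Kint -(CIZ _ c2) -(CID c1); last by apply: conCM; [exact: conC_cst|exact: c2].
apply: CI_eq => t _; have z0 := cgam_neq r0 za t; have a0 := cgam_neq r0 aa t.
by rewrite !expr1; field; rewrite z0 a0.
Qed.

End CauchyKernel.

Section Holomorphic.
Variable R : realType.
Local Notation C := (cplx R).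

Definition holo (f : C -> C) (a : C) (rho : R) :=
  forall w, nrm (w - a) < rho -> exists d, cdiff f w d.

Lemma holo_sub f a b rho r : holo f a rho -> nrm (b - a) + r <= rho -> holo f b r.
Proof.
move=> hf h w wb; apply: hf; have := nrmD (w - b) (b - a).
by rewrite addrA subrK; lra.
Qed.

(** The exponent m counts Taylor steps: [Kint a r (cphi f a r m) 1] is the factor left after
    extracting (z - a)^m, and its value at a is the m-th Taylor coefficient of f. *)
Definition cphi (f : C -> C) a (r : R) m (t : R) : C :=
  f (cgam a r t) * (toC r * eturn t) * (cgam a r t - a) ^- m.

Lemma con_cphi f a rho r m : holo f a rho -> 0 < r -> r < rho -> conC 0 1 (cphi f a r m).
Proof.
move=> hf r0 rr; apply: conCM; last first.
  by apply: con_gamz; rewrite ?subrr ?nrm0.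
apply: conCM; first exact: (con_fgam hf).
by apply: conCM; [exact: conC_cst | exact: con_e].
Qed.

Lemma cauchyK f a rho r z : holo f a rho -> 0 < r -> r < rho -> nrm (z - a) < r ->
  f z = Kint a r (cphi f a r 0) 1 z.
Proof.
move=> hf r0 rr za; rewrite (cauchy_formula hf r0 rr za).
by apply: CI_eq => t _; rewrite /cphi expr0 invr1 mulr1 expr1.
Qed.

(** Near each point f is the Cauchy integral with kernel of order 1, so its derivative is the one of
    order 2, which is again differentiable. *)
Lemma holo_deriv f a rho : holo f a rho -> holo (f^`()%classic) a rho.
Proof.
move=> hf w wa; pose r := (nrm (w - a) + rho) / 2.
have n0 := nrm_ge0 (w - a).
have r0 : 0 < r by rewrite /r; lra.
have rr : r < rho by rewrite /r; lra.
have wr : nrm (w - a) < r by rewrite /r; lra.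
have cp := con_cphi (m:=0) hf r0 rr.
exists (CI 0 1 (fun t => cphi f a r 0 t * (2 * (cgam a r t - w) ^- 3))).
apply: cdiff_near (K2_cdiff r0 cp wr).
apply/nbhsCP; exists (r - nrm (w - a)); first by rewrite subr_gt0.
move=> y yw; have ya : nrm (y - a) < r.
  by have := nrmD (y - w) (w - a); rewrite addrA subrK; lra.
apply/esym/cdiff_derive1; apply: cdiff_near (K1_cdiff r0 cp ya).
apply/nbhsCP; exists (r - nrm (y - a)); first by rewrite subr_gt0.
move=> u uy; have ua : nrm (u - a) < r.
  by have := nrmD (u - y) (y - a); rewrite addrA subrK; lra.
by rewrite (cauchyK hf r0 rr ua).
Qed.

Lemma holo_expand f a rho r m z : holo f a rho -> 0 < r -> r < rho -> nrm (z - a) < r ->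
  (forall k, (k < m)%N -> Kint a r (cphi f a r k) 1 a = 0) ->
  f z = (z - a) ^+ m * Kint a r (cphi f a r m) 1 z.
Proof.
move=> hf r0 rr za; elim: m => [|m IH] H.
  by rewrite expr0 mul1r; apply: cauchyK hf _ _ _.
rewrite IH; last by move=> k km; apply: H; exact: ltnW.
rewrite (K_step r0 (con_cphi (m:=m) hf r0 rr) za) H // add0r exprSr mulrA; congr (_ * _).
apply: CI_eq => t _; rewrite /cphi (exprS (cgam a r t - a) m) invfM.
by congr (_ * _); rewrite [RHS]mulrA [RHS]mulrAC.
Qed.

(** The least nonzero Taylor coefficient gives the factorisation. If there is none, the remainder
    bound reads |f z| <= A q^m for all m, with q = |z - a| / r < 1. *)
Lemma holo_dichotomy f a rho r : holo f a rho -> 0 < r -> r < rho ->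
  (forall z, nrm (z - a) < r -> f z = 0) \/
  exists m g, [/\ holo g a r, g a != 0 &
    forall z, nrm (z - a) < r -> f z = (z - a) ^+ m * g z].
Proof.
move=> hf r0 rr.
have [nz|allz] := pselect (exists m, Kint a r (cphi f a r m) 1 a != 0).
  right; have [m nm mmin] := ex_minnP nz.
  exists m, (Kint a r (cphi f a r m) 1); split => //.
    by move=> w wa; eexists; exact: (K1_cdiff r0 (con_cphi (m:=m) hf r0 rr) wa).
  move=> z za; apply: (holo_expand hf) => // k km.
  by apply/eqP/negPn/negP => /mmin; rewrite leqNgt km.
left=> z za.
have Hm m : f z = (z - a) ^+ m * Kint a r (cphi f a r m) 1 z.
  apply: (holo_expand hf) => // k km; apply/eqP/negPn/negP => h.
  by apply: allz; exists k.
have [B B0 HB] := bounded_conC (con_cphi (m:=0) hf r0 rr).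
have za0 : 0 < r - nrm (z - a) by rewrite subr_gt0.
have bnd m : nrm (Kint a r (cphi f a r m) 1 z) <= 2 * (B / (r - nrm (z - a))) / r ^+ m.
  have b1 : forall t, 0 <= t <= 1 -> nrm (cphi f a r m t * (cgam a r t - z) ^- 1)
      <= B / (r - nrm (z - a)) / r ^+ m.
    move=> t t01; have -> : cphi f a r m t = cphi f a r 0 t * (cgam a r t - a) ^- m.
      by rewrite /cphi expr0 invr1 mulr1.
    rewrite mulrAC nrmM nrmV nrmX cgam_a // ler_pM2r ?invr_gt0 ?exprn_gt0 //.
    rewrite nrmM; apply: ler_pM; rewrite ?nrm_ge0 ?HB // nrmV expr1.
    have gz := cgam_z a r0 z t.
    by rewrite lef_pV2 ?posrE //; apply: lt_le_trans gz.
  apply: le_trans (CI_norm ler01 (con_K r0 (con_cphi (m:=m) hf r0 rr) (m:=1) za) b1) _.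
  by rewrite subr0 mulr1 !mulrA.
pose q := nrm (z - a) / r.
have q0 : 0 <= q by rewrite divr_ge0 ?nrm_ge0 // ltW.
have q1 : q < 1 by rewrite ltr_pdivrMr // mul1r.
pose A := 2 * (B / (r - nrm (z - a))).
have A0 : 0 < A by rewrite mulr_gt0 // divr_gt0.
have fb m : nrm (f z) <= A * q ^+ m.
  rewrite (Hm m) nrmM nrmX /q expr_div_n mulrCA.
  by apply: ler_wpM2l; [rewrite exprn_ge0 // nrm_ge0 | exact: bnd].
apply/eqP; rewrite -nrm_eq0; apply/eqP/le_anti; rewrite nrm_ge0 andbT.
apply/ler_addgt0Pl => eta eta0; rewrite addr0.
have /cvgrPdist_lt/(_ (eta / A)) : q ^+ k @[k --> \oo] --> (0 : R).
  by apply: cvg_expr; rewrite ger0_norm.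
rewrite divr_gt0 // => /(_ isT)[k _ Hk]; have := Hk k (leqnn k).
rewrite /= sub0r normrN ger0_norm ?exprn_ge0 // ltr_pdivlMr // mulrC => h.
exact: le_trans (fb k) (ltW h).
Qed.

(** Cauchy's formula gives the mean value on circles of radius s < 1; compactness of the circle
    makes the radial convergence uniform as s tends to 1. *)
Lemma mean_value_boundary (F : C -> C) :
  (forall x, nrm x <= 1 -> forall eps, 0 < eps -> exists2 d : R, 0 < d &
     forall y, nrm y <= 1 -> nrm (y - x) < d -> nrm (F y - F x) < eps) ->
  (forall w, nrm w < 1 -> exists d, cdiff F w d) ->
  conC 0 1 (fun t => F (eturn t)) /\ F 0 = CI 0 1 (fun t => F (eturn t)).
Proof.
move=> cF hF.
have ne (t : R) : nrm (eturn t) = 1 by exact: nrm_cis.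
have cFe : conC 0 1 (fun t => F (eturn t)).
  move=> t t01; apply/(cvgCP (nbhs_filter t)) => eps eps0.
  have [d d0 Hd] := cF (eturn t) (eq_ind_r (fun x => x <= 1) (lexx 1) (ne t)) eps eps0.
  have /(cvgCP (nbhs_filter t)) /(_ _ d0) := @con_e R 0 1 t t01.
  by apply: filterS => s hs; apply: Hd => //; rewrite ne.
split=> //.
have hol : holo F 0 1 by move=> w; rewrite subr0; exact: hF.
have FS (s : R) : 0 < s -> s < 1 -> F 0 = CI 0 1 (fun t => F (toC s * eturn t)).
  move=> s0 s1; have z0 : nrm ((0 : C) - 0) < s by rewrite subrr nrm0.
  rewrite (cauchy_formula hol s0 s1 z0); apply: CI_eq => t _.
  have e0 : eturn t != 0 by rewrite -nrm_eq0 ne oner_eq0.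
  have t0 : toC s != 0 by rewrite -nrm_eq0 nrm_toC normr_eq0 gt_eqF.
  by rewrite /cgam add0r subr0 mulfK // mulf_neq0.
apply/eqP; rewrite -subr_eq0 -nrm_eq0; apply/eqP/le_anti; rewrite nrm_ge0 andbT.
apply/ler_addgt0Pl => eta eta0; rewrite addr0.
have eta4 : 0 < eta / 4 by rewrite divr_gt0.
have cov : \forall s \near at_left (1 : R), `[0, 1]%classic `<=`
  (fun t => 0 < s < 1 /\ nrm (F (toC s * eturn t) - F (eturn t)) < eta / 4).
  apply: ((compact_near_coveringP _).1 (@segment_compact R 0 1) R (at_left (1 : R))
    (fun s t => 0 < s < 1 /\ nrm (F (toC s * eturn t) - F (eturn t)) < eta / 4)).
  move=> t; rewrite /= in_itv /= => t01.
  have eta8 : 0 < eta / 8 by rewrite divr_gt0.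
  have [d d0 Hd] := cF (eturn t) (eq_ind_r (fun x => x <= 1) (lexx 1) (ne t)) _ eta8.
  have d2 : 0 < d / 2 by rewrite divr_gt0.
  exists ([set t' | nrm (eturn t' - eturn t) < d / 2], [set s | 0 < s < 1 /\ 1 - s < d / 2]).
    split => /=.
      by have /(cvgCP (nbhs_filter t)) := @con_e R 0 1 t t01; apply.
    near=> s; split.
      by apply/andP; split; [near: s; apply: nbhs_left_gt|near: s; apply: nbhs_left_lt].
    rewrite ltrBlDr -ltrBlDl; near: s; apply: nbhs_left_gt.
    by rewrite ltrBlDr ltrDl.
  move=> [t' s] /= [ht [/andP[s0 s1] hs]]; split; first by rewrite s0 s1.
  have a1 : nrm (F (toC s * eturn t') - F (eturn t)) < eta / 8.
    apply: Hd; first by rewrite nrmM ne mulr1 nrm_toC ger0_norm ltW.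
    have -> : toC s * eturn t' - eturn t = (toC (s - 1) * eturn t') + (eturn t' - eturn t).
      by rewrite toCD toCN toC1; ring.
    apply: le_lt_trans (nrmD _ _) _; rewrite nrmM ne mulr1 nrm_toC ler0_norm; lra.
  have a2 : nrm (F (eturn t') - F (eturn t)) < eta / 8.
    by apply: Hd; [rewrite ne | lra].
  have := nrmB (F (toC s * eturn t') - F (eturn t)) (F (eturn t') - F (eturn t)).
  by rewrite opprB addrA subrK; lra.
have [s Hs] := filter_ex cov.
have [/andP[s0 s1] _] : 0 < s < 1 /\ nrm (F (toC s * eturn 0) - F (eturn 0)) < eta / 4.
  by apply: Hs; rewrite /= in_itv /= lexx ler01.
have cs : conC 0 1 (fun t => F (toC s * eturn t)).
  have H := @con_fgam R F 0 1 s hol s0 s1 0 1.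
  by have -> : (fun t => F (toC s * eturn t)) = (fun t => F (cgam 0 s t));
    [apply/funext => t; rewrite /cgam add0r | exact: H].
rewrite (FS s s0 s1) -(CIB cs cFe).
apply: le_trans (@CI_norm _ _ _ _ (eta / 4) ler01 (conCB cs cFe) _) _.
  by move=> t t01; have [|_ /ltW //] := Hs t; rewrite /= in_itv.
by rewrite subr0 mulr1; lra.
Unshelve. all: by end_near. Qed.

End Holomorphic.

(** * Smoothness *)

Section CkReal.
Variables (R : realType) (V : normedModType R).
Implicit Types (U O : set V) (f g : V -> R) (k : nat).

Lemma Ck_weaken k U f : Ck k.+1 U f -> Ck k U f.
Proof.
elim: k f => [|k IH] f /= [cf H]; split => // v.
by have [dv Hv] := H v; split => //; exact: IH.
Qed.

Lemma Ck_sub k U O f : O `<=` U -> Ck k U f -> Ck k O f.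
Proof.
move=> OU; elim: k f => [|k IH] f /= [cf H]; split=> //; try by move=> x /OU; exact: cf.
by move=> v; have [dv Hv] := H v; split; [move=> x /OU; exact: dv | exact: IH].
Qed.

Lemma Ck_local k U f : (forall x, U x -> exists2 O, O x & Ck k O f) -> Ck k U f.
Proof.
elim: k f => [|k IH] f H; split=> //.
- by move=> x /H[Q Qx [h _]]; exact: h.
- by move=> x /H[Q Qx [h _]]; exact: h.
- move=> v; split; first by move=> x /H[Q Qx [_ /(_ v)[h _]]]; exact: h.
  by apply: IH => x /H[Q Qx [_ /(_ v)[_ HQ]]]; exists Q => //; exact: HQ.
Qed.

Lemma continuous_near f g (x : V) : (\forall y \near x, f y = g y) ->
  {for x, continuous f} -> {for x, continuous g}.
Proof.
move=> E cf; have gx : g x = f x by rewrite (nbhs_singleton E).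
rewrite /prop_for /continuous_at gx; apply: cvg_trans cf.
by apply: near_eq_cvg; apply: filterS E => y ->.
Qed.

Lemma Ck_ext k U f g : open U -> (forall x, U x -> f x = g x) -> Ck k U f -> Ck k U g.
Proof.
move=> oU; elim: k f g => [|k IH] f g fg; move=> [cf H];
  have E x : U x -> \forall y \near x, f y = g y
    by move=> Ux; apply: filterS (open_nbhs_nbhs (conj oU Ux)) => y; exact: fg.
all: split=> //; first by move=> x Ux; exact: continuous_near (E x Ux) (cf x Ux).
move=> v; have [dv Hv] := H v; split.
  by move=> x Ux; apply: near_eq_derivable (dv x Ux); exact: E.
apply: IH Hv => x Ux; apply: near_eq_derive; exact: E.
Qed.

Lemma Ck_cst k U (a : R) : Ck k U (fun=> a).
Proof.
elim: k a => [|k IH] a; split=> //; try by move=> x _; exact: cvg_cst.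
move=> v; split; first by move=> x _; exact: derivable_cst.
by have -> : 'D_v (fun=> a) = (fun=> 0) by apply/funext => x; rewrite derive_cst.
Qed.

Lemma Ck_add k U f g : open U -> Ck k U f -> Ck k U g -> Ck k U (fun x => f x + g x).
Proof.
move=> oU; elim: k f g => [|k IH] f g [cf Hf] [cg Hg]; split=> //;
  try by move=> x Ux; apply: continuousD; [exact: cf|exact: cg].
move=> v; have [dv Hv] := Hf v; have [dv' Hv'] := Hg v; split.
  by move=> x Ux; apply: derivableD; [exact: dv|exact: dv'].
apply: Ck_ext (IH _ _ Hv Hv') => // x Ux; rewrite -deriveD //; [exact: dv|exact: dv'].
Qed.

Lemma Ck_mul k U f g : open U -> Ck k U f -> Ck k U g -> Ck k U (fun x => f x * g x).
Proof.
move=> oU; elim: k f g => [|k IH] f g; last first.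
  move=> Cf Cg; move: (Cf) (Cg) => [cf Hf] [cg Hg]; split.
    by move=> x Ux; apply: continuousM; [exact: cf|exact: cg].
  move=> v; have [dv Hv] := Hf v; have [dv' Hv'] := Hg v; split.
    by move=> x Ux; apply: derivableM; [exact: dv|exact: dv'].
  apply: Ck_ext (Ck_add oU (IH _ _ (Ck_weaken Cf) Hv') (IH _ _ (Ck_weaken Cg) Hv)) => // x Ux.
  by rewrite -[LHS]deriveM //; [exact: dv|exact: dv'].
by move=> [cf _] [cg _]; split=> // x Ux; apply: continuousM; [exact: cf|exact: cg].
Qed.

Lemma Ck_opp k U f : open U -> Ck k U f -> Ck k U (fun x => - f x).
Proof.
move=> oU /(Ck_mul oU (Ck_cst k U (-1))); apply: Ck_ext => // x _.
by rewrite mulN1r.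
Qed.

Lemma Ck_inv k U f : open U -> (forall x, U x -> f x != 0) ->
  Ck k U f -> Ck k U (fun x => (f x)^-1).
Proof.
move=> oU f0; elim: k f f0 => [|k IH] f f0 Cf; move: (Cf) => [cf Hf]; split=> //;
  try by move=> x Ux; apply: continuousV; [exact: f0|exact: cf].
move=> v; have [dv Hv] := Hf v; split.
  by move=> x Ux; apply: derivableV; [exact: f0|exact: dv].
have Ci := IH _ f0 (Ck_weaken Cf).
apply: Ck_ext (Ck_opp oU (Ck_mul oU (Ck_mul oU Ci Ci) Hv)) => // x Ux.
rewrite [RHS](deriveV (f0 _ Ux) (dv _ Ux)) /GRing.scale /=.
by rewrite expr2 invfM mulNr.
Qed.

End CkReal.

Section CkHolo.
Variables (R : realType) (V : normedModType R).
Local Notation C := (cplx R).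
Variable l : V -> C.
Hypothesis lD : forall (h : R) x v, l (h *: v + x) = toC h * l v + l x.
Hypothesis cl : continuous l.

Lemma cder_line (f : C -> C) (d : C) x v : cdiff f (l x) d ->
  cder (fun h : R => f (l (h *: v + x))) 0 (d * l v).
Proof.
move=> H.
have key : forall p : C -> R, (forall z w, p (z - w) = p z - p w) ->
    (forall z (h : R), p (toC h * z) = h * p z) -> (forall z, `|p z| <= nrm z) ->
    is_derive (0 : R) 1 (fun h : R => p (f (l (h *: v + x)))) (p (d * l v)).
  move=> p pB pZ pn.
  have lim : (fun h : R => h^-1 *: (((fun h : R => p (f (l (h *: v + x)))) \o shift 0) (h *: (1 : R))
      - p (f (l (0 *: v + x))))) @ (0 : R)^' --> p (d * l v).
    apply/cvgrPdist_lt => e e0.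
    pose K := 1 + nrm (l v); have K0 : 0 < K by rewrite ltr_wpDr // nrm_ge0.
    have e2 : 0 < e / (2 * K) by rewrite divr_gt0 // mulr_gt0.
    have [r r0 Hr] := H _ e2.
    near=> h; have h0 : h != 0 by near: h; exact: nbhs_dnbhs_neq.
    have hr : `|h| < r / K.
      near: h; apply: (@nbhs_dnbhs _ (0 : R)); apply/nbhs_ballP; exists (r / K) => /=; first by rewrite divr_gt0.
      by move=> y; rewrite /ball /= sub0r normrN.
    have -> : h *: (1 : R) = h by rewrite /GRing.scale /= mulr1.
    rewrite /= addr0 -pB lD scale0r add0r -[h^-1 *: _]/(h^-1 * _).
    have hn : 0 < `|h| by rewrite normr_gt0.
    have -> : p (d * l v) - h^-1 * p (f (toC h * l v + l x) - f (l x)) =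
       - h^-1 * p (f (toC h * l v + l x) - f (l x) - d * (toC h * l v)).
      have e1 : p (d * (toC h * l v)) = h * p (d * l v) by rewrite mulrCA pZ.
      by rewrite (pB (f (toC h * l v + l x) - f (l x))) e1; field.
    rewrite normrM normrN normfV mulrC ltr_pdivrMr //.
    have := Hr (toC h * l v + l x); rewrite addrK nrmM nrm_toC.
    have hv : `|h| * nrm (l v) < r.
      rewrite ltr_pdivlMr // in hr; apply: le_lt_trans hr.
      by rewrite ler_wpM2l // lerDr.
    move=> /(_ hv) h1; apply: le_lt_trans (le_trans (pn _) h1) _.
    apply: (@le_lt_trans _ _ (e / 2 * `|h|)); last first.
      by rewrite ltr_pM2r //; lra.
    have Kl : nrm (l v) / K <= 1 by rewrite ler_pdivrMr // mul1r lerDr.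
    rewrite [leLHS](_ : _ = e / 2 * `|h| * (nrm (l v) / K)); last by field; rewrite gt_eqF.
    by rewrite ler_piMr // mulr_ge0 // ltW // divr_gt0.
  split; first by apply/cvg_ex; exists (p (d * l v)).
  exact: cvg_lim lim.
split; apply: key => *; rewrite ?(reB, imB, reM, imM, re_le_nrm, im_le_nrm) //.
all: by rewrite /toC /re /im /= ?mul0r ?subr0 ?addr0.
Unshelve. all: by end_near. Qed.

Lemma holo_derive (f : C -> C) (d : C) x v : cdiff f (l x) d ->
  [/\ derivable (fun y => re (f (l y))) x v, 'D_v (fun y => re (f (l y))) x = re (d * l v),
      derivable (fun y => im (f (l y))) x v & 'D_v (fun y => im (f (l y))) x = im (d * l v)].
Proof.
move=> /(cder_line v)[hr hi].
have g : forall p : V -> R, forall D : R, is_derive (0 : R) 1 (fun h : R => p (h *: v + x)) D ->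
    derivable p x v /\ 'D_v p x = D.
  move=> p D [h1 h2]; split; first exact/derivable1P.
  rewrite -h2 /derive; congr (lim _).
  set a1 := (X in X @ _); set a2 := (X in _ = X @ _).
  suff -> : a1 = a2 by [].
  by apply/funext => h; rewrite /a1 /a2 /= addr0 scale0r add0r [_%:A]mulr1.
have [a b] := g (fun y => re (f (l y))) _ hr.
by have [a' b'] := g (fun y => im (f (l y))) _ hi; split.
Qed.

(** For a real-linear l the derivative of f (l x) along v is l v times f' (l x), again a holomorphic
    function composed with l; so the induction on k closes by [holo_deriv]. *)
Lemma Ck_holo k (O : set C) (f : C -> C) : open O ->
  (forall w, O w -> exists d, cdiff f w d) ->
  Ck k (l @^-1` O) (fun x => re (f (l x))) /\ Ck k (l @^-1` O) (fun x => im (f (l x))).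
Proof.
move=> oO; have olO : open (l @^-1` O) by exact: open_comp.
elim: k f => [|k IH] f hf.
  by split; split=> // x /hf[d /cdiff_cont cf];
    (apply: continuous_comp; [apply: continuous_comp; [exact: cl|exact: cf] |
     (exact: continuous_re || exact: continuous_im)]).
have hf' : forall w, O w -> exists d, cdiff f^`()%classic w d.
  move=> w Ow; have /nbhsCP[r r0 Hr] := open_nbhs_nbhs (conj oO Ow).
  have hol : holo f w r by move=> u uw; apply: hf; exact: Hr.
  by apply: (holo_deriv hol); rewrite subrr nrm0.
split; split; try by move=> x /hf[d /cdiff_cont cf];
    (apply: continuous_comp; [apply: continuous_comp; [exact: cl|exact: cf] |
     (exact: continuous_re || exact: continuous_im)]).
- move=> v; split; first by move=> x /hf[d /holo_derive-/(_ v)[]].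
  have hv : forall w, O w -> exists d, cdiff (fun y => l v * f^`()%classic y) w d.
    by move=> w /hf'[d Hd]; exists (l v * d); exact: cdiffZ.
  have [H _] := IH _ hv; apply: Ck_ext H => // x Ox.
  have [d Hd] := hf _ Ox; have [_ -> _ _] := holo_derive v Hd.
  by rewrite (cdiff_derive1 Hd) mulrC.
- move=> v; split; first by move=> x /hf[d /holo_derive-/(_ v)[]].
  have hv : forall w, O w -> exists d, cdiff (fun y => l v * f^`()%classic y) w d.
    by move=> w /hf'[d Hd]; exists (l v * d); exact: cdiffZ.
  have [_ H] := IH _ hv; apply: Ck_ext H => // x Ox.
  have [d Hd] := hf _ Ox; have [_ _ _ ->] := holo_derive v Hd.
  by rewrite (cdiff_derive1 Hd) mulrC.
Qed.

End CkHolo.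

Section Conj.
Variable R : realType.
Local Notation C := (cplx R).

Lemma conjE (z : C) : z^* = mkC (re z) (- im z).
Proof. by case: z. Qed.
Lemma re_conj (z : C) : re z^* = re z. Proof. by rewrite conjE. Qed.
Lemma im_conj (z : C) : im z^* = - im z. Proof. by rewrite conjE. Qed.
Lemma nrm_conj (z : C) : nrm z^* = nrm z.
Proof. by rewrite /nrm re_conj im_conj sqrrN. Qed.
Lemma mul_conj (z : C) : z * z^* = toC (nrm z ^+ 2).
Proof.
rewrite sqr_sqrtr ?addr_ge0 ?sqr_ge0 //; apply: cplxP;
  rewrite ?reM ?imM re_conj im_conj /toC /re /im /=; ring.
Qed.
Lemma conj_circle (z : C) : circle z -> z^* = z^-1.
Proof.
move=> cz; have z0 := circle_neq0 cz; apply: (mulfI z0).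
by rewrite mulfV // mul_conj; move/circleE: cz => ->; rewrite expr1n.
Qed.
End Conj.

Section LineDerive.
Variables (R : realType) (V : normedModType R).

Lemma line_derive (p : V -> R) (x v : V) (D : R) :
  is_derive (0 : R) 1 (fun h : R => p (h *: v + x)) D ->
  derivable p x v /\ 'D_v p x = D.
Proof.
move=> [h1 h2]; split; first exact/derivable1P.
rewrite -h2 /derive; congr (lim _).
set a1 := (X in X @ _); set a2 := (X in _ = X @ _).
suff -> : a1 = a2 by [].
by apply/funext => h; rewrite /a1 /a2 /= addr0 scale0r add0r [_%:A]mulr1.
Qed.

Variable p : V -> R.
Hypothesis pD : forall (h : R) x v, p (h *: v + x) = h * p v + p x.
Hypothesis cp : continuous p.

(** The family A cos + B sin is stable under directional derivatives, so the induction keeps A and B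
    free. *)
Lemma Ck_trig k (A B : R) : Ck k setT (fun x => A * cos (p x) + B * sin (p x)).
Proof.
elim: k A B => [|k IH] A B.
  split=> // x _; apply: continuousD; apply: continuousM; try exact: cvg_cst.
    by apply: continuous_comp; [exact: cp | exact: continuous_cos].
  by apply: continuous_comp; [exact: cp | exact: continuous_sin].
split.
  move=> x _; apply: continuousD; apply: continuousM; try exact: cvg_cst.
    by apply: continuous_comp; [exact: cp | exact: continuous_cos].
  by apply: continuous_comp; [exact: cp | exact: continuous_sin].
move=> v; have H x : is_derive (0 : R) 1
    (fun h : R => A * cos (p (h *: v + x)) + B * sin (p (h *: v + x)))
    ((p v * B) * cos (p x) + (- p v * A) * sin (p x)).
  have -> : (fun h : R => A * cos (p (h *: v + x)) + B * sin (p (h *: v + x))) =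
     (fun h : R => A * cos (h * p v + p x) + B * sin (h * p v + p x)).
    by apply/funext => h; rewrite pD.
  have L : is_derive (0 : R) 1 (fun h : R => h * p v + p x) (p v).
    by apply: is_derive_eq; rewrite /GRing.scale /=; ring.
  have c1 : is_derive (0 : R) 1 (fun h : R => cos (h * p v + p x)) (- sin (p x) * p v).
    have := @is_derive1_comp _ (@cos R) (fun h : R => h * p v + p x) 0 _ _ _ L.
    by rewrite /= mul0r add0r; apply.
  have s1 : is_derive (0 : R) 1 (fun h : R => sin (h * p v + p x)) (cos (p x) * p v).
    have := @is_derive1_comp _ (@sin R) (fun h : R => h * p v + p x) 0 _ _ _ L.
    by rewrite /= mul0r add0r; apply.
  apply: is_derive_eq; rewrite /GRing.scale /=; ring.
split; first by move=> x _; have [] := line_derive (p := fun x => A * cos (p x) + B * sin (p x)) (H x).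
rewrite (_ : 'D_v _ = (fun x => (p v * B) * cos (p x) + (- p v * A) * sin (p x))).
  exact: IH.
by apply/funext => x; have [_ ->] := line_derive (p := fun x => A * cos (p x) + B * sin (p x)) (H x).
Qed.

End LineDerive.

Section SmoothC.
Variables (R : realType) (V : normedModType R).
Local Notation C := (cplx R).
Variable U : set V.
Hypothesis oU : open U.

Definition smoothC (f : V -> C) : Prop :=
  forall k, Ck k U (fun x => re (f x)) /\ Ck k U (fun x => im (f x)).

Lemma smooth_onP m p (f : V -> 'M[C]_(m, p)) :
  smooth_on U f <-> forall a b, smoothC (fun x => f x a b).
Proof. by split=> H a b k; have [] := H a b k. Qed.

Lemma smoothC_ext f g : (forall x, U x -> f x = g x) -> smoothC f -> smoothC g.
Proof.
move=> fg H k; have [hr hi] := H k.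
by split; [apply: Ck_ext hr | apply: Ck_ext hi] => // x Ux; rewrite fg.
Qed.
Lemma smoothC_cst z : smoothC (fun=> z).
Proof. by move=> k; split; exact: Ck_cst. Qed.
Lemma smoothCD f g : smoothC f -> smoothC g -> smoothC (fun x => f x + g x).
Proof.
move=> hf hg k; have [fr fi] := hf k; have [gr gi] := hg k.
split; [apply: Ck_ext (Ck_add oU fr gr) | apply: Ck_ext (Ck_add oU fi gi)] => // x _;
 by rewrite ?reD ?imD.
Qed.
Lemma smoothCM f g : smoothC f -> smoothC g -> smoothC (fun x => f x * g x).
Proof.
move=> hf hg k; have [fr fi] := hf k; have [gr gi] := hg k; split.
- apply: Ck_ext (Ck_add oU (Ck_mul oU fr gr) (Ck_opp oU (Ck_mul oU fi gi))) => // x _.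
  by rewrite reM.
- by apply: Ck_ext (Ck_add oU (Ck_mul oU fr gi) (Ck_mul oU fi gr)) => // x _; rewrite imM.
Qed.
Lemma smoothCN f : smoothC f -> smoothC (fun x => - f x).
Proof.
by move=> /(smoothCM (smoothC_cst (-1))); apply: smoothC_ext => x _; rewrite mulN1r.
Qed.
Lemma smoothCB f g : smoothC f -> smoothC g -> smoothC (fun x => f x - g x).
Proof. by move=> hf hg; apply: smoothCD => //; exact: smoothCN. Qed.
Lemma smoothC_conj f : smoothC f -> smoothC (fun x => (f x)^*).
Proof.
move=> hf k; have [fr fi] := hf k; split.
- by apply: Ck_ext fr => // x _; rewrite re_conj.
- by apply: Ck_ext (Ck_opp oU fi) => // x _; rewrite im_conj.
Qed.
Lemma smoothCV f : (forall x, U x -> f x != 0) -> smoothC f -> smoothC (fun x => (f x)^-1).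
Proof.
move=> f0 hf; pose q x := re (f x) ^+ 2 + im (f x) ^+ 2.
have q0 x : U x -> q x != 0.
  move=> /f0; rewrite -nrm_gt0 => h.
  by rewrite -[q x]sqr_sqrtr ?addr_ge0 ?sqr_ge0 // expf_neq0 // gt_eqF.
have sq : smoothC (fun x => toC (q x)^-1).
  move=> k; have [fr fi] := hf k; split; last exact: Ck_cst.
  apply: Ck_inv => //; apply: Ck_ext (Ck_add oU (Ck_mul oU fr fr) (Ck_mul oU fi fi)) => // x _.
apply: smoothC_ext (smoothCM (smoothC_conj hf) sq) => x Ux.
apply: (mulfI (f0 x Ux)); rewrite mulrA mul_conj mulfV ?f0 // -toCM.
by rewrite /nrm sqr_sqrtr ?addr_ge0 ?sqr_ge0 // mulfV // q0.
Qed.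
Lemma smoothC_sum (I : Type) (s : seq I) (F : I -> V -> C) :
  (forall i, smoothC (F i)) -> smoothC (fun x => \sum_(i <- s) F i x).
Proof.
move=> H; elim: s => [|i s IH].
  by apply: smoothC_ext (smoothC_cst 0) => x _; rewrite big_nil.
by apply: smoothC_ext (smoothCD (H i) IH) => x _; rewrite big_cons.
Qed.
Lemma smoothC_prod (I : Type) (s : seq I) (F : I -> V -> C) :
  (forall i, smoothC (F i)) -> smoothC (fun x => \prod_(i <- s) F i x).
Proof.
move=> H; elim: s => [|i s IH].
  by apply: smoothC_ext (smoothC_cst 1) => x _; rewrite big_nil.
by apply: smoothC_ext (smoothCM (H i) IH) => x _; rewrite big_cons.
Qed.

Definition smoothM m p (f : V -> 'M[C]_(m, p)) : Prop :=
  forall a b, smoothC (fun x => f x a b).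

Lemma smoothM_cst m p (A : 'M[C]_(m, p)) : smoothM (fun=> A).
Proof. by move=> a b; exact: smoothC_cst. Qed.
Lemma smoothMD m p (f g : V -> 'M[C]_(m, p)) : smoothM f -> smoothM g -> smoothM (fun x => f x + g x).
Proof. by move=> hf hg a b; apply: smoothC_ext (smoothCD (hf a b) (hg a b)) => x _; rewrite mxE. Qed.
Lemma smoothMB m p (f g : V -> 'M[C]_(m, p)) : smoothM f -> smoothM g -> smoothM (fun x => f x - g x).
Proof. by move=> hf hg a b; apply: smoothC_ext (smoothCB (hf a b) (hg a b)) => x _; rewrite !mxE. Qed.
Lemma smoothM_mul m p q (f : V -> 'M[C]_(m, p)) (g : V -> 'M[C]_(p, q)) :
  smoothM f -> smoothM g -> smoothM (fun x => f x *m g x).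
Proof.
move=> hf hg a b; apply: smoothC_ext (smoothC_sum _ (fun c => smoothCM (hf a c) (hg c b))) => x _.
by rewrite mxE.
Qed.
Lemma smoothMZ m p (c : V -> C) (f : V -> 'M[C]_(m, p)) :
  smoothC c -> smoothM f -> smoothM (fun x => c x *: f x).
Proof. by move=> hc hf a b; apply: smoothC_ext (smoothCM hc (hf a b)) => x _; rewrite mxE. Qed.
Lemma smoothM_adj m p (f : V -> 'M[C]_(m, p)) : smoothM f -> smoothM (fun x => (f x)^t*).
Proof. by move=> hf a b; apply: smoothC_ext (smoothC_conj (hf b a)) => x _; rewrite !mxE. Qed.
Lemma smoothC_det m (f : V -> 'M[C]_m) : smoothM f -> smoothC (fun x => \det (f x)).
Proof.
move=> hf; rewrite /determinant; apply: smoothC_sum => s; apply: smoothCM; first exact: smoothC_cst.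
by apply: smoothC_prod => i; exact: hf.
Qed.
Lemma smoothM_invmx m (f : V -> 'M[C]_m) : (forall x, U x -> f x \in unitmx) ->
  smoothM f -> smoothM (fun x => invmx (f x)).
Proof.
move=> fu hf a b.
have d0 x : U x -> \det (f x) != 0 by move=> Ux; have := fu x Ux; rewrite unitmxE unitfE.
have hd := smoothCV d0 (smoothC_det hf).
apply: smoothC_ext (smoothCM hd (_ : smoothC (fun x => \adj (f x) a b))).
- by move=> x Ux; rewrite /invmx fu // !mxE.
- have -> : (fun x => \adj (f x) a b) = (fun x => (-1) ^+ (b + a) * \det (row' b (col' a (f x)))).
    by apply/funext => x; rewrite mxE.
  apply: smoothCM; first exact: smoothC_cst.
  by apply: smoothC_det => i j; apply: smoothC_ext (hf (lift b i) (lift a j)) => x _; rewrite !mxE.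
Qed.
Lemma smoothM_ext m p (f g : V -> 'M[C]_(m, p)) :
  (forall x, U x -> f x = g x) -> smoothM f -> smoothM g.
Proof. by move=> fg hf a b; apply: smoothC_ext (hf a b) => x Ux; rewrite fg. Qed.

End SmoothC.

(** * Orthogonal projections from idempotents *)

Section Adjoint.
Variable R : realType.
Local Notation C := (cplx R).

Lemma hadjM m p q (A : 'M[C]_(m, p)) (B : 'M[C]_(p, q)) : (A *m B)^t* = B^t* *m A^t*.
Proof. by rewrite trmx_mul map_mxM. Qed.
Lemma hadjK m p (A : 'M[C]_(m, p)) : (A^t*)^t* = A.
Proof. by apply/matrixP => i j; rewrite !mxE conjCK. Qed.
Lemma hadjD m p (A B : 'M[C]_(m, p)) : (A + B)^t* = A^t* + B^t*.
Proof. by apply/matrixP => i j; rewrite !mxE rmorphD. Qed.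
Lemma hadjB m p (A B : 'M[C]_(m, p)) : (A - B)^t* = A^t* - B^t*.
Proof. by apply/matrixP => i j; rewrite !mxE rmorphB. Qed.
Lemma hadjZ m p c (A : 'M[C]_(m, p)) : (c *: A)^t* = c^* *: A^t*.
Proof. by apply/matrixP => i j; rewrite !mxE rmorphM. Qed.
Lemma hadj1 m : (1%:M : 'M[C]_m)^t* = 1%:M.
Proof. by apply/matrixP => i j; rewrite !mxE rmorph_nat eq_sym. Qed.
Lemma hadj0 m p : (0 : 'M[C]_(m, p))^t* = 0.
Proof. by apply/matrixP => i j; rewrite !mxE rmorph0. Qed.
Lemma hadj_sum (I : Type) (s : seq I) m p (F : I -> 'M[C]_(m, p)) :
  (\sum_(i <- s) F i)^t* = \sum_(i <- s) (F i)^t*.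
Proof. by elim: s => [|i s IH]; rewrite ?big_nil ?hadj0 // !big_cons hadjD IH. Qed.

Lemma adj_mul_eq0 m p (A : 'M[C]_(m, p)) : \tr (A^t* *m A) = 0 -> A = 0.
Proof.
move=> H; have H2 : \sum_j \sum_i toC (nrm (A i j) ^+ 2) = 0.
  rewrite -[RHS]H /mxtrace; apply: eq_bigr => j _; rewrite mxE; apply: eq_bigr => i _.
  by rewrite !mxE; apply: cplxP; rewrite ?reM ?imM; case: (A i j) => a b;
     rewrite /nrm sqr_sqrtr ?addr_ge0 ?sqr_ge0 // /toC /re /im /=; ring.
apply/matrixP => i j; rewrite mxE.
have pos k : 0 <= \sum_i toC (nrm (A i k) ^+ 2).
  by apply: sumr_ge0 => a _; rewrite -toC0 toC_le sqr_ge0.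
have H3 : \sum_i toC (nrm (A i j) ^+ 2) = 0.
  exact: (psumr_eq0P (fun k _ => pos k) H2).
have pos' k : 0 <= toC (nrm (A k j) ^+ 2) by rewrite -toC0 toC_le sqr_ge0.
have : toC (nrm (A i j) ^+ 2) = 0 by exact: (psumr_eq0P (fun k _ => pos' k) H3).
by move/toC_inj/eqP; rewrite sqrf_eq0 nrm_eq0 => /eqP.
Qed.

Lemma proj_trace0 m (X : 'M[C]_m) : X^t* = X -> X *m X = X -> \tr X = 0 -> X = 0.
Proof. by move=> X1 X2 X3; apply: adj_mul_eq0; rewrite X1 X2. Qed.

Lemma unitary_left m (A : 'M[C]_m) : A *m A^t* = 1%:M -> A^t* *m A = 1%:M.
Proof. exact: mulmx1C. Qed.

(* Kerzman-Stein: [E (E + E^* - 1)^-1] is the orthogonal projection on the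
   image of an idempotent E. *)
Definition kerzman m (E : 'M[C]_m) : 'M[C]_m := E + E^t* - 1%:M.
Definition orthp m (E : 'M[C]_m) : 'M[C]_m := E *m invmx (kerzman E).

Section Orthp.
Variables (m : nat) (E : 'M[C]_m).
Hypothesis EE : E *m E = E.

(** The right side is the identity plus a positive semidefinite matrix; this is what makes
    [kerzman E] invertible whatever the rank of E. *)
Lemma kerzman_sq : kerzman E *m kerzman E = 1%:M + (E - E^t*)^t* *m (E - E^t*).
Proof.
have EE' : E^t* *m E^t* = E^t* by rewrite -hadjM EE.
rewrite /kerzman hadjB hadjK !(mulmxBl, mulmxBr, mulmxDl, mulmxDr) EE EE' !(mulmx1, mul1mx).
apply/matrixP => i j; rewrite !mxE; ring.
Qed.

Lemma kerzman_unit : kerzman E \in unitmx.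
Proof.
rewrite -row_free_unit -kermx_eq0; apply/rowV0P => v /sub_kermxP vK.
suff : v^t* = 0 by move=> h; rewrite -[v]hadjK h hadj0.
apply: adj_mul_eq0; rewrite hadjK.
set K := E - E^t*.
have h : v *m v^t* + (K *m v^t*)^t* *m (K *m v^t*) = 0.
  rewrite hadjM hadjK -mulmxA [_ *m (K *m _)]mulmxA.
  rewrite -[X in X + _]mulmx1 -mulmxA [1%:M as X in _ *m (_ *m X)]lock -lock.
  have -> : v *m (v^t* *m 1%:M) = v *m (1%:M *m v^t*) by rewrite mulmx1 mul1mx.
  by rewrite -mulmxDr -mulmxDl -kerzman_sq -!mulmxA mulmxA vK mul0mx.
have nn (p q : nat) (A : 'M[C]_(p, q)) : 0 <= \tr (A^t* *m A).
  apply: sumr_ge0 => j _; rewrite mxE; apply: sumr_ge0 => i _; rewrite !mxE mulrC mul_conjC_ge0 //.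
have := congr1 mxtrace h; rewrite mxtraceD linear0 => /eqP.
have e : v *m v^t* = (v^t*)^t* *m v^t* by rewrite hadjK.
by rewrite {1}e paddr_eq0 ?nn // => /andP[/eqP]; rewrite -e.
Qed.

(** With K = [kerzman E], the relation E^* K = K E yields K^-1 E^* = E K^-1, and then E K^-1 E =
    K^-1 E^* E = K^-1 K E = E. *)
Lemma orthp_im : orthp E *m E = E.
Proof.
have EE' : E^t* *m E^t* = E^t* by rewrite -hadjM EE.
rewrite /orthp -mulmxA.
have key : kerzman E *m E^t* *m E = kerzman E *m E^t* *m E by [].
have h1 : kerzman E *m E = E^t* *m E.
  by rewrite /kerzman mulmxBl mulmxDl EE mul1mx addrAC subrr add0r.
have h2 : E *m kerzman E = E *m E^t*.
  by rewrite /kerzman mulmxBr mulmxDr EE mulmx1 addrAC subrr add0r.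
have h3 : E^t* *m kerzman E = kerzman E *m E.
  by rewrite h1 /kerzman mulmxBr mulmxDr EE' mulmx1 addrK.
have h4 : invmx (kerzman E) *m E^t* = E *m invmx (kerzman E).
  by rewrite -[RHS](mulKmx kerzman_unit) [kerzman E *m (E *m _)]mulmxA -h3 (mulmxK kerzman_unit).
have h5 : E *m invmx (kerzman E) *m E = E.
  rewrite -h4 -mulmxA -h1 mulKmx //; exact: kerzman_unit.
by rewrite mulmxA.
Qed.

Lemma im_orthp : E *m orthp E = orthp E.
Proof. by rewrite /orthp mulmxA EE. Qed.

Lemma orthp_idem : orthp E *m orthp E = orthp E.
Proof. by rewrite {2}/orthp mulmxA orthp_im. Qed.

(** With P = [orthp E], the relations P K = E and P E = E force P E^* = P. Taking adjoints, E P^* =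
    P^* and hence P P^* = P^*, where the left side is self-adjoint. *)
Lemma orthp_adj : (orthp E)^t* = orthp E.
Proof.
have EE' : E^t* *m E^t* = E^t* by rewrite -hadjM EE.
have h : orthp E *m kerzman E = E by rewrite /orthp mulmxKV // kerzman_unit.
have h' : orthp E *m E^t* = orthp E.
  move: h; rewrite /kerzman mulmxBr mulmxDr mulmx1 orthp_im => /eqP.
  by rewrite -addrA -subr_eq0 addrAC subrr add0r subr_eq0 => /eqP.
have h'' : E *m (orthp E)^t* = (orthp E)^t*.
  by have := hadjM (orthp E) (E^t*); rewrite h' hadjK.
have k1 : orthp E *m (orthp E)^t* = (orthp E)^t* by rewrite -{1}h'' mulmxA orthp_im h''.
by have := hadjM (orthp E) ((orthp E)^t*); rewrite k1 !hadjK k1 => /esym.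
Qed.

End Orthp.

Lemma orthp_eq m (E F : 'M[C]_m) : E *m E = E -> F *m F = F ->
  E *m F = F -> F *m E = E -> orthp E = orthp F.
Proof.
move=> EE FF EF FE.
have h1 : orthp E *m orthp F = orthp F by rewrite -(im_orthp FF) mulmxA -{1}EF mulmxA orthp_im // EF.
have h2 : orthp F *m orthp E = orthp E by rewrite -(im_orthp EE) mulmxA -{1}FE mulmxA orthp_im // FE.
by rewrite -(orthp_adj FF) -h1 hadjM (orthp_adj EE) (orthp_adj FF) h2.
Qed.

Lemma orthp_fix m p (E : 'M[C]_m) (X : 'M[C]_(m, p)) : E *m E = E ->
  E *m X = X <-> orthp E *m X = X.
Proof.
move=> EE; split=> h.
  by rewrite -h mulmxA orthp_im.
by rewrite -h mulmxA im_orthp.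
Qed.

End Adjoint.

(** * Truncated shift and uniton factors *)

Section Blocks.
Variables (R : realType) (n r : nat).
Local Notation C := (cplx R).
Local Notation N := r.+1.
Local Notation DD := (r.+1 * n)%N.

(* the [a]-th block of a vector of length [r.+1 * n]; zero for [a > r] *)
Definition blk (a : nat) : 'M[C]_(n, DD) := \matrix_(i, e) (val e == a * n + i)%N%:R.
Definition jlb (a : nat) : 'M[C]_(DD, n) := (blk a)^T.

Lemma jlb_adj a : (blk a)^t* = jlb a.
Proof. by apply/matrixP => i j; rewrite !mxE rmorph_nat. Qed.
Lemma blk_adj a : (jlb a)^t* = blk a.
Proof. by rewrite -jlb_adj hadjK. Qed.

Lemma block_index (a b : nat) (i j : 'I_n) : (a * n + i == b * n + j)%N = (a == b) && (i == j).
Proof.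
apply/eqP/andP => [h|[/eqP-> /eqP->] //].
have n0 : (0 < n)%N by apply: leq_ltn_trans (ltn_ord i).
have hb : a = b.
  have := congr1 (fun x => x %/ n)%N h.
  by rewrite !divnMDl // !divn_small // !addn0.
by move: h; rewrite hb => /addnI/val_inj ->; split.
Qed.

Lemma blk_jlb a b : blk a *m jlb b = ((a == b) && (a <= r)%N)%:R%:M.
Proof.
apply/matrixP => i j; rewrite !mxE.
have [ar|ra] := leqP a r; last first.
  rewrite andbF mul0rn big1 // => e _; rewrite !mxE.
  case: eqP => [h|_]; last by rewrite mul0r.
  have lt := ltn_ord e.
  have ge : (DD <= a * n + i)%N := leq_trans (leq_mul ra (leqnn n)) (leq_addr _ _).
  by rewrite -h in ge; move: (leq_ltn_trans ge lt); rewrite ltnn.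
have lt : (a * n + i < DD)%N.
  apply: leq_trans (_ : a * n + n <= _)%N; first by rewrite ltn_add2l.
  by rewrite addnC -mulSn leq_mul.
rewrite (bigD1 (Ordinal lt)) //= big1 ?addr0; last first.
  move=> e ne; rewrite !mxE; case: eqP => [h|_]; last by rewrite mul0r.
  by case/eqP: ne; apply: val_inj.
rewrite !mxE /= eqxx mul1r block_index andbT.
by case: (a == b); case: (i == j).
Qed.

Lemma sum_jlb_blk : \sum_(a < N) jlb a *m blk a = 1%:M.
Proof.
apply/matrixP => e f; rewrite summxE !mxE.
have n0 : (0 < n)%N.
  by rewrite lt0n; apply/eqP => n0; have := ltn_ord e; rewrite {2}n0 muln0.
have lt1 : (e %/ n < N)%N by rewrite ltn_divLR.
have lt2 : (e %% n < n)%N by rewrite ltn_mod.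
rewrite (bigD1 (Ordinal lt1)) //= big1 ?addr0; last first.
  move=> a ne; rewrite mxE big1 // => i _; rewrite !mxE.
  case: eqP => [h|_]; last by rewrite mul0r.
  by case/eqP: ne; apply: val_inj; rewrite /= h divnMDl // divn_small ?addn0.
rewrite mxE (bigD1 (Ordinal lt2)) //= big1 ?addr0; last first.
  move=> i ne; rewrite !mxE; case: eqP => [h|_]; last by rewrite mul0r.
  by case/eqP: ne; apply: val_inj; rewrite /= h modnMDl modn_small.
by rewrite !mxE /= -divn_eq eqxx mul1r; congr (_%:R); rewrite eq_sym.
Qed.

Lemma blk_ext m (X Y : 'M[C]_(DD, m)) : (forall a, (a <= r)%N -> blk a *m X = blk a *m Y) -> X = Y.
Proof.
move=> H; rewrite -[X]mul1mx -[Y]mul1mx -sum_jlb_blk !mulmx_suml.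
by apply: eq_bigr => a _; rewrite -!mulmxA H // -ltnS.
Qed.

(** Blocks are coefficients of a polynomial in l of degree at most r: [Tsh] is multiplication by l
    modulo l^(r+1), and [ev l] below is evaluation at l. *)
Definition Tsh : 'M[C]_DD := \sum_(a < r) jlb a.+1 *m blk a.
Definition Elast : 'M[C]_DD := jlb r *m blk r.
Definition ev (l : C) : 'M[C]_(n, DD) := \sum_(a < N) l ^+ a *: blk a.

Lemma jlb_big b : (r < b)%N -> jlb b = 0.
Proof.
move=> rb; apply: blk_ext => a ar; rewrite blk_jlb mulmx0.
have -> : (a == b) = false by apply/eqP => h; move: rb; rewrite -h ltnNge ar.
by rewrite scalar_mx_is_zmod_morphism || (apply/matrixP => i j; rewrite !mxE mul0rn).
Qed.

Lemma blk_big b : (r < b)%N -> blk b = 0.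
Proof. by move=> h; rewrite -blk_adj jlb_big // hadj0. Qed.

Lemma blk_jlb_eq a : (a <= r)%N -> blk a *m jlb a = 1%:M.
Proof. by move=> ar; rewrite blk_jlb eqxx ar. Qed.

Lemma blk_jlb_neq a b : a != b -> blk a *m jlb b = 0.
Proof. by move=> /negbTE ab; rewrite blk_jlb ab /= scale_scalar_mx || (apply/matrixP => i j; rewrite blk_jlb ab !mxE mul0rn). Qed.

Lemma T_jlb b : Tsh *m jlb b = jlb b.+1.
Proof.
rewrite /Tsh mulmx_suml; have [br|rb] := ltnP b r.
  rewrite (bigD1 (Ordinal br)) //= big1 ?addr0; last first.
    by move=> a ne; rewrite -mulmxA blk_jlb_neq ?mulmx0.
  by rewrite -mulmxA blk_jlb_eq ?mulmx1 // ltnW.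
rewrite [RHS]jlb_big ?ltnS // big1 // => a _.
by rewrite -mulmxA blk_jlb_neq ?mulmx0 // neq_ltn (leq_trans (ltn_ord a)).
Qed.

Lemma blk_T a : blk a.+1 *m Tsh = if (a < r)%N then blk a else 0.
Proof.
rewrite /Tsh mulmx_sumr; have [ar|ra] := ltnP a r.
  rewrite (bigD1 (Ordinal ar)) //= big1 ?addr0; last first.
    by move=> b ne; rewrite mulmxA blk_jlb_neq ?mul0mx // eqSS eq_sym.
  by rewrite mulmxA blk_jlb_eq ?mul1mx.
by rewrite big1 // => b _; rewrite mulmxA blk_big ?ltnS // !mul0mx.
Qed.

Lemma blk0_T : blk 0 *m Tsh = 0.
Proof. by rewrite /Tsh mulmx_sumr big1 // => b _; rewrite mulmxA blk_jlb_neq ?mul0mx. Qed.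

Lemma Tadj_T : Tsh^t* *m Tsh = 1%:M - Elast.
Proof.
rewrite -sum_jlb_blk big_ord_recr /= addrK {1}/Tsh hadj_sum mulmx_suml.
apply: eq_bigr => a _; rewrite hadjM blk_adj jlb_adj -mulmxA blk_T.
by rewrite ltn_ord.
Qed.

Lemma T_E : Tsh *m Elast = 0.
Proof. by rewrite /Elast mulmxA T_jlb jlb_big // mul0mx. Qed.

Lemma Elast_adj : Elast^t* = Elast.
Proof. by rewrite /Elast hadjM blk_adj jlb_adj. Qed.

Lemma tr_Elast : \tr Elast = n%:R.
Proof. by rewrite /Elast mxtrace_mulC blk_jlb_eq // mxtrace1. Qed.

Lemma ev_jlb l b : (b <= r)%N -> ev l *m jlb b = (l ^+ b)%:M.
Proof.
move=> br; rewrite /ev mulmx_suml (bigD1 (inord b)) //= inordK ?ltnS // big1 ?addr0.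
  by rewrite -scalemxAl blk_jlb_eq // scalemx1.
move=> a ne; rewrite -scalemxAl blk_jlb_neq ?scaler0 //.
by apply: contraNneq ne => h; apply/eqP/val_inj; rewrite /= inordK ?ltnS.
Qed.

Lemma ev_T l : ev l *m Tsh = l *: (ev l *m (1%:M - Elast)).
Proof.
rewrite -sum_jlb_blk big_ord_recr /= addrK /Tsh !mulmx_sumr scaler_sumr.
apply: eq_bigr => a _.
rewrite [LHS]mulmxA [in RHS]mulmxA (ev_jlb l (ltn_ord a)) (ev_jlb l (ltnW (ltn_ord a))).
by rewrite [LHS]mul_scalar_mx [in RHS]mul_scalar_mx scalerA -exprS.
Qed.

Lemma ev_E l : ev l *m Elast = l ^+ r *: blk r.
Proof. by rewrite /Elast mulmxA ev_jlb // mul_scalar_mx. Qed.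

Lemma Elast_idem : Elast *m Elast = Elast.
Proof. by rewrite /Elast mulmxA -(mulmxA (jlb r)) blk_jlb_eq // mulmx1. Qed.

Lemma ev_E_ev l : circle l -> ev l *m Elast *m (ev l)^t* = 1%:M.
Proof.
move=> cl; have l0 := circle_neq0 cl; have lc := conj_circle cl.
rewrite ev_E -scalemxAl -{1}(blk_adj r) -hadjM ev_jlb // tr_scalar_mx map_scalar_mx /=.
by rewrite scale_scalar_mx rmorphXn /= lc -exprMn mulfV // expr1n.
Qed.

Lemma ElastE : Elast = jlb r *m blk r. Proof. by []. Qed.

Lemma ev_adj l : (ev l)^t* = \sum_(a < N) (l^*) ^+ a *: jlb a.
Proof. by rewrite /ev hadj_sum; apply: eq_bigr => a _; rewrite hadjZ rmorphXn /= jlb_adj. Qed.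

Fixpoint Tpow (k : nat) : 'M[C]_DD := if k is k'.+1 then Tsh *m Tpow k' else 1%:M.

Lemma Tpow0 : Tpow 0 = 1%:M. Proof. by []. Qed.
Lemma TpowSl k : Tpow k.+1 = Tsh *m Tpow k. Proof. by []. Qed.
Lemma Tpow1 : Tpow 1 = Tsh. Proof. exact: mulmx1. Qed.
Lemma TpowS k : Tpow k.+1 = Tpow k *m Tsh.
Proof. by elim: k => [|k IH] /=; rewrite ?mulmx1 ?mul1mx // -mulmxA -IH. Qed.
Lemma TpowD k m : Tpow (k + m) = Tpow k *m Tpow m.
Proof. by elim: k => [|k IH]; rewrite ?mul1mx //= IH mulmxA. Qed.

Lemma Tpow_jlb k b : Tpow k *m jlb b = jlb (k + b).
Proof. by elim: k b => [|k IH] b; rewrite ?mul1mx // addSn /= -mulmxA IH T_jlb. Qed.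

Lemma Tpow_big k : (r < k)%N -> Tpow k = 0.
Proof.
move=> rk; rewrite -[Tpow k]mulmx1 -sum_jlb_blk mulmx_sumr big1 // => a _.
by rewrite mulmxA Tpow_jlb jlb_big ?mul0mx // ltn_addr.
Qed.

(** The block Toeplitz kernel with entries l^(b - a). With Z = l^-1 T nilpotent and G the geometric
    series inverting 1 - Z, multiplying either side by 1 - Z on the right and its adjoint on the
    left gives 1 - Z^* Z. *)
Lemma toeplitz (l : C) : circle l -> (ev l)^t* *m ev l =
  \sum_(k < N.+1) l^-1 ^+ k *: Tpow k + \sum_(k < N.+1) l ^+ k.+1 *: (Tpow k.+1)^t*.
Proof.
move=> cl; have l0 := circle_neq0 cl; have lc := conj_circle cl.
pose Z := l^-1 *: Tsh; pose G := \sum_(k < N.+1) l^-1 ^+ k *: Tpow k.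
have Zs : Z^t* = l *: Tsh^t* by rewrite /Z hadjZ -lc conjCK.
have GZ : G *m Z = \sum_(k < N.+1) l^-1 ^+ k.+1 *: Tpow k.+1.
  rewrite /G mulmx_suml; apply: eq_bigr => k _.
  by rewrite /Z -scalemxAl -scalemxAr scalerA TpowS -exprSr.
have GZ1 : G *m (1%:M - Z) = 1%:M.
  pose F k := l^-1 ^+ k *: Tpow k.
  have FN : F N.+1 = 0 by rewrite /F Tpow_big ?scaler0.
  have F0 : F 0%N = 1%:M by rewrite /F scale1r.
  rewrite mulmxBr mulmx1 GZ -[G]/(\sum_(k < N.+1) F k).
  rewrite -[X in _ - X]/(\sum_(k < N.+1) F k.+1).
  rewrite big_ord_recl [X in _ - X]big_ord_recr.
  by rewrite /= FN F0 addr0 addrK.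
have ZG1 : (1%:M - Z) *m G = 1%:M by apply: mulmx1C.
have GZs : (1%:M - Z^t*) *m G^t* = 1%:M.
  by rewrite -{1}hadj1 -hadjB -hadjM GZ1 hadj1.
have GZs' : G^t* *m (1%:M - Z^t*) = 1%:M by apply: mulmx1C.
have eZ : ev l *m (1%:M - Z) = l ^+ r *: blk r.
  rewrite mulmxBr mulmx1 /Z -scalemxAr ev_T scalerA mulVf // scale1r.
  by rewrite mulmxBr mulmx1 opprB addrC subrK ev_E.
have key : (1%:M - Z^t*) *m ((ev l)^t* *m ev l) *m (1%:M - Z) = 1%:M - Z^t* *m Z.
  rewrite -!mulmxA eZ mulmxA -{1}hadj1 -hadjB -hadjM eZ hadjZ -scalemxAl -scalemxAr scalerA.
  rewrite jlb_adj mulrC rmorphXn /= lc -exprMn mulfV // expr1n scale1r.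
  rewrite Zs /Z -scalemxAl -scalemxAr scalerA mulfV // scale1r Tadj_T.
  by rewrite opprB addrC subrK.
have key2 : (1%:M - Z^t*) *m (G + Z^t* *m G^t*) *m (1%:M - Z) = 1%:M - Z^t* *m Z.
  have c : Z^t* *m G^t* = G^t* *m Z^t*.
    have /eqP := GZs; rewrite mulmxBl mul1mx subr_eq => /eqP h1.
    have /eqP := GZs'; rewrite mulmxBr mulmx1 subr_eq => /eqP h2.
    by apply: (addrI 1%:M); rewrite -h1 -h2.
  rewrite (mulmxDr (1%:M - Z^t*) G) (mulmxDl _ _ (1%:M - Z)).
  rewrite -(mulmxA _ G) GZ1 mulmx1 c (mulmxA _ (G^t*)) GZs mul1mx.
  by rewrite mulmxBr mulmx1 addrA subrK.
have -> : (ev l)^t* *m ev l = G + Z^t* *m G^t*.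
  have can (X : 'M[C]_DD) : G^t* *m ((1%:M - Z^t*) *m X *m (1%:M - Z)) *m G = X.
    by rewrite mulmxA (mulmxA (G^t*)) GZs' mul1mx -(mulmxA X) ZG1 mulmx1.
  by rewrite -[LHS]can key -key2 can.
congr (_ + _); rewrite -[LHS]hadjK hadjM hadjK hadjK GZ hadj_sum; apply: eq_bigr => k _.
by rewrite hadjZ rmorphXn /= -lc conjCK.
Qed.

Lemma sum_two (V : zmodType) (F : nat -> V) K : (forall k, F k.+2 = 0) ->
  \sum_(k < K.+2) F k = F 0%N + F 1%N.
Proof. by move=> F2; rewrite 2!big_ord_recl big1 ?addr0 // => k _; exact: F2. Qed.

Lemma sum_one (V : zmodType) (F : nat -> V) K : (forall k, F k.+1 = 0) ->
  \sum_(k < K.+1) F k = F 0%N.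
Proof. by move=> F2; rewrite big_ord_recl big1 ?addr0 // => k _; exact: F2. Qed.

(** If only the powers 0 and 1 of the shift and of its adjoint survive between X and Y, the product
    is a trinomial in l. Every computation with products of loops below goes through this
    expansion. *)
Lemma toeplitz_mul (l : C) p q (X : 'M[C]_(p, DD)) (Y : 'M[C]_(DD, q)) : circle l ->
  (forall k, (1 < k)%N -> X *m Tpow k *m Y = 0) ->
  (forall k, (1 < k)%N -> X *m (Tpow k)^t* *m Y = 0) ->
  (ev l *m X^t*)^t* *m (ev l *m Y) =
    X *m Y + l^-1 *: (X *m Tsh *m Y) + l *: (X *m Tsh^t* *m Y).
Proof.
move=> cl H1 H2.
have T1 : Tpow 1 = Tsh by exact: mulmx1.
have S1 : X *m (\sum_(k < N.+1) l^-1 ^+ k *: Tpow k) *m Y = X *m Y + l^-1 *: (X *m Tsh *m Y).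
  pose F k := l^-1 ^+ k *: (X *m Tpow k *m Y).
  have F0 : F 0%N = X *m Y by rewrite /F expr0 scale1r mulmx1.
  have F1 : F 1%N = l^-1 *: (X *m Tsh *m Y) by rewrite /F T1 expr1.
  have F2 k : F k.+2 = 0 by rewrite /F H1 ?scaler0.
  have -> : X *m (\sum_(k < N.+1) l^-1 ^+ k *: Tpow k) *m Y = \sum_(k < N.+1) F k.
    rewrite mulmx_sumr mulmx_suml; apply: eq_bigr => k _.
    rewrite -[X *m _]scalemxAr; exact: esym (scalemxAl _ _ _).
  by rewrite (sum_two _ F2) F0 F1.
have S2 : X *m (\sum_(k < N.+1) l ^+ k.+1 *: (Tpow k.+1)^t*) *m Y = l *: (X *m Tsh^t* *m Y).
  pose F k := l ^+ k.+1 *: (X *m (Tpow k.+1)^t* *m Y).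
  have F1 : F 0%N = l *: (X *m Tsh^t* *m Y) by rewrite /F T1 expr1.
  have F2 k : F k.+1 = 0 by rewrite /F H2 ?scaler0.
  have -> : X *m (\sum_(k < N.+1) l ^+ k.+1 *: (Tpow k.+1)^t*) *m Y = \sum_(k < N.+1) F k.
    rewrite mulmx_sumr mulmx_suml; apply: eq_bigr => k _.
    rewrite -[X *m _]scalemxAr; exact: esym (scalemxAl _ _ _).
  by rewrite (sum_one _ F2).
have -> : (ev l *m X^t*)^t* *m (ev l *m Y) = X *m ((ev l)^t* *m ev l) *m Y.
  by rewrite hadjM hadjK !mulmxA.
rewrite (toeplitz cl) (mulmxDr X) (mulmxDl _ _ Y).
by congr (_ + _); [exact: S1 | exact: S2].
Qed.

End Blocks.

Global Opaque Tpow blk jlb ev Tsh Elast.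

Lemma circle1 (R : realType) : circle (1 : cplx R).
Proof. by apply/circleE; rewrite nrm1. Qed.

(** The points 1, -1 and i of the circle determine the three coefficients. *)
Lemma pencil_zero (R : realType) n (A B : 'M[cplx R]_n) :
  (forall l, circle l -> A + l *: B + l^* *: B^t* = 1%:M) -> B = 0.
Proof.
move=> U.
have cm1 : circle (-1 : cplx R) by apply/circleE; rewrite nrmN nrm1.
have ci : circle (imagI R).
  by apply/circleE; rewrite /nrm /imagI /re /im /= expr0n add0r expr1n sqrtr1.
have hii : imagI R * imagI R = -1 by apply: cplxP; rewrite ?reM ?imM /imagI /re /im /=; ring.
have iI : (imagI R)^-1 = - imagI R.
  by apply: (mulfI (circle_neq0 ci)); rewrite mulfV ?circle_neq0 // mulrN hii opprK.
apply/matrixP => i j; rewrite [RHS]mxE.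
have E l : circle l -> A i j + l * B i j + l^-1 * (B j i)^* = (i == j)%:R.
  by move=> cl; have /matrixP/(_ i j) := U l cl; rewrite (conj_circle cl) !mxE.
have := E _ (circle1 R); have := E _ cm1; have := E _ ci.
rewrite iI invrN1 invr1; move: (A i j) (B i j) ((B j i)^*) ((i == j)%:R) => a b b' d e3 e2 e1.
have two : (2 : cplx R) != 0 by rewrite pnatr_eq0.
have s1 : b + b' = 0 by apply: (mulfI two); rewrite mulr0 -[RHS](subrr d) -{1}e1 -e2; ring.
have a1 : a = d by rewrite -e1 !mul1r -addrA s1 addr0.
have s3 : b - b' = 0.
  by apply: (mulfI (circle_neq0 ci)); rewrite mulr0 -[RHS](subrr d) -{1}e3 -a1; ring.
by apply: (mulfI two); rewrite mulr0 -[RHS](addr0 0) -{1}s1 -s3; ring.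
Qed.

(** Unitarity on the whole circle kills the coefficient Q^* (1 - Q) of l; so Q^* = Q^* Q, which is
    self-adjoint. *)
Lemma unitary_pencil (R : realType) n (Q : 'M[cplx R]_n) :
  (forall l, circle l -> (Q + l *: (1%:M - Q))^t* *m (Q + l *: (1%:M - Q)) = 1%:M) ->
  Q^t* = Q /\ Q *m Q = Q.
Proof.
move=> hU; pose A := Q^t* *m Q + (1%:M - Q)^t* *m (1%:M - Q).
pose B := Q^t* *m (1%:M - Q).
have U l : circle l -> A + l *: B + l^* *: B^t* = 1%:M.
  move=> cl; rewrite -(hU l cl) /A /B hadjD hadjZ (mulmxDl (Q^t*)) (mulmxDr (Q^t*) Q (l *: _)).
  rewrite (mulmxDr (l^* *: _) Q (l *: _)) -!scalemxAr -!scalemxAl scalerA hadjM hadjK.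
  have -> : l * l^* = 1 by rewrite conj_circle // mulfV // circle_neq0.
  rewrite scale1r; move: (Q^t* *m Q) ((1%:M - Q)^t* *m (1%:M - Q))
    (Q^t* *m (1%:M - Q)) ((1%:M - Q)^t* *m Q) => a b e d.
  by apply/matrixP => i j; rewrite !mxE; ring.
have B0 := pencil_zero U.
have QQ : Q^t* = Q^t* *m Q by move/eqP: B0; rewrite /B mulmxBr mulmx1 subr_eq0 => /eqP.
have Qa : Q^t* = Q.
  by have := hadjM (Q^t*) Q; rewrite -QQ !hadjK -QQ => /esym.
by split => //; rewrite -{1}Qa -QQ.
Qed.

Lemma mulmx_assoc4 (R : pzRingType) a b c d e (Y : 'M[R]_(a, b)) (W : 'M[R]_(b, c))
  (J : 'M[R]_(c, d)) (X : 'M[R]_(d, e)) : Y *m (W *m J *m X) = Y *m W *m J *m X.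
Proof. by rewrite !mulmxA. Qed.

Section PhiAlgebra.
Variables (R : realType) (n r : nat).
Local Notation C := (cplx R).
Local Notation DD := (r.+1 * n)%N.
Local Notation T := (Tsh R n r).
Local Notation E0 := (Elast R n r).
Local Notation ev := (@ev R n r).
Local Notation J := ((ev 1)^t*).
Local Notation Tp := (Tpow R n r).

Definition wandering (P : 'M[C]_DD) : 'M[C]_DD := P - T *m P *m T^t*.
(** When the wandering subspace is Phi C^n, the product of [ev l], its projection and J is Phi(l)
    times the adjoint of Phi(1): the factor J normalises the value at 1 to the identity. *)
Definition PhiP (P : 'M[C]_DD) (l : C) : 'M[C]_n := ev l *m wandering P *m J.

(* [P] is the orthogonal projection on [W / l^(r.+1) H_+] for a shift-invariant
   [W] containing [l^r H_+]. *)
Definition inv_proj (P : 'M[C]_DD) : Prop :=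
  [/\ P *m P = P, P^t* = P, P *m T *m P = T *m P & P *m E0 = E0].

Section OneProjection.
Variable P : 'M[C]_DD.
Hypothesis hP : inv_proj P.
Let PP : P *m P = P. Proof. by case: hP. Qed.
Let Pa : P^t* = P. Proof. by case: hP. Qed.
Let PTP : P *m T *m P = T *m P. Proof. by case: hP. Qed.
Let PE : P *m E0 = E0. Proof. by case: hP. Qed.
Let EP : E0 *m P = E0.
Proof. by have := hadjM P E0; rewrite PE (Elast_adj R n r) Pa => <-. Qed.
Local Notation W := (wandering P).

Lemma wandering_adj : W^t* = W.
Proof. by rewrite /wandering hadjB !hadjM hadjK Pa mulmxA. Qed.

Lemma P_wandering : P *m W = W.
Proof. by rewrite /wandering mulmxBr PP mulmxA (mulmxA P) PTP. Qed.

Lemma wandering_P : W *m P = W.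
Proof. by have := hadjM P W; rewrite P_wandering wandering_adj Pa => <-. Qed.

Lemma wandering_TP : W *m T *m P = 0.
Proof.
rewrite /wandering mulmxBl mulmxBl PTP -(mulmxA (T *m P)) Tadj_T mulmxBr mulmx1 mulmxBl.
rewrite -(mulmxA T P P) PP -(mulmxA (T *m P)) EP -(mulmxA T) PE T_E subr0; exact: subrr.
Qed.

Lemma wandering_idem : W *m W = W.
Proof.
rewrite {2}/wandering mulmxBr wandering_P !mulmxA wandering_TP mul0mx; exact: subr0.
Qed.

Lemma wandering_trace : \tr W = n%:R.
Proof.
rewrite /wandering linearB /= -mulmxA mxtrace_mulC -mulmxA Tadj_T mulmxBr mulmx1 PE.
by rewrite linearB /= opprB addrC subrK tr_Elast.
Qed.

(** For |l| = 1 conjugation by [ev l] gives T P T^* and P - E0 the same value, so in the difference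
    only the last block E0 remains, whatever P is. *)
Lemma ev_wandering l : circle l -> ev l *m W *m (ev l)^t* = 1%:M.
Proof.
move=> cl; have l0 := circle_neq0 cl; have lc := conj_circle cl.
have h : ev l *m (T *m P *m T^t*) *m (ev l)^t* = ev l *m (P - E0) *m (ev l)^t*.
  have -> : ev l *m (T *m P *m T^t*) *m (ev l)^t* = (ev l *m T) *m P *m (ev l *m T)^t*.
    by rewrite hadjM !mulmxA.
  rewrite ev_T hadjZ lc -!scalemxAl -scalemxAr scalerA mulfV // scale1r hadjM.
  rewrite hadjB hadj1 Elast_adj !mulmxA; congr (_ *m _); rewrite -!mulmxA; congr (_ *m _).
  rewrite mulmxA mulmxBl mul1mx EP mulmxBr mulmx1 mulmxBl PE.
  by rewrite Elast_idem subrr subr0.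
rewrite /wandering mulmxBr mulmxBl h -mulmxBl -mulmxBr opprB addrC subrK.
exact: ev_E_ev.
Qed.

Lemma JWJ : ev 1 *m W *m J = 1%:M.
Proof. by apply: ev_wandering; exact: circle1. Qed.

Lemma PhiP1 : PhiP P 1 = 1%:M.
Proof. exact: JWJ. Qed.

(** A dimension count: W and Y = W J (ev 1) W are orthogonal projections with Y below W, both of
    trace n, so their difference is a projection of trace zero. *)
Lemma wandering_J : W = W *m J *m (ev 1 *m W).
Proof.
apply/eqP; rewrite -subr_eq0; apply/eqP; set Y := W *m J *m _.
have YY : Y *m Y = Y.
  by rewrite /Y -(mulmxA (W *m J)) (mulmxA (ev 1 *m W)) (mulmxA (ev 1 *m W) W)
    -(mulmxA (ev 1) W W) wandering_idem JWJ mul1mx.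
have WY : W *m Y = Y by rewrite /Y !mulmxA wandering_idem.
have YW : Y *m W = Y by rewrite /Y -(mulmxA (W *m J)) -(mulmxA (ev 1)) wandering_idem.
apply: proj_trace0.
- by rewrite hadjB wandering_adj /Y !hadjM hadjK wandering_adj mulmxA.
- by rewrite (mulmxBl W Y) (mulmxBr W W) (mulmxBr Y W) wandering_idem WY YW YY subrr subr0.
- rewrite linearB /= wandering_trace /Y -(mulmxA W) mxtrace_mulC -(mulmxA J) -(mulmxA (ev 1))
   wandering_idem mxtrace_mulC JWJ mxtrace1; exact: subrr.
Qed.

Lemma PhiP_adj l : (PhiP P l)^t* = ev 1 *m W *m (ev l)^t*.
Proof. by rewrite /PhiP hadjM hadjK hadjM wandering_adj mulmxA. Qed.

Lemma PhiP_unitary l : circle l -> PhiP P l *m (PhiP P l)^t* = 1%:M.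
Proof.
move=> cl; rewrite PhiP_adj /PhiP -(ev_wandering cl) [in RHS]wandering_J.
by rewrite !mulmxA.
Qed.

Lemma PhiP_unitary' l : circle l -> (PhiP P l)^t* *m PhiP P l = 1%:M.
Proof. by move=> cl; apply/unitary_left/PhiP_unitary. Qed.

Lemma T_P_stable k : P *m Tp k *m P = Tp k *m P.
Proof.
elim: k => [|k IH]; first by rewrite Tpow0 mulmx1 mul1mx PP.
have e : Tp k.+1 *m P = T *m P *m (Tp k *m P).
  by rewrite TpowSl -(mulmxA T P) (mulmxA P) IH mulmxA.
by rewrite -(mulmxA P) e mulmxA (mulmxA P) PTP.
Qed.

Lemma wandering_Tpow k : (0 < k)%N -> W *m Tp k *m P = 0.
Proof.
case: k => // k _; have e : Tp k.+1 *m P = T *m P *m (Tp k *m P).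
  by rewrite TpowSl -(mulmxA T P) (mulmxA P) T_P_stable mulmxA.
by rewrite -(mulmxA W) e !mulmxA wandering_TP !mul0mx.
Qed.

(** On the circle the inverse of Phi is its adjoint, a polynomial in l^-1: these are the matrices S
    of the formulae. *)
Definition Scoef (s : nat) : 'M[C]_n := ev 1 *m W *m jlb R n r s.

Lemma PhiP_adj_expand l : (PhiP P l)^t* = \sum_(s < r.+1) (l^*) ^+ s *: Scoef s.
Proof.
rewrite PhiP_adj ev_adj mulmx_sumr; apply: eq_bigr => s _.
exact: esym (scalemxAr _ _ _).
Qed.

Lemma Scoef_vec (v : 'cV[C]_DD) : ev 1 *m W *m v = \sum_(s < r.+1) Scoef s *m (blk R n r s *m v).
Proof.
have e : v = \sum_(s < r.+1) jlb R n r s *m (blk R n r s *m v).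
  rewrite -[LHS]mul1mx -sum_jlb_blk mulmx_suml; apply: eq_bigr => s _.
  exact: esym (mulmxA _ _ _).
rewrite [in LHS]e mulmx_sumr; apply: eq_bigr => s _.
by rewrite /Scoef !mulmxA.
Qed.

Lemma Scoef0 s : P *m jlb R n r s = jlb R n r s -> Scoef s.+1 = 0.
Proof.
move=> h; rewrite /Scoef -T_jlb -h !mulmxA -(mulmxA (ev 1)) -(mulmxA (ev 1)).
by rewrite wandering_TP mulmx0 mul0mx.
Qed.

Lemma wanderingE : W = P - T *m P *m T^t*. Proof. by []. Qed.
Lemma PhiPE l : PhiP P l = ev l *m W *m J. Proof. by []. Qed.

End OneProjection.
Opaque wandering PhiP.

Section TwoProjections.
Variables P' P : 'M[C]_DD.
Hypothesis hP' : inv_proj P'.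
Hypothesis hP : inv_proj P.
Hypothesis sub : P' *m P = P.
Hypothesis Tsub : P *m T *m P' = T *m P'.
Local Notation W' := (wandering P').
Local Notation W := (wandering P).

(** The coefficient of l^0 in the quotient of the loops of P' and P; it turns out to be the
    projection onto the uniton. *)
Definition Q0 : 'M[C]_n := ev 1 *m W' *m W *m J.

Lemma two_Tpow k : (0 < k)%N -> W' *m Tp k *m W = 0.
Proof.
move=> k0; rewrite -(P_wandering hP) -sub !mulmxA (wandering_Tpow hP') //.
by rewrite !mul0mx.
Qed.

Lemma two_Tadj k : (1 < k)%N -> W' *m (Tp k)^t* *m W = 0.
Proof.
case: k => [|[|k]] // _.
have h : W *m Tp k.+2 *m W' = 0.
  have e : T *m W' = P *m (T *m W').
    by rewrite -{1}(P_wandering hP') (mulmxA T) -Tsub -(mulmxA (P *m T)) (P_wandering hP') -mulmxA.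
  rewrite TpowS -(mulmxA W) -(mulmxA (Tp k.+1)) e (mulmxA (Tp k.+1)) (mulmxA W) (mulmxA W).
  by rewrite (wandering_Tpow hP) // !mul0mx.
move: h (wandering_adj hP) (wandering_adj hP'); generalize (wandering P') (wandering P) => U V h hV hU.
have := congr1 (fun X => X^t*) h.
by rewrite (hadjM (V *m Tp k.+2)) (hadjM V) hU hV hadj0 mulmxA.
Qed.

(** The two inclusions leave only the identity and T^* between W' and W, so the quotient is affine
    in l; its value 1 at l = 1 fixes the linear coefficient. *)
Lemma two_PhiP l : circle l -> (PhiP P' l)^t* *m PhiP P l = Q0 + l *: (1%:M - Q0).
Proof.
have main l' : circle l' -> (PhiP P' l')^t* *m PhiP P l' =
    Q0 + l' *: (ev 1 *m W' *m T^t* *m W *m J).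
  move=> cl; have e1 : PhiP P' l' = ev l' *m (ev 1 *m W')^t*.
    by rewrite PhiPE hadjM (wandering_adj hP') mulmxA.
  have e2 : PhiP P l' = ev l' *m (W *m J) by rewrite PhiPE -mulmxA.
  rewrite e1 e2 (toeplitz_mul cl).
  - have z : W' *m T *m W = 0 by have := two_Tpow (k := 1) isT; rewrite Tpow1.
    have -> : ev 1 *m W' *m T *m (W *m J) = ev 1 *m (W' *m T *m W) *m J by rewrite !mulmxA.
    rewrite /Q0; move: z; generalize (wandering P') (wandering P) => U V z.
    by rewrite z mulmx0 mul0mx scaler0 addr0 !mulmxA.
  - move=> k k1; have -> : ev 1 *m W' *m Tp k *m (W *m J) = ev 1 *m (W' *m Tp k *m W) *m J by rewrite !mulmxA.
    by rewrite two_Tpow 1?ltnW // mulmx0 mul0mx.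
  - move=> k k1; have -> : ev 1 *m W' *m (Tp k)^t* *m (W *m J) = ev 1 *m (W' *m (Tp k)^t* *m W) *m J by rewrite !mulmxA.
    by rewrite two_Tadj // mulmx0 mul0mx.
move=> cl; rewrite (main l cl); apply: (congr1 (fun X => Q0 + l *: X)).
have := main 1 (circle1 R); rewrite (PhiP1 hP) (PhiP1 hP') hadj1 mulmx1 scale1r => ->.
by rewrite [Q0 + _]addrC addrK.
Qed.

Lemma two_unitary l : circle l -> (Q0 + l *: (1%:M - Q0))^t* *m (Q0 + l *: (1%:M - Q0)) = 1%:M.
Proof.
move=> cl; rewrite -two_PhiP // hadjM hadjK -mulmxA (mulmxA (PhiP P' l)) (PhiP_unitary hP') //.
by rewrite mul1mx (PhiP_unitary' hP).
Qed.

Lemma Q0_proj : Q0^t* = Q0 /\ Q0 *m Q0 = Q0.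
Proof. by apply: unitary_pencil => l; exact: two_unitary. Qed.

(** W' kills T P, so only the component of v in the range of W counts, and [wandering_J] factors
    that component through C^n. Hence the values lie in the range of [Q0]. *)
Lemma two_vec p (v : 'M[C]_(DD, p)) : P *m v = v -> ev 1 *m W' *m v = Q0 *m (ev 1 *m W *m v).
Proof.
move=> hv; have e : v = W *m v + T *m P *m T^t* *m v.
  by rewrite wanderingE (mulmxBl P) hv subrK.
have z : W' *m (T *m P *m T^t* *m v) = 0.
  by rewrite -sub !mulmxA (wandering_TP hP') !mul0mx.
have e2 : ev 1 *m W' *m v = ev 1 *m W' *m (W *m v).
  move: z (congr1 (mulmx (ev 1 *m W')) e); generalize (wandering P') (wandering P) => U V z.
  by rewrite (mulmxDr (ev 1 *m U)) -(mulmxA (ev 1) U (T *m P *m T^t* *m v)) z mulmx0 addr0.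
have e3 : W *m v = W *m J *m (ev 1 *m W *m v).
  by rewrite {1}(wandering_J hP) -(mulmxA (W *m J)).
apply: etrans e2 (etrans (congr1 (mulmx (ev 1 *m W')) e3) _).
exact: mulmx_assoc4.
Qed.

Lemma Q0_range p (w : 'M[C]_(n, p)) : Q0 *m w = ev 1 *m W' *m (W *m (J *m w)) /\
  P *m (W *m (J *m w)) = W *m (J *m w).
Proof. by split; [rewrite /Q0 !mulmxA | rewrite mulmxA (P_wandering hP)]. Qed.

End TwoProjections.

(** A loop whose block vector generates P under the shift and is orthogonal to its own shifts is
    Phi: all positive powers of T and T^* vanish between W and Th, so the quotient of the two loops
    is constant, and both are 1 at l = 1. *)
Lemma PhiP_unique (P : 'M[C]_DD) (Th : 'M[C]_(DD, n)) : inv_proj P ->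
  P *m Th = Th ->
  (forall (y : 'M[C]_(n, DD)), (forall m, y *m Tp m *m Th = 0) -> y *m P = 0) ->
  (forall k, (0 < k)%N -> Th^t* *m Tp k *m Th = 0) ->
  ev 1 *m Th = 1%:M -> forall l, circle l -> PhiP P l = ev l *m Th.
Proof.
move=> hP PTh span orth Th1.
have z1 k : (0 < k)%N -> wandering P *m Tp k *m Th = 0.
  by move=> k0; rewrite -PTh mulmxA (wandering_Tpow hP) // mul0mx.
have z2 k : (0 < k)%N -> wandering P *m (Tp k)^t* *m Th = 0.
  move=> k0; have h : (Th^t* *m Tp k) *m P = 0.
    apply: span => m; rewrite -(mulmxA (Th^t*)) -TpowD orth //.
    by rewrite addn_gt0 k0.
  have h' : Th^t* *m Tp k *m wandering P = 0.
    by rewrite -(P_wandering hP) mulmxA h mul0mx.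
  have := hadjM (Th^t* *m Tp k) (wandering P); rewrite h' hadj0 hadjM hadjK (wandering_adj hP).
  by rewrite mulmxA => /esym.
have main l : circle l -> (PhiP P l)^t* *m (ev l *m Th) = ev 1 *m wandering P *m Th.
  move=> cl; have e1 : PhiP P l = ev l *m (ev 1 *m wandering P)^t*.
    by rewrite PhiPE hadjM (wandering_adj hP) mulmxA.
  have z k : (0 < k)%N -> ev 1 *m wandering P *m Tp k *m Th = 0.
    by move=> k0; rewrite -!mulmxA (mulmxA (wandering P)) z1 // mulmx0.
  have z' k : (0 < k)%N -> ev 1 *m wandering P *m (Tp k)^t* *m Th = 0.
    by move=> k0; rewrite -!mulmxA (mulmxA (wandering P)) z2 // mulmx0.
  rewrite e1 (toeplitz_mul cl) => [|k /ltnW /z //|k /ltnW /z' //].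
  have := z 1%N isT; have := z' 1%N isT; rewrite Tpow1 => -> ->.
  by rewrite !scaler0 !addr0.
move=> l cl; have := main l cl; rewrite -(main 1 (circle1 R)) (PhiP1 hP) hadj1 mul1mx Th1 => h.
by rewrite -[LHS]mulmx1 -h mulmxA (PhiP_unitary hP) // mul1mx.
Qed.

(* [dW] and [dW^*] are the derivatives of the wandering projection along
   d/dz and d/dzbar. *)
Lemma PhiP_derivative (P dW : 'M[C]_DD) : inv_proj P ->
  P *m (T *m dW) = T *m dW -> P *m dW^t* = dW^t* ->
  (forall k, (0 < k)%N -> dW^t* *m Tp k *m wandering P + wandering P *m Tp k *m dW^t* = 0) ->
  ev 1 *m dW *m J = 0 -> forall l, circle l ->
  (PhiP P l)^t* *m (ev l *m dW *m J) = (1 - l^-1) *: (ev 1 *m wandering P *m dW *m J).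
Proof.
move=> hP PTd Pd leib norm.
have z1 k : (1 < k)%N -> wandering P *m Tp k *m dW = 0.
  case: k => [|[|k]] // _; rewrite TpowS -(mulmxA (wandering P)) -(mulmxA (Tp k.+1)) -PTd.
  rewrite (mulmxA (Tp k.+1)) (mulmxA (wandering P)) (mulmxA (wandering P)).
  by rewrite (wandering_Tpow hP) // !mul0mx.
have z2 k : (0 < k)%N -> wandering P *m (Tp k)^t* *m dW = 0.
  move=> k0; have h : dW^t* *m Tp k *m wandering P = 0.
    have := leib k k0; rewrite -[in X in _ + X]Pd (mulmxA _ P) (wandering_Tpow hP) //.
    by rewrite mul0mx addr0.
  have := hadjM (dW^t* *m Tp k) (wandering P); rewrite h hadj0 hadjM hadjK (wandering_adj hP).
  by rewrite mulmxA => /esym.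
have main l : circle l -> (PhiP P l)^t* *m (ev l *m dW *m J) =
   ev 1 *m wandering P *m dW *m J + l^-1 *: (ev 1 *m wandering P *m T *m dW *m J).
  move=> cl; have e1 : PhiP P l = ev l *m (ev 1 *m wandering P)^t*.
    by rewrite PhiPE hadjM (wandering_adj hP) mulmxA.
  have z k : (1 < k)%N -> ev 1 *m wandering P *m Tp k *m (dW *m J) = 0.
    by move=> k0; rewrite -!mulmxA (mulmxA (Tp k)) (mulmxA (wandering P)) (mulmxA (wandering P)) z1 // mul0mx mulmx0.
  have z' k : (0 < k)%N -> ev 1 *m wandering P *m (Tp k)^t* *m (dW *m J) = 0.
    by move=> k0; rewrite -!mulmxA (mulmxA ((Tp k)^t*)) (mulmxA (wandering P)) (mulmxA (wandering P)) z2 // mul0mx mulmx0.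
  rewrite e1 -(mulmxA (ev l)) (toeplitz_mul cl) => [|k k1|k /ltnW /z' //]; last exact: z.
  have := z' 1%N isT; rewrite Tpow1 => ->.
  by rewrite scaler0 addr0 !mulmxA.
move=> l cl; rewrite main // scalerBl scale1r; congr (_ + _).
have := main 1 (circle1 R); rewrite norm mulmx0 invr1 scale1r => /eqP.
by rewrite eq_sym addrC addr_eq0 => /eqP ->; rewrite scalerN.
Qed.

End PhiAlgebra.

(** * Polynomial loops and their Fourier coefficients *)

Section Nodes.
Variable R : realType.
Local Notation C := (cplx R).

Lemma eturnX (t : R) k : eturn t ^+ k = eturn (t *+ k).
Proof. by rewrite /eturn cisX -mulrnAr. Qed.

Lemma circle_eturn (t : R) : circle (eturn t).
Proof. exact: circle_cis. Qed.

Lemma eturn_neq0 (t : R) : eturn t != 0.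
Proof. exact: circle_neq0 (circle_eturn t). Qed.

Lemma circle_eturnP (l : C) : circle l -> exists2 t : R, 0 <= t <= 1 & l = eturn t.
Proof.
move=> /circle_cisP[t /andP[t0 t1] ->]; have p := pi_gt0 R.
have p2 : 0 < 2 * (pi : R) by lra.
exists (t / (2 * pi)).
  by rewrite divr_ge0 //= ?(ltW p2) // ler_pdivrMr // mul1r.
by rewrite /eturn mulrCA divff ?mulr1 // gt_eqF.
Qed.

Lemma eturn_neq1 (t : R) : 0 < t -> t < 1 -> eturn t != 1.
Proof.
move=> t0 t1; apply/eqP => h; have := congr1 (@re R) h.
rewrite /eturn re_cis => c1; have p := pi_gt0 R.
have s0 : 0 < sin (pi * t).
  by apply: sin_gt0_pi; rewrite ?mulr_gt0 //; rewrite -[ltRHS]mulr1 ltr_pM2l.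
have : cos (pi * t *+ 2) = 1 by rewrite -mulr_natl mulrA.
rewrite cos_mulr2n -[1]/(re (1 : C)) => c2.
have := cos2Dsin2 (pi * t); rewrite [re 1]/= in c2.
have q : 0 < sin (pi * t) ^+ 2 by rewrite exprn_gt0.
rewrite -mulr_natl in c2; lra.
Qed.

Definition node K j : C := eturn (j%:R / K%:R : R).

Lemma circle_node K j : circle (node K j).
Proof. exact: circle_eturn. Qed.

Lemma nodeE K j : node K j = node K 1 ^+ j.
Proof. by rewrite /node eturnX -[_ / _ *+ j]mulr_natl mulr1n mul1r. Qed.

Lemma node_orth K i k : (i < K)%N -> (k < K)%N ->
  \sum_(j < K) node K j ^+ i / node K j ^+ k = if i == k then K%:R else 0.
Proof.
move=> iK kK; have K0 : (0 < K)%N by exact: leq_ltn_trans iK.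
have Kn : (K%:R : R) != 0 by rewrite pnatr_eq0 -lt0n.
have Kp : 0 < (K%:R : R) by rewrite ltr0n.
pose q := node K 1 ^+ i / node K 1 ^+ k.
have -> : \sum_(j < K) node K j ^+ i / node K j ^+ k = \sum_(j < K) q ^+ j.
  by apply: eq_bigr => j _; rewrite nodeE /q expr_div_n -!exprM mulnC [(k * j)%N]mulnC.
have n0 : node K 1 != 0 by exact: eturn_neq0.
case: eqP => [ik|/eqP ik].
  rewrite (eq_bigr (fun _ => 1)) ?sumr_const ?card_ord // => j _.
  by rewrite /q ik divff ?expr1n // expf_neq0.
have qK : q ^+ K = 1.
  rewrite /q expr_div_n -!exprM ![(_ * K)%N]mulnC !exprM.
  have -> : node K 1 ^+ K = 1 by rewrite -nodeE /node divff // e1.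
  by rewrite !expr1n divr1.
have q1 : q != 1.
  have key a d : (a + d < K)%N -> (0 < d)%N -> node K 1 ^+ (a + d) != node K 1 ^+ a.
    move=> h d0; rewrite exprD -[X in _ != X]mulr1 (inj_eq (mulfI _)) ?expf_neq0 //.
    rewrite -nodeE; apply: eturn_neq1; first by rewrite divr_gt0 ?ltr0n.
    by rewrite ltr_pdivrMr // mul1r ltr_nat; apply: leq_ltn_trans h; rewrite leq_addl.
  have -> : (q != 1) = (node K 1 ^+ i != node K 1 ^+ k).
    by rewrite /q -(inj_eq (mulIf (expf_neq0 k n0))) mulfVK ?expf_neq0 // mul1r.
  case: (ltngtP i k) ik => // [lt|lt] _.
    by rewrite eq_sym -(subnKC (ltnW lt)) key ?subn_gt0 // subnKC // ltnW.
  by rewrite -(subnKC (ltnW lt)) key ?subn_gt0 // subnKC // ltnW.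
have := subrX1 q K; rewrite qK subrr => /esym/eqP; rewrite mulf_eq0 subr_eq0 (negbTE q1) /=.
by move/eqP.
Qed.

End Nodes.

Section LoopPolynomials.
Variable R : realType.
Local Notation C := (cplx R).

(** The coefficient sequence is indexed by all naturals and zero from K on. By [pl_uniq] it depends
    on f alone, so K may be widened or cut down freely. *)
Definition pl m p K (f : C -> 'M[C]_(m, p)) (a : nat -> 'M[C]_(m, p)) : Prop :=
  (forall k, (K <= k)%N -> a k = 0) /\
  forall l, circle l -> f l = \sum_(k < K) l ^+ k *: a k.

(** The discrete Fourier transform at the K-th roots of unity. Being a finite combination of values
    of f, it inherits holomorphy and continuity in parameters, which coefficients obtained from an
    existence statement would not. *)
Definition dft m p K (f : C -> 'M[C]_(m, p)) k : 'M[C]_(m, p) :=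
  K%:R^-1 *: \sum_(j < K) (node R K j ^+ k)^-1 *: f (node R K j).

Lemma pl_widen m p K K' (f : C -> 'M[C]_(m, p)) a : (K <= K')%N -> pl K f a -> pl K' f a.
Proof.
move=> KK [a0 H]; split=> [k kK|l cl]; first by rewrite a0 // (leq_trans KK).
rewrite H //.
rewrite (big_ord_widen K' (fun k => l ^+ k *: a k) KK) big_mkcond /=.
apply: eq_bigr => k _; case: ifP => // /negbT; rewrite -leqNgt => /a0 ->.
by rewrite scaler0.
Qed.

Lemma pl_eq m p K (f g : C -> 'M[C]_(m, p)) a : (forall l, circle l -> f l = g l) ->
  pl K f a -> pl K g a.
Proof. by move=> E [a0 H]; split=> // l cl; rewrite -E // H. Qed.

Lemma dft_pl m p K (f : C -> 'M[C]_(m, p)) a k : (k < K)%N -> pl K f a -> dft K f k = a k.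
Proof.
move=> kK [_ H]; rewrite /dft.
have -> : \sum_(j < K) (node R K j ^+ k)^-1 *: f (node R K j) =
    \sum_(i < K) (\sum_(j < K) node R K j ^+ i / node R K j ^+ k) *: a i.
  transitivity (\sum_(j < K) \sum_(i < K) (node R K j ^+ k)^-1 *: (node R K j ^+ i *: a i)).
    by apply: eq_bigr => j _; rewrite H ?scaler_sumr //; exact: circle_node.
  rewrite exchange_big; apply: eq_bigr => i _; rewrite scaler_suml.
  by apply: eq_bigr => j _; rewrite scalerA mulrC.
rewrite (bigD1 (Ordinal kK)) //= node_orth // eqxx big1 ?addr0; last first.
  by move=> i ik; rewrite node_orth // ifN ?scale0r.
rewrite scalerA mulVf ?scale1r // pnatr_eq0 -lt0n; exact: leq_ltn_trans kK.
Qed.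

Lemma pl_uniq m p K K' (f : C -> 'M[C]_(m, p)) a a' : pl K f a -> pl K' f a' -> forall k, a k = a' k.
Proof.
move=> ha hb k; pose L := (maxn (maxn K K') k.+1).
have ha' : pl L f a by apply: pl_widen ha; rewrite /L !leq_max leqnn.
have hb' : pl L f a' by apply: pl_widen hb; rewrite /L !leq_max leqnn orbT.
have kL : (k < L)%N by rewrite /L leq_max leqnn orbT.
by rewrite -(dft_pl kL ha') (dft_pl kL hb').
Qed.

Definition polymx m p K (a : nat -> 'M[C]_(m, p)) : 'M[{poly C}]_(m, p) :=
  \matrix_(i, j) \poly_(k < K) a k i j.
Definition evmx m p (M : 'M[{poly C}]_(m, p)) (l : C) : 'M[C]_(m, p) := map_mx (horner_eval l) M.
Definition cofmx m p (M : 'M[{poly C}]_(m, p)) (k : nat) : 'M[C]_(m, p) := \matrix_(i, j) (M i j)`_k.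

Lemma evmx_sum m p K (M : 'M[{poly C}]_(m, p)) l : (forall i j, (size (M i j) <= K)%N) ->
  evmx M l = \sum_(k < K) l ^+ k *: cofmx M k.
Proof.
move=> H; apply/matrixP => i j; rewrite mxE summxE /horner_eval (horner_coef_wide _ (H i j)).
by apply: eq_bigr => k _; rewrite !mxE mulrC.
Qed.

Lemma pl_evmx m p K (M : 'M[{poly C}]_(m, p)) : (forall i j, (size (M i j) <= K)%N) ->
  pl K (evmx M) (cofmx M).
Proof.
move=> H; split=> [k kK|l _]; last exact: evmx_sum.
by apply/matrixP => i j; rewrite !mxE nth_default // (leq_trans (H i j)).
Qed.

Lemma size_polymx m p K (a : nat -> 'M[C]_(m, p)) i j : (size (polymx K a i j) <= K)%N.
Proof. by rewrite mxE size_poly. Qed.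

Lemma cof_polymx m p K (a : nat -> 'M[C]_(m, p)) k : (forall k, (K <= k)%N -> a k = 0) ->
  cofmx (polymx K a) k = a k.
Proof.
move=> H; apply/matrixP => i j; rewrite !mxE coef_poly; case: ltnP => // /H ->.
by rewrite mxE.
Qed.

Lemma pl_polymx m p K (f : C -> 'M[C]_(m, p)) a l : pl K f a -> circle l -> f l = evmx (polymx K a) l.
Proof.
move=> [a0 H] cl; rewrite H // (evmx_sum l (size_polymx K a)).
by apply: eq_bigr => k _; rewrite cof_polymx.
Qed.

Lemma evmxM m p q (M : 'M[{poly C}]_(m, p)) (P : 'M[{poly C}]_(p, q)) l :
  evmx (M *m P) l = evmx M l *m evmx P l.
Proof. exact: map_mxM. Qed.

Lemma pl_mul m p q K K' (f : C -> 'M[C]_(m, p)) (g : C -> 'M[C]_(p, q)) a b :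
  pl K f a -> pl K' g b ->
  pl (K + K') (fun l => f l *m g l) (fun s => \sum_(k < s.+1) a (s - k)%N *m b k).
Proof.
move=> ha hb.
have sz i j : (size ((polymx K a *m polymx K' b) i j) <= K + K')%N.
  rewrite mxE; apply: (leq_trans (size_sum _ _ _)); apply/bigmax_leqP => k _.
  apply: (leq_trans (size_polyMleq _ _)); apply: (leq_trans (leq_pred _)).
  by apply: leq_add; exact: size_polymx.
have [z H] := pl_evmx sz.
have E k : cofmx (polymx K a *m polymx K' b) k = \sum_(s < k.+1) a (k - s)%N *m b s.
  apply/matrixP => i j; rewrite summxE !mxE coef_sum.
  under eq_bigr => s _ do rewrite coefMr.
  rewrite exchange_big; apply: eq_bigr => s _; rewrite mxE; apply: eq_bigr => t _.
  have e1 := congr1 (fun A : 'M[C]_(m, p) => A i t) (cof_polymx (k - s) ha.1).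
  have e2 := congr1 (fun A : 'M[C]_(p, q) => A t j) (cof_polymx s hb.1).
  by move: e1 e2; rewrite !mxE => -> ->.
split=> [k kK|l cl]; first by rewrite -E z.
rewrite (pl_polymx ha cl) (pl_polymx hb cl) -evmxM H //.
by apply: eq_bigr => k _; rewrite E.
Qed.

Lemma pl_scaleX m p K N (f : C -> 'M[C]_(m, p)) a : pl K f a ->
  pl (N + K) (fun l => l ^+ N *: f l) (fun s => if (s < N)%N then 0 else a (s - N)%N).
Proof.
move=> [a0 H]; split=> [k kK|l cl].
  have h : (N <= k)%N by apply: leq_trans kK; rewrite leq_addr.
  by rewrite ltnNge h a0 // -(leq_add2l N) subnKC.
rewrite H // scaler_sumr big_split_ord /= [X in _ = X + _]big1 ?add0r; last first.
  by move=> i _; rewrite ltn_ord scaler0.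
by apply: eq_bigr => i _; rewrite ltnNge leq_addr /= addKn exprD scalerA.
Qed.

(** Conjugation inverts l on the circle, so taking adjoints reverses the coefficients after
    multiplication by l^r. *)
Lemma pl_adj m p r (f : C -> 'M[C]_(m, p)) a : pl r.+1 f a ->
  pl r.+1 (fun l => l ^+ r *: (f l)^t*) (fun s => if (s <= r)%N then (a (r - s)%N)^t* else 0).
Proof.
move=> [a0 H]; split=> [k|l cl]; first by rewrite ltnNge => /negbTE ->.
rewrite H // hadj_sum scaler_sumr (reindex_inj rev_ord_inj) /=; apply: eq_bigr => k _.
have kr : (k <= r)%N by rewrite -ltnS.
rewrite kr subSS hadjZ scalerA; congr (_ *: _).
have l0 := circle_neq0 cl.
rewrite rmorphXn /= (conj_circle cl) exprVn; apply: (mulIf (expf_neq0 (r - k) l0)).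
by rewrite mulfVK ?expf_neq0 // -exprD subnKC.
Qed.

End LoopPolynomials.

Section Means.
Variable R : realType.
Local Notation C := (cplx R).

Lemma con_eturnX a b k : conC a b (fun t : R => eturn t ^+ k).
Proof. apply: conCX; exact: con_e. Qed.

Lemma con_eturnXV a b k : conC a b (fun t : R => (eturn t ^+ k)^-1).
Proof.
apply: conCV; last exact: con_eturnX.
move=> x _; rewrite expf_neq0 //; exact: eturn_neq0.
Qed.

Lemma CI_eturn a b : CI 0 1 (fun t : R => eturn t ^+ a / eturn t ^+ b) = (a == b)%:R.
Proof.
have [->|ab] := eqVneq a b.
  rewrite (@CI_eq _ _ _ _ (fun=> 1)); last first.
    by move=> x _; rewrite divff // expf_neq0 // eturn_neq0.
  by rewrite CI_cst ?ler01 // subr0 mul1r.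
pose ka : R := 2 * pi * (a%:R - b%:R).
have k0 : ka != 0.
  rewrite /ka mulf_neq0 //; first by rewrite mulf_neq0 ?pnatr_eq0 // gt_eqF // pi_gt0.
  by rewrite subr_eq0 eqr_nat.
have ex (t : R) : eturn t ^+ a / eturn t ^+ b = cis (ka * t).
  apply/eqP; rewrite -(inj_eq (mulIf (expf_neq0 b (eturn_neq0 t)))) mulfVK ?expf_neq0 ?eturn_neq0 //.
  rewrite !eturnX /eturn -cisD; apply/eqP; congr cis.
  rewrite /ka -[t *+ a]mulr_natl -[t *+ b]mulr_natl -!mulrA -!mulrDr.
  by rewrite mulrBl subrK.
pose F (t : R) := (toC ka * imagI R)^-1 * cis (ka * t).
have i0 : toC ka * imagI R != 0.
  by rewrite mulf_neq0 // -nrm_eq0 ?nrm_toC ?normr_eq0 // /nrm /imagI /re /im /= expr0n add0r expr1n sqrtr1 oner_eq0.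
rewrite (@CI_FTC _ _ _ _ F) ?ler01 //.
- rewrite /F mulr1 mulr0 cis0 -mulrBr.
  have -> : cis ka = 1 :> C.
    have := ex 1; rewrite e1 !expr1n divr1 mulr1 => <-; exact: erefl.
  by rewrite subrr mulr0.
- apply: conCM; [exact: con_eturnX | exact: con_eturnXV].
- move=> x _; rewrite ex; apply: cder_eq (cderZ _ (cder_cis ka x)) _.
  by rewrite mulrA mulVf // mul1r.
Qed.

Lemma CI_sum a b (I : Type) (s : seq I) (F : I -> R -> C) : a <= b -> (forall i, conC a b (F i)) ->
  conC a b (fun t => \sum_(i <- s) F i t) /\
  CI a b (fun t => \sum_(i <- s) F i t) = \sum_(i <- s) CI a b (F i).
Proof.
move=> ab cF; elim: s => [|i s [c IH]].
  have E : (fun t => \sum_(i <- [::]) F i t) = fun=> 0 by apply/funext => t; rewrite big_nil.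
  rewrite E big_nil; split; first exact: conC_cst.
  by rewrite CI_cst // mul0r.
have E : (fun t => \sum_(j <- i :: s) F j t) = fun t => F i t + \sum_(j <- s) F j t.
  by apply/funext => t; rewrite big_cons.
rewrite E big_cons; split; first exact: (conCD (cF i) c).
by rewrite (CID (cF i) c) IH.
Qed.

Lemma pl_mean m p K (f : C -> 'M[C]_(m, p)) a i j k : pl K f a ->
  CI 0 1 (fun t => f (eturn t) i j / eturn t ^+ k) = a k i j.
Proof.
move=> ha; have {ha} ha : pl (maxn K k.+1) f a by apply: pl_widen ha; rewrite leq_maxl.
have kK : (k < maxn K k.+1)%N by rewrite leq_maxr.
move: (maxn K k.+1) ha kK => L [_ H] kL.
rewrite (@CI_eq _ _ _ _ (fun t => \sum_(s < L) a s i j * (eturn t ^+ s / eturn t ^+ k))); last first.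
  move=> t _; rewrite H; last exact: circle_eturn.
  rewrite summxE mulr_suml; apply: eq_bigr => s _; rewrite mxE mulrAC mulrC; exact: erefl.
have c s : conC 0 1 (fun t : R => eturn t ^+ s / eturn t ^+ k).
  apply: conCM; [exact: con_eturnX | exact: con_eturnXV].
have [_ ->] := @CI_sum 0 1 _ (index_enum (ordinal L)) (fun s t => a s i j * (eturn t ^+ s / eturn t ^+ k)) (ler01)
  (fun s => conCM (@conC_cst R 0 1 (a s i j)) (c s)).
rewrite (bigD1 (Ordinal kL)) //= CIZ ?CI_eturn ?eqxx ?mulr1; last exact: c.
rewrite big1 ?addr0 // => s sk; rewrite CIZ ?CI_eturn; last exact: c.
have -> : (s == k :> nat) = false by apply/negbTE.
by rewrite mulr0.
Qed.

Definition disc (F : C -> C) : Prop :=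
  {within [set l : C | nrm l <= 1], continuous F} /\
  (forall w, nrm w < 1 -> exists d, cdiff F w d).

Lemma disc_mean F : disc F -> conC 0 1 (fun t => F (eturn t)) /\ F 0 = CI 0 1 (fun t => F (eturn t)).
Proof.
case=> cF dF; apply: mean_value_boundary => // x x1 eps e0.
have /subspace_continuousP := cF => /(_ x x1) /cvgCP /(_ _ e0).
case/nbhsCP=> d d0 H; exists d => // y y1 yx; exact: H.
Qed.

Lemma disc_ext F G : (forall l, nrm l <= 1 -> F l = G l) -> disc F -> disc G.
Proof.
move=> E [cF dF]; split.
  apply/subspace_continuousP => x x1; apply/cvgCP => e e0.
  have /subspace_continuousP := cF => /(_ x x1) /cvgCP /(_ _ e0).
  case/nbhsCP=> d d0 H; apply/nbhsCP; exists d => // y yx y1.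
  have := H y yx y1; rewrite /from_subspace (E x x1) (E y y1); exact: id.
move=> w w1; have [d hd] := dF w w1; exists d; apply: cdiff_near hd.
apply/nbhsCP; exists (1 - nrm w); first by rewrite subr_gt0.
move=> y hy; apply: E; have := nrmD (y - w) w; rewrite subrK; lra.
Qed.

Lemma disc_entire F : (forall w, exists d, cdiff F w d) -> disc F.
Proof.
move=> H; split=> [|w _]; last exact: H.
apply/subspace_continuousP => x _; have [d hd] := H x.
exact: cvg_within_filter (cdiff_cont hd).
Qed.

Lemma discD F G : disc F -> disc G -> disc (fun l => F l + G l).
Proof.
case=> cF dF [cG dG]; split=> [|w w1].
  by move=> x; apply: continuousD; [exact: cF | exact: cG].
by have [d hd] := dF w w1; have [e he] := dG w w1; exists (d + e); exact: cdiffD.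
Qed.

Lemma discM F G : disc F -> disc G -> disc (fun l => F l * G l).
Proof.
case=> cF dF [cG dG]; split=> [|w w1].
  by move=> x; apply: continuousM; [exact: cF | exact: cG].
by have [d hd] := dF w w1; have [e he] := dG w w1; eexists; exact: cdiffM hd he.
Qed.

Lemma disc_cst c : disc (fun=> c).
Proof. by apply: disc_entire => w; exists 0; exact: cdiff_cst. Qed.

Lemma disc_id : disc id.
Proof. by apply: disc_entire => w; exists 1; exact: cdiff_id. Qed.

Lemma discX F k : disc F -> disc (fun l => F l ^+ k).
Proof.
move=> dF; elim: k => [|k IH]; first exact: disc_cst.
by apply: disc_ext (discM dF IH) => l _; rewrite exprS.
Qed.

Lemma disc_sum (I : Type) (s : seq I) (F : I -> C -> C) :
  (forall i, disc (F i)) -> disc (fun l => \sum_(i <- s) F i l).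
Proof.
move=> H; elim: s => [|i s IH].
  by apply: disc_ext (disc_cst 0) => l _; rewrite big_nil.
by apply: disc_ext (discD (H i) IH) => l _; rewrite big_cons.
Qed.

Lemma disc_prod (I : Type) (s : seq I) (F : I -> C -> C) :
  (forall i, disc (F i)) -> disc (fun l => \prod_(i <- s) F i l).
Proof.
move=> H; elim: s => [|i s IH].
  by apply: disc_ext (disc_cst 1) => l _; rewrite big_nil.
by apply: disc_ext (discM (H i) IH) => l _; rewrite big_cons.
Qed.

Lemma discV F : (forall l, nrm l <= 1 -> F l != 0) -> disc F -> disc (fun l => (F l)^-1).
Proof.
move=> F0 [cF dF]; split=> [|w w1].
  apply/subspace_continuousP => x x1; apply: cvgV; first exact: F0.
  by have /subspace_continuousP := cF => /(_ x x1).
have [d hd] := dF w w1; eexists; apply: cdiffV hd; apply: F0; exact: ltW.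
Qed.

Definition mdisc m p (F : C -> 'M[C]_(m, p)) := forall i j, disc (fun l => F l i j).

Lemma mdiscM m p q (F : C -> 'M[C]_(m, p)) (G : C -> 'M[C]_(p, q)) :
  mdisc F -> mdisc G -> mdisc (fun l => F l *m G l).
Proof.
move=> hF hG i j; apply: (disc_ext (F := fun l => \sum_k F l i k * G l k j)).
  by move=> l _; rewrite mxE.
by apply: disc_sum => k; apply: discM.
Qed.

Lemma disc_det m (F : C -> 'M[C]_m) : mdisc F -> disc (fun l => \det (F l)).
Proof.
move=> hF; rewrite /determinant; apply: disc_sum => s; apply: discM; first exact: disc_cst.
by apply: disc_prod => i; exact: hF.
Qed.

Lemma mdisc_adj m (F : C -> 'M[C]_m) : mdisc F -> mdisc (fun l => \adj (F l)).
Proof.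
move=> hF i j; apply: (disc_ext (F := fun l => cofactor (F l) j i)); first by move=> l _; rewrite mxE.
rewrite /cofactor; apply: discM; first exact: disc_cst.
by apply: disc_det => a b; apply: disc_ext (hF (lift j a) (lift i b)) => l _; rewrite !mxE.
Qed.

Lemma mdisc_inv m (F : C -> 'M[C]_m) : (forall l, nrm l <= 1 -> F l \in unitmx) ->
  mdisc F -> mdisc (fun l => invmx (F l)).
Proof.
move=> hu hF i j; apply: (disc_ext (F := fun l => (\det (F l))^-1 * (\adj (F l)) i j)).
  by move=> l l1; rewrite /invmx hu // [RHS]mxE.
apply: discM; last exact: mdisc_adj.
apply: discV; last exact: disc_det.
by move=> l l1; have := hu l l1; rewrite unitmxE unitfE.
Qed.

Lemma mdisc_evmx m p (M : 'M[{poly C}]_(m, p)) : mdisc (evmx M).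
Proof.
move=> i j; apply: (disc_ext (F := fun l => \sum_(k < size (M i j)) (M i j)`_k * l ^+ k)).
  by move=> l _; rewrite mxE /horner_eval horner_coef.
by apply: disc_sum => k; apply: discM; [exact: disc_cst | apply: discX; exact: disc_id].
Qed.

(** Coefficient k of l^N f is the mean over the circle of l^(N - k) F, that is, the value of this
    function at the centre of the disc. *)
Lemma disc_coef m p K N (f : C -> 'M[C]_(m, p)) F e k : pl K (fun l => l ^+ N *: f l) e ->
  mdisc F -> (forall l, circle l -> F l = f l) -> (k <= N)%N ->
  e k = if k == N then F 0 else 0.
Proof.
move=> he hF E kN; apply/matrixP => i j; rewrite -(pl_mean i j k he).
have dG : disc (fun l => l ^+ (N - k) * F l i j) by apply: discM (hF i j); apply: discX; exact: disc_id.
rewrite (@CI_eq _ _ _ _ (fun t => eturn t ^+ (N - k) * F (eturn t) i j)); last first.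
  move=> t _; rewrite E; last exact: circle_eturn.
  rewrite mxE; move: (f (eturn t) i j) => x; have z0 := expf_neq0 k (eturn_neq0 t).
  apply: (mulIf z0); rewrite mulfVK // mulrAC -exprD subnK //.
have [_ <-] := disc_mean dG.
case: eqP => [->|/eqP ne]; first by rewrite subnn expr0 mul1r.
by rewrite expr0n subn_eq0 leqNgt ltn_neqAle ne kN /= mul0r mxE.
Qed.

Lemma pl_noneg m p K N (f : C -> 'M[C]_(m, p)) F e : pl K (fun l => l ^+ N *: f l) e ->
  mdisc F -> (forall l, circle l -> F l = f l) -> pl K f (fun k => e (N + k)%N).
Proof.
move=> he hF E; have h k : (k < N)%N -> e k = 0.
  by move=> kN; rewrite (disc_coef he hF E (ltnW kN)) ltn_eqF.
have [e0 H] := pl_widen (leq_addl N K) he.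
split=> [k kK|l cl]; first by apply: he.1; apply: leq_trans kK _; rewrite leq_addl.
have l0 : l ^+ N != 0 by rewrite expf_neq0 // circle_neq0.
apply: (scalerI l0); rewrite H // big_split_ord /= big1 ?add0r; last first.
  by move=> i _; rewrite h // scaler0.
by rewrite scaler_sumr; apply: eq_bigr => i _; rewrite exprD scalerA.
Qed.

Lemma extends_mdisc n (S : set 'M[C]_n) (g : C -> 'M[C]_n) :
  extends_holomorphically [set l : C | `|l| <= 1] [set l : C | `|l| < 1] S g ->
  exists F, [/\ mdisc F, (forall l, circle l -> F l = g l) & (forall l, nrm l <= 1 -> S (F l))].
Proof.
have E1 : [set l : C | `|l| <= 1] = [set l : C | nrm l <= 1].
  by apply/funext => l; rewrite /mkset /= normE -[1]/(toC 1) toC_le.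
have E2 (l : C) : (`|l| < 1) = (nrm l < 1) by rewrite normE -[1]/(toC 1) toC_lt.
case=> F [Fg FS cF dF]; exists F; split=> // [i j|l l1].
  split; first by rewrite -E1; exact: cF.
  by move=> w w1; apply: derivable_cdiff; apply: dF; rewrite /= E2.
by apply: FS; have := E1; move/(congr1 (fun A => A l)); rewrite /mkset /= => ->.
Qed.

End Means.

(** * Germs of meromorphic functions *)

Section Germs.
Variable R : realType.
Local Notation C := (cplx R).
Variable w0 : C.
Implicit Types f g : C -> C.

Definition hol f := exists2 rho : R, 0 < rho & holo f w0 rho.

Lemma dnbhs_of_nbhs (P : C -> Prop) : (\forall w \near w0, P w) -> \forall w \near w0^', P w.
Proof. exact: nbhs_dnbhs. Qed.

Lemma hol_near f g : (\forall w \near w0, f w = g w) -> hol f -> hol g.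
Proof.
move=> /nbhsCP[d d0 fg] [rho r0 hf]; exists (Num.min d rho); first by rewrite lt_min d0.
move=> w; rewrite lt_min => /andP[wd wr]; have [e he] := hf w wr.
exists e; apply: cdiff_near he; apply/nbhsCP; exists (d - nrm (w - w0)); first by rewrite subr_gt0.
move=> y yw; apply: fg; have := nrmD (y - w) (w - w0); rewrite addrA subrK; lra.
Qed.

Lemma hol_cdiff f : hol f -> \forall w \near w0, exists d, cdiff f w d.
Proof. by move=> [rho r0 hf]; apply/nbhsCP; exists rho. Qed.

Lemma hol_cont f : hol f -> {for w0, continuous f}.
Proof. by move=> [rho r0 /(_ w0)]; rewrite subrr nrm0 => /(_ r0)[d /cdiff_cont]. Qed.

Lemma hol_cst c : hol (fun=> c).
Proof. by exists 1 => // w _; exists 0; exact: cdiff_cst. Qed.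
Lemma hol_id : hol (fun w => w).
Proof. by exists 1 => // w _; exists 1; exact: cdiff_id. Qed.
Lemma hol2 f g : hol f -> hol g -> exists rho : R, [/\ 0 < rho, holo f w0 rho & holo g w0 rho].
Proof.
move=> [r r0 hf] [s s0 hg]; exists (Num.min r s); split; first by rewrite lt_min r0 s0.
- by move=> w; rewrite lt_min => /andP[a _]; exact: hf.
- by move=> w; rewrite lt_min => /andP[_ b]; exact: hg.
Qed.
Lemma holD f g : hol f -> hol g -> hol (fun w => f w + g w).
Proof.
move=> hf hg; have [rho [r0 af ag]] := hol2 hf hg; exists rho => // w wr.
by have [d hd] := af w wr; have [e he] := ag w wr; exists (d + e); exact: cdiffD.
Qed.
Lemma holB f g : hol f -> hol g -> hol (fun w => f w - g w).
Proof.
move=> hf hg; have [rho [r0 af ag]] := hol2 hf hg; exists rho => // w wr.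
by have [d hd] := af w wr; have [e he] := ag w wr; exists (d - e); exact: cdiffB.
Qed.
Lemma holM f g : hol f -> hol g -> hol (fun w => f w * g w).
Proof.
move=> hf hg; have [rho [r0 af ag]] := hol2 hf hg; exists rho => // w wr.
by have [d hd] := af w wr; have [e he] := ag w wr; eexists; exact: cdiffM hd he.
Qed.
Lemma holX f m : hol f -> hol (fun w => f w ^+ m).
Proof.
move=> hf; elim: m => [|m IH]; first exact: hol_cst.
by apply: hol_near (holM hf IH); near=> w; rewrite exprS.
Unshelve. all: by end_near. Qed.
Lemma hol_sum (I : Type) (s : seq I) (F : I -> C -> C) :
  (forall i, hol (F i)) -> hol (fun w => \sum_(i <- s) F i w).
Proof.
move=> H; elim: s => [|i s IH].
  by apply: hol_near (hol_cst 0); near=> w; rewrite big_nil.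
by apply: hol_near (holD (H i) IH); near=> w; rewrite big_cons.
Unshelve. all: by end_near. Qed.
Lemma hol_prod (I : Type) (s : seq I) (P : pred I) (F : I -> C -> C) :
  (forall i, hol (F i)) -> hol (fun w => \prod_(i <- s | P i) F i w).
Proof.
move=> H; elim: s => [|i s IH].
  by apply: hol_near (hol_cst 1); near=> w; rewrite big_nil.
have [Pi|Pi] := boolP (P i).
  by apply: hol_near (holM (H i) IH); near=> w; rewrite big_cons Pi.
by apply: hol_near IH; near=> w; rewrite big_cons (negbTE Pi).
Unshelve. all: by end_near. Qed.
Lemma hol_near_neq0 f : hol f -> f w0 != 0 -> \forall w \near w0, f w != 0.
Proof.
move=> /hol_cont cf f0; have n0 : 0 < nrm (f w0) by rewrite nrm_gt0.
have /(cvgCP (nbhs_filter w0)) /(_ _ n0) := cf; apply: filterS => w h.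
by apply: contraTneq h => ->; rewrite sub0r nrmN ltxx.
Qed.
Lemma holV f : hol f -> f w0 != 0 -> hol (fun w => (f w)^-1).
Proof.
move=> hf f0; have /nbhsCP[d d0 fd] := hol_near_neq0 hf f0.
case: hf => rho r0 hf; exists (Num.min d rho); first by rewrite lt_min d0.
move=> w; rewrite lt_min => /andP[wd wr]; have [e he] := hf w wr.
by eexists; exact: cdiffV (fd _ wd) he.
Qed.
Lemma hol_derive f : hol f -> hol (f^`()%classic).
Proof. by move=> [rho r0 hf]; exists rho => //; exact: holo_deriv. Qed.

Lemma cont_dnbhs_eq f g : {for w0, continuous f} -> {for w0, continuous g} ->
  (\forall w \near w0^', f w = g w) -> f w0 = g w0.
Proof.
move=> cf cg /dnbhsCP[d d0 fg]; apply/eqP; rewrite -subr_eq0 -nrm_eq0.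
apply/eqP/le_anti; rewrite nrm_ge0 andbT; apply/ler_addgt0Pl => e e0; rewrite addr0.
have e2 : 0 < e / 2 by rewrite divr_gt0.
have /(cvgCP (nbhs_filter w0)) /(_ _ e2)/nbhsCP[s s0 hs] := cf.
have /(cvgCP (nbhs_filter w0)) /(_ _ e2)/nbhsCP[t t0 ht] := cg.
pose m := Num.min d (Num.min s t); have m0 : 0 < m by rewrite !lt_min d0 s0.
pose y := w0 + toC (m / 2).
have yw : y - w0 = toC (m / 2) by rewrite /y addrC addKr.
have ny : nrm (y - w0) = m / 2 by rewrite yw nrm_toC gtr0_norm // divr_gt0.
have ym : nrm (y - w0) < m by rewrite ny; lra.
move: (ym); rewrite !lt_min => /and3P[yd ys yt].
have yn : y != w0 by rewrite -subr_eq0 -nrm_eq0 ny gt_eqF // divr_gt0.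
have := hs y ys; have := ht y yt; rewrite -(fg y yd yn) => h1 h2.
have e1 : f w0 - g w0 = (f y - g w0) - (f y - f w0) by ring.
by rewrite e1; apply: le_trans (nrmB _ _) _; lra.
Qed.

Lemma near_of_dnbhs (P : C -> Prop) : (\forall w \near w0^', P w) -> P w0 -> \forall w \near w0, P w.
Proof.
move=> /dnbhsCP[d d0 H] P0; apply/nbhsCP; exists d => // w wd.
by have [->|/H] := eqVneq w w0; last exact.
Qed.

Lemma hol_dichotomy f : hol f -> (\forall w \near w0, f w = 0) \/
  exists m g, [/\ hol g, g w0 != 0 & \forall w \near w0, f w = (w - w0) ^+ m * g w].
Proof.
move=> [rho r0 hf]; have r2 : 0 < rho / 2 by rewrite divr_gt0.
have r3 : rho / 2 < rho by lra.
have [z|[m [g [hg g0 fg]]]] := holo_dichotomy hf r2 r3.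
  by left; apply/nbhsCP; exists (rho / 2).
by right; exists m, g; split => //; [exists (rho / 2) | apply/nbhsCP; exists (rho / 2)].
Qed.

(** Only values off w0 enter, so functions with arbitrary values on D can be treated as total. *)
Definition mero f := exists a b, [/\ hol a, hol b &
  \forall w \near w0^', b w != 0 /\ f w = a w / b w].

Lemma hol_mero f : hol f -> mero f.
Proof.
move=> hf; exists f, (fun=> 1); split => //; first exact: hol_cst.
by near=> w; rewrite oner_eq0 divr1.
Unshelve. all: by end_near. Qed.
Lemma mero_near f g : (\forall w \near w0^', f w = g w) -> mero f -> mero g.
Proof.
move=> fg [a [b [ha hb H]]]; exists a, b; split => //.
by apply: filterS2 fg H => w <-.
Qed.
Lemma meroD f g : mero f -> mero g -> mero (fun w => f w + g w).
Proof.
move=> [a [b [ha hb H]]] [a' [b' [ha' hb' H']]].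
exists (fun w => a w * b' w + a' w * b w), (fun w => b w * b' w); split.
- by apply: holD; apply: holM.
- exact: holM.
- apply: filterS2 H H' => w [b0 ->] [b0' ->]; split; first by rewrite mulf_neq0.
  by field; rewrite b0 b0'.
Qed.
Lemma meroM f g : mero f -> mero g -> mero (fun w => f w * g w).
Proof.
move=> [a [b [ha hb H]]] [a' [b' [ha' hb' H']]].
exists (fun w => a w * a' w), (fun w => b w * b' w); split; try exact: holM.
apply: filterS2 H H' => w [b0 ->] [b0' ->]; split; first by rewrite mulf_neq0.
by field; rewrite b0 b0'.
Qed.
Lemma mero_sum (I : Type) (s : seq I) (F : I -> C -> C) :
  (forall i, mero (F i)) -> mero (fun w => \sum_(i <- s) F i w).
Proof.
move=> H; elim: s => [|i s IH].
  by apply: mero_near (hol_mero (hol_cst 0)); near=> w; rewrite big_nil.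
by apply: mero_near (meroD (H i) IH); near=> w; rewrite big_cons.
Unshelve. all: by end_near. Qed.

Lemma near_dnbhs_near (P : C -> Prop) : (\forall w \near w0^', P w) ->
  \forall w \near w0^', \forall y \near w, P y.
Proof.
move=> /dnbhsCP[d d0 H]; apply/dnbhsCP; exists d => // w wd wn.
have n0 : 0 < nrm (w - w0) by rewrite nrm_gt0 subr_eq0.
apply/nbhsCP; exists (Num.min (d - nrm (w - w0)) (nrm (w - w0))).
  by rewrite lt_min subr_gt0 wd.
move=> y; rewrite lt_min => /andP[y1 y2]; apply: H.
  by have := nrmD (y - w) (w - w0); rewrite addrA subrK; lra.
by apply: contraTneq y2 => ->; rewrite nrm_distC ltxx.
Qed.

Lemma near_near (P : C -> Prop) : (\forall w \near w0, P w) ->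
  \forall w \near w0, \forall y \near w, P y.
Proof.
move=> /nbhsCP[d d0 H]; apply/nbhsCP; exists d => // w wd.
apply/nbhsCP; exists (d - nrm (w - w0)); first by rewrite subr_gt0.
by move=> y y1; apply: H; have := nrmD (y - w) (w - w0); rewrite addrA subrK; lra.
Qed.

Lemma mero_cdiff f : mero f -> \forall w \near w0^', exists d, cdiff f w d.
Proof.
move=> [a [b [ha hb H]]].
apply: filterS3 (near_dnbhs_near H) (dnbhs_of_nbhs (hol_cdiff ha)) (dnbhs_of_nbhs (hol_cdiff hb)).
move=> w Hw [d hd] [e he]; have [b0 _] := nbhs_singleton Hw.
eexists; apply: cdiff_near (cdiffM hd (cdiffV b0 he)).
by apply: filterS Hw => y [_ ->].
Qed.

Lemma mero_derive f : mero f -> mero (f^`()%classic).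
Proof.
move=> [a [b [ha hb H]]].
exists (fun w => a^`()%classic w * b w - a w * b^`()%classic w), (fun w => b w ^+ 2); split.
- by apply: holB; apply: holM => //; exact: hol_derive.
- exact: holX.
- apply: filterS3 (near_dnbhs_near H) (dnbhs_of_nbhs (hol_cdiff ha)) (dnbhs_of_nbhs (hol_cdiff hb)).
  move=> w Hw [d hd] [e he]; have [b0 _] := nbhs_singleton Hw.
  split; first by rewrite expf_neq0.
  have : cdiff f w (d * (b w)^-1 + a w * (- e / b w ^+ 2)).
    by apply: cdiff_near (cdiffM hd (cdiffV b0 he)); apply: filterS Hw => y [_ ->].
  move/cdiff_derive1 ->; rewrite (cdiff_derive1 hd) (cdiff_derive1 he).
  by field.
Qed.

End Germs.

Section MatrixGerms.
Variable R : realType.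
Local Notation C := (cplx R).
Variable w0 : C.

Definition mhol m p (F : C -> 'M[C]_(m, p)) := forall i j, hol w0 (fun w => F w i j).
Definition mmero m p (F : C -> 'M[C]_(m, p)) := forall i j, mero w0 (fun w => F w i j).

Lemma filter_forall_fin (I : finType) (F : set_system C) (FF : Filter F) (P : I -> C -> Prop) :
  (forall i, \forall w \near F, P i w) -> \forall w \near F, forall i, P i w.
Proof. by move=> H; exact: filter_forall. Qed.

Lemma nearWC (P : C -> Prop) : (forall w, P w) -> \forall w \near w0, P w.
Proof. by move=> H; apply/nbhsCP; exists 1. Qed.
Lemma nearWD (P : C -> Prop) : (forall w, P w) -> \forall w \near w0^', P w.
Proof. by move=> H; apply/dnbhsCP; exists 1. Qed.

Lemma mhol_near m p (F G : C -> 'M[C]_(m, p)) :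
  (\forall w \near w0, F w = G w) -> mhol F -> mhol G.
Proof. by move=> FG hF i j; apply: hol_near (hF i j); apply: filterS FG => w ->. Qed.
Lemma mhol_cst m p (A : 'M[C]_(m, p)) : mhol (fun=> A).
Proof. by move=> i j; exact: hol_cst. Qed.
Lemma mholD m p (F G : C -> 'M[C]_(m, p)) : mhol F -> mhol G -> mhol (fun w => F w + G w).
Proof. by move=> hF hG i j; apply: hol_near (holD (hF i j) (hG i j)); apply: nearWC => w; rewrite mxE. Qed.
Lemma mholB m p (F G : C -> 'M[C]_(m, p)) : mhol F -> mhol G -> mhol (fun w => F w - G w).
Proof. by move=> hF hG i j; apply: hol_near (holB (hF i j) (hG i j)); apply: nearWC => w; rewrite !mxE. Qed.
Lemma mholM m p q (F : C -> 'M[C]_(m, p)) (G : C -> 'M[C]_(p, q)) :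
  mhol F -> mhol G -> mhol (fun w => F w *m G w).
Proof.
move=> hF hG i j; apply: hol_near (hol_sum _ (fun k => holM (hF i k) (hG k j))).
by apply: nearWC => w; rewrite mxE.
Qed.
Lemma mholZ m p (c : C -> C) (F : C -> 'M[C]_(m, p)) :
  hol w0 c -> mhol F -> mhol (fun w => c w *: F w).
Proof. by move=> hc hF i j; apply: hol_near (holM hc (hF i j)); apply: nearWC => w; rewrite mxE. Qed.
Lemma mhol_mmero m p (F : C -> 'M[C]_(m, p)) : mhol F -> mmero F.
Proof. by move=> hF i j; exact: hol_mero. Qed.
Lemma mmeroM m p q (F : C -> 'M[C]_(m, p)) (G : C -> 'M[C]_(p, q)) :
  mmero F -> mmero G -> mmero (fun w => F w *m G w).
Proof.
move=> hF hG i j; apply: mero_near (mero_sum _ (fun k => meroM (hF i k) (hG k j))).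
by apply: nearWD => w; rewrite mxE.
Qed.

Lemma mhol_eq0 m p (F : C -> 'M[C]_(m, p)) : mhol F ->
  (\forall w \near w0^', F w = 0) -> \forall w \near w0, F w = 0.
Proof.
move=> hF F0; apply: near_of_dnbhs => //; apply/matrixP => i j; rewrite mxE.
apply: (cont_dnbhs_eq (hol_cont (hF i j)) (hol_cont (hol_cst w0 0))).
by apply: filterS F0 => w ->; rewrite mxE.
Qed.

Lemma mhol_eq m p (F G : C -> 'M[C]_(m, p)) : mhol F -> mhol G ->
  (\forall w \near w0^', F w = G w) -> \forall w \near w0, F w = G w.
Proof.
move=> hF hG FG; have FG0 : \forall w \near w0^', F w - G w = 0.
  by apply: filterS FG => w ->; rewrite subrr.
by apply: filterS (mhol_eq0 (mholB hF hG) FG0) => w /eqP; rewrite subr_eq0 => /eqP.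
Qed.

(** Filling out zeros for one vector: the product of the denominators is cleared, then the least
    order of vanishing among the nonzero entries is divided out. *)
Lemma vec_dichotomy K (v : C -> 'cV[C]_K) : mmero v ->
  (\forall w \near w0^', v w = 0) \/
  exists s h, [/\ mhol h, h w0 != 0 & \forall w \near w0^', s w != 0 /\ v w = s w *: h w].
Proof.
move=> hv.
have /choice[ab Hab] : forall i : 'I_K, exists ab : (C -> C) * (C -> C),
   [/\ hol w0 ab.1, hol w0 ab.2 &
     \forall w \near w0^', ab.2 w != 0 /\ v w i 0 = ab.1 w / ab.2 w].
  by move=> i; have [a [b H]] := hv i 0; exists (a, b).
pose b w := \prod_(i < K) (ab i).2 w.
pose A i w := (ab i).1 w * \prod_(j < K | j != i) (ab j).2 w.
have hA i : hol w0 (A i).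
  by apply: holM; [have [] := Hab i | apply: hol_prod => j; have [] := Hab j].
have vA : \forall w \near w0^', b w != 0 /\ forall i, v w i 0 = A i w / b w.
  have H : \forall w \near w0^', forall i : 'I_K, (ab i).2 w != 0 /\ v w i 0 = (ab i).1 w / (ab i).2 w.
    by apply: filter_forall => i; have [] := Hab i.
  apply: filterS H => w Hw; have b0 : b w != 0.
    by apply/prodf_neq0 => i _; have [] := Hw i.
  split=> // i; have [bi ->] := Hw i.
  move: b0; rewrite /A /b (bigD1 i) //= mulf_eq0 negb_or => /andP[_ p0].
  by rewrite -mulf_div divff // mulr1.
have /choice[mg Hmg] : forall i : 'I_K, exists mg : bool * nat * (C -> C),
    if mg.1.1 then \forall w \near w0, A i w = 0 else
    [/\ hol w0 mg.2, mg.2 w0 != 0 & \forall w \near w0, A i w = (w - w0) ^+ mg.1.2 * mg.2 w].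
  move=> i; have [z|[m [g H]]] := hol_dichotomy (hA i).
    by exists (true, 0%N, fun=> 0).
  by exists (false, m, g).
have [/forallP allz|/forallPn[i0 ni0]] := boolP [forall i, (mg i).1.1].
  left; have H : \forall w \near w0^', forall i : 'I_K, A i w = 0.
    by apply: filter_forall => i; apply: dnbhs_of_nbhs; have := Hmg i; rewrite allz.
  apply: filterS2 H vA => w Hw [b0 vw]; apply/matrixP => i j.
  by rewrite ord1 vw Hw mul0r mxE.
right.
case: (@arg_minnP _ i0 (fun i => ~~ (mg i).1.1) (fun i => (mg i).1.2) ni0) => i1 ni1 min1.
pose m := (mg i1).1.2.
pose h w : 'cV[C]_K := \col_i (if (mg i).1.1 then 0 else (w - w0) ^+ ((mg i).1.2 - m) * (mg i).2 w).
exists (fun w => (w - w0) ^+ m / b w), h; split.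
- move=> i j; move: (Hmg i); case E : ((mg i).1.1); first move=> _.
    by apply: hol_near (hol_cst w0 0); apply: nearWC => w; rewrite mxE E.
  move=> [hg _ _]; apply: hol_near (holM (holX ((mg i).1.2 - m) (holB (hol_id w0) (hol_cst w0 w0))) hg).
  by apply: nearWC => w; rewrite mxE E.
- have := Hmg i1; rewrite (negbTE ni1) => -[_ g0 _].
  apply: contraNneq g0 => /matrixP/(_ i1 0); rewrite !mxE (negbTE ni1) subnn expr0 mul1r.
  by move=> ->.
- have H : \forall w \near w0^', forall i : 'I_K, A i w = (w - w0) ^+ m * h w i 0.
    apply: filter_forall => i; apply: dnbhs_of_nbhs.
    move: (Hmg i); case E : ((mg i).1.1); first move=> Az.
      by apply: filterS Az => w ->; rewrite mxE E mulr0.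
    move=> [_ _ Hg]; apply: filterS Hg => w ->; rewrite mxE E mulrA -exprD subnKC //.
    by apply: min1; rewrite E.
  have nz : \forall w \near w0^', w - w0 != 0.
    by apply/dnbhsCP; exists 1 => // w _; rewrite subr_eq0.
  apply: filterS3 H vA nz => w Hw [b0 vw] w0n; split.
    by rewrite mulf_neq0 ?invr_eq0 // expf_neq0.
  by apply/matrixP => i j; rewrite ord1 vw Hw [RHS]mxE mulrAC.
Qed.

(** Spanning is expressed dually: a row vector killing every g i kills the image of E. In this form
    it can be checked on the rows of 1 - E. *)
Definition spans_idem K (g : nat -> C -> 'cV[C]_K) (k : nat) (E : C -> 'M[C]_K) :=
  [/\ mhol E, (\forall w \near w0, E w *m E w = E w) &
   \forall w \near w0^', (forall i, (i < k)%N -> E w *m g i w = g i w) /\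
     forall y : 'rV[C]_K, (forall i, (i < k)%N -> y *m g i w = 0) -> y *m E w = 0].

(* A finite family of meromorphic vectors spans, off [w0], a subbundle that
   extends over [w0]: it is the image of a holomorphic idempotent. *)
Lemma extension K (g : nat -> C -> 'cV[C]_K) k :
  (forall i, (i < k)%N -> mmero (g i)) -> exists E, spans_idem g k E.
Proof.
elim: k => [|k IH] hg.
  exists (fun=> 0); split; first exact: mhol_cst.
    by apply: nearWC => w; rewrite mul0mx.
  by apply: nearWD => w; split=> // y _; rewrite mulmx0.
have [|E [hE EE HE]] := IH; first by move=> i ik; apply: hg; exact: ltnW.
(* The part of the new vector outside the image of E. If it vanishes nothing changes; otherwise its
   direction h, holomorphic and nonzero at w0, is adjoined. *)
pose g' w := (1%:M - E w) *m g k w.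
have mg' : mmero g'.
  by apply: mmeroM; [apply: mhol_mmero; apply: mholB => //; exact: mhol_cst | exact: hg].
have [z|[s [h [hh h0 sh]]]] := vec_dichotomy mg'.
  exists E; split=> //; apply: filterS2 z HE => w z [H1 H2]; split.
    move=> i; rewrite ltnS leq_eqVlt => /predU1P[->|/H1 //].
    by apply/esym/eqP; rewrite -subr_eq0 -{1}[g k w]mul1mx -mulmxBl -/(g' w) z.
  by move=> y Hy; apply: H2 => i ik; apply: Hy; exact: ltnW.
have [i0 hi0] : exists i, h w0 i 0 != 0.
  apply/existsP; apply: contraNT h0 => /existsPn H; apply/eqP/matrixP => i j.
  by rewrite ord1 mxE; apply/eqP/negPn.
have Eh : \forall w \near w0, E w *m h w = 0.
  apply: mhol_eq0; first exact: mholM.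
  apply: filterS2 sh (dnbhs_of_nbhs EE) => w [s0 e] ee.
  have : s w *: (E w *m h w) = 0.
    by rewrite scalemxAr -e /g' mulmxA mulmxBr mulmx1 ee subrr mul0mx.
  by move/eqP; rewrite scaler_eq0 (negbTE s0) => /eqP.
have hn0 := hol_near_neq0 (hh i0 0) hi0.
(* A coordinate of 1 - E in which h does not vanish, scaled so that l h = 1 and l E = 0; since also
   E h = 0, the sum E + h l is idempotent. *)
pose l w : 'rV[C]_K := (h w i0 0)^-1 *: (delta_mx 0 i0 *m (1%:M - E w)).
have hl : mhol l.
  apply: mholZ; first exact: holV.
  by apply: mholM; [exact: mhol_cst | apply: mholB => //; exact: mhol_cst].
have lh : \forall w \near w0, l w *m h w = 1%:M.
  apply: filterS2 Eh hn0 => w eh hn.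
  rewrite /l -scalemxAl -mulmxA mulmxBl mul1mx eh subr0 -rowE.
  by apply/matrixP => a b; rewrite !ord1 !mxE mulVf.
have lE : \forall w \near w0, l w *m E w = 0.
  by apply: filterS EE => w ee; rewrite /l -scalemxAl -mulmxA mulmxBl mul1mx ee subrr mulmx0 scaler0.
exists (fun w => E w + h w *m l w); split.
- by apply: mholD => //; exact: mholM.
- apply: filterS2 (filterI EE Eh) (filterI lh lE) => w [ee eh] [lh1 le].
  rewrite mulmxDl !mulmxDr ee mulmxA eh mul0mx addr0 -mulmxA le mulmx0 add0r.
  by rewrite -mulmxA (mulmxA (l w)) lh1 mul1mx.
- apply: filterS3 (filterI HE sh) (dnbhs_of_nbhs (filterI EE Eh)) (dnbhs_of_nbhs (filterI lh lE)).
  move=> w [[H1 H2] [s0 e]] [ee eh] [lh1 le].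
  have gk : g k w = E w *m g k w + s w *: h w.
    by rewrite -e /g' mulmxBl mul1mx addrC subrK.
  split.
    move=> i; rewrite ltnS leq_eqVlt => /predU1P[->|ik].
      have lg : l w *m g k w = (s w)%:M.
        by rewrite gk mulmxDr mulmxA le mul0mx add0r -scalemxAr lh1 scalemx1.
      by rewrite mulmxDl -mulmxA lg mul_mx_scalar -gk.
    by rewrite mulmxDl -mulmxA -{2}(H1 i ik) (mulmxA (l w)) le mul0mx mulmx0 addr0 H1.
  move=> y Hy; have yE : y *m E w = 0 by apply: H2 => i ik; apply: Hy; exact: ltnW.
  rewrite mulmxDr yE add0r mulmxA.
  have : s w *: (y *m h w) = 0.
    have := Hy k (ltnSn k); rewrite {1}gk mulmxDr mulmxA yE mul0mx add0r => <-.
    by rewrite scalemxAr.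
  by move/eqP; rewrite scaler_eq0 (negbTE s0) /= => /eqP ->; rewrite mul0mx.
Qed.

End MatrixGerms.

(** * Matrix norms, the exponential and closed matrix groups *)

Section MatrixTopology.
Variables (R : realType) (m p : nat).
Local Notation C := (cplx R).

Lemma nbhs_mxP (A : 'M[C]_(m, p)) (P : set 'M[C]_(m, p)) : nbhs A P <->
  exists2 d : R, 0 < d & forall B : 'M[C]_(m, p), (forall i j, nrm (B i j - A i j) < d) -> P B.
Proof.
split.
- case/nbhs_ballP => e /= /C_gt0P[d d0 ->] H; exists d => // B hB.
  by apply: H; split=> [|i j]; [rewrite toC_gt0 | apply/ballCP; rewrite nrm_distC].
- case=> d d0 H; apply/nbhs_ballP; exists (toC d) => /=; first by rewrite toC_gt0.
  by move=> B [_ hB]; apply: H => i j; have /ballCP := hB i j; rewrite nrm_distC.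
Qed.

Lemma closed_mx (G : set 'M[C]_(m, p)) (A : 'M[C]_(m, p)) : closed G ->
  (forall d : R, 0 < d -> exists2 B, G B & forall i j, nrm (B i j - A i j) < d) -> G A.
Proof.
move=> cG H; apply: cG => P /nbhs_mxP[d d0 HP].
by have [B GB hB] := H d d0; exists B; split => //; exact: HP.
Qed.

Lemma mx_hausdorff : hausdorff_space 'M[C]_(m, p).
Proof.
move=> A B cl; apply/matrixP => i j; apply/eqP; apply: contrapT => /negP ne.
pose d := nrm (A i j - B i j) / 2.
have n0 : 0 < d by rewrite divr_gt0 // nrm_gt0 subr_eq0.
have nA : nbhs A [set X | nrm (X i j - A i j) < d] by apply/nbhs_mxP; exists d => // X; apply.
have nB : nbhs B [set X | nrm (X i j - B i j) < d] by apply/nbhs_mxP; exists d => // X; apply.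
have [X [/= h1 h2]] := cl _ _ nA nB.
have := nrmB (X i j - B i j) (X i j - A i j).
have -> : X i j - B i j - (X i j - A i j) = A i j - B i j by ring.
rewrite /d in h1 h2; lra.
Qed.

End MatrixTopology.

Section RowNorm.
Variable R : realType.
Local Notation C := (cplx R).

Definition rowle m p (A : 'M[C]_(m, p)) (a : R) := forall i, \sum_j nrm (A i j) <= a.

Lemma rowle_entry m p (A : 'M[C]_(m, p)) a i j : rowle A a -> nrm (A i j) <= a.
Proof.
move=> /(_ i); apply: le_trans; rewrite (bigD1 j) //= lerDl.
by apply: sumr_ge0 => k _; exact: nrm_ge0.
Qed.
Lemma rowle_le m p (A : 'M[C]_(m, p)) a b : rowle A a -> a <= b -> rowle A b.
Proof. by move=> H ab i; exact: le_trans (H i) ab. Qed.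
Lemma rowleD m p (A B : 'M[C]_(m, p)) a b : rowle A a -> rowle B b -> rowle (A + B) (a + b).
Proof.
move=> hA hB i; apply: le_trans (lerD (hA i) (hB i)); rewrite -big_split /=.
by apply: ler_sum => j _; rewrite mxE nrmD.
Qed.
Lemma rowle0 m p : rowle (0 : 'M[C]_(m, p)) 0.
Proof. by move=> i; rewrite big1 // => j _; rewrite mxE nrm0. Qed.
Lemma rowleZ m p c (A : 'M[C]_(m, p)) a : rowle A a -> rowle (c *: A) (nrm c * a).
Proof.
move=> hA i; apply: le_trans (ler_wpM2l (nrm_ge0 c) (hA i)); rewrite mulr_sumr.
by apply: ler_sum => j _; rewrite mxE nrmM.
Qed.
Lemma rowle1 m : rowle (1%:M : 'M[C]_m) 1.
Proof.
move=> i; rewrite (bigD1 i) //= big1 ?addr0 ?mxE ?eqxx ?nrm1 // => j /negbTE ji.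
by rewrite mxE eq_sym ji nrm0.
Qed.
Lemma rowleM m p q (A : 'M[C]_(m, p)) (B : 'M[C]_(p, q)) a b : 0 <= b ->
  rowle A a -> rowle B b -> rowle (A *m B) (a * b).
Proof.
move=> b0 hA hB i.
apply: le_trans (_ : \sum_j \sum_k nrm (A i k) * nrm (B k j) <= _).
  apply: ler_sum => j _; rewrite mxE; apply: le_trans (nrm_sum _ _ _) _.
  by apply: ler_sum => k _; rewrite nrmM.
rewrite exchange_big /=; apply: le_trans (ler_wpM2r b0 (hA i)); rewrite mulr_suml.
by apply: ler_sum => k _; rewrite -mulr_sumr ler_wpM2l ?nrm_ge0.
Qed.
Lemma rowleX m (A : 'M[C]_m) a k : 0 <= a -> rowle A a -> rowle (A ^+ k) (a ^+ k).
Proof.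
move=> a0 hA; elim: k => [|k IH]; first by rewrite !expr0; exact: rowle1.
by rewrite !exprS; apply: rowleM => //; rewrite exprn_ge0.
Qed.
Lemma rowle_sum m p (I : Type) (s : seq I) (F : I -> 'M[C]_(m, p)) (f : I -> R) :
  (forall i, rowle (F i) (f i)) -> rowle (\sum_(i <- s) F i) (\sum_(i <- s) f i).
Proof.
move=> H; elim: s => [|i s IH]; first by rewrite !big_nil; exact: rowle0.
by rewrite !big_cons; exact: rowleD.
Qed.
Lemma rowle_total m p (A : 'M[C]_(m, p)) : rowle A (\sum_i \sum_j nrm (A i j)).
Proof.
move=> i; rewrite [leRHS](bigD1 i) //= lerDl.
by apply: sumr_ge0 => k _; apply: sumr_ge0 => j _; exact: nrm_ge0.
Qed.

Lemma rowle_pow_diff m (A B : 'M[C]_m) c d k : 1 <= c -> 0 <= d ->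
  rowle A c -> rowle B c -> rowle (A - B) d -> rowle (A ^+ k - B ^+ k) (k%:R * d * c ^+ k).
Proof.
move=> c1 d0 hA hB hAB; have c0 : 0 <= c by lra.
elim: k => [|k IH]; first by rewrite !expr0 subrr !mul0r; exact: rowle0.
have -> : A ^+ k.+1 - B ^+ k.+1 = A *m (A ^+ k - B ^+ k) + (A - B) *m B ^+ k.
  rewrite !exprS mulmxBr mulmxBl addrA subrK; exact: erefl.
have ck : 0 <= c ^+ k by rewrite exprn_ge0.
have kd : 0 <= k%:R * d * c ^+ k by rewrite !mulr_ge0.
apply: rowle_le (rowleD (rowleM kd hA IH) (rowleM ck hAB (rowleX k c0 hB))) _.
rewrite -natr1 mulrDl mul1r mulrDl exprS.
have -> : c * (k%:R * d * c ^+ k) = k%:R * d * (c * c ^+ k) by ring.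
by rewrite lerD2l ler_wpM2l // ler_peMl.
Qed.

End RowNorm.

Section Expmx.
Variables (R : realType) (n : nat).
Local Notation C := (cplx R).
Implicit Types Y : 'M[C]_n.

Lemma toCV (x : R) : toC x^-1 = (toC x)^-1.
Proof.
have [->|x0] := eqVneq x 0; first by rewrite invr0 toC0 invr0.
have x0' : toC x != 0 by rewrite -toC0 (inj_eq (@toC_inj R)).
by apply: (mulfI x0'); rewrite mulfV // -toCM mulfV.
Qed.

Definition expsum Y N : 'M[C]_n := \sum_(k < N) (k`!%:R^-1 *: Y ^+ k).

Lemma exp_partial (y : R) N : 0 <= y -> \sum_(k < N) (k`!%:R^-1 * y ^+ k) <= expR y.
Proof.
move=> y0; have -> : \sum_(k < N) (k`!%:R^-1 * y ^+ k) = series (exp_coeff y) N.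
  by rewrite /series /= big_mkord; apply: eq_bigr => k _; rewrite /exp_coeff /= mulrC.
apply: nondecreasing_cvgn_le; last exact: is_cvg_series_exp_coeff.
by apply: nondecreasing_series => k _ _; exact: exp_coeff_ge0.
Qed.

Lemma fact_gt0' k : 0 < (k`!%:R : R). Proof. by rewrite ltr0n fact_gt0. Qed.

Lemma expmx_exists Y : exists E, is_expmx Y E.
Proof.
have [y y0 hY] : exists2 y, 0 <= y & rowle Y y.
  exists (\sum_i \sum_j nrm (Y i j)); last exact: rowle_total.
  by apply: sumr_ge0 => k _; apply: sumr_ge0 => j _; exact: nrm_ge0.
have key (f : C -> R) : (forall z w, f (z + w) = f z + f w) -> f 0 = 0 ->
    (forall z, `|f z| <= nrm z) -> forall a b,
    cvgn (fun N : nat => f ((expsum Y N) a b)).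
  move=> fD f0 fn a b.
  pose u k := f ((k`!%:R^-1 *: Y ^+ k) a b).
  have -> : (fun N : nat => f ((expsum Y N) a b)) = series u.
    apply/funext => N; rewrite /series /= big_mkord /expsum.
    elim: N => [|N IH]; first by rewrite !big_ord0 mxE f0.
    by rewrite !big_ord_recr /= -IH mxE fD.
  apply: normed_cvg; apply: (@series_le_cvg _ _ (exp_coeff y)) => //.
  - by move=> k; exact: normr_ge0.
  - by move=> k; rewrite /exp_coeff /= divr_ge0 // exprn_ge0.
  - move=> k; rewrite /= /u mxE; apply: le_trans (fn _) _; rewrite nrmM nrmV nrm_nat /exp_coeff /= mulrC.
    by apply: ler_wpM2r; [rewrite invr_ge0 ler0n | exact: rowle_entry (rowleX k y0 hY)].
  - exact: is_cvg_series_exp_coeff.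
pose E : 'M[C]_n := \matrix_(a, b) mkC (lim (re ((expsum Y N) a b) @[N --> \oo]))
   (lim (im ((expsum Y N) a b) @[N --> \oo])).
exists E => a b; apply/cvgC_reim; rewrite !mxE; split.
- by apply: (key (@re R)); [exact: reD | by [] | exact: re_le_nrm].
- by apply: (key (@im R)); [exact: imD | by [] | exact: im_le_nrm].
Qed.

(** The inequality 1 - t <= exp(-t) at t = u / (1 + u), inverted. *)
Lemma one_plus_expR (u : R) : 0 <= u -> expR (u / (1 + u)) <= 1 + u.
Proof.
move=> u0; have p : 0 < 1 + u by lra.
have := expR_ge1Dx (- (u / (1 + u))); rewrite expRN.
have -> : 1 - u / (1 + u) = (1 + u)^-1 by field; rewrite gt_eqF.
by rewrite lef_pV2 ?posrE ?expR_gt0.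
Qed.

Lemma binom_bound N k : 'C(N, k)%:R / N%:R ^+ k <= k`!%:R^-1 :> R.
Proof.
have [->|N0] := posnP N.
  case: k => [|k]; first by rewrite bin0 fact0 expr0 invr1 mulr1.
  by rewrite bin0n /= mul0r invr_ge0 ler0n.
have ff : (N ^_ k <= N ^ k)%N.
  elim: k => [//|k IH]; rewrite ffactnSr expnSr; apply: leq_mul => //; exact: leq_subr.
rewrite ler_pdivrMr ?exprn_gt0 ?ltr0n // mulrC ler_pdivlMr ?fact_gt0' //.
by rewrite -natrM bin_ffact -natrX ler_nat.
Qed.

Lemma mxexpZ (c : C) Y k : (c *: Y) ^+ k = c ^+ k *: Y ^+ k.
Proof.
elim: k => [|k IH]; first by rewrite !expr0 scale1r.
by rewrite !exprS IH -!mulmxE -scalemxAl -scalemxAr scalerA.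
Qed.

(** Term by term the coefficients of the difference are nonnegative by [binom_bound], so its norm is
    bounded by the same expression at the scalar y; there (1 + y/N)^N is bounded below by
    [one_plus_expR]. *)
Lemma expsum_pow Y y N : 0 <= y -> rowle Y y -> (0 < N)%N ->
  rowle (expsum Y N.+1 - (1%:M + N%:R^-1 *: Y) ^+ N) (expR y - expR (y / (1 + y / N%:R))).
Proof.
move=> y0 hY N0.
have Nn0 : (N%:R : R) != 0 by rewrite pnatr_eq0 -lt0n.
have e1 : (1%:M + N%:R^-1 *: Y) ^+ N = \sum_(k < N.+1) (('C(N, k)%:R / N%:R ^+ k) *: Y ^+ k).
  rewrite addrC (_ : 1%:M = 1) // exprD1n; apply: eq_bigr => k _.
  by rewrite mxexpZ -scaler_nat scalerA exprVn.
have e2 : (1 + y / N%:R) ^+ N = \sum_(k < N.+1) (('C(N, k)%:R / N%:R ^+ k) * y ^+ k) :> R.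
  rewrite addrC exprD1n; apply: eq_bigr => k _.
  by rewrite expr_div_n -mulr_natl mulrCA mulrC -!mulrA [_ * y ^+ k]mulrC.
have lower : expR (y / (1 + y / N%:R)) <= (1 + y / N%:R) ^+ N.
  have u0 : 0 <= y / N%:R by rewrite divr_ge0.
  have -> : y / (1 + y / N%:R) = N%:R * (y / N%:R / (1 + y / N%:R)).
    have Ny : 0 < N%:R + y by rewrite ltr_wpDr // ltr0n.
    by field; rewrite Nn0 gt_eqF.
  rewrite expRM_natl; apply: lerXn2r; rewrite ?nnegrE ?expR_ge0 ?addr_ge0 //.
  exact: one_plus_expR.
rewrite e1 /expsum -sumrB.
have e3 : rowle (\sum_(k < N.+1) (k`!%:R^-1 *: Y ^+ k - ('C(N, k)%:R / N%:R ^+ k) *: Y ^+ k))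
   (\sum_(k < N.+1) (k`!%:R^-1 * y ^+ k - ('C(N, k)%:R / N%:R ^+ k) * y ^+ k)).
  apply: rowle_sum => k; rewrite -scalerBl -mulrBl.
  have -> : (k`!%:R^-1 - 'C(N, k)%:R / N%:R ^+ k : C) = toC (k`!%:R^-1 - 'C(N, k)%:R / N%:R ^+ k).
    by rewrite toCD toCN toCM !toCV -!natrX !toC_nat.
  apply: rowle_le (rowleZ _ (rowleX k y0 hY)) _.
  by rewrite nrm_toC ger0_norm // subr_ge0 binom_bound.
apply: rowle_le e3 _; rewrite sumrB -e2; apply: lerB => //.
exact: exp_partial.
Qed.

Lemma expR_gap (y : R) N : 0 <= y -> (0 < N)%N ->
  expR y - expR (y / (1 + y / N%:R)) <= y ^+ 2 * expR y / N%:R.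
Proof.
move=> y0 N0; have Np : 0 < (N%:R : R) by rewrite ltr0n.
set y' := y / _.
have h : y - y' <= y ^+ 2 / N%:R.
  have q0 : 0 < 1 + y / N%:R by rewrite ltr_wpDr // divr_ge0 // ltW.
  have -> : y - y' = (y ^+ 2 / N%:R) / (1 + y / N%:R).
    have Ny : 0 < N%:R + y by lra.
    by rewrite /y'; field; rewrite !gt_eqF.
  rewrite ler_pdivrMr // ler_peMr // ?divr_ge0 ?sqr_ge0 ?ler0n //.
  by rewrite lerDl divr_ge0 // ltW.
have e : expR y' = expR y * expR (- (y - y')) by rewrite -expRD; congr expR; ring.
have := expR_ge1Dx (- (y - y')); rewrite e => e'.
have p := expR_gt0 y.
have := ler_wpM2l (ltW p) e'; have := ler_wpM2l (ltW p) h.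
rewrite [y ^+ 2 * _]mulrC -mulrA; lra.
Qed.

Lemma small_inv (a d : R) : 0 <= a -> 0 < d ->
  exists N0, forall N : nat, (N0 <= N)%N -> (0 < N)%N /\ a / N%:R < d.
Proof.
move=> a0 d0; exists (Num.truncn (a / d)).+1 => N hN.
have N0 : (0 < N)%N by exact: leq_trans hN.
split=> //; rewrite ltr_pdivrMr ?ltr0n // mulrC -ltr_pdivrMr //.
by apply: lt_le_trans (truncnS_gt _) _; rewrite ler_nat.
Qed.

Lemma rowle_bound Y : exists2 y, 0 <= y & rowle Y y.
Proof.
exists (\sum_i \sum_j nrm (Y i j)); last exact: rowle_total.
by apply: sumr_ge0 => k _; apply: sumr_ge0 => j _; exact: nrm_ge0.
Qed.

Lemma pow_expmx Y E : is_expmx Y E -> forall d : R, 0 < d -> exists N0, forall N : nat,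
  (N0 <= N)%N -> (0 < N)%N /\ forall i j, nrm (((1%:M + N%:R^-1 *: Y) ^+ N) i j - E i j) < d.
Proof.
move=> hE d d0; have [y y0 hY] := rowle_bound Y.
have d2 : 0 < d / 2 by lra.
have : \forall N \near \oo, forall ij : 'I_n * 'I_n, nrm ((expsum Y N) ij.1 ij.2 - E ij.1 ij.2) < d / 2.
  by apply: filter_forall => ij; exact: ((cvgCP _ _ _).1 (hE ij.1 ij.2)).
case=> N1 _ H1.
have [N2 H2] := small_inv (mulr_ge0 (sqr_ge0 y) (expR_ge0 y)) d2.
exists (maxn N1 N2) => N; rewrite geq_max => /andP[h1 h2].
have [N0 hN] := H2 N h2; split=> // i j.
have h3 := H1 N.+1 (leqW h1) (i, j); rewrite /= in h3.
have h4 := rowle_entry i j (expsum_pow y0 hY N0).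
have h5 := expR_gap y0 N0; rewrite mxE [X in nrm (_ + X)]mxE in h4.
set P := ((1%:M + N%:R^-1 *: Y) ^+ N) i j in h4 *.
have -> : P - E i j = (P - expsum Y N.+1 i j) + (expsum Y N.+1 i j - E i j) by ring.
apply: le_lt_trans (nrmD _ _) _; rewrite (nrm_distC P); lra.
Qed.

Lemma rowle_of_entry (A : 'M[C]_n) d : (forall i j, nrm (A i j) <= d) -> rowle A (n%:R * d).
Proof.
move=> H i; apply: le_trans (ler_sum _ (fun j _ => H i j)) _.
by rewrite sumr_const card_ord mulr_natl.
Qed.

Lemma expR_pow_bound (a : R) N : 0 <= a -> (0 < N)%N -> (1 + a / N%:R) ^+ N <= expR a.
Proof.
move=> a0 N0; have -> : a = N%:R * (a / N%:R) by rewrite mulrCA divff ?mulr1 // pnatr_eq0 -lt0n.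
rewrite expRM_natl; apply: lerXn2r; rewrite ?nnegrE ?expR_ge0 ?addr_ge0 ?divr_ge0 ?mulr_ge0 //.
by rewrite mulrAC divff ?mul1r ?expR_ge1Dx // pnatr_eq0 -lt0n.
Qed.

Lemma nrm_invn N : nrm (N%:R^-1 : C) = N%:R^-1 :> R.
Proof. by rewrite nrmV nrm_nat. Qed.

(** exp(-Y) is the inverse, as the limit of (1 + Y/N)^N (1 - Y/N)^N = (1 - Y^2/N^2)^N, which differs
    from the identity by a term of order 1/N. *)
Lemma expmx_unit Y E : is_expmx Y E -> E \in unitmx.
Proof.
move=> hE; have [E' hE'] := expmx_exists (- Y).
have [y y0 hY] := rowle_bound Y.
have [f f0 hF] := rowle_bound E'.
have nn : 0 <= (n%:R : R) by [].
suff : E *m E' = 1%:M by move=> /mulmx1_unit[].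
apply/eqP; rewrite -subr_eq0; apply/eqP/matrixP => i j; rewrite [RHS]mxE.
apply/eqP; rewrite -nrm_eq0; apply: contrapT => /negP ne.
set e := nrm _ in ne; have e0 : 0 < e by rewrite lt_def ne nrm_ge0.
have [a a0 hA] := rowle_bound E.
pose K := n%:R * (f + 1 + a + n%:R) + 1.
have K0 : 0 < K by rewrite /K ltr_wpDl // mulr_ge0 // !addr_ge0.
have [d [d0 d1 dK]] : exists d : R, [/\ 0 < d, d <= 1 & K * d <= e / 2].
  exists (Num.min 1 (e / 2 / K)); split; first by rewrite lt_min ltr01 !divr_gt0.
    by rewrite ge_min lexx.
  by rewrite mulrC -ler_pdivlMr // ge_min lexx orbT.
have [N1 H1] := pow_expmx hE d0; have [N2 H2] := pow_expmx hE' d0.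
have [N3 H3] := small_inv (mulr_ge0 (sqr_ge0 y) (expR_ge0 (y ^+ 2))) (divr_gt0 e0 (ltr0n _ 2)).
pose N := maxn N1 (maxn N2 N3).
have [N0 h1] := H1 N (leq_maxl _ _).
have [_ h2] := H2 N (leq_trans (leq_maxl _ _) (leq_maxr _ _)).
have [_ h3] := H3 N (leq_trans (leq_maxr _ _) (leq_maxr _ _)).
set A := _ ^+ N in h1; set B := _ ^+ N in h2.
have rA : rowle (E - A) (n%:R * d).
  by apply: rowle_of_entry => p q; rewrite !mxE nrm_distC; exact: ltW (h1 p q).
have rB : rowle (E' - B) (n%:R * d).
  by apply: rowle_of_entry => p q; rewrite !mxE nrm_distC; exact: ltW (h2 p q).
have nd : 0 <= n%:R * d by rewrite mulr_ge0 // ltW.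
have rA' : rowle A (a + n%:R * d).
  have -> : A = E + (-1) *: (E - A) by rewrite scaleN1r opprB addrCA subrr addr0.
  by apply: rowle_le (rowleD hA (rowleZ (-1) rA)) _; rewrite nrmN nrm1 mul1r.
have N0' : 0 < (N%:R : R) by rewrite ltr0n.
have AB : A *m B = (1%:M - N%:R^-1 ^+ 2 *: (Y *m Y)) ^+ N.
  have cm : GRing.comm (1%:M + N%:R^-1 *: Y) (1%:M + N%:R^-1 *: (- Y)).
    rewrite /GRing.comm -!mulmxE scalerN !mulmxDl !mulmxDr !mul1mx !mulmx1 !mulmxN !mulNmx.
    by rewrite !addrA subrK addrK.
  have -> : A *m B = A * B by exact: erefl.
  rewrite /A /B -(exprMn_comm _ cm); congr (_ ^+ N); rewrite -mulmxE.
  rewrite scalerN mulmxDl mul1mx mulmxBr mulmx1 -scalemxAl -scalemxAr scalerA -expr2.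
  by rewrite addrA subrK.
have r1 : rowle (A *m B - 1%:M) (y ^+ 2 * expR (y ^+ 2) / N%:R).
  rewrite AB; have c1 : 1 <= 1 + y ^+ 2 / N%:R by rewrite lerDl divr_ge0 // sqr_ge0.
  have rr : rowle (- (N%:R^-1 ^+ 2 *: (Y *m Y))) (N%:R^-1 ^+ 2 * y ^+ 2).
    rewrite -scaleNr; apply: rowle_le (rowleZ _ (rowleM y0 hY hY)) _.
    by rewrite nrmN nrmX nrm_invn expr2.
  have d0' : 0 <= N%:R^-1 ^+ 2 * y ^+ 2 by rewrite mulr_ge0 ?sqr_ge0.
  have r2 : rowle (1%:M - N%:R^-1 ^+ 2 *: (Y *m Y)) (1 + y ^+ 2 / N%:R).
    apply: rowle_le (rowleD (@rowle1 _ n) rr) _; rewrite lerD2l mulrC expr2 mulrA.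
    rewrite ler_piMr ?divr_ge0 ?sqr_ge0 ?ler0n //.
    by rewrite invf_le1 // ler1n.
  have r3 : rowle (1%:M : 'M[C]_n) (1 + y ^+ 2 / N%:R) by apply: rowle_le (@rowle1 _ n) c1.
  have r4 : rowle (1%:M - N%:R^-1 ^+ 2 *: (Y *m Y) - 1%:M) (N%:R^-1 ^+ 2 * y ^+ 2).
    by rewrite addrAC subrr add0r.
  have := rowle_pow_diff N c1 d0' r2 r3 r4; rewrite expr1n => H; apply: rowle_le H _.
  apply: le_trans (ler_wpM2l _ (expR_pow_bound (sqr_ge0 y) N0)) _.
    by rewrite mulr_ge0.
  rewrite le_eqVlt; apply/orP; left; apply/eqP; field; by rewrite gt_eqF.
have eq : E *m E' - 1%:M = ((E - A) *m E' + A *m (E' - B)) + (A *m B - 1%:M).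
  by rewrite mulmxBl mulmxBr [_ + (A *m E' - _)]addrA subrK [RHS]addrA subrK.
have big : rowle (E *m E' - 1%:M)
   ((n%:R * d * f + (a + n%:R * d) * (n%:R * d)) + y ^+ 2 * expR (y ^+ 2) / N%:R).
  rewrite eq; apply: rowleD r1; apply: rowleD; first exact: rowleM.
  exact: rowleM.
have := rowle_entry i j big; rewrite -/e => fin.
have b1 : (a + n%:R * d) * (n%:R * d) <= (a + n%:R) * (n%:R * d).
  by rewrite ler_wpM2r // lerD2l ler_piMr.
have b2 : n%:R * d * f + (a + n%:R) * (n%:R * d) <= K * d.
  have -> : K * d = n%:R * d * f + (a + n%:R) * (n%:R * d) + (n%:R * d + d) by rewrite /K; ring.
  by rewrite lerDl addr_ge0 // ltW.
lra.
Qed.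

Lemma complexification_unit (G : set 'M[C]_n) Z : G `<=` @unitary_group R n ->
  complexification G Z -> Z \in unitmx.
Proof.
move=> GU [g [X [E [Gg _ hE ->]]]]; rewrite unitmx_mul (expmx_unit hE) andbT.
exact: unitarymx_unit (GU _ Gg).
Qed.

End Expmx.

Section LieAlgebra.
Variables (R : realType) (n : nat) (G : set 'M[cplx R]_n).
Local Notation C := (cplx R).
Hypothesis G1 : G 1%:M.
Hypothesis GM : forall A B, G A -> G B -> G (A *m B).
Hypothesis cG : closed G.

Lemma cder_small (f : R -> C) d : cder f 0 d -> forall e : R, 0 < e ->
  exists2 del : R, 0 < del & forall h, `|h| < del -> nrm (f h - f 0 - toC h * d) <= e * `|h|.
Proof.
have key (p : R -> R) (q : R) : is_derive (0 : R) 1 p q -> forall e : R, 0 < e ->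
    exists2 del : R, 0 < del & forall h, `|h| < del -> `|p h - p 0 - h * q| <= e * `|h|.
  move=> hp e e0; have [dp dq] := hp; move: dp.
  rewrite derivable_nbhsP => /eqaddoP /(_ e e0) /=.
  rewrite /= dq => /nbhs_ballP[del /= del0 H]; exists del => // h hh.
  have := H h; rewrite /ball /= sub0r normrN => /(_ hh).
  by rewrite /= !fctE /= addr0 /GRing.scale /= mulr1 opprD addrA.
case=> h1 h2 e e0; have e2 : 0 < e / 2 by lra.
have [d1 d10 H1] := key _ _ h1 _ e2; have [d2 d20 H2] := key _ _ h2 _ e2.
exists (Num.min d1 d2); first by rewrite lt_min d10.
move=> h; rewrite lt_min => /andP[/H1 a1 /H2 a2].
apply: le_trans (nrm_le_reim _) _; rewrite !reB !imB reM imM /toC.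
rewrite [re (mkC h 0)]/= [im (mkC h 0)]/= !mul0r subr0 addr0; lra.
Qed.

Lemma G_pow A N : G A -> G (A ^+ N).
Proof. by move=> GA; elim: N => [|N IH]; rewrite ?expr0 // exprS; exact: GM. Qed.

(** The elements g(t/N)^N of G tend to exp(t X): g(t/N) agrees with 1 + t X / N up to o(1/N), and
    N-th powers multiply this error by at most a constant times N. Closedness of G keeps the limit
    inside. *)
Lemma lie_of_curve (g : R -> 'M[C]_n) (X : 'M[C]_n) : g 0 = 1%:M -> (forall t, G (g t)) ->
  (forall i j, cder (fun t => g t i j) 0 (X i j)) -> lie_algebra G X.
Proof.
move=> g0 Gg hX t; have [E hE] := expmx_exists (mkC t 0 *: X); exists E => //.
apply: (closed_mx cG) => d d0.
have [y y0 hY] := rowle_bound (mkC t 0 *: X).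
pose Y := mkC t 0 *: X; rewrite -/Y in hE hY.
have nn : 0 <= (n%:R : R) by [].
pose K := n%:R * (`|t| + 1) * expR (y + n%:R * (`|t| + 1)).
have K0 : 0 <= K by rewrite !mulr_ge0 ?expR_ge0.
have [e [e0 e1 eK]] : exists e : R, [/\ 0 < e, e <= 1 & K * e < d / 2].
  have K1 : 0 < K + 1 by lra.
  exists (Num.min 1 (d / 2 / (K + 1))); split; first by rewrite lt_min ltr01 !divr_gt0.
    by rewrite ge_min lexx.
  apply: le_lt_trans (_ : K * (d / 2 / (K + 1)) < _).
    by rewrite ler_wpM2l // ge_min lexx orbT.
  by rewrite mulrA ltr_pdivrMr // mulrC ltr_pM2l ?divr_gt0 //; lra.
have [del del0 Hd] : exists2 del : R, 0 < del & forall h, `|h| < del ->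
    forall ij : 'I_n * 'I_n, nrm (g h ij.1 ij.2 - g 0 ij.1 ij.2 - toC h * X ij.1 ij.2) <= e * `|h|.
  have : \forall h \near (0 : R), forall ij : 'I_n * 'I_n,
      nrm (g h ij.1 ij.2 - g 0 ij.1 ij.2 - toC h * X ij.1 ij.2) <= e * `|h|.
    pose P (ij : 'I_n * 'I_n) h := nrm (g h ij.1 ij.2 - g 0 ij.1 ij.2 - toC h * X ij.1 ij.2) <= e * `|h|.
    apply: (@filter_forall R _ P (nbhs (0 : R)) (nbhs_filter (0 : R))) => ij; rewrite /P; have [del del0 H] := cder_small (hX ij.1 ij.2) e0.
    apply/nbhs_ballP; exists del => //= h; rewrite /ball /= sub0r normrN; exact: H.
  case/nbhs_ballP=> del /= del0 H; exists del => // h hh; apply: H.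
  by rewrite /ball /= sub0r normrN.
have d2 : 0 < d / 2 by lra.
have [N1 H1] := pow_expmx hE d2.
have [N2 H2] := small_inv (normr_ge0 t) del0.
pose N := maxn N1 N2.
have [N0 h1] := H1 N (leq_maxl _ _); have [_ h2] := H2 N (leq_maxr _ _).
have N0' : 0 < (N%:R : R) by rewrite ltr0n.
pose A := g (t / N%:R); exists (A ^+ N); first exact: (G_pow N (Gg (t / N%:R))).
move=> i j.
have rAB : rowle (A - (1%:M + N%:R^-1 *: Y)) (n%:R * (e * `|t|) / N%:R).
  rewrite -mulrA; apply: rowle_of_entry => a b.
  have := Hd (t / N%:R); rewrite normrM normfV (ger0_norm (ltW N0')) => /(_ h2 (a, b)) /=.
  rewrite g0 -mulrA => H; apply: le_trans H; rewrite le_eqVlt; apply/orP; left; apply/eqP.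
  congr nrm; rewrite /A /Y !mxE opprD addrA; congr (_ - _); rewrite mulrA; congr (_ * _).
  by rewrite -/(toC t) toCM toCV toC_nat mulrC.
have b0 : 0 <= n%:R * (e * `|t|) by rewrite !mulr_ge0 // ltW.
pose c := 1 + (y + n%:R * (e * `|t|)) / N%:R.
have c1 : 1 <= c by rewrite /c lerDl divr_ge0 ?addr_ge0 // ltW.
have rB : rowle (1%:M + N%:R^-1 *: Y) (1 + y / N%:R).
  apply: rowle_le (rowleD (@rowle1 _ n) (rowleZ _ hY)) _.
  by rewrite nrm_invn mulrC.
have rB' : rowle (1%:M + N%:R^-1 *: Y) c.
  by apply: rowle_le rB _; rewrite /c lerD2l ler_pM2r ?invr_gt0 // lerDl.
have rA : rowle A c.
  have -> : A = (1%:M + N%:R^-1 *: Y) + (A - (1%:M + N%:R^-1 *: Y)) by rewrite addrCA subrr addr0.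
  by apply: rowle_le (rowleD rB rAB) _; rewrite /c mulrDl addrA.
have b0' : 0 <= n%:R * (e * `|t|) / N%:R by rewrite divr_ge0 // ltW.
have H := rowle_entry i j (rowle_pow_diff N c1 b0' rA rB' rAB).
rewrite mxE [X in nrm (_ + X)]mxE in H.
have cb : c ^+ N <= expR (y + n%:R * (`|t| + 1)).
  apply: le_trans (expR_pow_bound (addr_ge0 y0 b0) N0) _; rewrite ler_expR lerD2l ler_wpM2l //.
  by apply: le_trans (_ : `|t| <= _); [rewrite ler_piMl | lra].
have fin : N%:R * (n%:R * (e * `|t|) / N%:R) * c ^+ N <= K * e.
  have -> : N%:R * (n%:R * (e * `|t|) / N%:R) = n%:R * `|t| * e by field; rewrite gt_eqF.
  apply: le_trans (ler_wpM2l _ cb) _; first by rewrite !mulr_ge0 // ltW.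
  rewrite /K -!mulrA ler_wpM2l // [e * _]mulrC !mulrA ler_wpM2r ?(ltW e0) //.
  by rewrite ler_wpM2r ?expR_ge0 //; lra.
have tri (P Q S : C) a : nrm (P - Q) <= a -> nrm (Q - S) < d / 2 -> a <= d / 2 -> nrm (P - S) < d.
  move=> u v w; have -> : P - S = (P - Q) + (Q - S) by ring.
  by apply: le_lt_trans (nrmD _ _) _; lra.
by apply: tri H (h1 i j) (le_trans fin _); lra.
Qed.

Lemma lie_scale (s : R) X : lie_algebra G X -> lie_algebra G (toC s *: X).
Proof.
move=> H t; have [E hE GE] := H (t * s); exists E; last exact: GE.
rewrite scalerA -[mkC t 0 * _]/(toC t * toC s) -toCM; exact: hE.
Qed.

End LieAlgebra.

Section UnitaryClosed.
Variables (R : realType) (n : nat).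
Local Notation C := (cplx R).

Lemma unitary_groupP (A : 'M[C]_n) : @unitary_group R n A <-> A *m A^t* = 1%:M.
Proof. by split=> [/unitarymxP|/unitarymxP]. Qed.

Lemma compact_closed_mx (G : set 'M[C]_n) : compact G -> closed G.
Proof. by move=> cG; apply: compact_closed => //; exact: mx_hausdorff. Qed.

Lemma unitary_group_closed : closed (@unitary_group R n).
Proof.
move=> A cl; apply/unitary_groupP/matrixP => i j; apply/eqP; rewrite -subr_eq0 -nrm_eq0.
apply: contrapT => /negP ne; set e := nrm _ in ne.
have e0 : 0 < e by rewrite lt_def ne nrm_ge0.
have [a a0 hA] := rowle_bound A; have [b b0 hB] := rowle_bound (A^t*).
have nn : 0 <= (n%:R : R) by [].
pose K := n%:R * (a + b + n%:R) + 1.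
have K0 : 0 < K by rewrite ltr_wpDl // mulr_ge0 // !addr_ge0.
have [d [d0 d1 dK]] : exists d : R, [/\ 0 < d, d <= 1 & K * d < e].
  exists (Num.min 1 (e / 2 / K)); split; first by rewrite lt_min ltr01 !divr_gt0.
    by rewrite ge_min lexx.
  apply: le_lt_trans (_ : K * (e / 2 / K) < _); first by rewrite ler_pM2l // ge_min lexx orbT.
  by rewrite mulrCA divff ?gt_eqF // mulr1; lra.
have nb : nbhs A [set B : 'M[C]_n | forall i j, nrm (B i j - A i j) < d] by apply/nbhs_mxP; exists d.
have [B [/unitary_groupP hBB /= hB']] := cl _ nb.
have r1 : rowle (A - B) (n%:R * d).
  by apply: rowle_of_entry => p q; rewrite !mxE nrm_distC; exact: ltW (hB' p q).
have r2 : rowle ((A - B)^t*) (n%:R * d).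
  apply: rowle_of_entry => p q; rewrite !mxE nrm_conj nrm_distC; exact: ltW (hB' q p).
have nd : 0 <= n%:R * d by rewrite mulr_ge0 // ltW.
have r3 : rowle B (a + n%:R * d).
  have -> : B = A + (-1) *: (A - B) by rewrite scaleN1r opprB addrCA subrr addr0.
  by apply: rowle_le (rowleD hA (rowleZ (-1) r1)) _; rewrite nrmN nrm1 mul1r.
have eq : A *m A^t* - 1%:M = (A - B) *m A^t* + B *m (A - B)^t*.
  by rewrite -hBB hadjB mulmxBl mulmxBr addrA subrK.
have := rowle_entry i j (rowleD (rowleM b0 r1 hB) (rowleM nd r3 r2)).
rewrite -eq mxE [X in nrm (_ + X)]mxE -/e => fin.
have b1 : (a + n%:R * d) * (n%:R * d) <= (a + n%:R) * (n%:R * d).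
  by rewrite ler_wpM2r // lerD2l ler_piMr.
have b2 : n%:R * d * b + (a + n%:R) * (n%:R * d) <= K * d.
  have -> : K * d = n%:R * d * b + (a + n%:R) * (n%:R * d) + d by rewrite /K; ring.
  by rewrite lerDl ltW.
lra.
Qed.

Lemma unitary_group1 : @unitary_group R n 1%:M.
Proof. by apply/unitary_groupP; rewrite hadj1 mulmx1. Qed.

Lemma unitary_groupM A B : @unitary_group R n A -> @unitary_group R n B -> @unitary_group R n (A *m B).
Proof.
move=> /unitary_groupP a /unitary_groupP b; apply/unitary_groupP.
by rewrite hadjM !mulmxA -(mulmxA A) b mulmx1.
Qed.

End UnitaryClosed.

(** * Loops and the Grassmannian model *)

Section SquareIntegrable.
Variable R : realType.
Local Notation C := (cplx R).
Local Notation mu := (@lebesgue_measure R).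
Local Notation I := (`[0, 2 * pi]%classic : set R).

Lemma mI : measurable (I : set (measurableTypeR R)). Proof. exact: measurable_itv. Qed.

Lemma twopi_gt0 : 0 < 2 * pi :> R. Proof. by rewrite mulr_gt0 ?pi_gt0. Qed.

Lemma muI : mu I = (2 * pi)%:E.
Proof. by rewrite lebesgue_measure_itv /= lte_fin twopi_gt0 oppr0 adde0. Qed.

Lemma integrable_cstI (k : R) : mu.-integrable I (EFin \o cst k).
Proof.
apply/integrableP; split; first by apply/measurable_EFinP; exact: measurable_cst.
rewrite (_ : (fun x => _) = cst (`|k|%:E)) // integral_cst //.
by rewrite [X in (_ * X)%E]muI -EFinM ltry.
Qed.

Lemma sq_integrable (x : R -> R) : measurable_fun I x ->
  (\int[mu]_(t in I) (x t ^+ 2)%:E < +oo)%E ->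
  mu.-integrable I (EFin \o (fun t => x t ^+ 2)) /\ mu.-integrable I (EFin \o x).
Proof.
move=> mx fx.
have i2 : mu.-integrable I (EFin \o (fun t => x t ^+ 2)).
  apply/integrableP; split; first by apply/measurable_EFinP; exact: measurable_funX.
  by under eq_integral => t _ do rewrite /= ger0_norm ?sqr_ge0 //.
split=> //.
have := integrableD mI (integrable_cstI 1) i2.
apply: le_integrable; [exact: mI | exact/measurable_EFinP | move=> t _].
rewrite /= lee_fin [leRHS]ger0_norm ?addr_ge0 ?sqr_ge0 //.
have := sqr_ge0 (`|x t| - 1); rewrite sqrrB1 real_normK ?num_real // => h.
have := sqr_ge0 (x t); have := normr_ge0 (x t); lra.
Qed.

(** The integral of (x - c)^2 is nonnegative; c is chosen as the mean of x. *)
Lemma sq_mean (x : R -> R) : measurable_fun I x ->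
  (\int[mu]_(t in I) (x t ^+ 2)%:E < +oo)%E ->
  RI 0 (2 * pi) x ^+ 2 <= 2 * pi * RI 0 (2 * pi) (fun t => x t ^+ 2).
Proof.
move=> mx fx; have [i2 i1] := sq_integrable mx fx.
have p := twopi_gt0; set X := RI _ _ x; set Y := RI _ _ _.
pose c := X / (2 * pi).
have h : 0 <= RI 0 (2 * pi) (fun t => x t ^+ 2 + (- (2 * c) * x t + c ^+ 2)).
  apply: Rintegral_ge0 => t _.
  have -> : x t ^+ 2 + (- (2 * c) * x t + c ^+ 2) = (x t - c) ^+ 2 by ring.
  exact: sqr_ge0.
have il : mu.-integrable I (EFin \o (fun t => - (2 * c) * x t)).
  exact: (integrableZl mI (- (2 * c)) i1).
have ic := integrable_cstI (c ^+ 2).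
have ilc : mu.-integrable I (EFin \o (fun t => - (2 * c) * x t + c ^+ 2)).
  exact: (integrableD mI il ic).
move: h; rewrite /RI (RintegralD mI i2 ilc) (RintegralD mI il ic) (RintegralZl _ mI i1).
rewrite Rintegral_cst; last exact: mI.
rewrite [X in fine X]muI [fine _]/= -/(RI 0 (2 * pi) x) -/(RI 0 (2 * pi) (fun t => x t ^+ 2)) -/X -/Y => h.
have e : c * (2 * pi) = X by rewrite /c mulfVK // gt_eqF.
have : 0 <= 2 * pi * (Y + (- (2 * c) * X + c ^+ 2 * (2 * pi))) by rewrite mulr_ge0 // ltW.
have -> : 2 * pi * (Y + (- (2 * c) * X + c ^+ 2 * (2 * pi))) =
   2 * pi * Y - 2 * (c * (2 * pi)) * X + (c * (2 * pi)) ^+ 2 by ring.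
rewrite e; move: (2 * pi * Y) => Z h2.
have : 0 <= Z - X ^+ 2 by rewrite (_ : Z - X ^+ 2 = Z - 2 * X * X + X ^+ 2) //; ring.
by rewrite subr_ge0.
Qed.

End SquareIntegrable.

Section Loops.
Variables (R : realType) (n : nat).
Local Notation C := (cplx R).
Local Notation vec := 'cV[cplx R]_n.
Local Notation mu := (@lebesgue_measure R).
Local Notation I := (`[0, 2 * pi]%classic : set R).
Implicit Types f g h : C -> vec.

Definition sqn (v : vec) : R := \sum_a (re (v a 0) ^+ 2 + im (v a 0) ^+ 2).
Definition mea f := forall a, measurable_fun I (fun t => re (f (cis t) a 0)) /\
                              measurable_fun I (fun t => im (f (cis t) a 0)).

Lemma nrm_sq (z : C) : nrm z ^+ 2 = re z ^+ 2 + im z ^+ 2.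
Proof. by rewrite /nrm sqr_sqrtr // addr_ge0 ?sqr_ge0. Qed.

Lemma sqnE v : sqn v = \sum_a nrm (v a 0) ^+ 2.
Proof. by apply: eq_bigr => a _; rewrite nrm_sq. Qed.

Lemma sqn_ge0 v : 0 <= sqn v.
Proof. by rewrite sqnE; apply: sumr_ge0 => a _; exact: sqr_ge0. Qed.

Lemma sqnZ c v : sqn (c *: v) = nrm c ^+ 2 * sqn v.
Proof. by rewrite !sqnE mulr_sumr; apply: eq_bigr => a _; rewrite mxE nrmM exprMn. Qed.

Lemma sqnD u v : sqn (u + v) <= 2 * sqn u + 2 * sqn v.
Proof.
rewrite !sqnE !mulr_sumr -big_split; apply: ler_sum => a _; rewrite mxE /=.
have h := nrmD (u a 0) (v a 0); move: (nrm_ge0 (u a 0 + v a 0)) (nrm_ge0 (u a 0)) (nrm_ge0 (v a 0)) h.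
move: (nrm (u a 0 + v a 0)) (nrm (u a 0)) (nrm (v a 0)) => x y z x0 y0 z0 h.
have : x ^+ 2 <= (y + z) ^+ 2 by rewrite ler_sqr ?nnegrE ?addr_ge0.
have := sqr_ge0 (y - z); rewrite sqrrB sqrrD; lra.
Qed.

Lemma sqn_entry (v : vec) a : nrm (v a 0) ^+ 2 <= sqn v.
Proof.
rewrite sqnE (bigD1 a) //= lerDl; apply: sumr_ge0 => b _; exact: sqr_ge0.
Qed.

Lemma measurable_sqn f : mea f -> measurable_fun I (fun t => (sqn (f (cis t)))%:E).
Proof.
move=> mf; apply/measurable_EFinP; apply: measurable_sum => a.
by apply: measurable_funD; apply: measurable_funX; have [] := mf a.
Qed.

Lemma normsqE f : normsq f = (\int[mu]_(t in I) (sqn (f (cis t)))%:E)%E.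
Proof. by []. Qed.

Lemma normsq_ae (K : R) f g : 0 <= K -> mea f -> mea g ->
  {ae mu, forall t : R, I t -> sqn (f (cis t)) <= K * sqn (g (cis t))} ->
  (normsq f <= K%:E * normsq g)%E.
Proof.
move=> K0 mf mg H; rewrite !normsqE -ge0_integralZl_EFin //.
- apply: ae_ge0_le_integral.
  + exact: mI.
  + by move=> t _; rewrite lee_fin sqn_ge0.
  + exact: measurable_sqn.
  + by move=> t _; rewrite mule_ge0 // lee_fin // sqn_ge0.
  + by apply: measurable_funeM; exact: measurable_sqn.
  + apply: (@filterS _ _ (ae_filter_ringOfSetsType mu) _ _ _ H) => t h It.
    by rewrite -EFinM lee_fin; exact: h.
- by move=> t _; rewrite lee_fin sqn_ge0.
- exact: measurable_sqn.
Qed.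

Lemma meaD f g : mea f -> mea g -> mea (fun l => f l + g l).
Proof.
move=> mf mg a; have [f1 f2] := mf a; have [g1 g2] := mg a; split.
- rewrite (_ : (fun t => _) = (fun t => re (f (cis t) a 0)) \+ (fun t => re (g (cis t) a 0))).
    exact: measurable_funD.
  by apply/funext => t; rewrite mxE reD.
- rewrite (_ : (fun t => _) = (fun t => im (f (cis t) a 0)) \+ (fun t => im (g (cis t) a 0))).
    exact: measurable_funD.
  by apply/funext => t; rewrite mxE imD.
Qed.

Definition ccont (f : C -> C) := forall t : R, {for t, continuous (fun t : R => f (cis t))}.

Lemma ccont_meas (f : C -> C) : ccont f -> measurable_fun I (fun t => re (f (cis t))) /\
   measurable_fun I (fun t => im (f (cis t))).
Proof.
move=> cf; split; apply: measurable_funTS; apply: continuous_measurable_fun => t.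
- by have /cvgC_reim[] := cf t.
- by have /cvgC_reim[] := cf t.
Qed.

Lemma mea_mul m (A : C -> 'M[C]_(n, m)) (h : C -> 'cV[C]_m) :
  (forall i j, ccont (fun l => A l i j)) ->
  (forall a, measurable_fun I (fun t => re (h (cis t) a 0)) /\
             measurable_fun I (fun t => im (h (cis t) a 0))) ->
  mea (fun l => A l *m h l).
Proof.
move=> cA mh a.
have key b : measurable_fun I (fun t => re (A (cis t) a b * h (cis t) b 0)) /\
     measurable_fun I (fun t => im (A (cis t) a b * h (cis t) b 0)).
  have [a1 a2] := ccont_meas (cA a b); have [h1 h2] := mh b; split.
  - rewrite (_ : (fun t => _) = ((fun t => re (A (cis t) a b)) \* (fun t => re (h (cis t) b 0)))
       \- ((fun t => im (A (cis t) a b)) \* (fun t => im (h (cis t) b 0)))).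
      by apply: measurable_funB; apply: measurable_funM.
    by apply/funext => t; rewrite reM.
  - rewrite (_ : (fun t => _) = ((fun t => re (A (cis t) a b)) \* (fun t => im (h (cis t) b 0)))
       \+ ((fun t => im (A (cis t) a b)) \* (fun t => re (h (cis t) b 0)))).
      by apply: measurable_funD; apply: measurable_funM.
    by apply/funext => t; rewrite imM.
have re_sum (s : seq 'I_m) (F : 'I_m -> C) : re (\sum_(i <- s) F i) = \sum_(i <- s) re (F i).
  by elim/big_rec2: _ => // i x y _ <-; rewrite reD.
have im_sum (s : seq 'I_m) (F : 'I_m -> C) : im (\sum_(i <- s) F i) = \sum_(i <- s) im (F i).
  by elim/big_rec2: _ => // i x y _ <-; rewrite imD.
split.
- rewrite (_ : (fun t => _) = (fun t => \sum_b re (A (cis t) a b * h (cis t) b 0))).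
    by apply: measurable_sum => b; have [] := key b.
  by apply/funext => t; rewrite mxE re_sum.
- rewrite (_ : (fun t => _) = (fun t => \sum_b im (A (cis t) a b * h (cis t) b 0))).
    by apply: measurable_sum => b; have [] := key b.
  by apply/funext => t; rewrite mxE im_sum.
Qed.

Lemma meaZ (c : C -> C) f : ccont c -> mea f -> mea (fun l => c l *: f l).
Proof.
move=> cc mf; have h := @mea_mul n (fun l => (c l)%:M) f _ mf.
have E : (fun l => (c l)%:M *m f l) = (fun l => c l *: f l) by apply/funext => l; rewrite mul_scalar_mx.
rewrite -E; apply: h => i j t.
have [->|/negbTE ij] := eqVneq i j.
  rewrite (_ : (fun t : R => _) = (fun t : R => c (cis t))); first exact: cc.
  by apply/funext => s; rewrite mxE eqxx.
rewrite (_ : (fun t : R => _) = (fun t : R => 0)); first exact: cvg_cst.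
by apply/funext => s; rewrite mxE ij.
Qed.

Lemma meaB f g : mea f -> mea g -> mea (fun l => f l - g l).
Proof.
move=> mf mg; have -> : (fun l => f l - g l) = (fun l => f l + (-1) *: g l).
  by apply/funext => l; rewrite scaleN1r.
have cc : ccont (fun=> -1) by move=> t; exact: cvg_cst.
exact: (meaD mf (meaZ cc mg)).
Qed.

Lemma mea_ccont f : (forall a, ccont (fun l => f l a 0)) -> mea f.
Proof. by move=> H a; exact: (ccont_meas (H a)). Qed.

Lemma ccontX k : ccont (fun l => l ^+ k).
Proof.
move=> t; elim: k => [|k IH]; first by rewrite (_ : (fun t => _) = fun=> 1) //; exact: cvg_cst.
rewrite (_ : (fun t : R => _) = (fun t : R => cis t * cis t ^+ k)); last by apply/funext => s; rewrite exprS.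
by apply: continuousM; [exact: continuous_cis | exact: IH].
Qed.

Lemma ccontXV k : ccont (fun l => (l ^+ k)^-1).
Proof.
move=> t; apply: continuousV; last exact: ccontX.
by rewrite expf_neq0 // circle_neq0 //; exact: circle_cis.
Qed.

Lemma ccont_pl m p K (f : C -> 'M[C]_(m, p)) a i j : pl K f a -> ccont (fun l => f l i j).
Proof.
move=> [_ H] t.
rewrite (_ : (fun t : R => _) = (fun t : R => \sum_(k < K) cis t ^+ k * a k i j)); last first.
  apply/funext => s; rewrite H ?summxE; last exact: circle_cis.
  by apply: eq_bigr => k _; rewrite mxE.
elim: (index_enum _) => [|k s IH].
  by rewrite (_ : (fun t => _) = fun=> 0); [exact: cvg_cst | apply/funext => x; rewrite big_nil].
rewrite (_ : (fun t : R => _) = (fun t : R => cis t ^+ k * a k i j + \sum_(j0 <- s) cis t ^+ j0 * a j0 i j)).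
  apply: continuousD; last exact: IH.
  apply: continuousM; last exact: cvg_cst.
  exact: ccontX.
by apply/funext => x; rewrite big_cons.
Qed.

Lemma mea_poly N (v : nat -> vec) : mea (fun l => \sum_(i < N) l ^+ i *: v i).
Proof.
apply: mea_ccont => a; pose v' k := if (k < N)%N then v k else 0.
apply: (@ccont_pl _ _ N _ v'); split=> [k kN|l _]; first by rewrite /v' ltnNge kN.
by apply: eq_bigr => i _; rewrite /v' ltn_ord.
Qed.

Lemma normsqD f g : mea f -> mea g -> (normsq (fun l => (f l + g l)%R) <= 2%:E * normsq f + 2%:E * normsq g)%E.
Proof.
move=> mf mg; have q h : forall t : R, I t -> (0%E <= (sqn (h (cis t)))%:E)%E by move=> t _; rewrite lee_fin sqn_ge0.
have q2 h : forall t : R, I t -> (0%E <= 2%:E * (sqn (h (cis t)))%:E)%E.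
  by move=> t _; rewrite mule_ge0 // lee_fin sqn_ge0.
have m2 h : mea h -> measurable_fun I (fun t => 2%:E * (sqn (h (cis t)))%:E)%E.
  by move=> mh; apply: measurable_funeM; exact: measurable_sqn.
rewrite !normsqE -(ge0_integralZl_EFin _ (@mI R) (q f) (measurable_sqn mf)) //.
rewrite -(ge0_integralZl_EFin _ (@mI R) (q g) (measurable_sqn mg)) //.
rewrite -(ge0_integralD _ (@mI R) (q2 f) (m2 f mf) (q2 g) (m2 g mg)).
apply: ge0_le_integral; [exact: mI | exact: (q (fun l => f l + g l)) | exact: (measurable_sqn (meaD mf mg)) | |].
- apply: emeasurable_funD; exact: m2.
- by move=> t _; rewrite -!EFinM -EFinD lee_fin sqnD.
Qed.

Lemma L2D f g : L2 f -> L2 g -> L2 (fun l => f l + g l).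
Proof.
case=> mf ff [mg fg]; split; first exact: (meaD mf mg).
apply: le_lt_trans (normsqD mf mg) _.
by rewrite lte_add_pinfty // lte_mul_pinfty.
Qed.

Lemma L2Z (c : C -> C) f : ccont c -> (forall l, circle l -> nrm (c l) = 1) -> L2 f -> L2 (fun l => c l *: f l).
Proof.
move=> cc c1 [mf ff]; split; first exact: (meaZ cc mf).
rewrite (_ : normsq _ = normsq f) //; rewrite !normsqE; apply: eq_integral => t _.
by rewrite sqnZ c1 ?expr1n ?mul1r //; exact: circle_cis.
Qed.

Lemma L2N f : L2 f -> L2 (fun l => - f l).
Proof.
move=> hf; rewrite (_ : (fun l => - f l) = (fun l => (-1) *: f l)); last first.
  by apply/funext => l; rewrite scaleN1r.
apply: (@L2Z (fun=> -1)) => //; first by move=> t; exact: cvg_cst.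
by move=> l _; rewrite nrmN nrm1.
Qed.

Lemma L2B f g : L2 f -> L2 g -> L2 (fun l => f l - g l).
Proof. by move=> hf hg; apply: L2D => //; exact: L2N. Qed.

Lemma L2_ccont f : (forall a, ccont (fun l => f l a 0)) -> L2 f.
Proof.
move=> cf; split; first exact: mea_ccont.
rewrite /normsq.
pose g t := \sum_a (re (f (cis t) a 0) ^+ 2 + im (f (cis t) a 0) ^+ 2) : R.
have cg : con 0 (2 * pi) g.
  move=> t _; rewrite /g; elim: (index_enum _) => [|a s IH].
    by rewrite (_ : (fun t => _) = fun=> 0); [exact: cvg_cst | apply/funext => x; rewrite big_nil].
  rewrite (_ : (fun t : R => _) = (fun t : R => (re (f (cis t) a 0) * re (f (cis t) a 0) +
      im (f (cis t) a 0) * im (f (cis t) a 0)) + \sum_(b <- s) (re (f (cis t) b 0) ^+ 2 + im (f (cis t) b 0) ^+ 2))).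
    have /cvgC_reim[c1 c2] := cf a t.
    apply: continuousD; last exact: IH.
    by apply: continuousD; apply: continuousM; [exact: c1 | exact: c1 | exact: c2 | exact: c2].
  by apply/funext => x; rewrite big_cons !expr2.
have := con_integrable cg => /integrableP[_]; apply: le_lt_trans.
rewrite le_eqVlt; apply/orP; left; apply/eqP; apply: eq_integral => t _.
rewrite /= ger0_norm //; apply: sumr_ge0 => a _; by rewrite addr_ge0 ?sqr_ge0.
Qed.

(** 2 pi times the constant Fourier coefficient; the other coefficients are reached by multiplying f
    by powers of l. *)
Definition Mn f a : C := CI 0 (2 * pi) (fun t => f (cis t) a 0).

Lemma L2_parts f a : L2 f ->
  [/\ measurable_fun I (fun t => re (f (cis t) a 0)),
      (\int[mu]_(t in I) (re (f (cis t) a 0) ^+ 2)%:E <= normsq f)%E,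
      measurable_fun I (fun t => im (f (cis t) a 0)) &
      (\int[mu]_(t in I) (im (f (cis t) a 0) ^+ 2)%:E <= normsq f)%E].
Proof.
case=> mf ff; have [f1 f2] := mf a; split=> //.
- apply: ge0_le_integral; first exact: mI.
  + by move=> t _; rewrite lee_fin sqr_ge0.
  + by apply/measurable_EFinP; exact: measurable_funX.
  + exact: measurable_sqn.
  + move=> t _; rewrite lee_fin; apply: le_trans (sqn_entry _ a).
    by rewrite nrm_sq lerDl sqr_ge0.
- apply: ge0_le_integral; first exact: mI.
  + by move=> t _; rewrite lee_fin sqr_ge0.
  + by apply/measurable_EFinP; exact: measurable_funX.
  + exact: measurable_sqn.
  + move=> t _; rewrite lee_fin; apply: le_trans (sqn_entry _ a).
    by rewrite nrm_sq lerDr sqr_ge0.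
Qed.

Lemma Mn_bound f a (e : R) : L2 f -> (normsq f <= e%:E)%E -> nrm (Mn f a) ^+ 2 <= 4 * pi * e.
Proof.
move=> hf fe; have [m1 l1 m2 l2] := L2_parts a hf.
have key (x : R -> R) : measurable_fun I x -> (\int[mu]_(t in I) (x t ^+ 2)%:E <= normsq f)%E ->
    RI 0 (2 * pi) x ^+ 2 <= 2 * pi * e.
  move=> mx lx; have fx := le_trans lx fe.
  apply: le_trans (sq_mean mx (le_lt_trans fx (ltry e))) _.
  rewrite ler_pM2l ?twopi_gt0 //.
  rewrite -lee_fin /RI /Rintegral fineK ?(le_trans _ fx) //.
  rewrite ge0_fin_numE; first exact: le_lt_trans fx (ltry e).
  by apply: integral_ge0 => t _; rewrite lee_fin sqr_ge0.
rewrite nrm_sq re_CI im_CI; have := key _ m1 l1; have := key _ m2 l2.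
rewrite (_ : 4 * pi * e = 2 * pi * e + 2 * pi * e :> R); last by ring.
by move=> h1 h2; rewrite lerD.
Qed.

Lemma L2_integrable f a : L2 f -> mu.-integrable I (EFin \o (fun t => re (f (cis t) a 0))) /\
  mu.-integrable I (EFin \o (fun t => im (f (cis t) a 0))).
Proof.
move=> hf; have [m1 l1 m2 l2] := L2_parts a hf; have [_ ff] := hf.
split; [have [_ h] := sq_integrable m1 (le_lt_trans l1 ff)
       | have [_ h] := sq_integrable m2 (le_lt_trans l2 ff)]; exact: h.
Qed.

Lemma MnB f g a : L2 f -> L2 g -> Mn (fun l => f l - g l) a = Mn f a - Mn g a.
Proof.
move=> hf hg; have [f1 f2] := L2_integrable a hf; have [g1 g2] := L2_integrable a hg.
apply: cplxP.
- rewrite reB !re_CI /RI -(RintegralB (@mI R) f1 g1).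
  by apply: eq_Rintegral => t _; rewrite !mxE reB.
- rewrite imB !im_CI /RI -(RintegralB (@mI R) f2 g2).
  by apply: eq_Rintegral => t _; rewrite !mxE imB.
Qed.

Lemma small_zero (z : C) (K : R) : 0 <= K -> (forall e : R, 0 < e -> nrm z ^+ 2 <= K * e) -> z = 0.
Proof.
move=> K0 H; apply/eqP; rewrite -nrm_eq0; apply: contrapT => /negP ne.
have z0 : 0 < nrm z ^+ 2 by rewrite exprn_gt0 // lt_def ne nrm_ge0.
have K1 : 0 < K + 1 by lra.
have := H (nrm z ^+ 2 / (K + 1)) (divr_gt0 z0 K1).
rewrite mulrA ler_pdivlMr // mulrC ler_pM2r //; lra.
Qed.

Lemma Mn_ae f g a : L2 f -> L2 g -> ae_circle f g -> Mn f a = Mn g a.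
Proof.
move=> hf hg fg; apply/eqP; rewrite -subr_eq0 -MnB //; apply/eqP.
have hB := L2B hf hg.
have z : (normsq (fun l => (f l - g l)%R) <= 0%:E)%E.
  have := @normsq_ae 0 (fun l => f l - g l) f (lexx 0) hB.1 hf.1; rewrite mul0e; apply.
  apply: (@filterS _ _ (ae_filter_ringOfSetsType mu) _ _ _ fg) => t h It; rewrite h // subrr mul0r sqnE big1 // => b _; by rewrite mxE nrm0 expr0n.
apply: (@small_zero _ 1) => // e e0; rewrite mul1r.
by apply: le_trans (Mn_bound a hB z) _; rewrite mulr0 ltW.
Qed.

Lemma CI_cis i k : CI 0 (2 * pi) (fun t => cis t ^+ i / cis t ^+ k) = if i == k then toC (2 * pi) else 0 :> C.
Proof.
have p := twopi_gt0 R.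
have [->|ik] := eqVneq i k.
  rewrite (@CI_eq _ _ _ _ (fun=> 1)); last first.
    by move=> x _; rewrite divff // expf_neq0 // circle_neq0 //; exact: circle_cis.
  by rewrite CI_cst ?(ltW p) // subr0 mul1r.
pose ka : R := i%:R - k%:R.
have k0 : ka != 0 by rewrite subr_eq0 eqr_nat.
have ex (t : R) : cis t ^+ i / cis t ^+ k = cis (ka * t).
  have z0 := circle_neq0 (circle_cis t).
  apply: (mulIf (expf_neq0 k z0)); rewrite mulfVK ?expf_neq0 // !cisX -cisD; congr cis.
  by rewrite /ka -[t *+ i]mulr_natl -[t *+ k]mulr_natl mulrBl subrK.
pose F (t : R) := (toC ka * imagI R)^-1 * cis (ka * t).
have i0 : toC ka * imagI R != 0.
  by rewrite mulf_neq0 // -nrm_eq0 ?nrm_toC ?normr_eq0 // /nrm /imagI /re /im /= expr0n add0r expr1n sqrtr1 oner_eq0.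
have cX m : conC 0 (2 * pi) (fun t : R => cis t ^+ m).
  by move=> x _; exact: (@ccontX m x).
have cV m : conC 0 (2 * pi) (fun t : R => (cis t ^+ m)^-1).
  by move=> x _; exact: (@ccontXV m x).
rewrite (@CI_FTC _ _ _ _ F (ltW p)).
- rewrite /F -mulrBr mulr0 -[cis (ka * (2 * pi))]ex cis2pi cis0 !expr1n divr1 subrr mulr0; exact: erefl.
- exact: conCM (cX i) (cV k).
- move=> x _; rewrite ex; apply: cder_eq (cderZ _ (cder_cis ka x)) _.
  by rewrite mulrA mulVf // mul1r.
Qed.

Lemma Mn_laurent K f (c : nat -> vec) k a : (forall l, circle l -> l ^+ k *: f l = \sum_(i < K) l ^+ i *: c i) ->
  Mn f a = \sum_(i < K) (if i == k :> nat then toC (2 * pi) * c i a 0 else 0).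
Proof.
move=> H; rewrite /Mn (@CI_eq _ _ _ _ (fun t => \sum_(i < K) c i a 0 * (cis t ^+ i / cis t ^+ k))); last first.
  move=> t _; have z0 := circle_neq0 (circle_cis t).
  have := congr1 (fun v : vec => v a 0) (H _ (circle_cis t)); rewrite !mxE summxE => h.
  apply: (mulfI (expf_neq0 k z0)); rewrite h mulr_sumr; apply: eq_bigr => i _.
  by rewrite mxE [c i a 0 * _]mulrC mulrA mulrCA divff ?mulr1 // expf_neq0.
have cc i : conC 0 (2 * pi) (fun t : R => cis t ^+ i / cis t ^+ k).
  by apply: conCM => x _; [exact: (@ccontX i x) | exact: (@ccontXV k x)].
have [_ ->] := @CI_sum R 0 (2 * pi) _ (index_enum (ordinal K)) (fun i t => c i a 0 * (cis t ^+ i / cis t ^+ k))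
  (ltW (twopi_gt0 R)) (fun i => conCM (@conC_cst R 0 (2 * pi) (c i a 0)) (cc i)).
apply: eq_bigr => i _; rewrite CIZ ?CI_cis; last exact: cc.
by case: eqP => _; rewrite ?mulr0 // mulrC.
Qed.

(** Clear for polynomials, and [Mn] is continuous in the L^2 norm by [Mn_bound]. *)
Lemma Hplus_mean f m a : Hplus f -> (0 < m)%N -> Mn (fun l => l ^+ m *: f l) a = 0.
Proof.
move=> [hf H] m0; apply: (@small_zero _ (4 * pi)); first by rewrite mulr_ge0 // pi_ge0.
move=> e e0; have [N [v hv]] := H e e0.
pose p l : vec := \sum_(i < N) l ^+ i *: v i.
have hp : L2 p.
  apply: L2_ccont => b; pose v' k := if (k < N)%N then v k else 0.
  apply: (@ccont_pl _ _ N _ v'); split=> [k kN|l _]; first by rewrite /v' ltnNge kN.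
  by apply: eq_bigr => i _; rewrite /v' ltn_ord.
have u1 (l : C) : circle l -> nrm (l ^+ m) = 1 by move=> /circleE cl; rewrite nrmX cl expr1n.
have hmf := L2Z (@ccontX m) u1 hf; have hmp := L2Z (@ccontX m) u1 hp.
have z : Mn (fun l => l ^+ m *: p l) a = 0.
  rewrite (@Mn_laurent (m + N) _ (fun i => if (i < m)%N then 0 else v (i - m)%N) 0) => [|l cl].
    rewrite big1 // => i _; case: eqP => // -> ; by rewrite m0 mxE mulr0.
  rewrite expr0 scale1r /p scaler_sumr big_split_ord /= [X in _ = X + _]big1 ?add0r.
    by apply: eq_bigr => i _; rewrite ltnNge leq_addr /= addKn exprD scalerA.
  by move=> i _; rewrite ltn_ord scaler0.
rewrite -[Mn _ a]subr0 -{1}z -MnB //.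
apply: Mn_bound; first exact: L2B.
apply: ltW; apply: le_lt_trans hv; rewrite /normsq le_eqVlt; apply/orP; left; apply/eqP.
apply: eq_integral => t _; congr EFin.
rewrite -!/(sqn _).
by rewrite -/(p _) -scalerBr sqnZ u1 ?expr1n ?mul1r //; exact: circle_cis.
Qed.

Lemma Hplus_noneg K N f (c : nat -> vec) : Hplus f -> pl K (fun l => l ^+ N *: f l) c ->
  forall k, (k < N)%N -> c k = 0.
Proof.
move=> hf hc k kN; apply/matrixP => a b; rewrite ord1 [RHS]mxE.
have {}hc := pl_widen (leq_maxl K k.+1) hc; have kL : (k < maxn K k.+1)%N by rewrite leq_maxr.
move: (maxn K k.+1) hc kL => L [_ H] kL.
have m0 : (0 < N - k)%N by rewrite subn_gt0.
have := Hplus_mean a hf m0.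
rewrite (@Mn_laurent L _ c k) => [|l cl]; last by rewrite scalerA -exprD subnKC ?H // ltnW.
rewrite (bigD1 (Ordinal kL)) //= eqxx big1 ?addr0; last first.
  move=> i ik; have -> : (i == k :> nat) = false by apply/negbTE.
  exact: erefl.
move/eqP; rewrite mulf_eq0 => /orP[/eqP h|/eqP //].
by have := twopi_gt0 R; rewrite -toC_lt h toC0 ltxx.
Qed.

Lemma Hplus_poly K f (c : nat -> vec) : pl K f c -> Hplus f.
Proof.
move=> hf; split; first by apply: L2_ccont => a; exact: ccont_pl hf.
move=> e e0; exists K, c; rewrite normsqE (@eq_integral _ _ _ _ _ (cst 0%E)).
  by rewrite integral0 lte_fin.
move=> t _; rewrite hf.2; last exact: circle_cis.
by rewrite subrr sqnE big1 // => a _; rewrite mxE nrm0 expr0n.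
Qed.

Lemma Hplus_cst (v : vec) : Hplus (fun=> v).
Proof.
apply: (@Hplus_poly 1 _ (fun k => if k is 0%N then v else 0)); split; first by case.
by move=> l _; rewrite big_ord_recl big_ord0 addr0 expr0 scale1r.
Qed.

Lemma pl_bound m p K (A : C -> 'M[C]_(m, p)) c : pl K A c ->
  exists2 B : R, 0 <= B & forall l, circle l -> forall i j, nrm (A l i j) <= B.
Proof.
move=> [_ H]; exists (\sum_(k < K) \sum_i \sum_j nrm (c k i j)).
  by do 3 (apply: sumr_ge0 => ? _); exact: nrm_ge0.
move=> l cl i j; rewrite H // summxE; apply: le_trans (nrm_sum _ _ _) _.
apply: ler_sum => k _; rewrite mxE nrmM nrmX; have /circleE -> := cl.
rewrite expr1n mul1r (bigD1 i) //= (bigD1 j) //= -addrA lerDl addr_ge0 //.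
  by apply: sumr_ge0 => ? _; exact: nrm_ge0.
by do 2 (apply: sumr_ge0 => ? _); exact: nrm_ge0.
Qed.

Lemma sqn_mul_bound (A : 'M[C]_n) (B : R) w : 0 <= B -> (forall i j, nrm (A i j) <= B) ->
  sqn (A *m w) <= n%:R * (n%:R * B) ^+ 2 * sqn w.
Proof.
move=> B0 hB; set s := Num.sqrt (sqn w).
have s2 : s ^+ 2 = sqn w by rewrite sqr_sqrtr // sqn_ge0.
have hw b : nrm (w b 0) <= s.
  rewrite -(ler_pXn2r (ltn0Sn 1)) ?nnegrE ?nrm_ge0 ?sqrtr_ge0 // s2; exact: sqn_entry.
rewrite sqnE -s2 -mulrA -exprMn.
have -> : n%:R * (n%:R * B * s) ^+ 2 = \sum_(a < n) (n%:R * B * s) ^+ 2.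
  by rewrite sumr_const card_ord mulr_natl.
apply: ler_sum => a _; rewrite ler_pXn2r ?nnegrE ?nrm_ge0 ?mulr_ge0 ?sqrtr_ge0 //.
rewrite mxE; apply: le_trans (nrm_sum _ _ _) _.
have -> : n%:R * B * s = \sum_(b < n) B * s by rewrite sumr_const card_ord -[RHS]mulr_natl mulrA.
by apply: ler_sum => b _; rewrite nrmM ler_pM ?nrm_ge0.
Qed.

Lemma Hplus_mul K (A : C -> 'M[C]_n) c h f : pl K A c -> Hplus h -> L2 f ->
  ae_circle f (fun l => A l *m h l) -> Hplus f.
Proof.
move=> hA [hh H] hf fA; split=> // e e0.
have [B B0 hB] := pl_bound hA.
pose Q := n%:R * (n%:R * B) ^+ 2 + 1.
have Q1 : 0 < Q by rewrite /Q ltr_wpDl // mulr_ge0 // sqr_ge0.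
have [N [v hv]] := H (e / Q) (divr_gt0 e0 Q1).
pose v' k := if (k < N)%N then v k else 0.
have hp : pl N (fun l => \sum_(i < N) l ^+ i *: v i) v'.
  split=> [k kN|l _]; first by rewrite /v' ltnNge kN.
  by apply: eq_bigr => i _; rewrite /v' ltn_ord.
have hq := pl_mul hA hp.
exists (K + N)%N, (fun s => \sum_(k < s.+1) c (s - k)%N *m v' k).
have mp : mea (fun l => \sum_(i < N) l ^+ i *: v i) by apply: mea_poly.
apply: le_lt_trans (@normsq_ae Q _ (fun l => h l - \sum_(i < N) l ^+ i *: v i) (ltW Q1) _ _ _) _.
- apply: (meaB hf.1); exact: (mea_poly (K + N) (fun i => \sum_(k < i.+1) c (i - k)%N *m v' k)).
- exact: (meaB hh.1 mp).
- apply: (@filterS _ _ (ae_filter_ringOfSetsType mu) _ _ _ fA) => t E It; rewrite E // -hq.2; last exact: circle_cis.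
  rewrite -mulmxBr; apply: le_trans (sqn_mul_bound _ B0 (hB _ (circle_cis t))) _.
  by rewrite ler_wpM2r ?sqn_ge0 // /Q lerDl.
- have -> : e%:E = (Q%:E * (e / Q)%:E)%E by rewrite -EFinM mulrCA divff ?mulr1 // gt_eqF.
  by rewrite lte_pmul2l.
Qed.

Lemma Mn_pl K f (c : nat -> vec) a : pl K f c -> Mn f a = toC (2 * pi) * c 0%N a 0.
Proof.
move=> hc; have [_ H] := pl_widen (leqnSn K) hc.
rewrite (@Mn_laurent K.+1 _ c 0) => [|l cl]; last by rewrite expr0 scale1r H.
by rewrite (bigD1 ord0) //= big1 ?addr0 // => i i0; rewrite -lt0n in i0; rewrite gtn_eqF.
Qed.

Lemma normsq_cst (u : vec) : normsq (fun=> u) = (2 * pi * sqn u)%:E.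
Proof.
rewrite normsqE (_ : (fun t => _) = cst (sqn u)%:E) // integral_cst //.
by rewrite [X in (_ * X)%E]muI -EFinM mulrC.
Qed.

(** Approximants of (h - h(0)) / l are those of h with the constant term dropped and the indices
    lowered. The constant terms of h and of its approximant differ by a mean value, which [Mn_bound]
    controls. *)
Lemma Hplus_split h : Hplus h ->
  Hplus (fun l => (l ^+ 1)^-1 *: (h l - \col_b ((toC (2 * pi))^-1 * Mn h b))).
Proof.
move=> [hh H]; set a := \col_b _.
have tp0 : toC (2 * pi : R) != 0 by rewrite -nrm_eq0 nrm_toC normr_eq0 gt_eqF // twopi_gt0.
have iv1 (l : C) : circle l -> nrm ((l ^+ 1)^-1) = 1.
  by move=> /circleE cl; rewrite nrmV nrmX cl expr1n invr1.
have La (u : vec) : L2 (fun=> u) by apply: L2_ccont => b t; exact: cvg_cst.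
split; first by apply: (L2Z (@ccontXV 1) iv1); exact: L2B.
(* 2 and 4 pi n come from [normsqD] applied to the approximation error and to the constant vector of
   n entries; the final 1 makes the inequality strict. *)
move=> e e0; pose K := 2 + 4 * pi * n%:R + 1 : R.
have p0 := pi_gt0 R.
have K0 : 0 < K.
  have : 0 <= 4 * pi * n%:R :> R by rewrite !mulr_ge0 // ltW.
  rewrite /K; lra.
pose e' := e / K; have e'0 : 0 < e' by rewrite divr_gt0.
have [N [v hv]] := H e' e'0.
pose v' k := if (k < N)%N then v k else 0.
pose p l : vec := \sum_(i < N) l ^+ i *: v i.
have hp : pl N p v'.
  split=> [k kN|l _]; first by rewrite /v' ltnNge kN.
  by apply: eq_bigr => i _; rewrite /v' ltn_ord.
have Lp : L2 p by apply: L2_ccont => b; exact: ccont_pl hp.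
have Lr := L2B hh Lp.
have ha b : nrm ((a - v' 0%N) b 0) ^+ 2 <= e'.
  have -> : (a - v' 0%N) b 0 = (toC (2 * pi))^-1 * Mn (fun l => h l - p l) b.
    by rewrite MnB // (Mn_pl b hp) mulrBr mulKf // !mxE.
  rewrite nrmM exprMn nrmV nrm_toC gtr0_norm ?twopi_gt0 //.
  apply: le_trans (ler_wpM2l _ (Mn_bound b Lr (ltW hv))) _; first exact: sqr_ge0.
  have -> : (2 * pi)^-1 ^+ 2 * (4 * pi * e') = e' / pi :> R.
    by clear -p0; move: (pi : R) p0 => x x0; field; rewrite gt_eqF.
  rewrite ler_pdivrMr // ler_peMr ?(ltW e'0) //.
  by have := pi_ge2 R; lra.
have sa : sqn (a - v' 0%N) <= n%:R * e'.
  rewrite sqnE mulr_natl -[X in _ *+ X](card_ord n) -sumr_const; exact: ler_sum.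
exists N, (fun i => v' i.+1).
have E l : circle l -> (l ^+ 1)^-1 *: (h l - a) - \sum_(i < N) l ^+ i *: v' i.+1 =
    (l ^+ 1)^-1 *: ((h l - p l) + - (a - v' 0%N)).
  move=> cl; have l0 := circle_neq0 cl.
  have -> : p l = v' 0%N + l *: \sum_(i < N) l ^+ i *: v' i.+1.
    rewrite (pl_widen (leqnSn N) hp).2 // big_ord_recl expr0 scale1r scaler_sumr; congr (_ + _).
    by apply: eq_bigr => i _; rewrite scalerA -exprS.
  have -> : h l - (v' 0%N + l *: \sum_(i < N) l ^+ i *: v' i.+1) + - (a - v' 0%N) =
     (h l - a) - l *: \sum_(i < N) l ^+ i *: v' i.+1.
    clearbody a; clear; move: (\sum_(i < N) _) (h l) (v' 0%N) (a) => S x y z.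
    by apply/matrixP => i k; rewrite !mxE; ring.
  by rewrite [RHS]scalerBr expr1 [_ *: (l *: _)]scalerA mulVf // scale1r.
have m1 : mea (fun l => h l - p l) by exact: Lr.1.
have L3 : L2 (fun=> - (a - v' 0%N)) by exact: La.
have le1 := normsqD m1 L3.1.
apply: (@le_lt_trans _ _ (normsq (fun l => (h l - p l) + - (a - v' 0%N))%R)).
  rewrite le_eqVlt; apply/orP; left; apply/eqP; rewrite !normsqE; apply: eq_integral => t _.
  by rewrite E ?sqnZ ?iv1 ?expr1n ?mul1r //; exact: circle_cis.
apply: le_lt_trans le1 _; rewrite normsq_cst.
have sN : sqn (- (a - v' 0%N)) <= n%:R * e' by rewrite -scaleN1r sqnZ nrmN nrm1 expr1n mul1r.
have q : (2%:E * normsq (fun l => (h l - p l)%R) <= (2 * e')%:E)%E.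
  by rewrite EFinM lee_pmul2l // ltW.
apply: (@le_lt_trans _ _ ((2 * e')%:E + (2 * (2 * pi * (n%:R * e')))%:E)%E).
  apply: leeD => //; rewrite -EFinM lee_fin ler_wpM2l // ler_wpM2l // ltW //; exact: twopi_gt0.
rewrite -EFinD lte_fin.
have -> : e = K * e' by rewrite /e' mulrCA divff ?mulr1 // gt_eqF.
rewrite /K; move: e'0; set z := pi * (n%:R * e'); move=> z0.
have -> : (2 + 4 * pi * n%:R + 1) * e' = 2 * e' + 4 * z + e' by rewrite /z; ring.
by rewrite -mulrA -/z; lra.
Qed.

End Loops.

Section WandGr.
Variables (R : realType) (n : nat).
Local Notation C := (cplx R).
Local Notation vec := 'cV[cplx R]_n.

Lemma smooth_loop_ccont (g : loop R n) : smooth_loop g -> forall i j, ccont (fun l => g l i j).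
Proof.
move=> hg i j t; have [[c1 _] [c2 _]] := hg i j 0%N.
by apply/cvgC_reim; split; [exact: (c1 t I) | exact: (c2 t I)].
Qed.

Lemma laurent_pl (g : loop R n) c : laurent_expansion g c -> exists N : nat,
  (forall i : int, c i != 0 -> - N%:Z <= i <= N%:Z) /\
  pl N.*2.+1 (fun l => l ^+ N *: g l) (fun k => c (k%:Z - N%:Z)).
Proof.
case=> N [h1 h2]; exists N; split=> //; split=> [k kN|l cl].
  apply/eqP; apply: contraTT kN => /h1 /andP[_]; rewrite -ltnNge ltnS => h.
  have : k%:Z <= N.*2%:Z by rewrite -addnn PoszD -lerBlDr.
  by rewrite lez_nat.
have l0 := circle_neq0 cl.
rewrite h2 // scaler_sumr; apply: eq_bigr => k _; rewrite scalerA; congr (_ *: _).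
by rewrite !exprnP -expfzDr // addrC subrK.
Qed.

Variable Psi : loop R n.
Hypothesis sPsi : smooth_loop Psi.
Let cPsi := smooth_loop_ccont sPsi.

Lemma Psi_vec_ccont (v : vec) a : ccont (fun l => (Psi l *m v) a 0).
Proof.
move=> t; rewrite (_ : (fun t : R => _) = (fun t : R => \sum_b Psi (cis t) a b * v b 0)); last first.
  by apply/funext => s; rewrite mxE.
elim: (index_enum _) => [|b s IH].
  by rewrite (_ : (fun t => _) = fun=> 0); [exact: cvg_cst | apply/funext => x; rewrite big_nil].
rewrite (_ : (fun t : R => _) = (fun t : R => Psi (cis t) a b * v b 0 + \sum_(b <- s) Psi (cis t) a b * v b 0)).
  by apply: continuousD; [apply: continuousM; [exact: cPsi | exact: cvg_cst] | exact: IH].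
by apply/funext => x; rewrite big_cons.
Qed.

Lemma vec_in_W (v : vec) : Wspace Psi (fun l => Psi l *m v).
Proof.
split; first by apply: L2_ccont => a; exact: Psi_vec_ccont.
exists (fun=> v); first exact: Hplus_cst.
by apply: aeW => t _.
Qed.

Lemma col_in_W j : Wspace Psi (fun l => col j (Psi l)).
Proof.
rewrite (_ : (fun l => _) = (fun l => Psi l *m delta_mx j 0)); first exact: vec_in_W.
by apply/funext => l; rewrite colE.
Qed.

Lemma Gr_noneg r c (i : int) : Gr r (Wspace Psi) -> laurent_expansion Psi c -> i < 0 -> c i = 0.
Proof.
case=> _ _ _ _ WH /laurent_pl[N [supp hc]] i0.
apply/eqP; apply: contraT => ci; have /andP[h1 _] := supp i ci.
have hN : 0 <= N%:Z + i by rewrite -lerBlDl sub0r.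
case E : (N%:Z + i) hN => [k|//] _.
have iE : i = k%:Z - N%:Z by rewrite -E addrC addKr.
have kN : (k < N)%N by rewrite -ltz_nat -E gtrDl.
suff : c i = 0 by move=> h; rewrite h eqxx in ci.
apply/matrixP => a j; rewrite [RHS]mxE.
have hj := WH _ (col_in_W j).
have pj : pl N.*2.+1 (fun l => l ^+ N *: col j (Psi l)) (fun k => col j (c (k%:Z - N%:Z))).
  split=> [m mN|l cl]; first by rewrite (hc.1 m mN) col0.
  have := congr1 (col j) (hc.2 l cl); rewrite linearZ /= => ->; rewrite linear_sum.
  by apply: eq_bigr => m _; rewrite linearZ.
have := congr1 (fun v : vec => v a 0) (Hplus_noneg hj pj kN).
by rewrite -iE !mxE.
Qed.

(** From l^r H_+ inside W it follows that l^r Phi^* v lies in H_+ for every constant v. A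
    coefficient of Phi of index k > r would contribute the negative frequency r - k. *)
Lemma Gr_degree r K L (Phi Pp : C -> 'M[C]_n) a th :
  Gr r (Wspace Psi) -> (forall l, circle l -> Psi l = Phi l *m Pp l) ->
  pl K Pp a -> (forall l, circle l -> (Phi l)^t* *m Phi l = 1%:M) -> pl L Phi th ->
  forall k, (r < k)%N -> th k = 0.
Proof.
case=> _ _ _ HW _ fact hPp PhiU hth k rk.
have {}hth := pl_widen (leq_trans (leq_maxl L k.+1) (leqnSn _)) hth.
have kL : (k <= maxn L k.+1)%N by rewrite leq_max leqnSn orbT.
move: (maxn L k.+1) hth kL => {}L hth kL.
have hadj := pl_scaleX r (pl_adj hth).
apply/matrixP => j b; rewrite [RHS]mxE.
pose f l := l ^+ r *: ((Phi l)^t* *m delta_mx j 0) : vec.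
have hf : pl (r + L.+1) (fun l => l ^+ L *: f l)
   (fun s => (if (s < r)%N then 0 else if (s - r <= L)%N then (th (L - (s - r))%N)^t* else 0) *m delta_mx j 0).
  split=> [s rs|l cl]; first by rewrite (hadj.1 s rs) mul0mx.
  have := congr1 (mulmx^~ (delta_mx j 0 : vec)) (hadj.2 l cl).
  rewrite /f mulmx_suml -!scalemxAl !scalerA mulrC => ->.
  by apply: eq_bigr => s _; rewrite -scalemxAl.
have cf c0 : ccont (fun l => f l c0 0).
  have h := ccont_pl (i := c0) (j := 0) hf; move=> t.
  rewrite (_ : (fun t : R => _) = (fun t : R => (cis t ^+ L)^-1 * (cis t ^+ L *: f (cis t)) c0 0)); last first.
    by apply/funext => s; rewrite [X in _ * X]mxE mulKf // expf_neq0 // circle_neq0 //; exact: circle_cis.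
  by apply: continuousM; [exact: ccontXV | exact: h].
have Lf : L2 f by apply: L2_ccont.
have hF : shift_by r (@Hplus R n) (fun l => l ^+ r *: (delta_mx j 0 : vec)).
  split.
    apply: L2_ccont => c0 t; rewrite (_ : (fun t : R => _) = (fun t : R => cis t ^+ r * (delta_mx j 0 : vec) c0 0)).
      by apply: continuousM; [exact: ccontX | exact: cvg_cst].
    by apply/funext => s; rewrite mxE.
  exists (fun=> delta_mx j 0); first exact: Hplus_cst.
  by apply: aeW => t _; rewrite mul_scalar_mx.
have [_ [h hh hae]] := HW _ hF.
have fae : ae_circle f (fun l => Pp l *m h l).
  apply: (@filterS _ _ (ae_filter_ringOfSetsType (@lebesgue_measure R)) _ _ _ hae) => t E It.
  rewrite /f scalemxAr E // fact; last exact: circle_cis.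
  by rewrite !mulmxA PhiU ?mul1mx //; exact: circle_cis.
have Hf := Hplus_mul hPp hh Lf fae.
have idx : (L + r - k < L)%N by clear -rk kL; lia.
have rle : (r <= L + r - k)%N by clear -rk kL; lia.
have := Hplus_noneg Hf hf idx.
rewrite ltnNge rle /=.
have -> : (L + r - k - r = L - k)%N by rewrite subnAC addnK.
rewrite leq_subr subKn // => /(congr1 (fun v : vec => v b 0)).
rewrite mxE (bigD1 j) //= !mxE eqxx mulr1 big1 ?addr0; last first.
  by move=> i /negbTE ij; rewrite !mxE ij mulr0.
by move=> h0; rewrite -[LHS]conjCK h0 conjC0.
Qed.

Hypothesis uPsi : forall l, circle l -> Psi l \in unitmx.

(** If f = Psi h, the coordinates are h(0), and [Hplus_split] puts the rest into l W. Two choices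
    differ by a constant vector lying in l H_+, whose mean is zero. *)
Lemma W_basis (f : C -> vec) : Wspace Psi f ->
  exists! a : vec, shift_by 1 (Wspace Psi) (fun l => f l - \sum_(j < n) a j 0 *: col j (Psi l)).
Proof.
case=> Lf [h hh fae].
have sumE (a : vec) l : \sum_(j < n) a j 0 *: col j (Psi l) = Psi l *m a.
  apply/matrixP => i j; rewrite ord1 summxE mxE; apply: eq_bigr => b _.
  by rewrite !mxE mulrC.
have sE (a : vec) : (fun l => f l - \sum_(j < n) a j 0 *: col j (Psi l)) = (fun l => f l - Psi l *m a).
  by apply/funext => l; rewrite sumE.
have La (a : vec) : L2 (fun l => Psi l *m a) by apply: L2_ccont => b; exact: Psi_vec_ccont.
have iv1 (l : C) : circle l -> nrm ((l ^+ 1)^-1) = 1.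
  by move=> /circleE cl; rewrite nrmV nrmX cl expr1n invr1.
pose a := \col_b ((toC (2 * pi))^-1 * Mn h b); exists a; split.
  rewrite sE; split; first exact: L2B.
  exists (fun l => (l ^+ 1)^-1 *: (f l - Psi l *m a)); last first.
    apply: aeW => t _; rewrite mul_scalar_mx scalerA divff ?scale1r //.
    by rewrite expf_neq0 // circle_neq0 //; exact: circle_cis.
  split; first by apply: (L2Z (@ccontXV R 1) iv1); exact: L2B.
  exists (fun l => (l ^+ 1)^-1 *: (h l - a)); first exact: Hplus_split.
  apply: (@filterS _ _ (ae_filter_ringOfSetsType (@lebesgue_measure R)) _ _ _ fae) => t E It.
  by rewrite E // -mulmxBr scalemxAr.
move=> a'; rewrite sE => -[L1 [g1 [Lg1 [h1 hh1 ae1]] e1]].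
have a1 : shift_by 1 (Wspace Psi) (fun l => f l - Psi l *m a).
  split; first exact: L2B.
  exists (fun l => (l ^+ 1)^-1 *: (f l - Psi l *m a)); last first.
    apply: aeW => t _; rewrite mul_scalar_mx scalerA divff ?scale1r //.
    by rewrite expf_neq0 // circle_neq0 //; exact: circle_cis.
  split; first by apply: (L2Z (@ccontXV R 1) iv1); exact: L2B.
  exists (fun l => (l ^+ 1)^-1 *: (h l - a)); first exact: Hplus_split.
  apply: (@filterS _ _ (ae_filter_ringOfSetsType (@lebesgue_measure R)) _ _ _ fae) => t E It.
  by rewrite E // -mulmxBr scalemxAr.
have [_ [g2 [Lg2 [h2 hh2 ae2]] e2]] := a1.
have c1 (l : C) : circle l -> nrm (l ^+ 1) = 1 by move=> /circleE cl; rewrite nrmX cl expr1n.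
have key : ae_circle (fun=> a - a') (fun l => l ^+ 1 *: h1 l - l ^+ 1 *: h2 l).
  have F := ae_filter_ringOfSetsType (@lebesgue_measure R).
  have := @filterI _ _ F _ _ (@filterI _ _ F _ _ ae1 e1) (@filterI _ _ F _ _ ae2 e2).
  apply: (@filterS _ _ F) => t /= [[A1 E1] [A2 E2]] It.
  have ct : circle (cis t : C) by exact: circle_cis.
  have e3 := E1 It; have e4 := E2 It; rewrite A1 // mul_scalar_mx in e3; rewrite A2 // mul_scalar_mx in e4.
  have u := uPsi ct.
  have : Psi (cis t) *m (a - a') = Psi (cis t) *m (cis t ^+ 1 *: h1 (cis t) - cis t ^+ 1 *: h2 (cis t)).
    rewrite !mulmxBr -!scalemxAr -e3 -e4 opprB [RHS]addrC addrA subrK; exact: erefl.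
  by move/(congr1 (mulmx (invmx (Psi (cis t))))); rewrite !mulKmx.
apply/matrixP => b j; rewrite ord1.
have Lc : L2 (fun=> a - a') by apply: L2_ccont => c0 t; exact: cvg_cst.
have l1 := L2Z (@ccontX R 1) c1 hh1.1; have l2 := L2Z (@ccontX R 1) c1 hh2.1.
have := Mn_ae b Lc (L2B l1 l2) key; rewrite MnB // !Hplus_mean // subrr.
have hc : pl 1 (fun=> a - a') (fun k => if k is 0%N then a - a' else 0).
  split; first by case.
  by move=> l _; rewrite big_ord_recl big_ord0 addr0 expr0 scale1r.
rewrite (Mn_pl b hc) => /eqP; rewrite mulf_eq0 => /orP[/eqP h0|].
  by have := twopi_gt0 R; rewrite -toC_lt h0 toC0 ltxx.
by rewrite !mxE subr_eq0 => /eqP.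
Qed.

End WandGr.

(** * The degree of the unitary Iwasawa factor *)

Section PolyFacts.
Variable R : realType.
Local Notation C := (cplx R).

Lemma poly_circle m p (M M' : 'M[{poly C}]_(m, p)) :
  (forall l, circle l -> evmx M l = evmx M' l) -> M = M'.
Proof.
move=> H; pose sz (A : 'M[{poly C}]_(m, p)) := \max_i \max_j size (A i j).
have hs (A : 'M[{poly C}]_(m, p)) i j : (size (A i j) <= sz A)%N.
  apply: leq_trans (leq_bigmax (F := fun i => \max_j size (A i j)) i).
  exact: (leq_bigmax (F := fun j => size (A i j)) j).
have h := pl_eq H (pl_evmx (hs M)); have h' := pl_evmx (hs M').
apply/matrixP => i j; apply/polyP => k.
by have := congr1 (fun A : 'M[C]_(m, p) => A i j) (pl_uniq h h' k); rewrite !mxE.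
Qed.

Lemma poly_circle1 (p q : {poly C}) : (forall l, circle l -> p.[l] = q.[l]) -> p = q.
Proof.
move=> H; have E : const_mx p = const_mx q :> 'M[{poly C}]_(1%N, 1%N).
  by apply: poly_circle => l cl; apply/matrixP => i j; rewrite !mxE /horner_eval H.
by have := congr1 (fun A : 'M[{poly C}]_(1%N, 1%N) => A 0 0) E; rewrite !mxE.
Qed.

(** The polynomial q with reversed conjugate coefficients equals l^s times the conjugate of D on the
    circle, so D q = X^s; a divisor of X^s is a monomial. *)
Lemma unimodular_monomial (D : {poly C}) : (forall l, circle l -> nrm D.[l] = 1) ->
  exists c m, c != 0 /\ D = c *: 'X^m.
Proof.
move=> H.
pose s := (size D).-1; pose q := \poly_(k < s.+1) (D`_(s - k))^*.
have qE l : circle l -> q.[l] = l ^+ s * (D.[l])^*.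
  move=> cl; have l0 := circle_neq0 cl; rewrite horner_poly.
  rewrite (@horner_coef_wide _ s.+1) ?leqSpred // rmorph_sum mulr_sumr /=.
  rewrite [RHS](reindex_inj rev_ord_inj) /=; apply: eq_bigr => k _.
  have ks : (k <= s)%N by rewrite -ltnS.
  rewrite subSS rmorphM rmorphXn /= (conj_circle cl) mulrCA; congr (_ * _).
  rewrite exprVn; apply: (mulIf (expf_neq0 (s - k) l0)).
  by rewrite mulfVK ?expf_neq0 // -exprD subnKC.
have E : D * q = 'X^s.
  apply: poly_circle1 => l cl; rewrite hornerM qE // hornerXn mulrCA mul_conj H //.
  by rewrite expr1n mulr1.
have dv : D %| ('X - 0%:P) ^+ s by rewrite subr0 -E dvdp_mulr.
have [k _ /eqpP[[c1 c2] /= /andP[c10 c20]]] := dvdp_exp_XsubCP dv.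
rewrite subr0 => e; exists (c2 / c1), k; split; first by rewrite mulf_neq0 // invr_neq0.
by rewrite mulrC -scalerA -e scalerA mulVf // scale1r.
Qed.

Lemma size_det n d (M : 'M[{poly C}]_n) : (forall i j, (size (M i j) <= d.+1)%N) ->
  (size (\det M) <= (d * n).+1)%N.
Proof.
move=> H; rewrite /determinant; apply: (leq_trans (size_sum _ _ _)); apply/bigmax_leqP => s _.
rewrite (_ : (-1) ^+ perm.odd_perm s = ((-1) ^+ perm.odd_perm s)%:P); last by rewrite rmorphXn rmorphN1.
rewrite size_Cmul ?signr_eq0 //; apply: (leq_trans (size_poly_prod_leq _ _)).
rewrite leq_subLR; have -> : #|(fun _ : 'I_n => true)| = n by rewrite card_ord.
rewrite addnS ltnS; apply: (@leq_trans (\sum_(i < n) d.+1)); first exact: leq_sum.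
by rewrite sum_nat_const card_ord mulnS [(d * n)%N]mulnC.
Qed.

Lemma det_evmx n (M : 'M[{poly C}]_n) l : \det (evmx M l) = (\det M).[l].
Proof. exact: det_map_mx. Qed.

Lemma nrm_det_unitary n (A : 'M[C]_n) : A *m A^t* = 1%:M -> nrm (\det A) = 1.
Proof.
move=> /(congr1 (fun B => \det B)); rewrite det1 det_mulmx det_map_mx det_tr mul_conj => h.
have := congr1 (@re R) h; rewrite [re (toC _)]/= [re 1]/= => /eqP.
by rewrite sqrp_eq1 ?nrm_ge0 // => /eqP.
Qed.

End PolyFacts.

Lemma pl_trunc (R : realType) m p L K (f : cplx R -> 'M[cplx R]_(m, p)) a : pl L f a ->
  (forall k, (K <= k)%N -> a k = 0) -> pl K f a.
Proof.
move=> ha a0; split=> // l cl.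
have [_ H] := pl_widen (leq_maxl L K) ha; rewrite H //.
rewrite (big_ord_widen (maxn L K) (fun k => l ^+ k *: a k) (leq_maxr L K)) [RHS]big_mkcond /=.
by apply: eq_bigr => k _; case: ltnP => // /a0 ->; rewrite scaler0.
Qed.

Lemma conj_CI (R : realType) (f : R -> cplx R) : conC 0 1 f -> (CI 0 1 f)^* = CI 0 1 (fun t => (f t)^*).
Proof.
move=> cf; rewrite conjE; apply: cplxP.
  by rewrite [LHS]/= re_CI; apply: RI_eq => t _; rewrite re_conj.
rewrite [LHS]/= !im_CI -mulN1r -RIZ; last exact: conC_im.
by apply: RI_eq => t _; rewrite im_conj mulN1r.
Qed.

Section IwasawaPoint.
Variables (R : realType) (n d : nat).
Local Notation C := (cplx R).
Variables (psi Th Pp F : C -> 'M[C]_n) (b a e : nat -> 'M[C]_n) (K N Kp : nat).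
Hypothesis hpsi : pl d.+1 psi b.
Hypothesis ThU : forall l, circle l -> Th l *m (Th l)^t* = 1%:M.
Hypothesis ThL : pl K (fun l => l ^+ N *: Th l) e.
Hypothesis fact : forall l, circle l -> psi l = Th l *m Pp l.
Hypothesis hPp : pl Kp Pp a.
Hypothesis dF : mdisc F.
Hypothesis FPp : forall l, circle l -> F l = Pp l.
Hypothesis Fu : forall l, nrm l <= 1 -> F l \in unitmx.

Lemma circle_nrm1 (l : C) : circle l -> nrm l <= 1.
Proof. by move=> /circleE ->. Qed.

Lemma Pp_unit l : circle l -> Pp l \in unitmx.
Proof. by move=> cl; rewrite -FPp //; apply: Fu; exact: circle_nrm1. Qed.

Lemma a0_unit : a 0%N \in unitmx.
Proof.
have h : pl Kp (fun l => l ^+ 0 *: Pp l) a by apply: pl_eq hPp => l _; rewrite expr0 scale1r.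
by rewrite (disc_coef h dF FPp (leqnn 0)) eqxx; apply: Fu; rewrite nrm0.
Qed.

(** Th is psi times the inverse of a loop invertible in the closed disc, so it extends
    holomorphically and has no negative coefficients. *)
Lemma Th_poly : exists L th, pl L Th th.
Proof.
have h : mdisc (fun l => evmx (polymx d.+1 b) l *m invmx (F l)).
  by apply: mdiscM; [exact: mdisc_evmx | exact: mdisc_inv].
exists K, (fun k => e (N + k)%N); apply: (pl_noneg ThL h) => l cl.
by rewrite -(pl_polymx hpsi cl) fact // FPp // mulmxK // Pp_unit.
Qed.

(** det Th is a monomial c l^m, and m <= d n because it divides det psi. On the circle the adjoint
    of Th is its inverse, hence adj(Th) / (c l^m); so l^m times it is a polynomial and Th has degree
    at most m. *)
Lemma iwasawa_degree : exists th, pl (d * n).+1 Th th.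
Proof.
have [L [th hth]] := Th_poly; exists th.
have dU l : circle l -> nrm (\det (Th l)) = 1 by move=> cl; apply: nrm_det_unitary; exact: ThU.
pose MT := polymx L th; pose MP := polymx Kp a; pose MB := polymx d.+1 b.
have eT l : circle l -> evmx MT l = Th l by move=> cl; rewrite /MT -(pl_polymx hth cl).
have eB l : circle l -> evmx MB l = psi l by move=> cl; rewrite /MB -(pl_polymx hpsi cl).
have E : MT *m MP = MB.
  by apply: poly_circle => l cl; rewrite evmxM eT // eB // /MP -(pl_polymx hPp cl) fact.
have [c [m [c0 Dm]]] : exists c m, c != 0 /\ \det MT = c *: 'X^m.
  by apply: unimodular_monomial => l cl; rewrite -det_evmx eT // dU.
have c1 : circle (1 : C) by exact: circle1.
have B0 : \det MB != 0.
  apply/eqP => h; have := det_evmx MB 1; rewrite h horner0 eB //.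
  move/eqP; rewrite fact // det_mulmx mulf_eq0; have := Pp_unit c1.
  rewrite unitmxE unitfE => /negbTE ->; rewrite orbF -nrm_eq0 dU // oner_eq0; exact: notF.
have md : (m <= d * n)%N.
  have := size_det (size_polymx d.+1 b); rewrite -/MB -E det_mulmx Dm -scalerAl size_scale //.
  have A0 : \det MP != 0 by apply: contraNneq B0 => h; rewrite -E det_mulmx h mulr0.
  rewrite mulrC size_mulXn // => h; rewrite -ltnS; apply: leq_trans h.
  by rewrite -addn1 leq_add2l lt0n size_poly_eq0.
apply: (pl_trunc hth) => k kd; have mk : (m < k)%N by exact: leq_ltn_trans md kd.
apply/matrixP => i j; rewrite mxE.
suff h : (th k i j)^* = 0 by rewrite -[LHS]conjCK h conjC0.
rewrite -(pl_mean i j k hth).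
have cT : conC 0 1 (fun t => Th (eturn t) i j / eturn t ^+ k).
  apply: conCM; last exact: con_eturnXV.
  have dT : disc (fun l => evmx MT l i j) by exact: mdisc_evmx.
  have [h _] := disc_mean dT.
  suff -> : (fun t => Th (eturn t) i j) = (fun t => evmx MT (eturn t) i j) by [].
  by apply/funext => t; rewrite eT //; exact: circle_eturn.
rewrite conj_CI //.
have dA : disc (fun l => c^-1 * (\adj (evmx MT l)) j i * l ^+ (k - m)).
  apply: discM; last by apply: discX; exact: disc_id.
  apply: discM; first exact: disc_cst.
  exact: (mdisc_adj (@mdisc_evmx R n n MT) j i).
have [_ h0] := disc_mean dA.
(* The conjugate of coefficient k is the mean of c^-1 adj(Th) l^(k - m), a polynomial vanishing at 0
   since k > m. *)
transitivity (c^-1 * (\adj (evmx MT 0)) j i * 0 ^+ (k - m)); last first.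
  by rewrite expr0n subn_eq0 leqNgt mk mulr0.
rewrite h0; apply: CI_eq => t _; set l := eturn t.
have cl : circle l by exact: circle_eturn.
have l0 := circle_neq0 cl.
rewrite rmorphM /= fmorphV rmorphXn /= (conj_circle cl) exprVn invrK.
have h : \adj (Th l) = (c * l ^+ m) *: (Th l)^t*.
  rewrite -[LHS]mulmx1 -(ThU cl) mulmxA mul_adj_mx -mul_scalar_mx; congr (_ %:M *m _).
  by rewrite -eT // det_evmx Dm hornerZ hornerXn.
rewrite eT // h !mxE -{1}(subnK (ltnW mk)) exprD; field.
by [].
Qed.

End IwasawaPoint.

(** * Truncated loops as block vectors *)

Section Truncation.
Variables (R : realType) (n r : nat).
Local Notation C := (cplx R).
Local Notation DD := (r.+1 * n)%N.
Local Notation blk := (blk R n r).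
Local Notation jlb := (jlb R n r).
Local Notation T := (Tsh R n r).
Local Notation Tp := (Tpow R n r).

Definition vecp q (a : nat -> 'M[C]_(n, q)) : 'M[C]_(DD, q) := \sum_(s < r.+1) jlb s *m a s.

Lemma blk_vecp q (a : nat -> 'M[C]_(n, q)) s : (s <= r)%N -> blk s *m vecp a = a s.
Proof.
move=> sr; rewrite /vecp mulmx_sumr; have sr' : (s < r.+1)%N by [].
rewrite (bigD1 (Ordinal sr')) //= mulmxA blk_jlb_eq // mul1mx big1 ?addr0 // => i si.
by rewrite mulmxA blk_jlb_neq ?mul0mx // eq_sym.
Qed.

Lemma vecp_ext q (a b : nat -> 'M[C]_(n, q)) : (forall s, (s <= r)%N -> a s = b s) -> vecp a = vecp b.
Proof. by move=> H; apply: blk_ext => s sr; rewrite !blk_vecp // H. Qed.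

Lemma vecp_blk q (X : 'M[C]_(DD, q)) : vecp (fun s => blk s *m X) = X.
Proof. by apply: blk_ext => s sr; rewrite blk_vecp. Qed.

Lemma blk_Tpow k s : (s <= r)%N -> blk s *m Tp k = if (k <= s)%N then blk (s - k)%N else 0.
Proof.
elim: k s => [|k IH] s sr; first by rewrite Tpow0 mulmx1 subn0.
rewrite TpowSl mulmxA; case: s sr => [|s] sr; first by rewrite blk0_T mul0mx.
by rewrite blk_T sr IH ?subSS // ltnW.
Qed.

Lemma Tpow_vecp q (a : nat -> 'M[C]_(n, q)) k :
  Tp k *m vecp a = vecp (fun s => if (k <= s)%N then a (s - k)%N else 0).
Proof.
apply: blk_ext => s sr; rewrite mulmxA blk_Tpow // blk_vecp //.
by case: leqP => ks; rewrite ?mul0mx // blk_vecp // (leq_trans (leq_subr _ _)).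
Qed.

Lemma ev_vecp q (f : C -> 'M[C]_(n, q)) a l : pl r.+1 f a -> circle l -> ev n r l *m vecp a = f l.
Proof.
move=> [a0 H] cl; rewrite H // /vecp mulmx_sumr; apply: eq_bigr => s _.
by rewrite mulmxA ev_jlb -1?ltnS // mul_scalar_mx.
Qed.

Lemma vecp_conv q p (a : nat -> 'M[C]_(n, q)) (b : nat -> 'M[C]_(q, p)) :
  vecp (fun s => \sum_(k < s.+1) a (s - k)%N *m b k) = \sum_(k < r.+1) Tp k *m vecp a *m b k.
Proof.
apply: blk_ext => s sr; rewrite blk_vecp // mulmx_sumr.
rewrite (big_ord_widen r.+1 (fun k => a (s - k)%N *m b k)) ?ltnS // big_mkcond /=.
apply: eq_bigr => k _; rewrite -mulmxA mulmxA [in RHS]mulmxA blk_Tpow // ltnS.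
by case: leqP => ks; rewrite ?mul0mx // blk_vecp // (leq_trans (leq_subr _ _)).
Qed.

Lemma conv_perp p q q' (y : 'M[C]_(p, DD)) (X : 'M[C]_(DD, q)) (Y : 'M[C]_(DD, q')) (A : nat -> 'M[C]_(q', q)) :
  X = \sum_(k < r.+1) Tp k *m Y *m A k -> (forall m, y *m Tp m *m Y = 0) -> forall m, y *m Tp m *m X = 0.
Proof.
move=> -> H m; rewrite mulmx_sumr big1 // => k _.
by rewrite !mulmxA -(mulmxA y) -TpowD H mul0mx.
Qed.

(** X is triangular in the shifts of Y with invertible diagonal A 0; the induction runs down from
    T^(r+1) = 0, each step cancelling A 0. *)
Lemma conv_perp_unit p q (y : 'M[C]_(p, DD)) (X Y : 'M[C]_(DD, q)) (A : nat -> 'M[C]_q) :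
  X = \sum_(k < r.+1) Tp k *m Y *m A k -> A 0%N \in unitmx ->
  (forall m, y *m Tp m *m X = 0) -> forall m, y *m Tp m *m Y = 0.
Proof.
move=> E A0 H.
suff key k m : (r < m + k)%N -> y *m Tp m *m Y = 0.
  by move=> m; apply: (key r.+1); rewrite addnS ltnS leq_addl.
elim: k m => [|k IH] m mr; first by rewrite Tpow_big ?mulmx0 ?mul0mx // -(addn0 m).
have := H m; rewrite E mulmx_sumr (bigD1 ord0) //= ?Tpow0 mul1mx big1 ?addr0.
  by rewrite mulmxA => /(congr1 (mulmx^~ (invmx (A 0%N)))); rewrite mul0mx mulmxK.
move=> i i0; rewrite !mulmxA -(mulmxA y (Tp m)) -TpowD IH ?mul0mx //.
have i1 : (0 < i)%N by rewrite lt0n.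
by apply: leq_trans mr _; rewrite addnS -addn1 -addnA [(k + 1)%N]addnC addnA leq_add2r leq_add2l.
Qed.

Section Inner.
Variables (Th : C -> 'M[C]_n) (th : nat -> 'M[C]_n).
Hypothesis hth : pl r.+1 Th th.
Hypothesis ThU : forall l, circle l -> Th l *m (Th l)^t* = 1%:M.

(** The identity Th (l^r Th^* ) = l^r writes the last block as a combination of shifts of the vector
    of Th. *)
Lemma inner_last (q : nat) (y : 'M[C]_(q, DD)) : (forall m, y *m Tp m *m vecp th = 0) ->
  y *m jlb r = 0.
Proof.
move=> H.
have h1 := pl_mul hth (pl_adj hth).
have h2 : pl r.+1 (fun l => Th l *m (l ^+ r *: (Th l)^t*)) (fun s => if s == r then 1%:M else 0).
  split=> [k rk|l cl]; first by rewrite gtn_eqF.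
  rewrite -scalemxAr ThU // (bigD1 ord_max) //= eqxx big1 ?addr0 // => i /negbTE ir.
  have -> : (i == r :> nat) = false by rewrite -ir.
  by rewrite scaler0.
have E s := pl_uniq h2 h1 s.
have -> : jlb r = vecp (fun s => if s == r then 1%:M else 0).
  apply: blk_ext => s sr; rewrite blk_vecp //.
  by case: eqP => [->|/eqP sne]; [rewrite blk_jlb_eq | rewrite blk_jlb_neq].
rewrite (vecp_ext (fun s _ => E s)) (vecp_conv th (fun k => if (k <= r)%N then (th (r - k)%N)^t* else 0)).
rewrite -[y]mulmx1 -[1%:M](Tpow0 R n r).
exact: (conv_perp (A := fun k => if (k <= r)%N then (th (r - k)%N)^t* else 0) (erefl _) H 0).
Qed.

(** The product is a nonconstant Fourier coefficient of Th^* Th = 1. *)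
Lemma inner_orth k : (0 < k)%N -> (vecp th)^t* *m Tp k *m vecp th = 0.
Proof.
move=> k0; have [kr|rk] := leqP k r; last by rewrite Tpow_big // mulmx0 mul0mx.
have h1 := pl_mul (pl_adj hth) hth.
have h2 : pl r.+1 (fun l => (l ^+ r *: (Th l)^t*) *m Th l) (fun s => if s == r then 1%:M else 0).
  split=> [s rs|l cl]; first by rewrite gtn_eqF.
  rewrite -scalemxAl (unitary_left (ThU cl)) (bigD1 ord_max) //= eqxx big1 ?addr0 // => i /negbTE ir.
  have -> : (i == r :> nat) = false by rewrite -ir.
  by rewrite scaler0.
have := pl_uniq h2 h1 (r - k).
rewrite ltn_eqF; last by rewrite -subn_gt0 subKn.
move=> /esym E.
rewrite -mulmxA Tpow_vecp {1}/vecp hadj_sum mulmx_suml.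
transitivity (\sum_(s < r.+1) (th s)^t* *m (if (k <= s)%N then th (s - k)%N else 0)).
  apply: eq_bigr => s _; rewrite hadjM blk_adj -mulmxA blk_vecp //; by rewrite -ltnS.
rewrite -[RHS]E.
rewrite -(big_mkord xpredT (fun s => (th s)^t* *m (if (k <= s)%N then th (s - k)%N else 0))).
rewrite (@big_cat_nat _ _ _ k) //=; last exact: leqW.
rewrite big_nat_cond big1 ?add0r; last first.
  by move=> i /andP[/andP[_ ik] _]; rewrite leqNgt ik /= mulmx0.
rewrite -{1}(add0n k) big_addn subSn // big_mkord; apply: eq_bigr => j _.
have jr : (j <= r - k)%N by rewrite -ltnS.
have h : (r - k - j <= r)%N by rewrite -subnDA leq_subr.
rewrite leq_addl addnK h -subnDA subKn ?[(k + j)%N]addnC //.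
by rewrite addnC -leq_subRL.
Qed.

End Inner.
End Truncation.

Lemma nearI (T : topologicalType) (p : T) (P Q : T -> Prop) : (\forall x \near p, P x) ->
  (\forall x \near p, Q x) -> \forall x \near p, P x /\ Q x.
Proof. exact: filterI. Qed.

(** * A locally uniform Laurent degree *)

Section BaireIdentity.
Variable R : realType.
Local Notation C := (cplx R).

(** If no P N held on an interval, the complements U N of the relatively closed sets would be open
    and dense, and a point common to all of them in the open segment would contradict the
    covering. *)
Lemma baire_segment (a b : R) (P : nat -> R -> Prop) : a < b ->
  (forall N s, a <= s <= b -> ~ P N s -> exists2 d : R, 0 < d & forall t, `|t - s| < d -> a <= t <= b -> ~ P N t) ->
  (forall s, a <= s <= b -> exists N, P N s) ->
  exists N s0 d, 0 < d /\ forall t, `|t - s0| < d -> a <= t <= b /\ P N t.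
Proof.
move=> ab cl cov.
pose U N := [set t : R^o | ~ (a <= t <= b /\ P N t)].
have oU N : open (U N).
  rewrite openE => s /= Us; have [sab|sab] := boolP (a <= s <= b).
    have [|d d0 H] := cl N s sab; first by move=> Ps; apply: Us.
    apply/nbhs_ballP; exists d => //= t; rewrite /ball /= distrC => h [tab Pt].
    exact: H h tab Pt.
  have : open (~` [set` `[a, b]] : set R) by apply: closed_openC; exact: interval_closed.
  rewrite openE => /(_ s); case; first by move=> /=; rewrite in_itv /=; apply/negP.
  move=> d /= d0 H; apply/nbhs_ballP; exists d => //= t ht [tab _].
  by apply: (H t ht); rewrite /= in_itv.
apply: contrapT => no.
have dU N : dense (U N).
  move=> Q [s Qs] oQ; apply: contrapT => em; apply: no.
  have : nbhs (s : R^o) Q by exact: open_nbhs_nbhs.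
  case/nbhs_ballP=> d /= d0 H; exists N, s, d; split=> // t ht.
  apply: contrapT => h; apply: em; exists t; split=> //.
  by apply: H; rewrite /ball /= distrC.
have [] := @Baire R (R^o : completeNormedModType R) U (fun N => conj (oU N) (dU N)) [set` `]a, b[].
- have h1 : a < (a + b) / 2 by lra.
  have h2 : (a + b) / 2 < b by lra.
  by exists ((a + b) / 2); rewrite /= in_itv /= h1 h2.
- exact: interval_open.
move=> s [/=]; rewrite in_itv /= => /andP[s1 s2] /(_ _ I) hU.
have [|N PN] := cov s; first by rewrite !ltW.
by apply: (hU N) => //; split=> //; rewrite !ltW.
Qed.

Lemma identity_real (f : C -> C) (a b : C) (rho d : R) : 0 < rho -> holo f a rho ->
  nrm (b - a) < rho / 2 -> 0 < d -> (forall t : R, `|t| < d -> f (b + toC t) = 0) ->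
  forall w, nrm (w - a) < rho / 2 - nrm (b - a) -> f w = 0.
Proof.
move=> r0 hf ba d0 z w hw.
have hb : holo f b (rho - nrm (b - a)) by apply: holo_sub hf _; rewrite addrC subrK.
have r2 : 0 < rho / 2 by lra.
have r3 : rho / 2 < rho - nrm (b - a) by lra.
have [H|[m [g [hg g0 E]]]] := holo_dichotomy hb r2 r3.
  apply: H; have := nrmB (w - a) (b - a).
  have -> : w - a - (b - a) = w - b by ring.
  lra.
exfalso.
have hgb : hol b g by exists (rho / 2).
have /nbhsCP[e e0 He] := hol_near_neq0 hgb g0.
pose t := Num.min (Num.min d e) (rho / 2) / 2.
have m0 : 0 < Num.min (Num.min d e) (rho / 2) by rewrite !lt_min d0 e0 r2.
have t0 : 0 < t by rewrite /t; lra.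
have [td te tr] : [/\ t < d, t < e & t < rho / 2].
  have h1 : Num.min (Num.min d e) (rho / 2) <= rho / 2 by rewrite ge_min lexx orbT.
  have h2 : Num.min (Num.min d e) (rho / 2) <= d by rewrite !ge_min lexx.
  have h3 : Num.min (Num.min d e) (rho / 2) <= e by rewrite !ge_min lexx !orbT.
  by rewrite /t; split; lra.
have nt : nrm (b + toC t - b) = t by rewrite addrAC subrr add0r nrm_toC gtr0_norm.
have := E (b + toC t); rewrite nt => /(_ tr); rewrite z ?gtr0_norm //.
move/esym/eqP; rewrite mulf_eq0 expf_eq0 (negbTE (He _ _)) ?nt // orbF => /andP[_].
by rewrite -nrm_eq0 nt gt_eqF.
Qed.

(** The coefficients of l^N f recovered from 2N + 1 nodes: a total function of f, meaningful once
    the Laurent degree of f is at most N. *)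
Definition lc m p N (f : C -> 'M[C]_(m, p)) k : 'M[C]_(m, p) :=
  if (k < N.*2.+1)%N then dft N.*2.+1 (fun l => l ^+ N *: f l) k else 0.

Lemma lc_pl m p N (f : C -> 'M[C]_(m, p)) c : pl N.*2.+1 (fun l => l ^+ N *: f l) c ->
  pl N.*2.+1 (fun l => l ^+ N *: f l) (lc N f).
Proof.
move=> h; split=> [k kN|l cl]; first by rewrite /lc ltnNge kN.
rewrite h.2 //; apply: eq_bigr => k _; rewrite /lc ltn_ord.
by rewrite (dft_pl _ h).
Qed.

Lemma lc_hol m p N (w0 : C) (g : C -> C -> 'M[C]_(m, p)) k :
  (forall l i j, circle l -> hol w0 (fun w => g w l i j)) -> mhol w0 (fun w => lc N (g w) k).
Proof.
move=> H i j; rewrite /lc; case: ltnP => _; last first.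
  apply: hol_near (hol_cst w0 0); apply: nearWC => w; by rewrite mxE.
rewrite /dft.
apply: (hol_near (f := fun w => (N.*2.+1)%:R^-1 * \sum_(s < N.*2.+1)
   ((node R N.*2.+1 s ^+ k)^-1 * node R N.*2.+1 s ^+ N) * g w (node R N.*2.+1 s) i j)).
  apply: nearWC => w; rewrite mxE summxE; congr (_ * _); apply: eq_bigr => s _.
  by rewrite !mxE mulrA.
apply: holM; first exact: hol_cst.
apply: hol_sum => s; apply: holM; first exact: hol_cst.
apply: H; exact: circle_node.
Qed.

Lemma lc_holo m p N (a : C) rho (g : C -> C -> 'M[C]_(m, p)) l i j : circle l ->
  (forall l i j, circle l -> holo (fun w => g w l i j) a rho) ->
  holo (fun w => (l ^+ N *: g w l - \sum_(k < N.*2.+1) l ^+ k *: lc N (g w) k) i j) a rho.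
Proof.
move=> cl H w hw.
have key k : exists d, cdiff (fun w => lc N (g w) k i j) w d.
  have h : hol w (fun w => lc N (g w) k i j).
    apply: lc_hol => l' i' j' cl'; exists (rho - nrm (w - a)); first by rewrite subr_gt0.
    by apply: holo_sub (H l' i' j' cl') _; rewrite addrC subrK.
  have /nbhsCP[d d0] := hol_cdiff h; apply; by rewrite subrr nrm0.
have ks : exists d, cdiff (fun w => \sum_(k < N.*2.+1) l ^+ k * lc N (g w) k i j) w d.
  elim: (index_enum _) => [|k s [d IH]].
    exists 0; rewrite (_ : (fun w => _) = fun=> 0); first exact: cdiff_cst.
    by apply/funext => y; rewrite big_nil.
  have [d' hd'] := key k; exists (l ^+ k * d' + d).
  rewrite (_ : (fun w => _) = (fun w => l ^+ k * lc N (g w) k i j + \sum_(j0 <- s) l ^+ j0 * lc N (g w) j0 i j)).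
    exact: cdiffD (cdiffZ _ hd') IH.
  by apply/funext => y; rewrite big_cons.
have [d hd] := H l i j cl w hw; have [d' hd'] := ks.
exists (l ^+ N * d - d').
rewrite (_ : (fun w => _) = (fun w => l ^+ N * g w l i j - \sum_(k < N.*2.+1) l ^+ k * lc N (g w) k i j)).
  exact: cdiffB (cdiffZ _ hd) hd'.
apply/funext => y; rewrite !mxE summxE; congr (_ - _); apply: eq_bigr => k _; by rewrite mxE.
Qed.

(** For fixed N, having degree at most N means that the difference between l^N g and its
    interpolation vanishes on the circle, a closed condition on the base point. Baire gives one N on
    an interval of a real segment, and the identity theorem spreads it to a disc about a. *)
Lemma local_degree m p (a : C) rho (g : C -> C -> 'M[C]_(m, p)) : 0 < rho ->
  (forall l i j, circle l -> holo (fun w => g w l i j) a rho) ->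
  (forall s : R, 0 < s -> s < rho -> exists N c, pl N.*2.+1 (fun l => l ^+ N *: g (a + toC s) l) c) ->
  exists N r, 0 < r /\ forall w, nrm (w - a) < r -> pl N.*2.+1 (fun l => l ^+ N *: g w l) (lc N (g w)).
Proof.
move=> r0 hg hL.
pose D N l i j w := (l ^+ N *: g w l - \sum_(k < N.*2.+1) l ^+ k *: lc N (g w) k) i j.
pose P N (s : R) := forall l i j, circle l -> D N l i j (a + toC s) = 0.
(* The segment stays away from a, where no degree is known, and within the radius rho / 2 required
   by [identity_real]. *)
have r8 : rho / 8 < rho / 4 by lra.
have nn (s : R) : 0 <= s -> nrm (a + toC s - a) = s by move=> s0; rewrite addrAC subrr add0r nrm_toC ger0_norm.
have [] := @baire_segment _ _ P r8.
- move=> N s /andP[s1 s2] nP.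
  have [l [i [j [cl nz]]]] : exists l i j, circle l /\ D N l i j (a + toC s) <> 0.
    apply: contrapT => h; apply: nP => l i j cl; apply: contrapT => h'; apply: h.
    by exists l, i, j.
  have hD := lc_holo N i j cl hg.
  have sr : nrm (a + toC s - a) < rho by rewrite nn; lra.
  have hh : hol (a + toC s) (D N l i j).
    exists (rho - nrm (a + toC s - a)); first by rewrite subr_gt0.
    by apply: holo_sub hD _; rewrite addrC subrK.
  have /nbhsCP[d d0 Hd] := hol_near_neq0 hh (introN eqP nz).
  exists d; first exact: d0.
  move=> t ht _ Pt.
  have e : a + toC t - (a + toC s) = toC (t - s) by rewrite toCD toCN opprD addrACA subrr add0r.
  have := Hd (a + toC t); rewrite e nrm_toC => /(_ ht); rewrite (Pt l i j cl) eqxx; exact: notF.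
- move=> s /andP[s1 s2]; have [||N [c hc]] := hL s; [lra | lra |].
  exists N => l i j cl; have h := lc_pl hc; rewrite /D h.2 // subrr mxE; exact: erefl.
move=> N [s0 [d [d0 H]]].
have [] := H s0; first by rewrite subrr normr0.
move=> /andP[s1 s2] _.
exists N, (rho / 2 - s0); split; first by lra.
move=> w hw; split=> [k kN|l cl]; first by rewrite /lc ltnNge kN.
apply/eqP; rewrite -subr_eq0; apply/eqP/matrixP => i j; rewrite [RHS]mxE.
have s00 : 0 <= s0 by lra.
apply: (identity_real r0 (lc_holo N i j cl hg) (b := a + toC s0) _ d0).
- by rewrite nn //; lra.
- move=> t td; rewrite -addrA -toCD; apply: (H _ _).2 => //; by rewrite addrAC subrr add0r.
- by rewrite nn.
Qed.

Lemma lcZ m p N c (f : C -> 'M[C]_(m, p)) k : lc N (fun l => c *: f l) k = c *: lc N f k.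
Proof.
rewrite /lc; case: ltnP => _; last by rewrite scaler0.
rewrite /dft scalerA mulrC -scalerA; congr (_ *: _); rewrite scaler_sumr; apply: eq_bigr => s _.
by rewrite !scalerA; congr (_ *: _); rewrite [c * _]mulrC -!mulrA; congr (_ * _); rewrite mulrC.
Qed.

Lemma lc_ext m p N (f g : C -> 'M[C]_(m, p)) k : (forall l, circle l -> f l = g l) -> lc N f k = lc N g k.
Proof.
move=> E; rewrite /lc; case: ltnP => [_|_]; last exact: erefl.
rewrite /dft; congr (_ *: _); apply: eq_bigr => s _.
by rewrite E //; exact: circle_node.
Qed.

Lemma hol_comp (w0 : C) (f t : C -> C) : hol w0 t -> hol (t w0) f -> hol w0 (fun w => f (t w)).
Proof.
move=> ht hf; have ct := hol_cont ht.
have h1 : \forall w \near w0, (exists d, cdiff t w d) /\ (exists d, cdiff f (t w) d).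
  apply: filterI; first exact: hol_cdiff ht.
  exact: ct (hol_cdiff hf).
have /nbhsCP[d d0 H] := h1; exists d => // w hw.
by have [[e he] [e' he']] := H w hw; eexists; exact: cdiff_comp he he'.
Qed.

End BaireIdentity.

(** * Charts *)

Section Charts.
Variables (R : realType) (M : riemann_surface R).
Local Notation C := (cplx R).
Implicit Types (z : chart R M) (p q x : M).

Section OneChart.
Variables (z : chart R M) (p : M).
Hypotheses (hz : coords z) (zp : cdom z p).

Lemma chart_near : \forall w \near z p, cdom z (cinv z w) /\ z (cinv z w) = w.
Proof.
have [_ oi _ _ ci] := rs_charts hz.
have : nbhs (z p) (chart_image z setT) by apply: open_nbhs_nbhs; split=> //; exists p.
apply: filterS => w [q [cq _] <-]; by rewrite ci.
Qed.

Lemma chartK : cinv z (z p) = p.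
Proof. by have [_ _ _ _ ci] := rs_charts hz; exact: ci. Qed.

Lemma chart_inv_near (P : M -> Prop) : (\forall q \near p, P q) -> \forall w \near z p, P (cinv z w).
Proof.
have [_ _ _ cc _] := rs_charts hz; move=> h.
have im : chart_image z setT (z p) by exists p.
have e : nbhs (cinv z (z p)) P by rewrite chartK.
exact: (cc _ im P e).
Qed.

Lemma near_chart (P : C -> Prop) : (\forall w \near z p, P w) -> \forall q \near p, P (z q).
Proof. by have [_ _ cz _ _] := rs_charts hz; move=> h; exact: (cz p zp P h). Qed.

Lemma cdom_near : \forall q \near p, cdom z q.
Proof. by have [od _ _ _ _] := rs_charts hz; exact: open_nbhs_nbhs. Qed.

Lemma chart_inv_dnear (P : M -> Prop) : (\forall q \near p^', P q) -> \forall w \near (z p)^', P (cinv z w).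
Proof.
move=> h; have h1 : \forall q \near p, q != p -> P q by exact: h.
have h2 := nearI chart_near (chart_inv_near h1).
suff : \forall w \near z p, w != z p -> P (cinv z w) by [].
apply: filterS h2 => w [[_ zw] H] wp; apply: H; apply: contraNneq wp => e.
by rewrite -zw e.
Qed.

Lemma dnear_chart (P : M -> Prop) : (\forall w \near (z p)^', P (cinv z w)) -> \forall q \near p^', P q.
Proof.
move=> h; have h1 : \forall w \near z p, w != z p -> P (cinv z w) by exact: h.
have [_ _ _ _ ci] := rs_charts hz.
have h2 := nearI cdom_near (near_chart h1).
suff : \forall q \near p, q != p -> P q by [].
apply: filterS h2 => q [cq H] qp; rewrite -[q]ci //; apply: H.
by apply: contraNneq qp => e; rewrite -[q]ci // e chartK.
Qed.

Lemma near_chart_inv (P : M -> Prop) : (\forall w \near z p, P (cinv z w)) -> \forall q \near p, P q.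
Proof.
move=> h; have [_ _ _ _ ci] := rs_charts hz.
have := nearI cdom_near (near_chart h).
by apply: filterS => q [cq]; rewrite ci.
Qed.

End OneChart.

Definition trans z1 z2 (w : C) : C := z2 (cinv z1 w).

Section Transition.
Variables (z1 z2 : chart R M) (p : M).
Hypotheses (h1 : coords z1) (h2 : coords z2) (p1 : cdom z1 p) (p2 : cdom z2 p).

Lemma trans_p : trans z1 z2 (z1 p) = z2 p.
Proof. by rewrite /trans chartK. Qed.

Lemma trans_hol : hol (z1 p) (trans z1 z2).
Proof.
have := nearI (chart_near h1 p1) (chart_inv_near h1 p1 (cdom_near h2 p2)).
case/nbhsCP=> d d0 H; exists d; first exact: d0.
move=> w hw.
have [[c1 zw] c2] := H w hw.
apply: derivable_cdiff; apply: (rs_compatible h1 h2); exists (cinv z1 w) => //.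
Qed.

Lemma trans_inv : \forall w \near z1 p, cinv z2 (trans z1 z2 w) = cinv z1 w.
Proof.
have := chart_inv_near h1 p1 (cdom_near h2 p2).
by apply: filterS => w c2; rewrite /trans chartK.
Qed.

Lemma trans_near (P : C -> Prop) : (\forall y \near z2 p, P y) -> \forall w \near z1 p, P (trans z1 z2 w).
Proof. by move=> h; have := hol_cont trans_hol; apply; rewrite trans_p. Qed.

Lemma mhol_trans m k (F : C -> 'M[C]_(m, k)) : mhol (z2 p) F -> mhol (z1 p) (fun w => F (trans z1 z2 w)).
Proof. by move=> hF i j; apply: (hol_comp (f := fun w => F w i j) trans_hol); rewrite trans_p; exact: hF. Qed.

End Transition.

Section LocalLaurent.
Variables (n : nat) (D : set M) (Psi : M -> loop R n).
Hypothesis hD : discrete_subset D.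
Hypothesis hmero : meromorphic_family D Psi.
Hypothesis hL : forall q, ~ D q -> exists N c, pl N.*2.+1 (fun l => l ^+ N *: Psi q l) c.

(** [local_degree] is applied to g, a power of the coordinate times [Psi], which is holomorphic
    across x; dividing by that power keeps the degree and makes the coefficients meromorphic. *)
Lemma local_laurent x : exists z N, [/\ coords z, cdom z x,
  (forall k, mmero (z x) (fun w => lc N (Psi (cinv z w)) k)) &
  \forall w \near (z x)^', pl N.*2.+1 (fun l => l ^+ N *: Psi (cinv z w) l) (lc N (Psi (cinv z w)))].
Proof.
have [z [V [k [g [hz oV Vx Vz [[_ hg] gE]]]]]] := hmero x.
have zx := Vz x Vx.
have nV : \forall q \near x, V q by exact: open_nbhs_nbhs.
have good := nearI (chart_near hz zx) (chart_inv_near hz zx nV).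
have nD := chart_inv_dnear hz zx (hD x).
have [d1 d10 H1] := (nbhsCP _ _).1 good.
have [d2 d20 H2] := (dnbhsCP _ _).1 nD.
pose rho := Num.min d1 d2; have r0 : 0 < rho by rewrite lt_min d10.
have r1 : rho <= d1 by rewrite ge_min lexx.
have r2 : rho <= d2 by rewrite ge_min lexx orbT.
pose G w l := g (cinv z w) l.
have hG l i j : circle l -> holo (fun w => G w l i j) (z x) rho.
  move=> cl w hw; have [[c1 zw] Vw] := H1 w (lt_le_trans hw r1).
  by apply: derivable_cdiff; apply: (hg z hz l cl i j); exists (cinv z w).
have GE w : nrm (w - z x) < rho -> w != z x -> ~ D (cinv z w) /\
    forall l, circle l -> G w l = (w - z x) ^+ k *: Psi (cinv z w) l.
  move=> hw wx; have [[c1 zw] Vw] := H1 w (lt_le_trans hw r1).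
  have nDw := H2 w (lt_le_trans hw r2) wx; split=> // l cl.
  by rewrite /G gE // zw.
have [] := local_degree r0 hG.
  move=> s s0 sr.
  have nn : nrm (z x + toC s - z x) = s by rewrite addrAC subrr add0r nrm_toC gtr0_norm.
  have ne : z x + toC s != z x by rewrite -subr_eq0 -nrm_eq0 nn gt_eqF.
  have [nDw E] := GE (z x + toC s) (eq_ind_r (fun y => y < rho) sr nn) ne.
  have [N [c hc]] := hL nDw; exists N, (fun i => (z x + toC s - z x) ^+ k *: c i).
  split=> [i iN|l cl]; first by rewrite (hc.1 i iN) scaler0.
  rewrite E // scalerA mulrC -scalerA hc.2 // scaler_sumr; apply: eq_bigr => i _.
  by rewrite !scalerA mulrC.
move=> N [r [rp Hr]]; exists z, N; split=> //.
- move=> i a b; have hh : hol (z x) (fun w => lc N (G w) i a b).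
    by apply: lc_hol => l i' j' cl; exists rho => //; exact: hG.
  exists (fun w => lc N (G w) i a b), (fun w => (w - z x) ^+ k); split=> //.
    by apply: holX; apply: holB; [exact: hol_id | exact: hol_cst].
  apply/dnbhsCP; exists rho => // w hw wx; have [_ E] := GE w hw wx.
  have w0 : (w - z x) ^+ k != 0 by rewrite expf_neq0 // subr_eq0.
  split=> //; rewrite (_ : lc N (G w) i = lc N (fun l => (w - z x) ^+ k *: Psi (cinv z w) l) i).
    by rewrite lcZ mxE mulrAC divff // mul1r.
  exact: lc_ext E.
- apply/dnbhsCP; exists (Num.min r rho); first by rewrite lt_min rp.
  move=> w; rewrite lt_min => /andP[wr wrho] wx; have [_ E] := GE w wrho wx.
  have w0 : (w - z x) ^+ k != 0 by rewrite expf_neq0 // subr_eq0.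
  have h := Hr w wr.
  apply: (lc_pl (c := fun i => ((w - z x) ^+ k)^-1 *: lc N (G w) i)).
  split=> [i iN|l cl]; first by rewrite (h.1 i iN) scaler0.
  have := h.2 l cl; rewrite E // => e.
  transitivity (((w - z x) ^+ k)^-1 *: (l ^+ N *: ((w - z x) ^+ k *: Psi (cinv z w) l))).
    by rewrite !scalerA mulrC mulrA divff // mul1r.
  by rewrite e scaler_sumr; apply: eq_bigr => i _; rewrite !scalerA mulrC.
Qed.

Hypothesis hPsi : holomorphic_family (~` D) Psi.

Lemma notD_near x : ~ D x -> \forall q \near x, ~ D q.
Proof.
move=> nx; have h : \forall q \near x, q != x -> ~ D q by exact: hD.
by apply: filterS h => q H; have [->|/H] := eqVneq q x.
Qed.

Lemma local_hol x z l i j : ~ D x -> coords z -> cdom z x -> circle l ->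
  hol (z x) (fun w => Psi (cinv z w) l i j).
Proof.
move=> nx hz zx cl.
have := nearI (chart_near hz zx) (chart_inv_near hz zx (notD_near nx)).
case/nbhsCP=> d d0 H; exists d; first exact: d0.
move=> w hw; have [[c1 zw] nw] := H w hw.
by apply: derivable_cdiff; apply: (hPsi.2 z hz l cl i j); exists (cinv z w).
Qed.

Lemma local_laurent_hol x z N : ~ D x -> coords z -> cdom z x ->
  (\forall w \near (z x)^', pl N.*2.+1 (fun l => l ^+ N *: Psi (cinv z w) l) (lc N (Psi (cinv z w)))) ->
  (forall k, mhol (z x) (fun w => lc N (Psi (cinv z w)) k)) /\
  \forall w \near z x, pl N.*2.+1 (fun l => l ^+ N *: Psi (cinv z w) l) (lc N (Psi (cinv z w))).
Proof.
move=> nx hz zx h.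
have hh k : mhol (z x) (fun w => lc N (Psi (cinv z w)) k).
  by apply: lc_hol => l i j cl; exact: local_hol.
split=> //; apply: near_of_dnbhs => //; split=> [k kN|l cl]; first by rewrite /lc ltnNge kN.
apply/matrixP => i j; rewrite mxE summxE.
apply: (cont_dnbhs_eq (f := fun w => l ^+ N * Psi (cinv z w) l i j)
   (g := fun w => \sum_(k < N.*2.+1) (l ^+ k *: lc N (Psi (cinv z w)) k) i j)).
- by apply: hol_cont; apply: holM; [exact: hol_cst | exact: local_hol].
- apply: hol_cont; apply: hol_sum => k.
  apply: (hol_near (f := fun w => l ^+ k * lc N (Psi (cinv z w)) k i j)); first by apply: nearWC => w; rewrite mxE.
  by apply: holM; [exact: hol_cst | exact: hh].
- apply: filterS h => w [_ H].
  by have := congr1 (fun A : 'M[C]_n => A i j) (H l cl); rewrite mxE summxE.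
Qed.

End LocalLaurent.
End Charts.

(** * Derivatives of matrix-valued functions *)

Section MatrixDerivative.
Variable R : realType.
Local Notation C := (cplx R).

Definition mder m p (F : C -> 'M[C]_(m, p)) (w : C) : 'M[C]_(m, p) :=
  \matrix_(i, j) (fun v => F v i j)^`()%classic w.
Definition mcdiff m p (F : C -> 'M[C]_(m, p)) w := forall i j, exists d, cdiff (fun v => F v i j) w d.

Lemma mcdiffP m p (F : C -> 'M[C]_(m, p)) w : mcdiff F w ->
  forall i j, cdiff (fun v => F v i j) w (mder F w i j).
Proof.
move=> H i j; have [d hd] := H i j; rewrite mxE.
by have h := cdiff_derive1 hd; apply: cdiff_eq hd _; rewrite h.
Qed.

Lemma mderE m p (F G : C -> 'M[C]_(m, p)) w : (forall i j, cdiff (fun v => F v i j) w (G w i j)) -> mder F w = G w.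
Proof. by move=> H; apply/matrixP => i j; rewrite mxE; exact: cdiff_derive1. Qed.

Lemma mder_near m p (F G : C -> 'M[C]_(m, p)) w : (\forall v \near w, F v = G v) -> mcdiff F w -> mder F w = mder G w.
Proof.
move=> E dF; apply/matrixP => i j; rewrite [RHS]mxE; symmetry; apply: cdiff_derive1.
apply: cdiff_near (mcdiffP dF i j).
by apply: filterS E => v ->.
Qed.

Lemma mcdiff_near m p (F G : C -> 'M[C]_(m, p)) w : (\forall v \near w, F v = G v) -> mcdiff F w -> mcdiff G w.
Proof.
move=> E dF i j; have [d hd] := dF i j; exists d; apply: cdiff_near hd.
by apply: filterS E => v ->.
Qed.

Lemma cdiff_big (I : Type) (s : seq I) (F : I -> C -> C) (d : I -> C) w :
  (forall i, cdiff (F i) w (d i)) -> cdiff (fun v => \sum_(i <- s) F i v) w (\sum_(i <- s) d i).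
Proof.
move=> H; elim: s => [|i s IH].
  rewrite big_nil (_ : (fun v => _) = fun=> 0); first exact: cdiff_cst.
  by apply/funext => v; rewrite big_nil.
rewrite big_cons (_ : (fun v => _) = fun v => F i v + \sum_(j <- s) F j v).
  exact: cdiffD.
by apply/funext => v; rewrite big_cons.
Qed.

Lemma mcdiff_mul m p q (F : C -> 'M[C]_(m, p)) (G : C -> 'M[C]_(p, q)) w : mcdiff F w -> mcdiff G w ->
  mcdiff (fun v => F v *m G v) w /\ mder (fun v => F v *m G v) w = mder F w *m G w + F w *m mder G w.
Proof.
move=> hF hG.
have key i j : cdiff (fun v => (F v *m G v) i j) w ((mder F w *m G w + F w *m mder G w) i j).
  rewrite (_ : (fun v => _) = fun v => \sum_k F v i k * G v k j); last by apply/funext => v; rewrite mxE.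
  apply: (cdiff_eq (d := \sum_k (mder F w i k * G w k j + F w i k * mder G w k j))).
    by apply: cdiff_big => k; apply: cdiffM; exact: mcdiffP.
  by rewrite big_split mxE; congr (_ + _); rewrite [RHS]mxE.
split; first by move=> i j; eexists; exact: key.
exact: (@mderE _ _ _ (fun=> mder F w *m G w + F w *m mder G w)).
Qed.

Lemma mcdiff_cst m p (A : 'M[C]_(m, p)) w : mcdiff (fun=> A) w /\ mder (fun=> A) w = 0.
Proof.
split; first by move=> i j; exists 0; exact: cdiff_cst.
by apply: (@mderE _ _ _ (fun=> 0)) => i j; rewrite mxE; exact: cdiff_cst.
Qed.

Lemma mcdiff_mulc m p q (A : 'M[C]_(m, p)) (G : C -> 'M[C]_(p, q)) w : mcdiff G w ->
  mcdiff (fun v => A *m G v) w /\ mder (fun v => A *m G v) w = A *m mder G w.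
Proof.
move=> hG; have [c1 c2] := mcdiff_cst A w; have [h1 h2] := mcdiff_mul c1 hG; split=> //.
by rewrite h2 c2 mul0mx add0r.
Qed.

Lemma mcdiff_mulr m p q (G : C -> 'M[C]_(m, p)) (A : 'M[C]_(p, q)) w : mcdiff G w ->
  mcdiff (fun v => G v *m A) w /\ mder (fun v => G v *m A) w = mder G w *m A.
Proof.
move=> hG; have [c1 c2] := mcdiff_cst A w; have [h1 h2] := mcdiff_mul hG c1; split=> //.
by rewrite h2 c2 mulmx0 addr0.
Qed.

Lemma mcdiff_sum m p (I : Type) (s : seq I) (F : I -> C -> 'M[C]_(m, p)) w : (forall i, mcdiff (F i) w) ->
  mcdiff (fun v => \sum_(i <- s) F i v) w /\ mder (fun v => \sum_(i <- s) F i v) w = \sum_(i <- s) mder (F i) w.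
Proof.
move=> H; have key a b : cdiff (fun v => (\sum_(i <- s) F i v) a b) w ((\sum_(i <- s) mder (F i) w) a b).
  rewrite (_ : (fun v => _) = fun v => \sum_(i <- s) F i v a b); last by apply/funext => v; rewrite summxE.
  by rewrite summxE; apply: cdiff_big => i; exact: mcdiffP.
split; first by move=> i j; eexists; exact: key.
exact: (@mderE _ _ _ (fun=> \sum_(i <- s) mder (F i) w)).
Qed.

Lemma mhol_mcdiff m p w0 (F : C -> 'M[C]_(m, p)) : mhol w0 F -> \forall w \near w0, mcdiff F w.
Proof.
move=> H; have h : \forall w \near w0, forall ij : 'I_m * 'I_p, exists d, cdiff (fun v => F v ij.1 ij.2) w d.
  exact: (@filter_forall_fin R _ (nbhs w0) (nbhs_filter w0)
    (fun ij w => exists d, cdiff (fun v => F v ij.1 ij.2) w d) (fun ij => hol_cdiff (H ij.1 ij.2))).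
by apply: filterS h => w Hw i j; exact: (Hw (i, j)).
Qed.

Lemma mmero_mcdiff m p w0 (F : C -> 'M[C]_(m, p)) : mmero w0 F -> \forall w \near w0^', mcdiff F w.
Proof.
move=> H; have h : \forall w \near w0^', forall ij : 'I_m * 'I_p, exists d, cdiff (fun v => F v ij.1 ij.2) w d.
  by apply: filter_forall_fin => ij; exact: mero_cdiff.
by apply: filterS h => w Hw i j; exact: (Hw (i, j)).
Qed.

Lemma mhol_mder m p w0 (F : C -> 'M[C]_(m, p)) : mhol w0 F -> mhol w0 (mder F).
Proof.
move=> H i j; apply: hol_near (hol_derive (H i j)).
by apply: nearWC => w; rewrite mxE.
Qed.

Lemma mmero_mder m p w0 (F : C -> 'M[C]_(m, p)) : mmero w0 F -> mmero w0 (mder F).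
Proof.
move=> H i j; apply: mero_near (mero_derive (H i j)).
by apply: nearWD => w; rewrite mxE.
Qed.

End MatrixDerivative.

Lemma near2D (R : realType) (w0 : cplx R) (P Q : cplx R -> Prop) : (\forall x \near w0^', P x) ->
  (\forall x \near w0^', Q x) -> \forall x \near w0^', P x /\ Q x.
Proof. exact: filterI. Qed.

(** * Holomorphic idempotents of shift-invariant families *)

Section GermPack.
Variables (R : realType) (n r : nat) (w0 : cplx R).
Local Notation C := (cplx R).
Local Notation DD := (r.+1 * n)%N.
Local Notation T := (Tsh R n r).
Local Notation E0 := (Elast R n r).

Lemma extension_fin K (I : finType) (F : I -> C -> 'cV[C]_K) : (forall i, mmero w0 (F i)) ->
  exists E, [/\ mhol w0 E, (\forall w \near w0, E w *m E w = E w) &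
   \forall w \near w0^', (forall i, E w *m F i w = F i w) /\
     forall y : 'rV[C]_K, (forall i, y *m F i w = 0) -> y *m E w = 0].
Proof.
move=> mF; pose g j : C -> 'cV[C]_K := if insub j is Some o then F (enum_val (o : 'I_#|I|)) else fun=> 0.
have gi (i : I) : g (enum_rank i) = F i.
  rewrite /g insubT ?ltn_ord // => h.
  by congr F; rewrite -[RHS]enum_rankK; congr enum_val; exact: val_inj.
have [|E [hE EE sp]] := @extension R w0 K g #|I|.
  move=> j jI; rewrite /g insubT; exact: mF.
exists E; split=> //; apply: filterS sp => w [s1 s2]; split=> [i|y H].
  by rewrite -gi; apply: s1.
apply: s2 => j jI; rewrite /g insubT; exact: H.
Qed.

(* [E] is a germ of holomorphic idempotents whose image is shift invariant,
   contains [l^r H_+] and satisfies the complex extended solution equation *)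
Definition packat (E : C -> 'M[C]_DD) (w : C) :=
  [/\ E w *m E w = E w, E w *m T *m E w = T *m E w, E w *m E0 = E0 &
      (1%:M - E w) *m T *m mder E w *m E w = 0].
Definition pack (E : C -> 'M[C]_DD) := mhol w0 E /\ \forall w \near w0, packat E w.

Lemma row_perp m p q (A : 'M[C]_(m, p)) (X : 'M[C]_(p, q)) :
  (forall i, row i A *m X = 0) -> A *m X = 0.
Proof. by move=> H; apply/row_matrixP => i; rewrite row_mul H row0. Qed.

Lemma germ_pack (I : finType) (F : I -> C -> 'cV[C]_DD) : (forall i, mmero w0 (F i)) ->
  (\forall w \near w0^', forall y : 'rV[C]_DD, (forall i, y *m F i w = 0) ->
     [/\ (forall i, y *m T *m F i w = 0), (forall i, y *m T *m mder (F i) w = 0) & y *m E0 = 0]) ->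
  exists E, pack E /\ \forall w \near w0^', (forall i, E w *m F i w = F i w) /\
     forall y : 'rV[C]_DD, (forall i, y *m F i w = 0) -> y *m E w = 0.
Proof.
move=> mF H; have [E [hE EE sp]] := extension_fin mF; exists E; split=> //; split=> //.
have dF : \forall w \near w0^', forall i, mcdiff (F i) w.
  by apply: filter_forall_fin => i; exact: mmero_mcdiff.
have fixn : \forall w \near w0^', \forall v \near w, forall i, E v *m F i v = F i v.
  apply: near_dnbhs_near; apply: filterS sp => w []; exact.
have all := near2D (near2D sp H) (near2D (near2D dF fixn) (dnbhs_of_nbhs (mhol_mcdiff hE))).
have key : \forall w \near w0^', [/\ E w *m T *m E w = T *m E w, E w *m E0 = E0 &
      (1%:M - E w) *m T *m mder E w *m E w = 0].
  apply: filterS all => w [[[s1 s2] Hw] [[dFw fw] dE]].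
  have perp (i : 'I_DD) : forall j, row i (1%:M - E w) *m F j w = 0.
    by move=> j; rewrite -row_mul mulmxBl mul1mx s1 subrr row0.
  have TE : (1%:M - E w) *m T *m E w = 0.
    apply: row_perp => i; rewrite row_mul; apply: s2 => j.
    by have [h _ _] := Hw _ (perp i); exact: h.
  split.
  - by move/eqP: TE; rewrite !mulmxBl mul1mx subr_eq0 => /eqP.
  - apply/eqP; rewrite eq_sym -subr_eq0 -{1}[E0]mul1mx -mulmxBl; apply/eqP.
    by apply: row_perp => i; have [_ _ h] := Hw _ (perp i).
  - apply: row_perp => i; rewrite !row_mul; apply: s2 => j.
    (* This is the derivative of E F = F. *)
    have e : mder E w *m F j w = (1%:M - E w) *m mder (F j) w.
      have [_ h] := mcdiff_mul dE (dFw j).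
      have h2 : mder (fun v => E v *m F j v) w = mder (F j) w.
        apply: mder_near; first by apply: filterS fw => v; exact.
        by have [] := mcdiff_mul dE (dFw j).
      by rewrite mulmxBl mul1mx -{1}h2 h addrK.
    rewrite -(mulmxA (row i (1%:M - E w) *m T)) e mulmxA mulmxBr mulmx1 mulmxBl.
    have [_ h _] := Hw _ (perp i); rewrite h sub0r.
    by rewrite -(row_mul i (1%:M - E w)) -(row_mul i _ (E w)) TE row0 mul0mx oppr0.
have c1 m q (A : 'M[C]_(m, q)) : mhol w0 (fun=> A) by exact: mhol_cst.
have k1 : \forall w \near w0, E w *m T *m E w = T *m E w.
  apply: mhol_eq; [|exact: mholM |by apply: filterS key => w []].
  by apply: mholM => //; apply: mholM.
have k2 : \forall w \near w0, E w *m E0 = E0.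
  by apply: mhol_eq; [exact: mholM | exact: c1 | apply: filterS key => w []].
have k3 : \forall w \near w0, (1%:M - E w) *m T *m mder E w *m E w = 0.
  apply: mhol_eq; [|exact: c1 |by apply: filterS key => w []].
  apply: mholM => //; apply: mholM; last exact: mhol_mder.
  by apply: mholM => //; apply: mholB.
by have := nearI (nearI EE k1) (nearI k2 k3); apply: filterS => w [[a b] [c d]].
Qed.

Lemma pack_proj E w : packat E w -> inv_proj (orthp (E w)).
Proof.
case=> EE ETE EE0 _; split.
- exact: orthp_idem.
- exact: orthp_adj.
- have h : E w *m (T *m orthp (E w)) = T *m orthp (E w).
    by rewrite -(im_orthp EE) !mulmxA ETE.
  have := (orthp_fix (T *m orthp (E w)) EE).1 h; by rewrite mulmxA.
- exact: (orthp_fix _ EE).1 EE0.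
Qed.

End GermPack.

Section WPoint.
Variables (R : realType) (n : nat) (G S : set 'M[cplx R]_n).
Local Notation C := (cplx R).
Hypothesis GU : G `<=` @unitary_group R n.
Variables (psi phi dpsi : loop R n) (N d : nat) (b db : nat -> 'M[C]_n).
Hypothesis hIw : iwasawa_unitary_part G psi phi.
Hypothesis hb : pl d.+1 (fun l => l ^+ N *: psi l) b.
Hypothesis hdb : pl d.+1 (fun l => l ^+ N *: dpsi l) db.
Hypothesis hC : Lambda_plus S (fun l => l *: (invmx (psi l) *m dpsi l)).

Lemma phi_unitary l : circle l -> phi l *m (phi l)^t* = 1%:M.
Proof. by move=> cl; have [[[[_ h] _] _] _] := hIw; apply/unitary_groupP; apply: GU; exact: h. Qed.

Lemma Th_unitary l : circle l -> (l ^+ N *: phi l) *m (l ^+ N *: phi l)^t* = 1%:M.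
Proof.
move=> cl; rewrite hadjZ -scalemxAl -scalemxAr phi_unitary // scalerA rmorphXn /= (conj_circle cl).
by rewrite exprVn divff ?scale1r // expf_neq0 // circle_neq0.
Qed.

Lemma W_point : exists th, [/\ pl (d * n).+1 (fun l => l ^+ N *: phi l) th,
   (forall l, circle l -> psi l \in unitmx) &
   forall r, (forall k, (r < k)%N -> th k = 0) ->
     (exists2 a, a 0%N \in unitmx & vecp r b = \sum_(k < r.+1) Tpow R n r k *m vecp r th *m a k) /\
     (exists B : nat -> 'M[C]_n, Tsh R n r *m vecp r db = \sum_(k < r.+1) Tpow R n r k *m vecp r th *m B k)].
Proof.
have [[_ [c hc]] [pp [[[_ ppS] ppe] [dp [a0 hpp]]] fact]] := hIw.
have [F [dF FE FS]] := extends_mdisc ppe.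
have Fu l : nrm l <= 1 -> F l \in unitmx by move=> l1; exact: complexification_unit GU (FS l l1).
pose a k := if (k < dp.+1)%N then a0 k else 0.
have ha : pl dp.+1 pp a.
  split=> [k kd|l cl]; first by rewrite /a ltnNge kd.
  by rewrite hpp //; apply: eq_bigr => k _; rewrite /a ltn_ord.
pose Th l := l ^+ N *: phi l.
have ThU l : circle l -> Th l *m (Th l)^t* = 1%:M by exact: Th_unitary.
have [N' [_ hphi]] := laurent_pl hc.
have ThL : pl (N + N'.*2.+1) (fun l => l ^+ N' *: Th l) (fun s => if (s < N)%N then 0 else c ((s - N)%N%:Z - N'%:Z)).
  by apply: pl_eq (pl_scaleX N hphi) => l _; rewrite /Th !scalerA mulrC.
have hfact l : circle l -> l ^+ N *: psi l = Th l *m pp l by move=> cl; rewrite fact // /Th scalemxAl.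
have [th hth] := iwasawa_degree hb ThU ThL hfact ha dF FE Fu.
have uphi l : circle l -> phi l \in unitmx by move=> cl; have := phi_unitary cl => /mulmx1_unit[].
have upsi l : circle l -> psi l \in unitmx.
  by move=> cl; rewrite fact // unitmx_mul uphi //= -FE //; apply: Fu; exact: circle_nrm1.
exists th; split=> // r rk; split.
  exists a; first exact: a0_unit ha dF FE Fu.
  have h1 := pl_mul hth ha.
  have h2 : pl d.+1 (fun l => Th l *m pp l) b by apply: pl_eq hb => l cl; rewrite hfact.
  by rewrite -vecp_conv; apply: vecp_ext => s _; exact: pl_uniq h2 h1 s.
have [_ Ce] := hC.
have [CF [dC CE _]] := extends_mdisc Ce.
(* A priori psi_+ times the loop of [hC] is known only up to negative powers, from multiplying by
   the adjoint of Th; its extension to the disc then removes them. *)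
have hB0 : pl ((d * n).+1 + d.+2) (fun l => l ^+ (d * n) *: (pp l *m CF l))
   (fun s => \sum_(k < s.+1) (if (s - k <= d * n)%N then (th (d * n - (s - k))%N)^t* else 0) *m
      (if (k < 1)%N then 0 else db (k - 1)%N)).
  apply: pl_eq (pl_mul (pl_adj hth) (pl_scaleX 1 hdb)) => l cl.
  rewrite -scalemxAl; congr (_ *: _).
  rewrite (CE l cl); set X := invmx (psi l) *m dpsi l.
  have e : l ^+ N *: dpsi l = Th l *m (pp l *m X).
    by rewrite mulmxA -(hfact l cl) -scalemxAl /X mulKVmx ?upsi.
  rewrite e expr1 -!scalemxAr (mulmxA ((Th l)^t*) (Th l)) (unitary_left (ThU l cl)) mul1mx; exact: erefl.
have [B hB] : exists B, pl ((d * n).+1 + d.+2) (fun l => pp l *m CF l) B.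
  eexists; apply: (pl_noneg hB0 (F := fun l => F l *m CF l)); first exact: mdiscM.
  by move=> l cl; rewrite FE.
exists B.
have h1 := pl_mul hth hB.
have h2 : pl (1 + d.+1) (fun l => Th l *m (pp l *m CF l)) (fun s => if (s < 1)%N then 0 else db (s - 1)%N).
  apply: pl_eq (pl_scaleX 1 hdb) => l cl.
  rewrite CE // mulmxA -hfact // expr1 -scalemxAr -!scalemxAl mulKVmx ?upsi //.
rewrite -vecp_conv -[Tsh R n r]Tpow1 Tpow_vecp; apply: vecp_ext => s _.
by move: (pl_uniq h2 h1 s); rewrite ltnNge; case: (1 <= s)%N.
Qed.

End WPoint.

(** * Wirtinger derivatives *)

Section RealDerivatives.
Variable R : realType.
Local Notation C := (cplx R).

Lemma cder_uniq (f : R -> C) t d d' : cder f t d -> cder f t d' -> d = d'.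
Proof.
move=> [[_ a] [_ b]] [[_ a'] [_ b']]; apply: cplxP; first by rewrite -a -a'.
by rewrite -b -b'.
Qed.

Lemma cder_conj (f : R -> C) t d : cder f t d -> cder (fun h => (f h)^*) t d^*.
Proof.
move=> [h1 h2]; split.
- by rewrite re_conj (_ : (fun x => _) = (fun x => re (f x))) //; apply/funext => x; rewrite re_conj.
- rewrite im_conj (_ : (fun x => _) = (fun x => - im (f x))); first exact: is_deriveN.
  by apply/funext => x; rewrite im_conj.
Qed.

Lemma cder_near (f g : R -> C) t d : (\forall h \near t, f h = g h) -> cder f t d -> cder g t d.
Proof.
move=> E [h1 h2]; split.
- by apply: near_eq_is_derive h1 => //; apply: filterS E => h ->.
- by apply: near_eq_is_derive h2 => //; apply: filterS E => h ->.
Qed.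

Lemma cder_ext (f g : R -> C) t d : (forall h, f h = g h) -> cder f t d -> cder g t d.
Proof. by move/funext=> ->. Qed.

Lemma real_derivE (f : R -> C) t d : cder f t d -> real_deriv f t = d.
Proof.
by move=> [[_ a] [_ b]]; apply: cplxP; rewrite /real_deriv /re /im /= derive1E ?a ?b.
Qed.

Lemma cder_sum (I : Type) (s : seq I) (F : I -> R -> C) (d : I -> C) t :
  (forall i, cder (F i) t (d i)) -> cder (fun v => \sum_(i <- s) F i v) t (\sum_(i <- s) d i).
Proof.
move=> H; elim: s => [|i s IH].
  rewrite big_nil (_ : (fun v => _) = fun=> 0); first exact: cder_cst.
  by apply/funext => v; rewrite big_nil.
rewrite big_cons (_ : (fun v => _) = fun v => F i v + \sum_(j <- s) F j v).
  exact: cderD.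
by apply/funext => v; rewrite big_cons.
Qed.

Definition cderm m p (F : R -> 'M[C]_(m, p)) (D : 'M[C]_(m, p)) :=
  forall i j, cder (fun h => F h i j) 0 (D i j).

Lemma cderm_mul m p q (F : R -> 'M[C]_(m, p)) (G : R -> 'M[C]_(p, q)) D D' : cderm F D -> cderm G D' ->
  cderm (fun h => F h *m G h) (D *m G 0 + F 0 *m D').
Proof.
move=> hF hG i j; rewrite (_ : (fun h => _) = fun h => \sum_k F h i k * G h k j); last first.
  by apply/funext => h; rewrite mxE.
apply: (cder_eq (d := \sum_k (D i k * G 0 k j + F 0 i k * D' k j))).
  by apply: cder_sum => k; apply: cderM.
by rewrite big_split mxE; congr (_ + _); rewrite [RHS]mxE.
Qed.

Definition ln1 (w : C) (h : R) : C := w + mkC h 0.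
Definition ln2 (w : C) (h : R) : C := w + mkC 0 h.

Lemma ln10 w : ln1 w 0 = w. Proof. exact: addr0. Qed.
Lemma ln20 w : ln2 w 0 = w. Proof. exact: addr0. Qed.

(* [A] and [B] are the derivatives of [F] along d/dz and d/dzbar *)
Definition wd m p (F : C -> 'M[C]_(m, p)) w (A B : 'M[C]_(m, p)) := exists Dx Dy,
  [/\ cderm (fun h => F (ln1 w h)) Dx, cderm (fun h => F (ln2 w h)) Dy,
      A = 2^-1 *: (Dx - imagI R *: Dy) & B = 2^-1 *: (Dx + imagI R *: Dy)].

Lemma wd_mul m p q (F : C -> 'M[C]_(m, p)) (G : C -> 'M[C]_(p, q)) w A B A' B' : wd F w A B -> wd G w A' B' ->
  wd (fun v => F v *m G v) w (A *m G w + F w *m A') (B *m G w + F w *m B').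
Proof.
move=> [Dx [Dy [hx hy -> ->]]] [Dx' [Dy' [hx' hy' -> ->]]].
exists (Dx *m G w + F w *m Dx'), (Dy *m G w + F w *m Dy'); split.
- by have := cderm_mul hx hx'; rewrite ln10.
- by have := cderm_mul hy hy'; rewrite ln20.
- rewrite -scalemxAl -scalemxAr -scalerDr !mulmxBl mulmxBr; congr (_ *: _).
  by rewrite scalerDr -!scalemxAl -!scalemxAr opprD addrACA.
- rewrite -scalemxAl -scalemxAr -scalerDr !mulmxDl mulmxDr; congr (_ *: _).
  by rewrite scalerDr -!scalemxAl -!scalemxAr addrACA.
Qed.

Lemma wd_cst m p (X : 'M[C]_(m, p)) w : wd (fun=> X) w 0 0.
Proof.
exists 0, 0; split; try (by move=> i j; rewrite mxE; exact: cder_cst).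
- by rewrite scaler0 subr0 scaler0.
- by rewrite scaler0 addr0 scaler0.
Qed.

Lemma wd_mulc m p q (X : 'M[C]_(m, p)) (G : C -> 'M[C]_(p, q)) w A B : wd G w A B ->
  wd (fun v => X *m G v) w (X *m A) (X *m B).
Proof. by move=> h; have := wd_mul (wd_cst X w) h; rewrite !mul0mx !add0r. Qed.

Lemma wd_mulr m p q (G : C -> 'M[C]_(m, p)) (X : 'M[C]_(p, q)) w A B : wd G w A B ->
  wd (fun v => G v *m X) w (A *m X) (B *m X).
Proof. by move=> h; have := wd_mul h (wd_cst X w); rewrite !mulmx0 !addr0. Qed.

Lemma wd_sub m p (F G : C -> 'M[C]_(m, p)) w A B A' B' : wd F w A B -> wd G w A' B' ->
  wd (fun v => F v - G v) w (A - A') (B - B').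
Proof.
have cderB' (f g : R -> C) d e : cder f 0 d -> cder g 0 e -> cder (fun x => f x - g x) 0 (d - e).
  move=> hf hg; have := cderD hf (cderZ (-1) hg); rewrite mulN1r.
  by rewrite (_ : (fun x => f x + -1 * g x) = (fun x => f x - g x)) //; apply/funext => x; rewrite mulN1r.
move=> [Dx [Dy [hx hy -> ->]]] [Dx' [Dy' [hx' hy' -> ->]]]; exists (Dx - Dx'), (Dy - Dy'); split.
- move=> i j; rewrite !mxE (_ : (fun h => _) = fun h => F (ln1 w h) i j - G (ln1 w h) i j); first exact: cderB'.
  by apply/funext => h; rewrite !mxE.
- move=> i j; rewrite !mxE (_ : (fun h => _) = fun h => F (ln2 w h) i j - G (ln2 w h) i j); first exact: cderB'.
  by apply/funext => h; rewrite !mxE.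
- by apply/matrixP => i j; rewrite !mxE; move: (imagI R) => I; ring.
- by apply/matrixP => i j; rewrite !mxE; move: (imagI R) => I; ring.
Qed.

Lemma wd_adj m p (F : C -> 'M[C]_(m, p)) w A B : wd F w A B -> wd (fun v => (F v)^t*) w (B^t*) (A^t*).
Proof.
have ic : (imagI R)^* = - imagI R by rewrite conjE; apply: cplxP; rewrite ?reN ?imN /imagI /re /im /= ?oppr0.
have c2 : (2^-1 : C)^* = 2^-1 by rewrite fmorphV rmorph_nat.
move=> [Dx [Dy [hx hy -> ->]]]; exists (Dx^t*), (Dy^t*); split.
- move=> i j; rewrite !mxE (_ : (fun h => _) = fun h => (F (ln1 w h) j i)^*); first exact: cder_conj.
  by apply/funext => h; rewrite !mxE.
- move=> i j; rewrite !mxE (_ : (fun h => _) = fun h => (F (ln2 w h) j i)^*); first exact: cder_conj.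
  by apply/funext => h; rewrite !mxE.
- by rewrite hadjZ hadjD hadjZ ic c2 scaleNr.
- by rewrite hadjZ hadjB hadjZ ic c2 scaleNr opprK.
Qed.

Lemma ln1_near w (P : C -> Prop) : (\forall v \near w, P v) -> \forall h \near (0 : R), P (ln1 w h).
Proof.
case/nbhsCP=> d d0 H; apply/nbhs_ballP; exists d => //= h; rewrite /ball /= sub0r normrN => hh.
by apply: H; rewrite /ln1 addrAC subrr add0r -/(toC h) nrm_toC.
Qed.

Lemma ln2_near w (P : C -> Prop) : (\forall v \near w, P v) -> \forall h \near (0 : R), P (ln2 w h).
Proof.
case/nbhsCP=> d d0 H; apply/nbhs_ballP; exists d => //= h; rewrite /ball /= sub0r normrN => hh.
by apply: H; rewrite /ln2 addrAC subrr add0r /nrm /re /im /= expr0n add0r sqrtr_sqr.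
Qed.

Lemma wd_near m p (F G : C -> 'M[C]_(m, p)) w A B : (\forall v \near w, F v = G v) -> wd F w A B -> wd G w A B.
Proof.
move=> E [Dx [Dy [hx hy -> ->]]]; exists Dx, Dy; split=> // i j.
- by apply: cder_near (hx i j); apply: filterS (ln1_near E) => h ->.
- by apply: cder_near (hy i j); apply: filterS (ln2_near E) => h ->.
Qed.

Lemma wd_uniq m p (F : C -> 'M[C]_(m, p)) w A B A' B' : wd F w A B -> wd F w A' B' -> A = A' /\ B = B'.
Proof.
move=> [Dx [Dy [hx hy -> ->]]] [Dx' [Dy' [hx' hy' -> ->]]].
have -> : Dx = Dx' by apply/matrixP => i j; exact: cder_uniq (hx i j) (hx' i j).
by have -> : Dy = Dy' by apply/matrixP => i j; exact: cder_uniq (hy i j) (hy' i j).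
Qed.

Lemma imagI2 : imagI R * imagI R = -1.
Proof. by apply: cplxP; rewrite ?reM ?imM ?reN ?imN /imagI /re /im /= ?mulr0 ?mul0r ?mulr1 ?sub0r ?addr0 ?oppr0. Qed.

Lemma wd_hol m p (E : C -> 'M[C]_(m, p)) w : mcdiff E w -> wd E w (mder E w) 0.
Proof.
have L (f : C -> C) (d v : C) : cdiff f w d -> cder (fun h : R => f (w + toC h * v)) 0 (d * v).
  move=> hf; pose l (h : R^o) : C := toC h * v.
  have lD (h : R) (x u : R^o) : l (h *: u + x) = toC h * l u + l x.
    by rewrite /l (toCD (h *: u) x) (toCM h u) mulrDl mulrA.
  have hf' : cdiff (fun u => f (w + u)) (l 0) (d * 1).
    apply: cdiff_comp; last by rewrite /l toC0 mul0r addr0.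
    by apply: cdiff_eq (cdiffD (cdiff_cst w (l 0)) (cdiff_id (l 0))) _; rewrite add0r.
  have := @cder_line R R^o l lD (fun u => f (w + u)) _ 0 1 hf'.
  rewrite [l 1]mul1r mulr1; apply: cder_ext => h.
  by rewrite addr0 [h *: 1]mulr1.
move=> hE; exists (mder E w), (imagI R *: mder E w); split.
- move=> i j; have := L _ _ 1 (mcdiffP hE i j); rewrite mulr1; apply: cder_ext => h.
  by rewrite mulr1.
- move=> i j; have := L _ _ (imagI R) (mcdiffP hE i j); rewrite [in X in _ -> X]mxE [in X in _ -> X]mulrC; apply: cder_ext => h.
  congr (E _ i j); congr (_ + _).
  by apply: cplxP; rewrite ?reM ?imM /imagI /toC /re /im /= ?mulr0 ?mul0r ?mulr1 ?subr0 ?addr0.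
- have I2 (x : C) : x = 2^-1 * (x - imagI R * (imagI R * x)).
    by rewrite (mulrA (imagI R)) imagI2 mulN1r; field.
  by apply/matrixP => i j; rewrite !mxE; exact: I2.
- have I2 (x : C) : 0 = 2^-1 * (x + imagI R * (imagI R * x)).
    by rewrite (mulrA (imagI R)) imagI2 mulN1r subrr mulr0.
  by apply/matrixP => i j; rewrite !mxE; exact: I2.
Qed.

Lemma wd_wirtinger m p (F : C -> 'M[C]_(m, p)) w A B : wd F w A B ->
  \matrix_(i, j) wirtinger (fun v => F v i j) w = A.
Proof.
move=> [Dx [Dy [hx hy -> _]]]; apply/matrixP => i j; rewrite !mxE /wirtinger.
by rewrite (real_derivE (hx i j)) (real_derivE (hy i j)).
Qed.

End RealDerivatives.

(** * Smoothness of the reconstructed loops *)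

Section Smoothness.
Variables (R : realType) (V : normedModType R).
Local Notation C := (cplx R).

Lemma smoothC_cis (U : set V) (th : V -> R) : (forall (h : R) x v, th (h *: v + x) = h * th v + th x) ->
  continuous th -> smoothC U (fun x => cis (th x)).
Proof.
move=> tD ct k; split.
- have := Ck_sub (@subsetT _ U) (@Ck_trig R V th tD ct k 1 0); congr (Ck k U _).
  by apply/funext => x; rewrite re_cis mul1r mul0r addr0.
- have := Ck_sub (@subsetT _ U) (@Ck_trig R V th tD ct k 0 1); congr (Ck k U _).
  by apply/funext => x; rewrite im_cis mul1r mul0r add0r.
Qed.

Lemma smoothM_orthp m (l : V -> C) (O : set C) (E : C -> 'M[C]_m) :
  (forall (h : R) x v, l (h *: v + x) = toC h * l v + l x) -> continuous l -> open O ->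
  (forall w, O w -> mcdiff E w /\ E w *m E w = E w) ->
  smoothM (l @^-1` O) (fun x => orthp (E (l x))).
Proof.
move=> lD cl oO hE.
have oU : open (l @^-1` O) by move/continuousP: cl; exact.
have sE : smoothM (l @^-1` O) (fun x => E (l x)).
  move=> i j k; apply: (Ck_holo lD cl k (O := O) (f := fun w => E w i j)) => // w /hE[h _].
  exact: h.
apply: smoothM_mul => //; apply: smoothM_invmx => //.
  by move=> x /hE[_ EE]; exact: kerzman_unit.
by apply: smoothMB => //; [apply: smoothMD => //; exact: smoothM_adj | exact: smoothM_cst].
Qed.

Lemma smoothM_PhiP n r N (U : set V) (P : V -> 'M[C]_(r.+1 * n)) (th : V -> R) : open U ->
  (forall (h : R) x v, th (h *: v + x) = h * th v + th x) -> continuous th -> smoothM U P ->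
  smoothM U (fun x => cis (th x) ^- N *: PhiP (P x) (cis (th x))).
Proof.
move=> oU tD ct sP.
have sc := @smoothC_cis U th tD ct.
have sX k : smoothC U (fun x => cis (th x) ^+ k).
  have := smoothC_prod oU (index_enum 'I_k) (fun=> sc).
  by apply: smoothC_ext => // x _; rewrite prodr_const card_ord.
apply: smoothMZ => //; first by apply: smoothCV => // x _; exact: expf_neq0 (circle_neq0 (circle_cis _)).
have h : smoothM U (fun x => ev n r (cis (th x)) *m (P x - Tsh R n r *m P x *m (Tsh R n r)^t*) *m (ev n r 1)^t*).
  apply: smoothM_mul => //; last exact: smoothM_cst.
  apply: smoothM_mul => //.
    suff h : smoothM U (fun x => (\sum_(a < r.+1) (cis (th x))^* ^+ a *: jlb R n r a)^t*).
      by apply: smoothM_ext h => // x _; rewrite -ev_adj hadjK.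
    apply: smoothM_adj => // i j.
    suff h : smoothC U (fun x => \sum_(a < r.+1) ((cis (th x)) ^+ a)^* * jlb R n r a i j).
      apply: smoothC_ext h => // x _; rewrite summxE; apply: eq_bigr => a _.
      by rewrite [RHS]mxE; congr (_ * _); exact: rmorphXn.
    apply: smoothC_sum => // a; apply: smoothCM => //; last exact: smoothC_cst.
    exact: smoothC_conj.
  apply: smoothMB => //; apply: smoothM_mul => //; last exact: smoothM_cst.
  by apply: smoothM_mul => //; exact: smoothM_cst.
by apply: smoothM_ext h => // x _; rewrite PhiPE wanderingE.
Qed.

End Smoothness.

Section RealPlane.
Variable R : realType.
Local Notation C := (cplx R).

Lemma smoothC_cder (U : set R^o) (f : R^o -> C) : open U -> U 0 -> smoothC U f -> exists d, cder f 0 d.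
Proof.
move=> oU U0 sf; have [[_ h1] [_ h2]] := sf 1%N.
exists (mkC ('D_1 (fun x => re (f x)) 0) ('D_1 (fun x => im (f x)) 0)); split; split=> //.
- by case: (h1 1) => /(_ 0 U0).
- by case: (h2 1) => /(_ 0 U0).
Qed.

Lemma wd_orthp m (E : C -> 'M[C]_m) w0 : mhol w0 E -> (\forall w \near w0, E w *m E w = E w) ->
  exists A B, wd (fun w => orthp (E w)) w0 A B.
Proof.
move=> hE nE; have [d d0 H] := (nbhsCP _ _).1 (nearI (mhol_mcdiff hE) nE).
have L (v : C) : exists A, cderm (fun h : R => orthp (E (w0 + toC h * v))) A.
  pose O : set C := [set u | nrm u < d].
  have oO : open O.
    rewrite openE => u Ou; apply/nbhsCP; exists (d - nrm u); first by rewrite subr_gt0.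
    by move=> y; rewrite ltrBrDr => hy; apply: le_lt_trans hy; rewrite -{1}(subrK u y); exact: nrmD.
  pose l (h : R^o) : C := toC h * v.
  have lD (h : R) (x u : R^o) : l (h *: u + x) = toC h * l u + l x.
    by rewrite /l (toCD (h *: u) x) (toCM h u) mulrDl mulrA.
  have cl : continuous l.
    by move=> x; apply: cvgMl; exact: continuous_toC.
  have sm : smoothM (l @^-1` O) (fun h => orthp (E (w0 + l h))).
    apply: (smoothM_orthp (E := fun u => E (w0 + u)) lD cl oO) => u Ou.
    have [|h1 h2] := H (w0 + u); first by rewrite addrAC subrr add0r.
    split=> // i j; exists (mder E (w0 + u) i j * (0 + 1)); apply: cdiff_comp (mcdiffP h1 i j).
    exact: cdiffD (cdiff_cst _ _) (cdiff_id _).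
  have oU : open (l @^-1` O) by move/continuousP: cl; exact.
  have U0 : (l @^-1` O) 0 by rewrite /O /l /= toC0 mul0r nrm0.
  have D i j : {d' | cder (fun h : R => orthp (E (w0 + toC h * v)) i j) 0 d'}.
    by apply: cid; apply: smoothC_cder oU U0 _; exact: sm.
  by exists (\matrix_(i, j) projT1 (D i j)) => i j; rewrite mxE; exact: (projT2 (D i j)).
have [Dx hx] := L 1; have [Dy hy] := L (imagI R).
exists (2^-1 *: (Dx - imagI R *: Dy)), (2^-1 *: (Dx + imagI R *: Dy)), Dx, Dy; split; [| |reflexivity|reflexivity].
- by move=> i j; apply: cder_ext (hx i j) => h; rewrite mulr1.
- move=> i j; apply: cder_ext (hy i j) => h.
  congr (orthp (E (_ + _)) i j).
  by apply: cplxP; rewrite ?reM ?imM /imagI /toC /re /im /= ?mulr0 ?mul0r ?mulr1 ?subr0 ?addr0.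
Qed.

Lemma PhiP_cont n r (E : C -> 'M[C]_(r.+1 * n)) w0 (t : R) i j : mhol w0 E -> (\forall w \near w0, E w *m E w = E w) ->
  {for w0, continuous (fun w => PhiP (orthp (E w)) (cis t) i j)}.
Proof.
move=> hE nE; have [d d0 H] := (nbhsCP _ _).1 (nearI (mhol_mcdiff hE) nE).
pose O : set C := [set u | nrm (u - w0) < d].
have oO : open O.
  rewrite openE => u Ou; apply/nbhsCP; exists (d - nrm (u - w0)); first by rewrite subr_gt0.
  move=> y; rewrite ltrBrDr => hy; apply: le_lt_trans hy.
  by rewrite -{1}(subrK u y) -addrA; exact: nrmD.
pose l (x : R * R * R) : C := mkC x.1.1 x.1.2.
have lD (h : R) (x u : R * R * R) : l (h *: u + x) = toC h * l u + l x.
  by apply: cplxP; rewrite ?reD ?imD ?reM ?imM /l /toC /re /im /= ?mul0r ?subr0 ?addr0.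
have cl : continuous l.
  move=> x; apply: (@continuous_comp _ _ _ fst (fun y : R * R => mkC y.1 y.2)); first exact: cvg_fst.
  exact: continuous_mkC.
have oU : open (l @^-1` O) by move/continuousP: cl; exact.
have sm : smoothM (l @^-1` O) (fun x => orthp (E (l x))).
  by apply: smoothM_orthp => // w /H[].
have tD (h : R) (x v : R * R * R) : (h *: v + x).2 = h * v.2 + x.2 by [].
have ct : continuous (@snd (R * R) R) by move=> x; exact: cvg_snd.
have := @smoothM_PhiP R _ n r 0 _ _ _ oU tD ct sm i j 0%N.
rewrite /= => -[[c1 _] [c2 _]].
pose e (w : C) : R * R * R := (re w, im w, t).
have ce : {for w0, continuous e}.
  have c' : {for w0, continuous (fun w : C => (re w, im w) : R * R)}.
    exact: (cvg_pair (@continuous_re R w0) (@continuous_im R w0)).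
  exact: (cvg_pair c' (cvg_cst t)).
have le w : l (e w) = w by exact: mkC_eta.
have Ue : (l @^-1` O) (e w0) by rewrite /= /O /= le subrr nrm0.
have fE w : (cis (e w).2 ^- 0 *: PhiP (orthp (E (l (e w)))) (cis (e w).2)) i j = PhiP (orthp (E w)) (cis t) i j.
  by rewrite le expr0 invr1 scale1r.
have E1 : (fun x => re ((cis x.2 ^- 0 *: PhiP (orthp (E (l x))) (cis x.2)) i j)) \o e = (fun w => re (PhiP (orthp (E w)) (cis t) i j)).
  by apply/funext => w /=; rewrite fE.
have E2 : (fun x => im ((cis x.2 ^- 0 *: PhiP (orthp (E (l x))) (cis x.2)) i j)) \o e = (fun w => im (PhiP (orthp (E w)) (cis t) i j)).
  by apply/funext => w /=; rewrite fE.
have h1 := continuous_comp ce (c1 _ Ue); have h2 := continuous_comp ce (c2 _ Ue).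
rewrite E1 in h1; rewrite E2 in h2.
exact: ((cvgC_reim _ _ _).2 (conj h1 h2)).
Qed.

End RealPlane.

Lemma wandering_orth (R : realType) n r (P : 'M[cplx R]_(r.+1 * n)) k : inv_proj P -> (0 < k)%N ->
  wandering P *m Tpow R n r k *m wandering P = 0.
Proof.
move=> hP k0; rewrite -{2}(P_wandering hP) (mulmxA _ P) (wandering_Tpow hP k0); exact: mul0mx.
Qed.

(** * The extended solution equation *)

Section Derivative.
Variables (R : realType) (n r : nat) (w0 : cplx R).
Local Notation C := (cplx R).
Local Notation DD := (r.+1 * n)%N.
Local Notation T := (Tsh R n r).
Local Notation Tp := (Tpow R n r).
Local Notation J := ((ev n r 1)^t*).
Variable E : C -> 'M[C]_DD.
Hypothesis pE : pack w0 E.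

(** Holomorphy of E puts the d/dzbar derivative of the projection inside W, and the extended
    solution equation puts T times its d/dz derivative there. Differentiating W T^k W = 0 and the
    normalisation at l = 1 supplies the other hypotheses of [PhiP_derivative]. *)
Lemma PhiP_wirtinger : exists A : 'M[C]_n, forall l, circle l -> exists Z Zb,
  wd (fun w => PhiP (orthp (E w)) l) w0 Z Zb /\ (PhiP (orthp (E w0)) l)^t* *m Z = (1 - l^-1) *: A.
Proof.
have [hE nP] := pE.
have nEE : \forall w \near w0, E w *m E w = E w by apply: filterS nP => w [].
have [A [B hw]] := wd_orthp hE nEE.
pose P w := orthp (E w).
have nI : \forall w \near w0, inv_proj (P w) by apply: filterS nP => w /pack_proj.
have [EE ETE EE0 dE] := nbhs_singleton nP.
have [PP Pa PTP PE] := nbhs_singleton nI.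
have hwE := wd_hol (nbhs_singleton (mhol_mcdiff hE)).
(* The two Wirtinger derivatives of E P = P; the d/dzbar derivative of E is zero. *)
have [e1 e2] : A = mder E w0 *m P w0 + E w0 *m A /\ B = 0 *m P w0 + E w0 *m B.
  apply: (wd_uniq hw); apply: wd_near (wd_mul hwE hw).
  by apply: filterS nEE => w ee; exact: im_orthp.
have PB : P w0 *m B = B by apply/(orthp_fix _ EE); rewrite {2}e2 mul0mx add0r.
have [AB BA] : A = B^t* /\ B = A^t*.
  apply: (wd_uniq hw); apply: wd_near (wd_adj hw).
  by apply: filterS nI => w [].
have PTA : P w0 *m (T *m A) = T *m A.
  apply/(orthp_fix _ EE); have : (1%:M - E w0) *m (T *m A) = 0.
    rewrite e1 mulmxDr mulmxDr (mulmxA T (E w0) A).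
    have N0 : (1%:M - E w0) *m (T *m E w0) = 0 by rewrite mulmxBl mul1mx (mulmxA (E w0) T (E w0)) ETE subrr.
    rewrite (mulmxA (1%:M - E w0) (T *m E w0) A) N0 mul0mx addr0.
    have PwE : P w0 = E w0 *m P w0 by rewrite /P im_orthp.
    transitivity ((1%:M - E w0) *m T *m mder E w0 *m E w0 *m P w0); last by rewrite dE mul0mx.
    by rewrite {1}PwE !mulmxA.
  by rewrite mulmxBl mul1mx => /eqP; rewrite subr_eq0 => /eqP.
pose dW := A - T *m A *m T^t*.
have dWa : dW^t* = B - T *m B *m T^t*.
  by rewrite /dW hadjB !hadjM hadjK -BA mulmxA.
have hW : wd (fun w => wandering (P w)) w0 dW (B - T *m B *m T^t*).
  apply: wd_near (wd_sub hw (wd_mulr (T^t*) (wd_mulc T hw))).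
  by apply: nearWC => w; symmetry; exact: wanderingE.
have c1 : P w0 *m (T *m dW) = T *m dW.
  rewrite /dW mulmxBr mulmxBr PTA; congr (_ - _).
  rewrite !mulmxA -(mulmxA (P w0 *m T *m T) A (T^t*)) -(mulmxA (P w0 *m T) T).
  rewrite (mulmxA T A) -{1}PTA (mulmxA (P w0 *m T) _ _) (mulmxA (P w0 *m T) _ _).
  by rewrite PTP -(mulmxA T (P w0)) PTA !mulmxA.
have c2 : P w0 *m dW^t* = dW^t*.
  rewrite dWa mulmxBr PB; congr (_ - _).
  by rewrite !mulmxA -{1}PB (mulmxA _ (P w0) B) PTP -(mulmxA T (P w0) B) PB.
have c3 k : (0 < k)%N -> dW^t* *m Tp k *m wandering (P w0) + wandering (P w0) *m Tp k *m dW^t* = 0.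
  move=> k0; have h := wd_mul (wd_mulr (Tp k) hW) hW.
  have h0 : wd (fun w => wandering (P w) *m Tp k *m wandering (P w)) w0 0 0.
    apply: wd_near (wd_cst 0 w0); apply: filterS nI => w hw'.
    exact: esym (wandering_orth hw' k0).
  by have [_] := wd_uniq h h0; rewrite -dWa.
have c4 : ev n r 1 *m dW *m J = 0.
  have h := wd_mulr J (wd_mulc (ev n r 1) hW).
  have h0 : wd (fun w => ev n r 1 *m wandering (P w) *m J) w0 0 0.
    by apply: wd_near (wd_cst 1%:M w0); apply: filterS nI => w hw'; rewrite JWJ.
  exact: (proj1 (wd_uniq h h0)).
exists (ev n r 1 *m wandering (P w0) *m dW *m J) => l hl.
exists (ev n r l *m dW *m J), (ev n r l *m (B - T *m B *m T^t*) *m J); split.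
  apply: wd_near (wd_mulr J (wd_mulc (ev n r l) hW)).
  by apply: nearWC => w; symmetry; exact: PhiPE.
exact: (PhiP_derivative (nbhs_singleton nI) c1 c2 c3 c4 hl).
Qed.

End Derivative.

Section ExtendedSolution.
Variables (R : realType) (n : nat) (M : riemann_surface R).
Local Notation C := (cplx R).

(** A change of coordinate multiplies the derivative of E by a scalar, and the equation in [packat]
    is linear in that derivative. *)
Lemma pack_trans r (z1 z2 : chart R M) x (E : C -> 'M[C]_(r.+1 * n)) : coords z1 -> coords z2 -> cdom z1 x -> cdom z2 x ->
  pack (z2 x) E -> pack (z1 x) (fun w => E (trans z1 z2 w)).
Proof.
move=> h1 h2 x1 x2 [hE nE]; split; first exact: mhol_trans.
have nd := trans_near h1 h2 x1 x2 (mhol_mcdiff hE).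
have ne := trans_near h1 h2 x1 x2 nE.
apply: filterS (nearI (nearI nd ne) (hol_cdiff (trans_hol h1 h2 x1 x2))) => w [[dE [a b c d]] [t ht]].
split; [exact: a | exact: b | exact: c |].
have -> : mder (fun w => E (trans z1 z2 w)) w = t *: mder E (trans z1 z2 w).
  apply: (mderE (G := fun w => t *: mder E (trans z1 z2 w))) => i j; have := cdiff_comp (f := fun v => E v i j) ht (mcdiffP dE i j).
  by move/cdiff_eq; apply; rewrite [RHS]mxE mulrC.
by rewrite -scalemxAr -scalemxAl d scaler0.
Qed.

(** The factor l^N absorbs negative powers of l, so Laurent loops are covered by polynomial
    truncations. *)
Definition local_form (Phi : M -> loop R n) x (z : chart R M) N r (E : C -> 'M[C]_(r.+1 * n)) :=
  [/\ coords z, cdom z x, pack (z x) E &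
      \forall w \near z x, forall l, circle l -> l ^+ N *: Phi (cinv z w) l = PhiP (orthp (E w)) l].

Lemma local_form_chart Phi x z z' N r (E : C -> 'M[C]_(r.+1 * n)) : coords z' -> cdom z' x ->
  local_form Phi x z N E -> local_form Phi x z' N (fun w => E (trans z' z w)).
Proof.
move=> hz' x' [hz xz pE nE]; split; [exact: hz' | exact: x' | exact: pack_trans |].
apply: filterS (nearI (trans_near hz' hz x' xz nE) (trans_inv hz' hz x' xz)) => w [h e] l hl.
by rewrite -h // e.
Qed.

Definition locES (Phi : M -> loop R n) := forall x, exists z N r (E : C -> 'M[C]_(r.+1 * n)), local_form Phi x z N E.

Section ES.
Variables (G : set 'M[C]_n) (Phi : M -> loop R n).
Hypothesis GU : G `<=` @unitary_group R n.
Hypothesis G1 : G 1%:M.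
Hypothesis GM : forall A B, G A -> G B -> G (A *m B).
Hypothesis GV : forall A, G A -> G (invmx A).
Hypothesis cG : closed G.
Hypothesis hloc : locES Phi.
Hypothesis hPhi : forall p l, circle l -> G (Phi p l).

Lemma local_formE x z N r (E : C -> 'M[C]_(r.+1 * n)) : local_form Phi x z N E ->
  forall l, circle l -> Phi x l = l ^- N *: PhiP (orthp (E (z x))) l.
Proof.
move=> [hz xz _ nE] l hl; have := nbhs_singleton nE l hl; rewrite (chartK hz xz) => <-.
by rewrite scalerA mulVf ?scale1r //; exact: expf_neq0 (circle_neq0 hl).
Qed.

Lemma ES_Omega p : Omega G (Phi p).
Proof.
have [z [N [r [E hE]]]] := hloc p; have Pp := local_formE hE; have [_ _ [_ nE] _] := hE.
split; last by rewrite Pp ?expr1n ?invr1 ?scale1r ?(PhiP1 (pack_proj (nbhs_singleton nE))) //; exact: circle1.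
split=> [|l hl]; last exact: hPhi.
apply/smooth_onP; pose th (t : R^o) : R := t.
have tD (h : R) (x v : R^o) : th (h *: v + x) = h * th v + th x by [].
have ct : continuous th by move=> t; exact: cvg_id.
have := @smoothM_PhiP R _ n r N setT (fun=> orthp (E (z p))) th openT tD ct (smoothM_cst _ _).
apply: smoothM_ext => [|t _]; first exact: openT.
by rewrite Pp //; exact: circle_cis.
Qed.

Lemma ES_smooth : smooth_family setT Phi.
Proof.
move=> z hz; apply/smooth_onP.
pose l (x : R * R * R) : C := mkC x.1.1 x.1.2.
have lD (h : R) (x u : R * R * R) : l (h *: u + x) = toC h * l u + l x.
  by apply: cplxP; rewrite ?reD ?imD ?reM ?imM /l /toC /re /im /= ?mul0r ?subr0 ?addr0.
have cl : continuous l.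
  move=> x; apply: (@continuous_comp _ _ _ fst (fun y : R * R => mkC y.1 y.2)); first exact: cvg_fst.
  exact: continuous_mkC.
have tD (h : R) (x v : R * R * R) : (h *: v + x).2 = h * v.2 + x.2 by [].
have ct : continuous (@snd (R * R) R) by move=> x; exact: cvg_snd.
suff L (x : R * R * R) : chart_image z setT (l x) -> exists2 O, O x &
    smoothM O (fun x => Phi (cinv z (l x)) (cis x.2)).
  move=> a b k; split; apply: Ck_local => x /L[]O Ox sO; exists O => //; by case: (sO a b k).
move=> [p [zp _] zpx].
have [z' [N [r [E0 hE0]]]] := hloc p.
have [_ _ [hE nE] nP] := local_form_chart hz zp hE0; move: hE nE nP; set E := fun w => _ => hE nE nP.
rewrite zpx in hE nE nP.
have [d d0 H] := (nbhsCP _ _).1 (nearI (nearI (mhol_mcdiff hE) nE) nP).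
pose O : set C := [set u | nrm (u - l x) < d].
have oO : open O.
  rewrite openE => u Ou; apply/nbhsCP; exists (d - nrm (u - l x)); first by rewrite subr_gt0.
  move=> y; rewrite ltrBrDr => hy; apply: le_lt_trans hy.
  by rewrite -{1}(subrK u y) -addrA; exact: nrmD.
have oU : open (l @^-1` O) by move/continuousP: cl; exact.
exists (l @^-1` O); first by rewrite /O /= subrr nrm0.
have sm : smoothM (l @^-1` O) (fun x => orthp (E (l x))).
  by apply: smoothM_orthp => // w /H[[h1 []]].
apply: smoothM_ext (smoothM_PhiP N oU tD ct sm) => // y /H[_ hy].
rewrite -hy; last exact: circle_cis.
by rewrite scalerA mulVf ?scale1r //; exact: expf_neq0 (circle_neq0 (circle_cis _)).
Qed.

(** A is read off at l = -1, where 1 - l^-1 = 2. The real derivatives of Phi there, translated to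
    the identity, are tangent to curves in G, so [lie_of_curve] applies. *)
Lemma ES_lie z p : coords z -> cdom z p -> exists A : 'M[C]_n, complex_lie_algebra G A /\
  forall l, circle l -> invmx (Phi p l) *m zwirtinger z (fun q => Phi q l) p = (1 - l^-1) *: A.
Proof.
move=> hz zp; have [z' [N [r [E0 hE0]]]] := hloc p.
have hE := local_form_chart hz zp hE0; move: hE; set E := fun w => _ => hE.
have Pp := local_formE hE; have [_ _ pE nP] := hE.
have [A hA] := PhiP_wirtinger pE; have iP := pack_proj (nbhs_singleton pE.2).
have X l : circle l -> exists Z Zb, wd (fun w => Phi (cinv z w) l) (z p) Z Zb /\ invmx (Phi p l) *m Z = (1 - l^-1) *: A.
  move=> hl; have [Z [Zb [hZ eZ]]] := hA l hl; have lN0 : l ^+ N != 0 := expf_neq0 _ (circle_neq0 hl).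
  exists (l ^- N *: Z), (l ^- N *: Zb); split.
    have := wd_mulc ((l ^- N)%:M) hZ; rewrite !mul_scalar_mx; apply: wd_near.
    by apply: filterS nP => w <- //; rewrite mul_scalar_mx scalerA mulVf ?scale1r.
  have U := PhiP_unitary' iP hl.
  have -> : invmx (Phi p l) = l ^+ N *: (PhiP (orthp (E (z p))) l)^t*.
    have uP : Phi p l \in unitmx.
      by apply: (mulmx1_unit (B := (Phi p l)^t*) _).1; apply/unitary_groupP; apply: GU; exact: hPhi.
    rewrite -[RHS]mulmx1 -(mulmxV uP) mulmxA -[LHS]mul1mx; congr (_ *m _).
    by rewrite Pp // -scalemxAl -scalemxAr scalerA mulfV // scale1r U.
  by rewrite -scalemxAl -scalemxAr scalerA mulfV // scale1r.
exists A; split; last first.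
  by move=> l /X[Z [Zb [hZ <-]]]; rewrite /zwirtinger (wd_wirtinger hZ).
have cm1 : circle (-1 : C) by apply/circleE; rewrite nrmN nrm1.
have [Z [Zb [[Dx [Dy [hx hy eZ _]]] eA]]] := X _ cm1.
have lie (F : R -> C) D : F 0 = z p -> cderm (fun h => Phi (cinv z (F h)) (-1)) D -> lie_algebra G (invmx (Phi p (-1)) *m D).
  move=> F0 hD; apply: (lie_of_curve G1 GM cG (g := fun h => invmx (Phi p (-1)) *m Phi (cinv z (F h)) (-1))).
  - rewrite F0 (chartK hz zp) mulVmx //.
    by apply: (mulmx1_unit (B := (Phi p (-1))^t*) _).1; apply/unitary_groupP; apply: GU; exact: hPhi.
  - by move=> t; apply: GM; [apply: GV; exact: hPhi | exact: hPhi].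
  - have h0 : cderm (fun=> invmx (Phi p (-1))) 0 by move=> i j; rewrite mxE; exact: cder_cst.
    by have := cderm_mul h0 hD; rewrite mul0mx add0r.
have lx := lie _ _ (ln10 (z p)) hx; have ly := lie _ _ (ln20 (z p)) hy.
(* 1/4 is the 1/2 of d/dz times the 1/2 from the value of 1 - l^-1 at -1. *)
exists (toC 4^-1 *: (invmx (Phi p (-1)) *m Dx)), (toC (- 4^-1) *: (invmx (Phi p (-1)) *m Dy)).
split; [exact: lie_scale | exact: lie_scale |].
have -> : A = 2^-1 *: (invmx (Phi p (-1)) *m Z).
  by rewrite eA scalerA invrN invr1 opprK mulVf ?scale1r // -(natrD _ 1 1) pnatr_eq0.
have t4 : toC (4^-1 : R) = 2^-1 * 2^-1 :> C.
  rewrite toCV -invfM; congr (_^-1); rewrite -natrM.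
  rewrite (_ : (4 : R) = 1 + 1 + 1 + 1); last by ring.
  by rewrite !toCD toC1; ring.
rewrite eZ toCN t4 -scalemxAr mulmxBr -scalemxAr.
move: (invmx _ *m Dx) (invmx _ *m Dy) => X' Y'; apply/matrixP => i j; rewrite !mxE.
by move: (imagI R) => I; ring.
Qed.

Lemma extended_solution_of_local : extended_solution G Phi.
Proof.
split; [exact: ES_Omega | exact: ES_smooth |] => z hz.
have H p : exists A : 'M[C]_n, cdom z p -> complex_lie_algebra G A /\ forall l, circle l ->
    invmx (Phi p l) *m zwirtinger z (fun q => Phi q l) p = (1 - l^-1) *: A.
  have [zp|nzp] := pselect (cdom z p); last by exists 0.
  by have [A hA] := ES_lie hz zp; exists A.
by have [A hA] := choice H; exists A.
Qed.

End ES.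
End ExtendedSolution.

(** The mean value property for 1 / det F; the loss of 2 is that of [CI_norm]. *)
Lemma det_lower_bound (R : realType) n (F : cplx R -> 'M[cplx R]_n) (delta : R) : 0 < delta -> mdisc F ->
  (forall l, nrm l <= 1 -> F l \in unitmx) -> (forall l, circle l -> delta <= nrm (\det (F l))) ->
  delta / 2 <= nrm (\det (F 0)).
Proof.
move=> d0 dF uF hF.
have F0 l : nrm l <= 1 -> \det (F l) != 0 by move=> /uF; rewrite unitmxE unitfE.
have [c1 e1] := disc_mean (discV F0 (disc_det dF)).
have b1 : nrm ((\det (F 0))^-1) <= 2 * delta^-1 * (1 - 0).
  rewrite e1; apply: CI_norm => // t _; rewrite nrmV lef_pV2 ?posrE //; first exact: hF (circle_eturn t).
  by apply: lt_le_trans d0 _; exact: hF (circle_eturn t).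
have p0 : 0 < nrm (\det (F 0)) by rewrite nrm_gt0 F0 // nrm0.
by move: b1; rewrite nrmV subr0 mulr1 -[2 * delta^-1]invf_div lef_pV2 ?posrE ?divr_gt0.
Qed.

Section PointLemmas.
Variables (R : realType) (n : nat).
Local Notation C := (cplx R).

Lemma pl_ev r q (X : 'M[C]_(r.+1 * n, q)) : pl r.+1 (fun l => ev n r l *m X) (fun s => blk R n r s *m X).
Proof.
have hp : pl r.+1 (fun l => \sum_(k < r.+1) l ^+ k *: (blk R n r k *m X)) (fun s => blk R n r s *m X).
  by split=> // k rk; rewrite blk_big // mul0mx.
by apply: (pl_eq _ hp) => l hl; rewrite -(ev_vecp hp hl) vecp_blk.
Qed.

Definition Wspan r q (B : 'M[C]_(r.+1 * n, q)) (E : 'M[C]_(r.+1 * n)) :=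
  (forall m, E *m (Tpow R n r m *m B) = Tpow R n r m *m B) /\
  forall y : 'rV[C]_(r.+1 * n), (forall m, y *m Tpow R n r m *m B = 0) -> y *m E = 0.

Lemma Wspan_rows r q p (B : 'M[C]_(r.+1 * n, q)) E (y : 'M[C]_(p, r.+1 * n)) : Wspan B E ->
  (forall m, y *m Tpow R n r m *m B = 0) -> y *m E = 0.
Proof.
move=> [_ h] hy; apply: row_perp => i; apply: h => m.
by rewrite -!row_mul hy row0.
Qed.

(* [P] is spanned by the [T^m W], where [W] is the wandering projection. *)
Lemma wandering_span r p (P : 'M[C]_(r.+1 * n)) (y : 'M[C]_(p, r.+1 * n)) : inv_proj P ->
  (forall m, y *m Tpow R n r m *m (wandering P *m (ev n r 1)^t*) = 0) -> y *m P = 0.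
Proof.
move=> hP hy.
have hW m : y *m Tpow R n r m *m wandering P = 0.
  by rewrite (wandering_J hP) mulmxA hy mul0mx.
have st m : y *m Tpow R n r m *m P = y *m Tpow R n r m.+1 *m P *m (Tsh R n r)^t*.
  transitivity (y *m Tpow R n r m *m (wandering P + Tsh R n r *m P *m (Tsh R n r)^t*)); first by rewrite wanderingE subrK.
  by rewrite mulmxDr hW add0r TpowS !mulmxA.
have big k m : exists Z, y *m Tpow R n r m *m P = y *m Tpow R n r (m + k)%N *m P *m Z.
  elim: k m => [|k IH] m; first by exists 1%:M; rewrite addn0 mulmx1.
  have [Z hZ] := IH m.+1; exists (Z *m (Tsh R n r)^t*).
  by rewrite st hZ addSnnS mulmxA.
have [Z] := big r.+1 0%N; rewrite Tpow0 mulmx1 => ->.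
by rewrite Tpow_big // mulmx0 !mul0mx.
Qed.

Variable G : set 'M[C]_n.
Hypothesis GU : G `<=` @unitary_group R n.
Variables (psi phi : loop R n).
Hypothesis hIw : iwasawa_unitary_part G psi phi.

(** Phi^* psi = psi_+ extends to the disc, so it has no negative coefficients and its constant one
    is the value at 0. On the circle its determinant has the modulus of det psi, since Phi is
    unitary. *)
Lemma iwasawa_coef (delta : R) s L e : 0 < delta -> (forall l, circle l -> delta <= nrm (\det (psi l))) ->
  pl L (fun l => l ^+ s *: ((phi l)^t* *m psi l)) e -> (forall k, (k < s)%N -> e k = 0) /\ delta / 2 <= nrm (\det (e s)).
Proof.
move=> d0 hd he; have hU := phi_unitary GU hIw.
have [_ [pp [[[_ _] ppe] _] fact]] := hIw.
have [F [dF FE FS]] := extends_mdisc ppe.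
have Fu l : nrm l <= 1 -> F l \in unitmx by move=> l1; exact: complexification_unit GU (FS l l1).
have Fe l : circle l -> F l = (phi l)^t* *m psi l.
  by move=> hl; rewrite FE // fact // mulmxA (unitary_left (hU l hl)) mul1mx.
have hk := disc_coef he dF Fe; split.
  by move=> k ks; rewrite hk ?(ltnW ks) // ltn_eqF.
rewrite hk // eqxx; apply: det_lower_bound => // l hl.
have := hd l hl; rewrite fact // det_mulmx nrmM (nrm_det_unitary (hU l hl)) mul1r.
by rewrite FE.
Qed.

(** The shift spans of b and of th coincide, so th satisfies the hypotheses of [PhiP_unique] for the
    projection made from E. *)
Lemma Wspan_phi N d b th a r (E : 'M[C]_(r.+1 * n)) :
  pl (d * n).+1 (fun l => l ^+ N *: phi l) th -> (forall k, (r < k)%N -> th k = 0) ->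
  a 0%N \in unitmx -> vecp r b = \sum_(k < r.+1) Tpow R n r k *m vecp r th *m a k ->
  E *m E = E -> inv_proj (orthp E) -> Wspan (vecp r b) E ->
  forall l, circle l -> l ^+ N *: phi l = PhiP (orthp E) l.
Proof.
move=> hth thr a0 hb EE iP hW l hl.
have hth' := pl_trunc hth (K := r.+1) thr.
have ThU := Th_unitary GU N hIw.
have up y : (forall m, y *m Tpow R n r m *m vecp r b = 0) -> forall m, y *m Tpow R n r m *m vecp r th = 0.
  by move=> p; exact: (conv_perp_unit hb a0 p).
rewrite -(ev_vecp hth' hl); symmetry; apply: (PhiP_unique iP) => //.
- apply/(orthp_fix _ EE).
  suff : (1%:M - E) *m vecp r th = 0 by rewrite mulmxBl mul1mx => /eqP; rewrite subr_eq0 => /eqP.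
  have := @up _ (1%:M - E) _ 0%N; rewrite Tpow0 mulmx1; apply=> m.
  by rewrite -mulmxA mulmxBl mul1mx hW.1 subrr.
- move=> y hy; rewrite -(im_orthp EE) mulmxA (Wspan_rows hW) ?mul0mx //.
  exact: conv_perp hb hy.
- by move=> k k0; exact: (inner_orth hth' ThU k0).
- rewrite (ev_vecp hth' (@circle1 R)) expr1n scale1r.
  by case: hIw => -[[_ ->]].
Qed.

End PointLemmas.

Section Family.
Variables (R : realType) (n : nat) (M : riemann_surface R).
Local Notation C := (cplx R).
Variables (D : set M) (G S : set 'M[C]_n) (Psi Phi : M -> loop R n).
Hypothesis GU : G `<=` @unitary_group R n.
Hypothesis hD : discrete_subset D.
Hypothesis hIw : forall p, ~ D p -> iwasawa_unitary_part G (Psi p) (Phi p).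
Hypothesis hC : forall z p, coords z -> cdom z p -> ~ D p ->
  Lambda_plus S (fun l => l *: (invmx (Psi p l) *m zderiv z 1 (fun q => Psi q l) p)).

Lemma mulmx_delta0 m p (A : 'M[C]_(m, p)) : (forall j, A *m delta_mx j (0 : 'I_1) = 0) -> A = 0.
Proof.
move=> h; apply/matrixP => i j; have := congr1 (fun X : 'M[C]_(m, 1) => X i 0) (h j).
by rewrite -colE !mxE.
Qed.

Lemma mulmx_delta m p (A B : 'M[C]_(m, p)) : (forall j, A *m delta_mx j (0 : 'I_1) = B *m delta_mx j 0) -> A = B.
Proof. by move=> h; apply/eqP; rewrite -subr_eq0; apply/eqP/mulmx_delta0 => j; rewrite mulmxBl h subrr. Qed.

Lemma mmero_vecp w0 r q (b : nat -> C -> 'M[C]_(n, q)) : (forall k, mmero w0 (b k)) ->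
  mmero w0 (fun w => vecp r (fun k => b k w)).
Proof.
move=> hb i j; have H (s : 'I_r.+1) : mero w0 (fun w => (jlb R n r s *m b s w) i j).
  by apply: mmeroM (hb s) i j; apply: mhol_mmero; exact: mhol_cst.
have := mero_sum (index_enum 'I_r.+1) H; apply: mero_near; apply: nearWD => w.
by rewrite /vecp summxE.
Qed.

Lemma mder_vecp w r q (b : nat -> C -> 'M[C]_(n, q)) : (forall k, mcdiff (b k) w) ->
  mcdiff (fun w => vecp r (fun k => b k w)) w /\ mder (fun w => vecp r (fun k => b k w)) w = vecp r (fun k => mder (b k) w).
Proof.
move=> hb.
have H (s : 'I_r.+1) := mcdiff_mulc (jlb R n r s) (hb s).
have [h1 h2] := mcdiff_sum (index_enum 'I_r.+1) (fun s => (H s).1).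
by split=> //; rewrite h2; apply: eq_bigr => s _; rewrite (H s).2.
Qed.

Section Chart.
Variables (x : M) (z : chart R M) (N d r : nat) (b : nat -> C -> 'M[C]_n).
Hypotheses (hz : coords z) (zx : cdom z x).
Hypothesis hb : forall k, mmero (z x) (b k).
Hypothesis hpl : \forall w \near (z x)^', pl d.+1 (fun l => l ^+ N *: Psi (cinv z w) l) (fun k => b k w).
Hypothesis hr : forall q th, ~ D q -> pl (d * n).+1 (fun l => l ^+ N *: Phi q l) th -> forall k, (r < k)%N -> th k = 0.

Definition W_data w := [/\ ~ D (cinv z w), (forall k, mcdiff (b k) w) & exists th, [/\
  pl (d * n).+1 (fun l => l ^+ N *: Phi (cinv z w) l) th, (forall k, (r < k)%N -> th k = 0),
  (exists2 a, a 0%N \in unitmx & vecp r (fun k => b k w) = \sum_(k < r.+1) Tpow R n r k *m vecp r th *m a k) &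
  (exists B : nat -> 'M[C]_n, Tsh R n r *m vecp r (fun k => mder (b k) w) = \sum_(k < r.+1) Tpow R n r k *m vecp r th *m B k)]].

Lemma W_at w : cdom z (cinv z w) -> z (cinv z w) = w -> ~ D (cinv z w) ->
  (\forall v \near w, pl d.+1 (fun l => l ^+ N *: Psi (cinv z v) l) (fun k => b k v)) ->
  (forall k : 'I_d.+1, mcdiff (b k) w) -> W_data w.
Proof.
move=> zw zwE nD np nc.
have z0 k : (d < k)%N -> \forall v \near w, 0 = b k v.
  by move=> dk; apply: filterS np => v [->].
have bc k : mcdiff (b k) w.
  have [kd|dk] := leqP k d; first exact: (nc (Ordinal (kd : k < d.+1)%N)).
  by apply: mcdiff_near (z0 k dk) _; exact: (mcdiff_cst _ _).1.
split=> //.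
have hdb : pl d.+1 (fun l => l ^+ N *: zderiv z 1 (fun q => Psi q l) (cinv z w)) (fun k => mder (b k) w).
  split=> [k dk|l hl].
    by rewrite -(mder_near (z0 k dk)) ?(mcdiff_cst _ _).2 //; exact: (mcdiff_cst _ _).1.
  have lN0 : l ^+ N != 0 := expf_neq0 _ (circle_neq0 hl).
  apply/matrixP => i j; rewrite mxE [in LHS]mxE zwE summxE.
  have cd : cdiff (fun v => Psi (cinv z v) l i j) w (l ^- N * \sum_(k < d.+1) (l ^+ k * mder (b k) w i j)).
    apply: cdiff_near (cdiffZ _ (cdiff_big (index_enum 'I_d.+1) (fun k => cdiffZ (l ^+ k) (mcdiffP (bc k) i j)))).
    apply: filterS np => v [_ /(_ l hl)] /(congr1 (fun X : 'M[C]_n => X i j)).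
    rewrite mxE summxE => e; transitivity (l ^- N * (l ^+ N * Psi (cinv z v) l i j)).
      by rewrite e; congr (_ * _); apply: eq_bigr => k _; rewrite mxE.
    by rewrite mulrA mulVf ?mul1r.
  rewrite [derive1n 1 _ w](cdiff_derive1 cd) mulrA mulfV // mul1r.
  by apply: eq_bigr => k _; rewrite [RHS]mxE.
have [th [h1 h2 h3]] := W_point GU (hIw nD) (nbhs_singleton np) hdb (hC hz zw nD).
have thr := hr nD h1; have [h4 h5] := h3 r thr.
by exists th.
Qed.

Lemma W_dat : \forall w \near (z x)^', W_data w.
Proof.
have n1 := dnbhs_of_nbhs (chart_near hz zx).
have n2 := chart_inv_dnear hz zx (hD x).
have n3 := near_dnbhs_near hpl.
have n4 := filter_forall_fin (dnbhs_filter _) (fun k : 'I_d.+1 => mmero_mcdiff (hb k)).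
by apply: filterS (near2D (near2D n1 n2) (near2D n3 n4)) => w [[[zw zwE] nD] [np nc]]; exact: W_at.
Qed.

(** The generators are the shifts of the columns of b. A functional killing them kills the shifts of
    th by [conv_perp_unit], hence the shifted derivatives by [W_point] and the last block by
    [inner_last]: this is what [germ_pack] asks for. *)
Lemma W_germ : exists E : C -> 'M[C]_(r.+1 * n), pack (z x) E /\ \forall w \near (z x)^',
  Wspan (vecp r (fun k => b k w)) (E w) /\
  forall l, circle l -> l ^+ N *: Phi (cinv z w) l = PhiP (orthp (E w)) l.
Proof.
pose F (i : 'I_r.+1 * 'I_n) (w : C) : 'cV[C]_(r.+1 * n) :=
  Tpow R n r i.1 *m vecp r (fun k => b k w) *m delta_mx i.2 (0 : 'I_1).
have cF q (A : 'M[C]_(r.+1 * n, q)) : mmero (z x) (fun=> A) by apply: mhol_mmero; exact: mhol_cst.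
have mF i : mmero (z x) (F i).
  apply: mmeroM; last by apply: mhol_mmero; exact: mhol_cst.
  have m1 := cF _ (Tpow R n r i.1); have m2 := mmero_vecp (r := r) hb.
  have m3 := mmeroM m1 m2; exact: m3.
have perp w (y : 'rV[C]_(r.+1 * n)) : (forall i, y *m F i w = 0) ->
    forall m, y *m Tpow R n r m *m vecp r (fun k => b k w) = 0.
  move=> hy m; have [mr|rm] := leqP m r; last by rewrite Tpow_big // mulmx0 mul0mx.
  apply: mulmx_delta0 => j; have := hy (Ordinal (mr : m < r.+1)%N, j).
  by rewrite /F /= !mulmxA.
have [|E [pE sE]] := @germ_pack R n r (z x) _ F mF.
  apply: filterS W_dat => w [nD bc [th [hth thr [a a0 ha] [B hB]]]] y /perp hy.
  have hyt := conv_perp_unit ha a0 hy.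
  have hyB := conv_perp hB hyt.
  have [cb db] := mder_vecp r bc.
  split.
  - move=> [m j]; rewrite /F /= !mulmxA -(mulmxA y) -TpowSl hy; exact: mul0mx.
  - move=> [m j]; rewrite /F /=.
    have [c1 e1] := mcdiff_mulc (Tpow R n r m) cb; have [_ e2] := mcdiff_mulr (delta_mx j (0 : 'I_1)) c1.
    rewrite e2 e1 db (mulmxA (y *m _)) (mulmxA (y *m _)) -(mulmxA y) -TpowSl TpowS (mulmxA y).
    by rewrite -(mulmxA (y *m _) (Tsh R n r)) hyB mul0mx.
  - have hth' := pl_trunc hth (K := r.+1) thr.
    by rewrite ElastE mulmxA (inner_last hth' (Th_unitary GU N (hIw nD)) hyt) mul0mx.
exists E; split=> //; apply: filterS (near2D (near2D W_dat sE) (dnbhs_of_nbhs pE.2)).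
move=> w [[[nD bc [th [hth thr [a a0 ha] _]]] [s1 s2]] pw].
have sp : Wspan (vecp r (fun k => b k w)) (E w).
  split=> [m|y hy].
    have [mr|rm] := leqP m r; last by rewrite Tpow_big // mul0mx mulmx0.
    by apply: mulmx_delta => j; rewrite -mulmxA; exact: (s1 (Ordinal (mr : m < r.+1)%N, j)).
  by apply: s2 => -[m j]; rewrite /F /= !mulmxA hy mul0mx.
split=> //.
have [EE _ _ _] := pw.
exact: (Wspan_phi GU (hIw nD) hth thr a0 ha EE (pack_proj pw) sp).
Qed.

End Chart.
End Family.

(** * Extension over the discrete set *)

Section Continuity.
Variables (R : realType) (w0 : cplx R).
Local Notation C := (cplx R).
Definition mcont m p (F : C -> 'M[C]_(m, p)) := forall i j, {for w0, continuous (fun w => F w i j)}.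

Lemma cont_sum (I : Type) (s : seq I) (F : I -> C -> C) : (forall i, {for w0, continuous (F i)}) ->
  {for w0, continuous (fun w => \sum_(i <- s) F i w)}.
Proof.
move=> H; elim: s => [|i s IH].
  have -> : (fun w => \sum_(i <- [::]) F i w) = fun=> 0 by apply/funext => w; rewrite big_nil.
  exact: (@cst_continuous C C 0 w0).
rewrite (_ : (fun w => _) = fun w => F i w + \sum_(j <- s) F j w); last by apply/funext => w; rewrite big_cons.
exact: (cvgD (H i) IH).
Qed.

Lemma cont_prod (I : Type) (s : seq I) (F : I -> C -> C) : (forall i, {for w0, continuous (F i)}) ->
  {for w0, continuous (fun w => \prod_(i <- s) F i w)}.
Proof.
move=> H; elim: s => [|i s IH].
  have -> : (fun w => \prod_(i <- [::]) F i w) = fun=> 1 by apply/funext => w; rewrite big_nil.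
  exact: (@cst_continuous C C 1 w0).
rewrite (_ : (fun w => _) = fun w => F i w * \prod_(j <- s) F j w); last by apply/funext => w; rewrite big_cons.
exact: (cvgM (H i) IH).
Qed.

Lemma contZ (c : C) (F : C -> C) : {for w0, continuous F} -> {for w0, continuous (fun w => c * F w)}.
Proof. by move=> h; exact: (cvgM (cvg_cst c) h). Qed.

Lemma mcontM m p q (F : C -> 'M[C]_(m, p)) (G : C -> 'M[C]_(p, q)) : mcont F -> mcont G -> mcont (fun w => F w *m G w).
Proof.
move=> hF hG i j; rewrite (_ : (fun w => _) = fun w => \sum_k F w i k * G w k j); last by apply/funext => w; rewrite mxE.
by apply: cont_sum => k; exact: (cvgM (hF i k) (hG k j)).
Qed.

Lemma mcontZ m p (c : C) (F : C -> 'M[C]_(m, p)) : mcont F -> mcont (fun w => c *: F w).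
Proof.
move=> hF i j; rewrite (_ : (fun w => _) = fun w => c * F w i j); last by apply/funext => w; rewrite mxE.
exact: contZ.
Qed.

Lemma mcont_sum (I : Type) (s : seq I) m p (F : I -> C -> 'M[C]_(m, p)) : (forall i, mcont (F i)) ->
  mcont (fun w => \sum_(i <- s) F i w).
Proof.
move=> hF i j; rewrite (_ : (fun w => _) = fun w => \sum_(k <- s) F k w i j); last by apply/funext => w; rewrite summxE.
by apply: cont_sum => k; exact: hF.
Qed.

Lemma mcont_adj m p (F : C -> 'M[C]_(m, p)) : mcont F -> mcont (fun w => (F w)^t*).
Proof.
move=> hF i j; rewrite (_ : (fun w => _) = fun w => (F w j i)^*); last by apply/funext => w; rewrite !mxE.
have [h1 h2] := (cvgC_reim (nbhs_filter w0) _ _).1 (hF j i).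
apply: (cvgC_reim (nbhs_filter w0) _ _).2; split.
  by rewrite re_conj (_ : (fun w => _) = fun w => re (F w j i)) //; apply/funext => w; rewrite re_conj.
by rewrite im_conj (_ : (fun w => _) = fun w => - im (F w j i)); [exact: cvgN | apply/funext => w; rewrite im_conj].
Qed.

Lemma cont_det m (F : C -> 'M[C]_m) : mcont F -> {for w0, continuous (fun w => \det (F w))}.
Proof.
move=> hF; rewrite /determinant.
apply: cont_sum => s; apply: contZ; apply: cont_prod => i; exact: hF.
Qed.

Lemma mcont_dft m p K (F : C -> C -> 'M[C]_(m, p)) k : (forall l, circle l -> mcont (fun w => F w l)) ->
  mcont (fun w => dft K (F w) k).
Proof.
move=> hF; apply: mcontZ; apply: mcont_sum => j; apply: mcontZ.
by apply: hF; exact: circle_node.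
Qed.

Lemma mhol_mcont m p (F : C -> 'M[C]_(m, p)) : mhol w0 F -> mcont F.
Proof. by move=> h i j; exact: hol_cont (h i j). Qed.

Lemma cont_lower (f : C -> C) (e : R) : {for w0, continuous f} -> (\forall w \near w0^', e <= nrm (f w)) -> e <= nrm (f w0).
Proof.
move=> cf H; rewrite leNgt; apply/negP => lt.
have n1 := (cvgCP (nbhs_filter w0) f (f w0)).1 cf _ (divr_gt0 (etrans (subr_gt0 _ _) lt) (ltr0n _ 2)).
have [w [h1 h2]] := filter_ex (near2D (dnbhs_of_nbhs n1) H).
have := nrmD (f w - f w0) (f w0); rewrite subrK; lra.
Qed.

Lemma mcont_eq m p (F G : C -> 'M[C]_(m, p)) : mcont F -> mcont G -> (\forall w \near w0^', F w = G w) -> F w0 = G w0.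
Proof.
move=> hF hG e; apply/matrixP => i j; apply: cont_dnbhs_eq (hF i j) (hG i j) _.
by apply: filterS e => w ->.
Qed.

End Continuity.

Lemma pl_shift (R : realType) m p K N (f : cplx R -> 'M[cplx R]_(m, p)) e :
  pl K (fun l => l ^+ N *: f l) e -> (forall k, (k < N)%N -> e k = 0) -> pl K f (fun k => e (N + k)%N).
Proof.
move=> [e0 hf] eN; split=> [k kK|l hl]; first by apply: e0; exact: leq_trans kK (leq_addl _ _).
have hg : pl K (fun l => \sum_(k < K) l ^+ k *: e (N + k)%N) (fun k => e (N + k)%N).
  by split=> // k kK; apply: e0; exact: leq_trans kK (leq_addl _ _).
have [_ /(_ l hl) h1] := pl_scaleX N hg.
have [_ /(_ l hl) h2] := pl_widen (leq_addl N K) (conj e0 hf).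
apply: (scalerI (expf_neq0 N (circle_neq0 hl))); rewrite h2 h1.
by apply: eq_bigr => k _; case: ltnP => kN; [rewrite eN | rewrite subnKC].
Qed.

(* The coefficients of [det] depend continuously on [w]: the bound is uniform on the circle. *)
Lemma det_lower_near (R : realType) n d (w0 : cplx R) (b : nat -> cplx R -> 'M[cplx R]_n) :
  (forall k, mcont w0 (b k)) -> (forall l, circle l -> \sum_(k < d.+1) l ^+ k *: b k w0 \in unitmx) ->
  exists2 delta : R, 0 < delta & \forall w \near w0, forall l, circle l ->
    delta <= nrm (\det (\sum_(k < d.+1) l ^+ k *: b k w)).
Proof.
move=> hb hu; pose g w l := \sum_(k < d.+1) l ^+ k *: b k w.
pose K := (d * n).+1; pose f w (l : cplx R) : 'M[cplx R]_1 := (\det (g w l))%:M.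
have hf w : exists a, pl K (f w) a.
  pose bb k := if (k < d.+1)%N then b k w else 0.
  have hg : pl d.+1 (g w) bb.
    split=> [k dk|l hl]; first by rewrite /bb ltnNge dk.
    by apply: eq_bigr => k _; rewrite /bb ltn_ord.
  pose Dt := \det (polymx d.+1 bb).
  have sD : (size Dt <= K)%N by apply: size_det => i j; exact: size_polymx.
  exists (fun k => (Dt`_k)%:M); split=> [k Kk|l hl].
    by rewrite nth_default ?raddf0 //; exact: leq_trans sD Kk.
  rewrite /f (pl_polymx hg hl) det_evmx (horner_coef_wide _ sD) raddf_sum.
  by apply: eq_bigr => k _; apply/matrixP => i j; rewrite !mxE mulrnAr mulrC.
pose e w k := dft K (f w) k 0 0.
have fe w l : circle l -> \det (g w l) = \sum_(k < K) l ^+ k * e w k.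
  move=> hl; have [a ha] := hf w; have := congr1 (fun X : 'M[cplx R]_1 => X 0 0) (ha.2 l hl).
  rewrite summxE {1}/f mxE eqxx mulr1n => ->; apply: eq_bigr => k _.
  by rewrite mxE /e (dft_pl (ltn_ord k) ha).
have ce k : {for w0, continuous (fun w => e w k)}.
  apply: mcont_dft => l hl i j.
  rewrite (_ : (fun w => _) = fun w => \det (g w l)); last first.
    by apply/funext => w; rewrite /f mxE !ord1 eqxx mulr1n.
  by apply: cont_det; apply: mcont_sum => m; apply: mcontZ; exact: hb.
have cc : conC 0 1 (fun t => (\det (g w0 (eturn t)))^-1).
  apply: conCV => [t _|].
    by have := hu _ (circle_eturn t); rewrite unitmxE unitfE.
  rewrite (_ : (fun t => _) = fun t => \sum_(k < K) eturn t ^+ k * e w0 k); last first.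
    by apply/funext => t; rewrite fe //; exact: circle_eturn.
  refine (CI_sum (index_enum 'I_K) ler01 (F := fun k t => eturn t ^+ (val k) * e w0 k) _).1 => k.
  by apply: conCM; [exact: con_eturnX | exact: conC_cst].
have [B B0 hB] := bounded_conC cc.
have low l : circle l -> B^-1 <= nrm (\det (g w0 l)).
  move=> /circle_eturnP[t ht ->]; have := hB t ht.
  have p0 : 0 < nrm (\det (g w0 (eturn t))).
    by rewrite nrm_gt0; have := hu _ (circle_eturn t); rewrite unitmxE unitfE.
  by rewrite nrmV -[B in _ <= B]invrK lef_pV2 ?posrE ?invr_gt0.
have B2 : 0 < B^-1 / 2 / K%:R by rewrite !divr_gt0 ?invr_gt0 ?ltr0n.
exists (B^-1 / 2); first by rewrite divr_gt0 ?invr_gt0.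
have n1 := filter_forall_fin (nbhs_filter w0) (fun k : 'I_K => (cvgCP (nbhs_filter w0) _ _).1 (ce k) _ B2).
apply: filterS n1 => w hw l hl; have h0 := low l hl.
have : nrm (\det (g w0 l) - \det (g w l)) <= B^-1 / 2.
  rewrite !fe // -sumrB; apply: le_trans (nrm_sum _ _ _) _.
  have -> : B^-1 / 2 = \sum_(k < K) (B^-1 / 2 / K%:R).
    by rewrite sumr_const card_ord -[RHS]mulr_natr divfK // pnatr_eq0.
  apply: ler_sum => k _; rewrite -mulrBr nrmM nrmX (circleE l).1 // expr1n mul1r nrm_distC.
  exact: ltW (hw k).
have aux (p q s y : R) : y <= p -> p <= q + s -> q <= y / 2 -> y / 2 <= s by lra.
by apply: aux h0 _; have := nrmD (\det (g w0 l) - \det (g w l)) (\det (g w l)); rewrite subrK.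
Qed.

Section LocalForm.
Variables (R : realType) (n : nat) (M : riemann_surface R).
Local Notation C := (cplx R).

Lemma mcont_PhiP r w0 (E : C -> 'M[C]_(r.+1 * n)) l : pack w0 E -> circle l -> mcont w0 (fun w => PhiP (orthp (E w)) l).
Proof.
move=> [hE nE] hl i j; have [t _ ->] := circle_cisP hl; apply: PhiP_cont => //.
by apply: filterS nE => w [].
Qed.

Lemma pl_PhiP r (P : 'M[C]_(r.+1 * n)) : pl r.+1 (fun l => PhiP P l) (fun s => blk R n r s *m (wandering P *m (ev n r 1)^t*)).
Proof. by apply: (pl_eq _ (pl_ev _)) => l hl; rewrite PhiPE mulmxA. Qed.

Lemma local_form_eq (Phi1 Phi2 : M -> loop R n) x z1 N1 r1 (E1 : C -> 'M[C]_(r1.+1 * n)) z2 N2 r2 (E2 : C -> 'M[C]_(r2.+1 * n)) :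
  local_form Phi1 x z1 N1 E1 -> local_form Phi2 x z2 N2 E2 ->
  (\forall q \near x^', forall l, circle l -> Phi1 q l = Phi2 q l) -> forall l, circle l -> Phi1 x l = Phi2 x l.
Proof.
move=> h1 h2 e l hl; have [hz1 x1 p1 n1] := h1.
have [_ _ p2 n2] := local_form_chart hz1 x1 h2.
have h2' := local_form_chart hz1 x1 h2.
rewrite (local_formE h1 hl) (local_formE h2' hl).
apply: (mcont_eq (F := fun w => l ^- N1 *: PhiP (orthp (E1 w)) l) (G := fun w => l ^- N2 *: PhiP (orthp (E2 (trans z1 z2 w))) l)).
- exact: mcontZ (mcont_PhiP p1 hl).
- exact: mcontZ (mcont_PhiP p2 hl).
have e' := chart_inv_dnear hz1 x1 e.
apply: filterS (near2D e' (dnbhs_of_nbhs (nearI n1 n2))) => w [ee [e1 e2]].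
have lN N : l ^+ N != 0 := expf_neq0 _ (circle_neq0 hl).
by rewrite -e1 // -e2 // !scalerA !mulVf // !scale1r ee.
Qed.

Lemma local_form_closed (S : set 'M[C]_n) (Phi : M -> loop R n) x z N r (E : C -> 'M[C]_(r.+1 * n)) l : closed S -> circle l ->
  local_form Phi x z N E -> (\forall w \near (z x)^', S (Phi (cinv z w) l)) -> S (Phi x l).
Proof.
move=> cS hl h nS; have [hz zx pE nE] := h.
have cc := mcontZ (c := l ^- N) (mcont_PhiP pE hl).
apply: (closed_mx cS) => d d0.
have n1 := filter_forall_fin (nbhs_filter (z x)) (fun ij : 'I_n * 'I_n => (cvgCP (nbhs_filter (z x)) _ _).1 (cc ij.1 ij.2) _ d0).
have [w [s [c e]]] := filter_ex (near2D nS (dnbhs_of_nbhs (nearI n1 nE))).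
exists (Phi (cinv z w) l) => // i j; rewrite (local_formE h hl).
have := c (i, j); rewrite /= -e // !scalerA mulVf ?scale1r //; exact: expf_neq0 (circle_neq0 hl).
Qed.

(** The coefficients of l^N Phi depend continuously on the point, so those outside the range N, ...,
    N + K - 1 vanish at the centre too. *)
Lemma local_form_pl (Phi : M -> loop R n) x z N r (E : C -> 'M[C]_(r.+1 * n)) K : local_form Phi x z N E ->
  (\forall w \near (z x)^', exists a, pl K (Phi (cinv z w)) a) -> exists a, pl K (Phi x) a.
Proof.
move=> h nK; have [hz zx pE nE] := h.
pose L := (r.+1 + (N + K))%N.
pose e w k := dft L (fun l => PhiP (orthp (E w)) l) k.
have he w : exists a, pl L (fun l => PhiP (orthp (E w)) l) a /\ forall k, (k < L)%N -> e w k = a k.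
  exists (fun s => blk R n r s *m (wandering (orthp (E w)) *m (ev n r 1)^t*)).
  have hp : pl L (fun l => PhiP (orthp (E w)) l) (fun s => blk R n r s *m (wandering (orthp (E w)) *m (ev n r 1)^t*)).
    by apply: pl_widen (pl_PhiP _); exact: leq_addr.
  by split=> // k kL; exact: (dft_pl kL hp).
have ce k : mcont (z x) (fun w => e w k) by apply: mcont_dft => l hl; exact: mcont_PhiP.
have e0 k : (k < L)%N -> (k < N)%N || (N + K <= k)%N -> e (z x) k = 0.
  move=> kL hk; apply: (mcont_eq (ce k) (G := fun=> 0)); first by move=> i j; exact: (@cst_continuous C C _ (z x)).
  apply: filterS (near2D nK (dnbhs_of_nbhs nE)) => w [[a ha] ew].
  have [a' [ha' ->//]] := he w.
  have h2 : pl (N + K) (fun l => PhiP (orthp (E w)) l) (fun s => if (s < N)%N then 0 else a (s - N)%N).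
    by apply: (pl_eq _ (pl_scaleX N ha)) => l hl; rewrite -ew.
  rewrite (pl_uniq ha' h2); case: ltnP hk => //= Nk hk; apply: ha.1.
  by rewrite -(leq_add2l N) subnKC.
have [a [ha ea]] := he (z x).
have ha' : pl L (fun l => l ^+ N *: Phi x l) a.
  apply: (pl_eq _ ha) => l hl; rewrite (local_formE h hl) scalerA mulfV ?scale1r //.
  exact: expf_neq0 (circle_neq0 hl).
exists (fun k => a (N + k)%N); apply: pl_trunc (pl_shift ha' _) _ => k kK.
  have kL : (k < L)%N by rewrite /L; lia.
  by rewrite -ea // e0 // kK.
have [kL|Lk] := ltnP (N + k) L; last exact: ha.1.
by rewrite -ea // e0 // leq_add2l kK orbT.
Qed.

End LocalForm.

Section Constancy.
Variables (R : realType) (n : nat) (M : riemann_surface R).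
Local Notation C := (cplx R).
Variables (D : set M) (G S : set 'M[C]_n) (Psi Phi : M -> loop R n).
Hypothesis GU : G `<=` @unitary_group R n.
Hypothesis hD : discrete_subset D.
Hypothesis hIw : forall p, ~ D p -> iwasawa_unitary_part G (Psi p) (Phi p).
Hypothesis hC : forall z p, coords z -> cdom z p -> ~ D p ->
  Lambda_plus S (fun l => l *: (invmx (Psi p l) *m zderiv z 1 (fun q => Psi q l) p)).

Lemma psi_unit p l : ~ D p -> circle l -> Psi p l \in unitmx.
Proof.
move=> nD hl; have hU := phi_unitary GU (hIw nD) hl.
have [_ [pp [[[_ _] ppe] _] ->]] // := hIw nD.
have [F [dF FE FS]] := extends_mdisc ppe.
rewrite unitmx_mul (mulmx1_unit hU).1 /= -FE //.
by apply: (complexification_unit GU); apply: FS; exact: circle_nrm1.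
Qed.

Lemma mhol_vecp w0 r q (b : nat -> C -> 'M[C]_(n, q)) : (forall k, mhol w0 (b k)) ->
  mhol w0 (fun w => vecp r (fun k => b k w)).
Proof.
move=> hb i j; have H (s : 'I_r.+1) : hol w0 (fun w => (jlb R n r s *m b s w) i j).
  by apply: mholM (hb s) i j; exact: mhol_cst.
have := hol_sum (index_enum 'I_r.+1) H; apply: hol_near; apply: nearWC => w.
by rewrite /vecp summxE.
Qed.

Variables (x : M) (z : chart R M) (N d r : nat) (b : nat -> C -> 'M[C]_n) (E : C -> 'M[C]_(r.+1 * n)).
Hypotheses (hz : coords z) (zx : cdom z x) (nDx : ~ D x).
Hypothesis hb : forall k, mhol (z x) (b k).
Hypothesis hpl : \forall w \near z x, pl d.+1 (fun l => l ^+ N *: Psi (cinv z w) l) (fun k => b k w).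
Hypothesis hr : forall q th, ~ D q -> pl (d * n).+1 (fun l => l ^+ N *: Phi q l) th -> forall k, (r < k)%N -> th k = 0.
Hypothesis pE : pack (z x) E.
Hypothesis hE : \forall w \near (z x)^', Wspan (vecp r (fun k => b k w)) (E w) /\
  forall l, circle l -> l ^+ N *: Phi (cinv z w) l = PhiP (orthp (E w)) l.

(** Off the centre this is Phi^* Psi. It is written with the continuous factor [PhiP (orthp (E w))],
    and so makes sense at the centre, where that factor is not yet known to be Phi. *)
Let A w l : 'M[C]_n := (PhiP (orthp (E w)) l)^t* *m (\sum_(k < d.+1) l ^+ k *: b k w).
Let L := (r.+1 + d.+1)%N.
Let e w k := dft L (fun l => l ^+ r *: A w l) k.

Lemma A_pl w : (forall k, (d < k)%N -> b k w = 0) -> pl L (fun l => l ^+ r *: A w l) (fun k => if (k < L)%N then e w k else 0).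
Proof.
move=> hk; have hbw : pl d.+1 (fun l => \sum_(k < d.+1) l ^+ k *: b k w) (fun k => b k w) by [].
have h := pl_mul (pl_adj (pl_PhiP (orthp (E w)))) hbw.
have [aa h'] : exists aa, pl L (fun l => l ^+ r *: A w l) aa.
  by eexists; apply: (pl_eq _ h) => l hl; rewrite -scalemxAl.
split=> [k Lk|l hl]; first by rewrite ltnNge Lk.
rewrite (h'.2 l hl); apply: eq_bigr => k _.
by rewrite ltn_ord /e (dft_pl (ltn_ord k) h').
Qed.

Lemma cont_e k : mcont (z x) (fun w => e w k).
Proof.
apply: mcont_dft => l hl; apply: mcontZ; apply: mcontM.
  by apply: mcont_adj; exact: mcont_PhiP.
by apply: mcont_sum => m; apply: mcontZ; apply: mhol_mcont; exact: hb.
Qed.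

(** Off the centre both facts are [iwasawa_coef]. Vanishing passes to the limit by continuity;
    invertibility does so because the bound of [det_lower_near] is uniform in the point. *)
Lemma e_coef : (forall k, (k < r)%N -> e (z x) k = 0) /\ e (z x) r \in unitmx.
Proof.
have pl0 := nbhs_singleton hpl; rewrite (chartK hz zx) in pl0.
have hu l : circle l -> \sum_(k < d.+1) l ^+ k *: b k (z x) \in unitmx.
  move=> hl; rewrite -(pl0.2 l hl) -mul_scalar_mx unitmx_mul (psi_unit nDx hl) andbT unitmxE det_scalar unitfE.
  by rewrite !expf_neq0 // circle_neq0.
have [delta d0 hdel] := det_lower_near (fun k => mhol_mcont (hb k)) hu.
have n1 := chart_inv_dnear hz zx (hD x).
have key : \forall w \near (z x)^', (forall k, (k < r)%N -> e w k = 0) /\ delta / 2 <= nrm (\det (e w r)).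
  apply: filterS (near2D (near2D n1 hE) (dnbhs_of_nbhs (nearI hpl hdel))) => w [[nD [_ hphi]] [hplw hdw]].
  have hk := A_pl hplw.1.
  have h : pl L (fun l => l ^+ r *: ((Phi (cinv z w) l)^t* *m Psi (cinv z w) l)) (fun k => if (k < L)%N then e w k else 0).
    apply: (pl_eq _ hk) => l hl; congr (_ *: _).
    rewrite /A -(hphi l hl) -(hplw.2 l hl) hadjZ -scalemxAl -scalemxAr scalerA.
    by rewrite mulrC mul_conj nrmX ((circleE l).1 hl) !expr1n toC1 scale1r.
  have hdl l : circle l -> delta <= nrm (\det (Psi (cinv z w) l)).
    move=> hl; have := hdw l hl; rewrite -(hplw.2 l hl) detZ nrmM !nrmX ((circleE l).1 hl) !expr1n mul1r; exact: id.
  have [h1 h2] := iwasawa_coef GU (hIw nD) d0 hdl h; split.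
    by move=> k kr; have := h1 k kr; rewrite (_ : (k < L)%N) // /L; lia.
  by move: h2; rewrite (_ : (r < L)%N) // /L; lia.
split=> [k kr|].
  apply: (mcont_eq (F := fun w => e w k) (G := fun=> 0)); [exact: cont_e | |]; first by move=> i j; exact: (@cst_continuous C C _ (z x)).
  by apply: filterS key => w [/(_ k kr)].
rewrite unitmxE unitfE -nrm_gt0; apply: lt_le_trans (divr_gt0 d0 (ltr0n _ 2)) _.
apply: (cont_lower (f := fun w => \det (e w r))); first by apply: cont_det; exact: cont_e.
by apply: filterS key => w [].
Qed.

(** The image of E at the centre might be larger than the span of b there. By [e_coef], b is a
    triangular combination of shifts of the limiting loop with invertible leading coefficient, so
    the two spans agree, and [Wspan_phi] applies at the centre. *)
Lemma W_const l : circle l -> l ^+ N *: Phi x l = PhiP (orthp (E (z x))) l.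
Proof.
have pl0 := nbhs_singleton hpl; have pE0 := nbhs_singleton pE.2.
have [EE _ _ _] := pE0; have iP := pack_proj pE0.
have [e0 eu] := e_coef.
have hA := pl_shift (A_pl pl0.1) (N := r) _.
have {}hA : pl L (A (z x)) (fun k => if (r + k < L)%N then e (z x) (r + k)%N else 0).
  by apply: hA => k kr; rewrite e0 //; case: ifP.
set a := (fun k => _) in hA.
pose J : 'M[C]_(r.+1 * n, n) := (ev n r 1)^t*; pose th' s := blk R n r s *m (wandering (orthp (E (z x))) *m J).
have hv : vecp r (fun k => b k (z x)) = \sum_(k < r.+1) Tpow R n r k *m vecp r th' *m a k.
  rewrite -vecp_conv; apply: vecp_ext => s _.
  have h1 := pl_mul (pl_PhiP (orthp (E (z x)))) hA.
  have h2 : pl d.+1 (fun l => PhiP (orthp (E (z x))) l *m A (z x) l) (fun k => b k (z x)).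
    by apply: (pl_eq _ pl0) => l0 hl0; rewrite /A mulmxA PhiP_unitary // mul1mx (pl0.2 l0 hl0).
  exact: pl_uniq h2 h1 s.
have au : a 0%N \in unitmx by rewrite /a addn0 (_ : (r < L)%N) //; rewrite /L; lia.
have bc := mhol_vecp (r := r) hb.
have sp : Wspan (vecp r (fun k => b k (z x))) (E (z x)).
  split=> [m|y hy].
    have m1 := mholM (mhol_cst (z x) (Tpow R n r m)) bc.
    have := mhol_eq (mholM pE.1 m1) m1; move/(_ _)/nbhs_singleton; apply.
    by apply: filterS hE => w [[h _] _]; exact: h.
  have hy' := conv_perp_unit hv au hy.
  rewrite -(orthp_im EE) mulmxA (wandering_span iP) ?mul0mx // => m.
  by have := hy' m; rewrite vecp_blk.
have mh := filter_forall_fin (nbhs_filter (z x)) (fun k : 'I_d.+1 => mhol_mcdiff (hb k)).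
have [zc zi] := nbhs_singleton (chart_near hz zx).
have nD' : ~ D (cinv z (z x)) by rewrite (chartK hz zx).
have [_ _ [th [hth thr [a' a0 ha] _]]] := W_at GU hIw hC hz hr zc zi nD' hpl (nbhs_singleton mh).
by rewrite -{1}(chartK hz zx); exact: (Wspan_phi GU (hIw nD') hth thr a0 ha EE iP sp).
Qed.

End Constancy.

Section PolynomialLoops.
Variables (R : realType) (n : nat).
Local Notation C := (cplx R).

Lemma poly_loopP d (g : loop R n) : poly_loop d g <-> exists a, pl d.+1 g a.
Proof.
split=> [[c hc]|[a [_ ha]]]; last by exists a.
exists (fun k => if (k < d.+1)%N then c k else 0); split=> [k dk|l hl]; first by rewrite ltnNge dk.
by rewrite hc //; apply: eq_bigr => k _; rewrite ltn_ord.
Qed.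

Variables (G : set 'M[C]_n) (psi phi : loop R n).
Hypothesis GU : G `<=` @unitary_group R n.
Hypothesis hIw : iwasawa_unitary_part G psi phi.

Lemma phi_degree d b : pl d.+1 psi b -> exists th, pl (d * n).+1 phi th.
Proof.
move=> hb; have ThU := phi_unitary GU hIw.
have [[_ [c hc]] [pp [[[_ ppS] ppe] [dp [a0 ha0]]] fact]] := hIw.
have [a ha] := (poly_loopP dp pp).1 (ex_intro _ a0 ha0).
have [F [dF FE FS]] := extends_mdisc ppe.
have Fu l : nrm l <= 1 -> F l \in unitmx by move=> l1; exact: complexification_unit GU (FS l l1).
have [N [_ hphi]] := laurent_pl hc.
exact: (iwasawa_degree hb ThU hphi fact ha dF FE Fu).
Qed.

Lemma phi_degree_Gr r L th : Gr r (Wspace psi) -> pl L phi th -> forall k, (r < k)%N -> th k = 0.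
Proof.
move=> hGr hth; have [_ [pp [_ [dp [a0 ha0]]] fact]] := hIw.
have [a ha] := (poly_loopP dp pp).1 (ex_intro _ a0 ha0).
apply: (Gr_degree hGr fact ha _ hth) => l hl.
exact: unitary_left (phi_unitary GU hIw hl).
Qed.

End PolynomialLoops.

Section Extension.
Variables (R : realType) (n : nat) (M : riemann_surface R).
Local Notation C := (cplx R).
Variables (D : set M) (G S : set 'M[C]_n) (Psi Phi : M -> loop R n) (c : M -> int -> 'M[C]_n).
Hypothesis hG : compact_subgroup G.
Hypothesis hD : discrete_subset D.
Hypothesis hIw : forall p, ~ D p -> iwasawa_unitary_part G (Psi p) (Phi p).
Hypothesis hC : forall z p, coords z -> cdom z p -> ~ D p ->
  Lambda_plus S (fun l => l *: (invmx (Psi p l) *m zderiv z 1 (fun q => Psi q l) p)).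
Hypothesis hmero : meromorphic_family D Psi.
Hypothesis hholo : holomorphic_family (~` D) Psi.
Hypothesis hc : forall p, ~ D p -> laurent_expansion (Psi p) (c p).
Hypothesis hsm : forall p, ~ D p -> smooth_loop (Psi p).

Let GU : G `<=` @unitary_group R n. Proof. by case: hG. Qed.

Let hL q : ~ D q -> exists N a, pl N.*2.+1 (fun l => l ^+ N *: Psi q l) a.
Proof. by move=> /hc/laurent_pl[N [_ h]]; exists N; eexists; exact: h. Qed.

(** On D the value is defined by the local formula; outside D it must be the given one, and
    [W_const] says that it satisfies the same formula. *)
Lemma local_value x : exists g : loop R n, (~ D x -> forall l, circle l -> g l = Phi x l) /\
  exists z N r (E : C -> 'M[C]_(r.+1 * n)), [/\ coords z, cdom z x, pack (z x) E,
    \forall w \near (z x)^', forall l, circle l -> l ^+ N *: Phi (cinv z w) l = PhiP (orthp (E w)) l &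
    forall l, circle l -> l ^+ N *: g l = PhiP (orthp (E (z x))) l].
Proof.
have [z [N [hz zx hb hpl]]] := local_laurent hD hmero hL x.
have hr q th : ~ D q -> pl (N.*2 * n).+1 (fun l => l ^+ N *: Phi q l) th -> forall k, (N.*2 * n < k)%N -> th k = 0.
  by move=> _ [h _].
have [E [pE hE]] := W_germ GU hD hIw hC hz zx hb hpl hr.
have hE' : \forall w \near (z x)^', forall l, circle l -> l ^+ N *: Phi (cinv z w) l = PhiP (orthp (E w)) l.
  by apply: filterS hE => w [].
have [Dx|nDx] := pselect (D x).
  exists (fun l => l ^- N *: PhiP (orthp (E (z x))) l); split=> //.
  exists z, N, (N.*2 * n)%N, E; split=> // l hl.
  by rewrite scalerA mulfV ?scale1r //; exact: expf_neq0 (circle_neq0 hl).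
exists (Phi x); split=> //; exists z, N, (N.*2 * n)%N, E; split=> // l hl.
have [hbh hplh] := local_laurent_hol hD hholo nDx hz zx hpl.
exact: (W_const GU hD hIw hC hz zx nDx hbh hplh hr pE hE hl).
Qed.

Lemma solution_extends : exists Phi' : M -> loop R n, [/\ (forall p l, ~ D p -> circle l -> Phi' p l = Phi p l),
  locES Phi' & forall p l, circle l -> G (Phi' p l)].
Proof.
have [Phi' hP] := choice local_value.
have eq p l : ~ D p -> circle l -> Phi' p l = Phi p l by move=> nD hl; exact: (hP p).1.
have loc : locES Phi'.
  move=> x; have [_ [z [N [r [E [hz zx pE hE hg]]]]]] := hP x.
  exists z, N, r, E; split=> //; apply: near_of_dnbhs; last by move=> l hl; rewrite (chartK hz zx) hg.
  have n1 := chart_inv_dnear hz zx (hD x).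
  by apply: filterS (near2D n1 hE) => w [nD h] l hl; rewrite eq // h.
exists Phi'; split=> // p l hl; have [_ _ _ _ /compact_closed_mx cG] := hG.
have [z [N [r [E hE]]]] := loc p; have [hz zp _ _] := hE.
apply: (local_form_closed cG hl hE); have n1 := chart_inv_dnear hz zp (hD p).
apply: filterS n1 => w nD; rewrite eq //.
by have [[[[_ h] _] _] _] := hIw nD; exact: h.
Qed.

Lemma extended_solution_of_locES (Phi' : M -> loop R n) : locES Phi' -> (forall p l, circle l -> G (Phi' p l)) ->
  extended_solution G Phi'.
Proof.
have [_ G1 GM GV /compact_closed_mx cG] := hG => h1 h2.
exact: extended_solution_of_local.
Qed.

(** In general the determinant argument gives degree d n; for W with values in Gr_d, [Gr_degree]
    lowers it to d. Both bounds cross D by continuity of the coefficients. *)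
Lemma polynomial_solution (Phi' : M -> loop R n) d : locES Phi' -> (forall p l, ~ D p -> circle l -> Phi' p l = Phi p l) ->
  (forall p, ~ D p -> poly_loop d (Psi p)) ->
  (exists e, forall p, poly_loop e (Phi' p)) /\
  ((forall p, ~ D p -> Gr d (Wspace (Psi p))) -> forall p, poly_loop d (Phi' p)).
Proof.
move=> loc eq hd.
have ext e : (forall p, ~ D p -> exists a, pl e.+1 (Phi p) a) -> forall p, poly_loop e (Phi' p).
  move=> h p; apply/poly_loopP; have [z [N [r [E hE]]]] := loc p; have [hz zp _ _] := hE.
  apply: (local_form_pl hE); apply: filterS (chart_inv_dnear hz zp (hD p)) => w nD.
  by have [a ha] := h _ nD; exists a; apply: (pl_eq _ ha) => l hl; rewrite eq.
split; [exists (d * n)%N; apply: ext | move=> hGr; apply: ext] => p nD.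
  by have [b hb] := (poly_loopP _ _).1 (hd p nD); exact: phi_degree GU (hIw nD) _ _ hb.
have [b hb] := (poly_loopP _ _).1 (hd p nD).
have [th hth] := phi_degree GU (hIw nD) hb.
by exists th; apply: (pl_trunc hth) => k dk; exact: (phi_degree_Gr GU (hIw nD) (hGr p nD) hth).
Qed.

Lemma columns_basis : columns_meromorphic_basis D Psi.
Proof.
split=> [j|].
  split=> [x|p nD]; last exact: col_in_W (hsm nD) _.
  have [z [V [k [g [hz oV Vx VD [[sg hg] e]]]]]] := hmero x.
  exists z, V, k, (fun p l => col j (g p l)); split=> //; split; last first.
    by move=> q l Vq nDq hl; rewrite e //; apply/matrixP => a b; rewrite !mxE.
  split=> [z' hz' a b m|z' hz' l hl a b].
    have := sg z' hz' a j m.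
    by congr (_ /\ _); congr Ck; apply/funext => y; rewrite !mxE.
  have := hg z' hz' l hl a j.
  by congr holomorphic_on; apply/funext => w; rewrite !mxE.
exists set0; first by move=> p; apply: nearW => q [].
by move=> p nD _ f; apply: W_basis (hsm nD) _ f => l hl; exact: (psi_unit GU hIw nD hl).
Qed.

Lemma Gr_local r x : (forall p, ~ D p -> Gr r (Wspace (Psi p))) -> exists z N (b : nat -> C -> 'M[C]_n),
  [/\ coords z, cdom z x, (forall k, mmero (z x) (b k)) &
   \forall w \near (z x)^', (forall k : nat, c (cinv z w) k%:Z = b k w) /\ pl N.+1 (fun l => l ^+ 0 *: Psi (cinv z w) l) (fun k => b k w)].
Proof.
move=> hGr; have [z [N [hz zx hb hpl]]] := local_laurent hD hmero hL x.
exists z, N.*2, (fun k w => lc N (Psi (cinv z w)) (N + k)); split=> //.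
apply: filterS (near2D hpl (chart_inv_dnear hz zx (hD x))) => w [h1 nD].
have [N' [_ h2]] := laurent_pl (hc nD).
have h1' := pl_scaleX N' h1; have h2' := pl_scaleX N h2.
have sw l : circle l -> l ^+ N *: (l ^+ N' *: Psi (cinv z w) l) = l ^+ N' *: (l ^+ N *: Psi (cinv z w) l).
  by move=> _; rewrite !scalerA mulrC.
have h2'' := pl_eq sw h2'.
have key k : lc N (Psi (cinv z w)) k = if (N' + k < N)%N then 0 else c (cinv z w) ((N' + k - N)%N%:Z - N'%:Z).
  by have := pl_uniq h1' h2'' (N' + k)%N; rewrite ltnNge leq_addr /= addKn.
split=> [k|].
  rewrite key ifF; last by apply/negbTE; rewrite -leqNgt; lia.
  by congr (c _ _); lia.
have h : pl N.*2.+1 (Psi (cinv z w)) (fun k => lc N (Psi (cinv z w)) (N + k)).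
  apply: (pl_shift h1) => k kN; rewrite key; case: ltnP => // h.
  by apply: (Gr_noneg (hsm nD) (hGr _ nD) (hc nD)); lia.
by apply: (pl_eq _ h) => l hl; rewrite expr0 scale1r.
Qed.

End Extension.

(** * The explicit formulae *)

Section Subspaces.
Variables (R : realType) (n : nat).
Local Notation C := (cplx R).
Local Notation vec := 'cV[cplx R]_n.

(** Among spans of finite families in X, one of maximal dimension already contains X. *)
Lemma vspan_exists (X : set vec) : exists A : {vspace vec}, (forall v, X v -> v \in A) /\
  forall B : {vspace vec}, (forall v, X v -> v \in B) -> (A <= B)%VS.
Proof.
pose P d := `[< exists s : seq vec, (forall v, v \in s -> X v) /\ \dim (span s) = d >].
have P0 : exists d, P d by exists (\dim (span ([::] : seq vec))); apply/asboolP; exists [::].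
have Pn d : P d -> (d <= \dim {:vec})%N by move/asboolP=> [s [_ <-]]; exact: dimvS (subvf _).
case: (ex_maxnP P0 Pn) => d /asboolP[s [sX sd]] dmax; exists (span s); split.
  move=> v Xv; have h : P (\dim (span (v :: s))).
    by apply/asboolP; exists (v :: s); split=> // w; rewrite inE => /orP[/eqP ->|/sX].
  have sub : ((span s) <= (span (v :: s)))%VS by apply: sub_span => w ws; rewrite inE ws orbT.
  have /eqP -> : ((span s) == (span (v :: s))) by rewrite eqEdim sub sd dmax.
  by apply: memv_span; rewrite mem_head.
by move=> B XB; apply/span_subvP => v /sX/XB.
Qed.

Lemma vspanP (X : set vec) : (forall v, X v -> v \in vspan X) /\
  forall B : {vspace vec}, (forall v, X v -> v \in B) -> (vspan X <= B)%VS.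
Proof. exact: (xgetPex 0%VS (vspan_exists X)). Qed.

Lemma vspace_kernel (B : {vspace vec}) : exists K : 'M[C]_n, forall v : vec, v \in B <-> K *m v = 0.
Proof.
pose g (v : vec) := v - projv B v.
have gl (a : C) u v : g (a *: u + v) = a *: g u + g v.
  by rewrite /g linearP scalerBr opprD addrACA.
exists (\matrix_(i, j) g (delta_mx j 0) i 0) => v.
have -> : (\matrix_(i, j) g (delta_mx j 0) i 0) *m v = g v.
  have gs (s : seq 'I_n) : g (\sum_(j <- s) v j 0 *: delta_mx j 0) = \sum_(j <- s) v j 0 *: g (delta_mx j 0).
    elim: s => [|j s IH]; first by rewrite !big_nil /g linear0 subr0.
    by rewrite !big_cons gl IH.
  have e : v = \sum_j v j 0 *: delta_mx j 0.
    by rewrite {1}[v]matrix_sum_delta; apply: eq_bigr => j _; rewrite big_ord1.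
  rewrite [in RHS]e gs; apply/matrixP => i k; rewrite ord1 mxE summxE.
  by apply: eq_bigr => j _; rewrite !mxE mulrC.
split=> [vB|]; first by rewrite /g projv_id ?subrr.
by move/eqP; rewrite subr_eq0 => /eqP ->; exact: memv_proj.
Qed.

Definition fixv (Q : 'M[C]_n) : {vspace vec} := lker (linfun (mulmx (Q - 1%:M) : vec -> vec)).

Lemma fixvP (Q : 'M[C]_n) v : v \in fixv Q <-> Q *m v = v.
Proof.
rewrite memv_ker lfunE /= mulmxBl mul1mx subr_eq0; split=> [/eqP|->] //.
Qed.

Lemma oproj_fixv (Q : 'M[C]_n) : Q^t* = Q -> Q *m Q = Q -> oproj (fixv Q) = Q.
Proof.
move=> Qa QQ; have hQ : is_orthogonal_projection (fixv Q) Q by split=> // v; exact: fixvP.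
have [PP Pa hP] : is_orthogonal_projection (fixv Q) (oproj (fixv Q)) by apply: (xgetPex 0); exists Q.
set P := oproj _ in PP Pa hP *.
have PQ : P *m Q = Q.
  by apply: mulmx_delta => j; rewrite -mulmxA; apply/hP/fixvP; rewrite mulmxA QQ.
have QP : Q *m P = P.
  by apply: mulmx_delta => j; rewrite -mulmxA; apply/fixvP/hP; rewrite mulmxA PP.
by rewrite -[LHS]Pa -QP hadjM Pa Qa PQ.
Qed.

End Subspaces.

Section SpanAlgebra.
Variables (R : realType) (n r : nat).
Local Notation C := (cplx R).
Local Notation DD := (r.+1 * n)%N.
Local Notation T := (Tsh R n r).
Local Notation Tp := (Tpow R n r).
Local Notation jlb := (jlb R n r).
Local Notation blk := (blk R n r).

Lemma inv_proj1 : inv_proj (1%:M : 'M[C]_DD).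
Proof. by split; rewrite ?hadj1 ?mul1mx ?mulmx1. Qed.

Lemma PhiP_id l : circle l -> PhiP (1%:M : 'M[C]_DD) l = 1%:M.
Proof.
move=> hl; rewrite (PhiP_unique inv_proj1 (Th := jlb 0)) //.
- by rewrite ev_jlb.
- by rewrite mul1mx.
- move=> y hy; rewrite mulmx1 -[y]mulmx1 -(sum_jlb_blk R n r) mulmx_sumr big1 // => a _.
  by have := hy a; rewrite -mulmxA Tpow_jlb addn0 mulmxA => ->; rewrite mul0mx.
- by move=> k k0; rewrite blk_adj -mulmxA Tpow_jlb addn0 blk_jlb_neq // eq_sym -lt0n.
- by rewrite ev_jlb // expr1n.
Qed.

Lemma orthp_sub (E E' : 'M[C]_DD) : E *m E = E -> E' *m E' = E' -> E' *m E = E -> orthp E' *m orthp E = orthp E.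
Proof.
by move=> EE EE' h; apply/(orthp_fix _ EE'); rewrite -(im_orthp EE) mulmxA h.
Qed.

Lemma orthp_Tsub (E E' : 'M[C]_DD) : E *m E = E -> E' *m E' = E' -> E *m (T *m E') = T *m E' ->
  orthp E *m T *m orthp E' = T *m orthp E'.
Proof.
move=> EE EE' h; rewrite -mulmxA; apply/(orthp_fix _ EE).
by rewrite -(im_orthp EE') (mulmxA T) mulmxA h.
Qed.

(* [E] projects onto the span of the [T^m X j k], [m >= e j k], and of the blocks [>= i]. *)
Definition Sp (e : 'I_n -> nat -> nat) (i : nat) (X : 'I_n -> nat -> 'cV[C]_DD) (E : 'M[C]_DD) :=
  [/\ forall j k m, (e j k <= m)%N -> E *m (Tp m *m X j k) = Tp m *m X j k,
      forall a, (i <= a)%N -> E *m jlb a = jlb a &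
      forall y : 'rV[C]_DD, (forall j k m, (e j k <= m)%N -> y *m (Tp m *m X j k) = 0) ->
        (forall a, (i <= a)%N -> y *m jlb a = 0) -> y *m E = 0].

Lemma Sp_rows e i X E p (y : 'M[C]_(p, DD)) : Sp e i X E ->
  (forall j k m, (e j k <= m)%N -> y *m (Tp m *m X j k) = 0) -> (forall a, (i <= a)%N -> y *m jlb a = 0) -> y *m E = 0.
Proof.
move=> [_ _ h] h1 h2; apply: row_perp => s; apply: h => [j k m le|a le].
  by rewrite -row_mul h1 // row0.
by rewrite -row_mul h2 // row0.
Qed.

Lemma Sp_le e i e' i' X E E' : Sp e i X E -> Sp e' i' X E' -> (forall j k, (e' j k <= e j k)%N) -> (i' <= i)%N ->
  E' *m E = E.
Proof.
move=> hE [f1 f2 _] le ii; suff : (1%:M - E') *m E = 0.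
  by rewrite mulmxBl mul1mx => /eqP; rewrite subr_eq0 => /eqP.
apply: (Sp_rows hE) => [j k m em|a ia].
  by rewrite mulmxBl mul1mx f1 ?subrr //; exact: leq_trans (le j k) em.
by rewrite mulmxBl mul1mx f2 ?subrr //; exact: leq_trans ii ia.
Qed.

Lemma Sp_T e i e' i' X E E' : Sp e i X E -> Sp e' i' X E' -> (forall j k, (e j k <= (e' j k).+1)%N) -> (i <= i'.+1)%N ->
  E *m (T *m E') = T *m E'.
Proof.
move=> [f1 f2 _] hE' le ii; suff : (1%:M - E) *m T *m E' = 0.
  by rewrite -mulmxA mulmxBl mul1mx => /eqP; rewrite subr_eq0 => /eqP.
apply: (Sp_rows hE') => [j k m em|a ia].
  rewrite -mulmxA (mulmxA T) -TpowSl mulmxBl mul1mx f1 ?subrr //.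
  exact: leq_trans (le j k) _.
by rewrite -mulmxA T_jlb mulmxBl mul1mx f2 ?subrr //; exact: leq_trans ii _.
Qed.

(** A triangular recombination of derivatives preserves the span because e j is monotone: lower
    derivatives enter with exponents already allowed. Changes of chart are of this kind. *)
Lemma Sp_change e i (X X' : 'I_n -> nat -> 'cV[C]_DD) E (P P' : nat -> nat -> C) : (forall j k m, (m <= k)%N -> (e j m <= e j k)%N) ->
  (forall j k, X' j k = \sum_(m < k.+1) P k m *: X j m) -> (forall j k, X j k = \sum_(m < k.+1) P' k m *: X' j m) ->
  Sp e i X E -> Sp e i X' E.
Proof.
move=> mono h h' [f1 f2 f3]; split=> // [j k m em|y hy].
  rewrite h mulmx_sumr mulmx_sumr; apply: eq_bigr => a _.
  rewrite -!scalemxAr f1 //; apply: leq_trans em; apply: mono; exact: ltn_ord a.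
apply: f3 => j k m em; rewrite h' mulmx_sumr mulmx_sumr big1 // => a _.
rewrite -!scalemxAr hy ?scaler0 //; apply: leq_trans em; apply: mono; exact: ltn_ord a.
Qed.

Section Formula.
Variables (e' e : 'I_n -> nat -> nat) (i : nat) (X : 'I_n -> nat -> 'cV[C]_DD) (E' E : 'M[C]_DD).
Hypothesis ir : (i <= r)%N.
Hypotheses (EE' : E' *m E' = E') (EE : E *m E = E).
Hypotheses (iP' : inv_proj (orthp E')) (iP : inv_proj (orthp E)).
Hypotheses (hE' : Sp e' i X E') (hE : Sp e i.+1 X E).
Hypothesis le1 : forall j k, (e' j k <= e j k)%N.
Hypothesis le2 : forall j k, (e j k <= (e' j k).+1)%N.
Let P' := orthp E'.
Let P := orthp E.

Lemma Sp_sub : P' *m P = P.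
Proof. by apply: orthp_sub => //; exact: Sp_le hE hE' le1 (leqnSn i). Qed.

Lemma Sp_Tsub : P *m T *m P' = T *m P'.
Proof. by apply: orthp_Tsub => //; exact: Sp_T hE hE' le2 (leqnn _). Qed.

Lemma Scoef_zero s : (i < s)%N -> Scoef P' s = 0.
Proof.
case: s => // s lt; apply: (Scoef0 iP'); apply/(orthp_fix _ EE').
by case: hE' => _ f _; exact: f.
Qed.

Lemma Scoef_sum (v : 'cV[C]_DD) : ev n r 1 *m wandering P' *m v = \sum_(s < i.+1) Scoef P' s *m (blk s *m v).
Proof.
rewrite Scoef_vec -(big_mkord xpredT (fun s => Scoef P' s *m (blk s *m v))).
rewrite (big_cat_nat (n := i.+1)) //= big_mkord [X in _ + X]big1_seq ?addr0 // => s /andP[_].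
rewrite mem_index_iota => /andP[lt _].
by rewrite Scoef_zero // mul0mx.
Qed.

(** The constant term of the inverse of Phi_i applied to the generator l^e X j k. The sum stops at i
    because the blocks from i on lie in the subspace, so that later S vanish. *)
Definition fvec j k : 'cV[C]_n := \sum_(s < i.+1) Scoef P' s *m (blk s *m (Tp (e j k) *m X j k)).

Lemma fvec_mem j k : fvec j k \in fixv (Q0 P' P).
Proof.
apply/fixvP; rewrite /fvec -Scoef_sum.
have fx : P *m (Tp (e j k) *m X j k) = Tp (e j k) *m X j k.
  by apply/(orthp_fix _ EE); case: hE => f _ _; exact: f.
rewrite (two_vec iP' iP Sp_sub fx) mulmxA.
by rewrite (Q0_proj iP' iP Sp_sub Sp_Tsub).2.
Qed.

(** Generators with e' < m are T times elements of the image of E', which W' annihilates; the rest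
    have m = e = e'. If in addition e > i, the blocks 0, ..., i vanish. So only the listed
    generators contribute. *)
Lemma fixv_sub (B : {vspace 'cV[C]_n}) : (forall j k, e' j k = e j k -> (e j k <= i)%N -> fvec j k \in B) ->
  (fixv (Q0 P' P) <= B)%VS.
Proof.
move=> hB; have [K hK] := vspace_kernel B.
pose Y := K *m (ev n r 1 *m wandering P').
have YT (x : 'cV[C]_DD) : E' *m x = x -> Y *m (T *m x) = 0.
  move=> /(orthp_fix _ EE') fx; rewrite -fx /Y.
  transitivity (K *m ev n r 1 *m (wandering P' *m T *m P') *m x); first by rewrite !mulmxA.
  by rewrite (wandering_TP iP') mulmx0 mul0mx.
have YTm (x : 'M[C]_(DD, n)) : E' *m x = x -> Y *m (T *m x) = 0.
  move=> fx; apply: mulmx_delta0 => j; rewrite -(mulmxA Y) -(mulmxA T); apply: YT.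
  by rewrite mulmxA fx.
have [f1' f2' _] := hE'.
have YE : Y *m E = 0.
  apply: (Sp_rows hE) => [j k m em|[//|a] ia]; last first.
    by rewrite -T_jlb; apply: YTm; exact: f2'.
  have [e'm|me'] := ltnP (e' j k) m.
    case: m em e'm => // m em e'm; rewrite TpowSl -mulmxA; apply: YT; exact: f1'.
  have me : m = e j k by apply/eqP; rewrite eqn_leq em (leq_trans me' (le1 j k)).
  have ee : e' j k = e j k by apply/eqP; rewrite eqn_leq le1 -me me'.
  rewrite me /Y -mulmxA Scoef_sum.
  have [ei|ie] := leqP (e j k) i; first by apply/hK; exact: hB.
  rewrite big1 ?mulmx0 // => s _; rewrite (mulmxA (blk s)) blk_Tpow; last by apply: leq_trans ir; rewrite -ltnS; exact: ltn_ord.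
  by rewrite leqNgt (leq_trans (ltn_ord s) ie) mul0mx mulmx0.
apply/subvP => w /fixvP hw; apply/hK.
have [q1 q2] := Q0_range P' iP w.
rewrite -hw q1 mulmxA -/Y -q2 /P -(im_orthp EE) !mulmxA.
by rewrite YE !mul0mx.
Qed.

End Formula.
End SpanAlgebra.

Section HigherDerivatives.
Variable R : realType.
Local Notation C := (cplx R).

Lemma hol_of_near (w0 : C) f : (\forall w \near w0, exists d, cdiff f w d) -> hol w0 f.
Proof. by case/nbhsCP => d d0 H; exists d => // w /H. Qed.

Lemma hol_derive1n (w0 : C) f k : hol w0 f -> hol w0 (derive1n k f).
Proof. by move=> hf; elim: k => [//|k IH]; rewrite derive1nS; exact: hol_derive. Qed.

Lemma derive1n_near (w0 : C) f g k : hol w0 f -> (\forall w \near w0, f w = g w) ->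
  \forall w \near w0, derive1n k f w = derive1n k g w.
Proof.
move=> hf e; elim: k => [//|k IH].
apply: filterS (nearI (near_near IH) (hol_cdiff (hol_derive1n k hf))) => w [ew [d hd]].
by rewrite !derive1nS (cdiff_derive1 hd) (cdiff_derive1 (cdiff_near ew hd)).
Qed.

(** The chain rule in triangular form: the coefficients depend on t alone and serve all f at once,
    as a change of chart requires. *)
Lemma derive1n_comp (w0 : C) (t : C -> C) k : hol w0 t -> exists P : nat -> C -> C, (forall m, hol w0 (P m)) /\
  forall f, hol (t w0) f -> \forall w \near w0, derive1n k (fun v => f (t v)) w = \sum_(m < k.+1) P m w * derive1n m f (t w).
Proof.
move=> ht; elim: k => [|k [P [hP IH]]].
  exists (fun _ _ => 1); split=> [m|f hf]; first exact: hol_cst.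
  by apply: nearWC => w; rewrite big_ord1 mul1r.
pose P' m w := (if (m < k.+1)%N then (P m)^`()%classic w else 0) + (if m is m'.+1 then P m' w * t^`()%classic w else 0).
exists P'; split=> [m|f hf].
  apply: holD; first by case: (m < k.+1)%N; [exact: hol_derive | exact: hol_cst].
  by case: m => [|m]; [exact: hol_cst | apply: holM => //; exact: hol_derive].
have n1 := filter_forall_fin (nbhs_filter w0) (fun m : 'I_k.+1 => hol_cdiff (hP m)).
have n2 : \forall w \near w0, forall m : 'I_k.+1, exists d, cdiff (derive1n m f) (t w) d.
  apply: (filter_forall_fin (nbhs_filter w0)) => m.
  exact: (hol_cont ht (hol_cdiff (hol_derive1n m hf))).
apply: filterS (nearI (nearI n1 n2) (nearI (hol_cdiff ht) (near_near (IH f hf)))) => w [[h1 h2] [[t' h3] h4]].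
have dP m : (m < k.+1)%N -> cdiff (P m) w ((P m)^`()%classic w).
  by move=> mk; have [d hd] := h1 (Ordinal mk); rewrite (cdiff_derive1 hd).
have df (m : 'I_k.+1) : cdiff (derive1n m f) (t w) (derive1n m.+1 f (t w)).
  by have [d hd] := h2 m; rewrite derive1nS (cdiff_derive1 hd).
have dt : cdiff t w (t^`()%classic w) by rewrite (cdiff_derive1 h3).
have D := cdiff_big (index_enum 'I_k.+1) (fun m : 'I_k.+1 => cdiffM (dP m (ltn_ord m)) (cdiff_comp dt (df m))).
have e4 : \forall v \near w, \sum_(m < k.+1) P m v * derive1n m f (t v) = derive1n k (fun v => f (t v)) v.
  by apply: filterS h4 => v ->.
rewrite derive1nS (cdiff_derive1 (cdiff_near e4 D)) big_split /=.
under [RHS]eq_bigr do rewrite /P' mulrDl.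
rewrite big_split /=; congr (_ + _).
  rewrite [RHS]big_ord_recr /= ltnn mul0r addr0; apply: eq_bigr => m _.
  by rewrite ltn_ord.
rewrite [RHS]big_ord_recl /= mul0r add0r; apply: eq_bigr => m _.
by rewrite add0n -mulrA [in RHS](mulrC (t^`()%classic w)).
Qed.

Definition mdern m p k (F : C -> 'M[C]_(m, p)) : C -> 'M[C]_(m, p) := iter k (@mder R m p) F.

Lemma mhol_mdern m p k w0 (F : C -> 'M[C]_(m, p)) : mhol w0 F -> mhol w0 (mdern k F).
Proof. by move=> h; elim: k => [//|k IH]; exact: mhol_mder IH. Qed.

Lemma mmero_mdern m p k w0 (F : C -> 'M[C]_(m, p)) : mmero w0 F -> mmero w0 (mdern k F).
Proof. by move=> h; elim: k => [//|k IH]; exact: mmero_mder IH. Qed.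

Lemma mdern_entry m p k (F : C -> 'M[C]_(m, p)) w i j : mdern k F w i j = derive1n k (fun v => F v i j) w.
Proof.
elim: k w => [//|k IH] w; rewrite derive1nS /mdern iterS mxE.
by congr (derive1 _ w); apply/funext => v; exact: IH.
Qed.

Lemma mcdiff_col m p w (F : C -> 'M[C]_(m, p)) j : mcdiff F w ->
  mcdiff (fun v => col j (F v)) w /\ mder (fun v => col j (F v)) w = col j (mder F w).
Proof.
move=> h; have H i k : cdiff (fun v => col j (F v) i k) w (col j (mder F w) i k).
  rewrite mxE; have := mcdiffP h i j; apply: cdiff_near; apply: nearWC => v; by rewrite mxE.
split=> [i k|]; first by exists (col j (mder F w) i k).
exact: (mderE (G := fun w => col j (mder F w))).
Qed.

Lemma vecp_sum n r q k (P : nat -> C) (a : nat -> nat -> 'M[C]_(n, q)) :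
  vecp r (fun s => \sum_(m < k) P m *: a m s) = \sum_(m < k) P m *: vecp r (a m).
Proof.
rewrite /vecp; under eq_bigr do rewrite mulmx_sumr.
rewrite exchange_big; apply: eq_bigr => m _; rewrite scaler_sumr.
by apply: eq_bigr => s _; rewrite -scalemxAr.
Qed.

Lemma vecp_col n r q (a : nat -> 'M[C]_(n, q)) j : vecp r (fun s => col j (a s)) = vecp r a *m delta_mx j 0.
Proof. by rewrite /vecp mulmx_suml; apply: eq_bigr => s _; rewrite colE mulmxA. Qed.

End HigherDerivatives.

(** * Derivatives of the columns and the spans they generate *)

Section Coefficients.
Variables (R : realType) (n r : nat) (M : riemann_surface R).
Local Notation C := (cplx R).
Local Notation DD := (r.+1 * n)%N.
Variables (D : set M) (c : M -> int -> 'M[C]_n).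
Local Notation o := (column_order D c).

Lemma column_orderP j i p : (i < o j)%N -> ~ D p -> col j (c p i%:Z) = 0.
Proof.
(* If the column vanishes identically off D the order is the default 0, and no i lies below it. *)
rewrite /column_order; case: xgetP => [k -> [_ h] lt nD|_ //]; exact: h.
Qed.

(* The blocks of the k-th derivative of the j-th column divided by its leading power of l. *)
Definition Xg (z : chart R M) (p : M) (j : 'I_n) (k : nat) : 'cV[C]_DD :=
  vecp r (fun a => Lder c j (a + o j)%N%:Z k z p).

Definition good (p : M) := ~ D p /\ exists z (b : nat -> C -> 'M[C]_n),
  [/\ coords z, cdom z p, (forall k, mhol (z p) (b k)) & \forall w \near z p, forall k : nat, c (cinv z w) k%:Z = b k w].

Lemma good_hol p z' (k : nat) j : good p -> coords z' -> cdom z' p -> forall a e, hol (z' p) (fun w => col j (c (cinv z' w) k%:Z) a e).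
Proof.
move=> [_ [z [b [hz zp hb e]]]] hz' zp' a f.
have h := mhol_trans hz' hz zp' zp (hb k).
have := h a j; apply: hol_near.
apply: filterS (nearI (trans_near hz' hz zp' zp e) (trans_inv hz' hz zp' zp)) => w [ew ew'].
by rewrite mxE -ew' ew.
Qed.

Lemma Xg_change p z1 z2 : good p -> coords z1 -> coords z2 -> cdom z1 p -> cdom z2 p ->
  exists P : nat -> nat -> C, forall j k, Xg z1 p j k = \sum_(m < k.+1) P k m *: Xg z2 p j m.
Proof.
move=> gp h1 h2 p1 p2.
have H k : exists P : nat -> C, forall j (i : nat), Lder c j i%:Z k z1 p = \sum_(m < k.+1) P m *: Lder c j i%:Z m z2 p.
  have [P [_ hP]] := derive1n_comp k (trans_hol h1 h2 p1 p2).
  exists (fun m => P m (z1 p)) => j i; apply/matrixP => a b; rewrite summxE mxE.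
  have hf := good_hol i j gp h2 p2 a b; rewrite -(trans_p z2 h1 p1) in hf.
  have e : \forall w \near z1 p, col j (c (cinv z2 (trans z1 z2 w)) i%:Z) a b = col j (c (cinv z1 w) i%:Z) a b.
    by apply: filterS (trans_inv h1 h2 p1 p2) => w ->.
  rewrite -(nbhs_singleton (derive1n_near k (hol_comp (trans_hol h1 h2 p1 p2) hf) e)).
  rewrite (nbhs_singleton (hP _ hf)); apply: eq_bigr => m _.
  by rewrite (trans_p z2 h1 p1) !mxE.
have [P hP] := choice H; exists P => j k.
transitivity (vecp r (fun s => \sum_(m < k.+1) P k m *: Lder c j (s + o j)%N%:Z m z2 p)).
  by apply: vecp_ext => s _; exact: hP.
exact: (vecp_sum r k.+1 (P k) (fun m s => Lder c j (s + o j)%N%:Z m z2 p)).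
Qed.

Lemma Sp_chart e i E p z1 z2 : (forall j k m, (m <= k)%N -> (e j m <= e j k)%N) -> good p ->
  coords z1 -> coords z2 -> cdom z1 p -> cdom z2 p -> Sp e i (Xg z1 p) E -> Sp e i (Xg z2 p) E.
Proof.
move=> mono gp h1 h2 p1 p2.
have [P hP] := Xg_change gp h1 h2 p1 p2; have [P' hP'] := Xg_change gp h2 h1 p2 p1.
exact: Sp_change mono hP' hP.
Qed.

Section Local.
Variables (z : chart R M) (x : M) (N : nat) (b : nat -> C -> 'M[C]_n).
Hypothesis hD : discrete_subset D.
Hypotheses (hz : coords z) (zx : cdom z x).
Hypothesis hb : forall k, mmero (z x) (b k).
Hypothesis hN : \forall w \near (z x)^', (forall k : nat, c (cinv z w) k%:Z = b k w) /\ (forall k, (N < k)%N -> b k w = 0).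

Definition regular w := [/\ cdom z (cinv z w), z (cinv z w) = w, (forall k, mhol w (b k)) &
  \forall v \near w, ~ D (cinv z v) /\ forall k : nat, c (cinv z v) k%:Z = b k v].

Lemma regular_near : \forall w \near (z x)^', regular w.
Proof.
have n1 := dnbhs_of_nbhs (chart_near hz zx).
have n2 := near_dnbhs_near (chart_inv_dnear hz zx (hD x)).
have n3 := near_dnbhs_near hN.
have n4 := filter_forall_fin (dnbhs_filter _) (fun k : 'I_N.+1 => near_dnbhs_near (mmero_mcdiff (hb k))).
apply: filterS (near2D (near2D n1 n2) (near2D n3 n4)) => w [[[h1 h2] h3] [h4 h5]].
split=> // [k|]; last by apply: filterS (nearI h3 h4) => v [? []].
have [kN|Nk] := leqP k N.
  by move=> i j; apply: hol_of_near; apply: filterS (h5 (Ordinal (kN : k < N.+1)%N)) => v; apply.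
by apply: mhol_near (mhol_cst w 0); apply: filterS h4 => v [_ h]; rewrite h.
Qed.

Lemma regular_good w : regular w -> good (cinv z w).
Proof.
move=> [h1 h2 h3 h4]; split; first by have [] := nbhs_singleton h4.
by exists z, b; split; rewrite ?h2 //; apply: filterS h4 => v [].
Qed.

Definition Xb (j : 'I_n) (k : nat) (w : C) : 'cV[C]_DD := vecp r (fun a => col j (mdern k (b (a + o j)%N) w)).

Lemma Xg_Xb w j k : regular w -> Xg z (cinv z w) j k = Xb j k w.
Proof.
move=> [_ h2 h3 h4]; apply: vecp_ext => s _; apply/matrixP => a e; rewrite !mxE mdern_entry h2.
have ee : \forall v \near w, b (s + o j)%N v a j = col j (c (cinv z v) (s + o j)%N%:Z) a e.
  by apply: filterS h4 => v [_ h]; rewrite mxE h.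
by rewrite (nbhs_singleton (derive1n_near k (h3 _ a j) ee)).
Qed.

Lemma Xb_mmero j k : mmero (z x) (Xb j k).
Proof.
apply: mmero_vecp => a i e.
have := mmero_mdern k (hb (a + o j)%N) i j; apply: mero_near; apply: nearWD => w; by rewrite mxE.
Qed.

Lemma Xb_mder w j k : regular w -> mcdiff (Xb j k) w /\ mder (Xb j k) w = Xb j k.+1 w.
Proof.
move=> [_ _ h3 _].
have hc a := mcdiff_col j (nbhs_singleton (mhol_mcdiff (mhol_mdern k (h3 (a + o j)%N)))).
have [h1 h2] := mder_vecp r (fun a => (hc a).1); split=> //.
by rewrite h2; apply: vecp_ext => s _; rewrite (hc s).2.
Qed.

Variables (e : 'I_n -> nat -> nat) (i K : nat).
Hypothesis ir : (i <= r)%N.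
Hypothesis eS : forall j k, (e j k.+1 <= (e j k).+1)%N.
Hypothesis eK : forall j k, (K <= k)%N -> (r < e j k)%N.

(** By [eK] finitely many derivatives matter, higher ones being shifted out of the truncation. By
    [eS] the exponent grows by at most 1 per derivative, so T times the derivative of a generator is
    again in the span. *)
Lemma Sp_germ : exists E : C -> 'M[C]_DD, pack (z x) E /\
  \forall w \near (z x)^', Sp e i (Xg z (cinv z w)) (E w).
Proof.
pose F (a : ('I_n * 'I_K * 'I_r.+1) + ('I_r.+1 * 'I_n)) (w : C) : 'cV[C]_DD := match a with
  | inl (j, k, m) => (if (e j k <= m)%N then Tpow R n r m else 0) *m Xb j k w
  | inr (a, v) => (if (i <= a)%N then jlb R n r a else 0) *m delta_mx v 0 end.
have cF m q (A : 'M[C]_(m, q)) : mmero (z x) (fun=> A) by apply: mhol_mmero; exact: mhol_cst.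
have mF a : mmero (z x) (F a).
  case: a => [[[j k] m]|[a v]]; last exact: cF.
  have m1 := cF _ _ (if (e j k <= m)%N then Tpow R n r m else 0).
  have m2 := mmeroM m1 (Xb_mmero j k); exact: m2.
have perp w (y : 'rV[C]_DD) : (forall a, y *m F a w = 0) ->
    (forall j k m, (e j k <= m)%N -> y *m (Tpow R n r m *m Xb j k w) = 0) /\ (forall a, (i <= a)%N -> y *m jlb R n r a = 0).
  move=> hy; split=> [j k m em|a ia].
    have [mr|rm] := leqP m r; last by rewrite Tpow_big // mul0mx mulmx0.
    have [Kk|kK] := leqP K k; first by have := leq_trans (eK j Kk) em; rewrite ltnNge mr.
    by have := hy (inl (j, Ordinal kK, Ordinal (mr : m < r.+1)%N)); rewrite /F /= em.
  have [ar|ra] := leqP a r; last by rewrite jlb_big // mulmx0.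
  apply: mulmx_delta0 => v; have := hy (inr (Ordinal (ar : a < r.+1)%N, v)).
  by rewrite /F /= ia mulmxA.
have [|E [pE sE]] := @germ_pack R n r (z x) _ F mF.
  apply: filterS regular_near => w rw y /perp[h1 h2]; split.
  - case=> [[[j k] m]|[a v]]; rewrite /F.
      case: ifP => em; last by rewrite mul0mx mulmx0.
      by rewrite -(mulmxA y) (mulmxA (Tsh R n r)) -TpowSl h1 // leqW.
    case: ifP => ia; last by rewrite mul0mx mulmx0.
    by rewrite -(mulmxA y) (mulmxA (Tsh R n r)) T_jlb mulmxA h2 ?mul0mx // leqW.
  - case=> [[[j k] m]|[a v]].
      have [h3 h4] := Xb_mder j k rw.
      have [_ h5] := mcdiff_mulc (if (e j k <= m)%N then Tpow R n r m else 0) h3.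
      have -> : mder (F (inl (j, k, m))) w = (if (e j k <= m)%N then Tpow R n r m else 0) *m Xb j k.+1 w.
        by rewrite -h4 -h5.
      case: ifP => em; last by rewrite mul0mx mulmx0.
      by rewrite -(mulmxA y) (mulmxA (Tsh R n r)) -TpowSl h1 //; apply: leq_trans (eS j k) _.
    have [_ h5] := mcdiff_cst ((if (i <= a)%N then jlb R n r a else 0) *m delta_mx v (0 : 'I_1)) w.
    have -> : mder (F (inr (a, v))) w = 0 by exact: h5.
    exact: mulmx0.
  - by rewrite ElastE mulmxA h2 // mul0mx.
exists E; split=> //; apply: filterS (near2D regular_near sE) => w [rw [s1 s2]].
split=> [j k m em|a ia|y h1 h2].
- rewrite Xg_Xb //.
  have [mr|rm] := leqP m r; last by rewrite Tpow_big // mul0mx mulmx0.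
  have [Kk|kK] := leqP K k; first by have := leq_trans (eK j Kk) em; rewrite ltnNge mr.
  by have := s1 (inl (j, Ordinal kK, Ordinal (mr : m < r.+1)%N)); rewrite /F /= em.
- have [ar|ra] := leqP a r; last by rewrite jlb_big // mulmx0.
  apply: mulmx_delta => v; have := s1 (inr (Ordinal (ar : a < r.+1)%N, v)).
  by rewrite /F /= ia mulmxA.
- apply: s2 => -[[[j k] m]|[a v]]; rewrite /F.
    case: ifP => em; last by rewrite mul0mx mulmx0.
    by rewrite -Xg_Xb // h1.
  case: ifP => ia; last by rewrite mul0mx mulmx0.
  by rewrite mulmxA h2 // mul0mx.
Qed.

End Local.
End Coefficients.

Lemma derive1n_zero (R : realType) k (w : cplx R) : derive1n k (fun=> 0 : cplx R) w = 0.
Proof.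
elim: k w => [//|k IH] w; rewrite derive1nS (_ : derive1n k (fun=> 0) = (fun=> 0)); last exact/funext.
exact: cdiff_derive1 (cdiff_cst 0 w).
Qed.

Section Invariance.
Variables (R : realType) (n r : nat).
Local Notation C := (cplx R).
Local Notation DD := (r.+1 * n)%N.
Local Notation T := (Tsh R n r).

Lemma fix_T_der p (E dE : 'M[C]_DD) (V dV : 'M[C]_(DD, p)) : E *m T *m E = T *m E -> (1%:M - E) *m T *m dE *m E = 0 ->
  E *m V = V -> dV = dE *m V + E *m dV -> E *m (T *m dV) = T *m dV.
Proof.
move=> ETE dEE EV e; suff : (1%:M - E) *m (T *m dV) = 0.
  by rewrite mulmxBl mul1mx => /eqP; rewrite subr_eq0 => /eqP.
have N0 : (1%:M - E) *m T *m E = 0 by rewrite -mulmxA mulmxBl mul1mx (mulmxA E) ETE subrr.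
rewrite e -EV mulmxDr mulmxDr (mulmxA T E) !mulmxA N0 mul0mx addr0.
by rewrite dEE mul0mx.
Qed.

Lemma fix_Tpow p (E : 'M[C]_DD) (V : 'M[C]_(DD, p)) m : E *m T *m E = T *m E -> E *m V = V ->
  E *m (Tpow R n r m *m V) = Tpow R n r m *m V.
Proof.
move=> ETE EV; elim: m => [|m IH]; first by rewrite Tpow0 mul1mx.
by rewrite TpowSl -mulmxA -IH !mulmxA ETE.
Qed.

Lemma fix_jlb (E : 'M[C]_DD) : E *m Elast R n r = Elast R n r -> E *m jlb R n r r = jlb R n r r.
Proof.
move=> h; have := congr1 (fun X => X *m jlb R n r r) h.
by rewrite /= ElastE mulmxA -!(mulmxA _ (blk R n r r)) blk_jlb_eq // !mulmx1.
Qed.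

End Invariance.

(** * The filtration from W = W_r to W_0 *)

Section Filtration.
Variables (R : realType) (n : nat) (M : riemann_surface R).
Local Notation C := (cplx R).
Variables (D : set M) (G S : set 'M[C]_n) (Psi Phi : M -> loop R n) (c : M -> int -> 'M[C]_n).
Hypothesis hG : compact_subgroup G.
Hypothesis hD : discrete_subset D.
Hypothesis hIw : forall p, ~ D p -> iwasawa_unitary_part G (Psi p) (Phi p).
Hypothesis hC : forall z p, coords z -> cdom z p -> ~ D p ->
  Lambda_plus S (fun l => l *: (invmx (Psi p l) *m zderiv z 1 (fun q => Psi q l) p)).
Hypothesis hmero : meromorphic_family D Psi.
Hypothesis hholo : holomorphic_family (~` D) Psi.
Hypothesis hc : forall p, ~ D p -> laurent_expansion (Psi p) (c p).
Hypothesis hsm : forall p, ~ D p -> smooth_loop (Psi p).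
Variables (r : nat) (u : nat -> nat).
Hypothesis hGr : forall p, ~ D p -> Gr r (Wspace (Psi p)).
Local Notation DD := (r.+1 * n)%N.
Local Notation o := (column_order D c).
Local Notation X z p := (@Xg R n r M D c z p).

Let GU : G `<=` @unitary_group R n. Proof. by case: hG. Qed.

(* The power of l carried by the k-th derivative of the j-th column in W_i. *)
Definition eg i j k := (o j + k - u i)%N.

Lemma eg_step i j k : (eg i j k.+1 <= (eg i j k).+1)%N. Proof. rewrite /eg; lia. Qed.
Lemma eg_mono i j k m : (m <= k)%N -> (eg i j m <= eg i j k)%N. Proof. rewrite /eg; lia. Qed.
Lemma eg_big i j k : (r.+1 + u i <= k)%N -> (r < eg i j k)%N. Proof. rewrite /eg; lia. Qed.
Hypothesis hu : forall i, (i < r)%N -> (u i.+1 <= u i <= (u i.+1).+1)%N.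

Lemma eg_le i j k : (i < r)%N -> (eg i j k <= eg i.+1 j k)%N. Proof. by move/hu; rewrite /eg; lia. Qed.
Lemma eg_leS i j k : (i < r)%N -> (eg i.+1 j k <= (eg i j k).+1)%N. Proof. by move/hu; rewrite /eg; lia. Qed.

Hypothesis ur : u r = 0%N.

Lemma Wspan_Sp x z N b (E : C -> 'M[C]_DD) : coords z -> cdom z x -> (forall k, mmero (z x) (b k)) ->
  (\forall w \near (z x)^', (forall k : nat, c (cinv z w) k%:Z = b k w) /\ (forall k, (N < k)%N -> b k w = 0)) ->
  pack (z x) E -> (\forall w \near (z x)^', Wspan (vecp r (fun k => b k w)) (E w)) ->
  \forall w \near (z x)^', Sp (eg r) r (X z (cinv z w)) (E w).
Proof.
move=> hz zx hb hN pE hW.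
have n1 := regular_near hD hz zx hb hN.
have n2 := dnbhs_of_nbhs (near_near (nearI pE.2 (mhol_mcdiff pE.1))).
apply: filterS (near2D n1 (near2D (near_dnbhs_near hW) n2)) => w [rw [nW nP]].
have [_ _ hbw hcw] := rw.
pose V k v : 'M[C]_(DD, n) := Tpow R n r k *m vecp r (fun a => mdern k (b a) v).
(* Induction on k: E V_k = V_k is differentiated and shifted, and [fix_T_der] says that T times the
   derivative of V_k, which is V_(k+1), is again fixed. *)
have fixV k : \forall v \near w, E v *m V k v = V k v.
  elim: k => [|k IH]; first by apply: filterS nW => v [h _]; exact: h.
  have mV : mhol w (fun v => vecp r (fun a => mdern k (b a) v)).
    by apply: mhol_vecp => a; exact: mhol_mdern.
  have nd := filter_forall_fin (nbhs_filter w) (fun a : 'I_r.+1 => mhol_mcdiff (mhol_mdern k (hbw a))).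
  apply: filterS (nearI (nearI (near_near IH) nP) (nearI (mhol_mcdiff mV) nd)) => v [[ev [[_ ETE _ dE] cE]] [cV da]].
  have [cV' dV'] := mcdiff_mulc (Tpow R n r k) cV.
  have [_ e1] := mcdiff_mul cE cV'.
  have e2 : mder (fun y => E y *m V k y) v = mder (V k) v.
    by apply: mder_near => //; have [] := mcdiff_mul cE cV'.
  have dV : mder (fun v => vecp r (fun a => mdern k (b a) v)) v = vecp r (fun a => mdern k.+1 (b a) v).
    apply: (mderE (G := fun v => vecp r (fun a => mdern k.+1 (b a) v))) => i j.
    have H (s : 'I_r.+1) := mcdiffP (mcdiff_mulc (jlb R n r s) (da s)).1 i j.
    have := cdiff_big (index_enum 'I_r.+1) H.
    have -> : (fun v0 => \sum_(s < r.+1) (jlb R n r s *m mdern k (b s) v0) i j) = (fun v0 => vecp r (fun a => mdern k (b a) v0) i j).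
      by apply/funext => y; rewrite /vecp summxE.
    move/cdiff_eq; apply; rewrite /vecp summxE; apply: eq_bigr => s _.
    by rewrite (mcdiff_mulc (jlb R n r s) (da s)).2.
  have e3 : V k.+1 v = Tsh R n r *m (Tpow R n r k *m vecp r (fun a => mdern k.+1 (b a) v)).
    by rewrite /V TpowSl -mulmxA.
  rewrite e3 -dV -dV'; apply: (fix_T_der (V := V k v) ETE dE (nbhs_singleton ev)).
  exact: (etrans (esym e2) e1).
have [EE ETE EE0 dE] := (nbhs_singleton nP).1.
have [w1 w2] := nbhs_singleton nW.
(* The blocks of column j below its order vanish, so shifting X j k by o(j) recovers the derivative
   of the whole column. *)
have key j k m : (o j + k <= m)%N -> Tpow R n r m *m Xb r D c b j k w = Tpow R n r (m - o j - k) *m V k w *m delta_mx j (0 : 'I_1).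
  move=> om; have -> : m = ((m - o j - k) + (k + o j))%N by lia.
  rewrite !TpowD (_ : (_ + (k + o j) - o j - k)%N = (m - o j - k)%N); last by lia.
  rewrite -!mulmxA; congr (_ *m (_ *m _)).
  rewrite /Xb Tpow_vecp -vecp_col; apply: vecp_ext => s _.
  case: leqP => [os|so]; first by rewrite subnK.
  apply/matrixP => a e; rewrite !mxE mdern_entry.
  have z0 : \forall v \near w, 0 = b s v a j.
    apply: filterS hcw => v [nD h]; rewrite -h.
    by have := congr1 (fun Y : 'cV[C]_n => Y a 0) (column_orderP so nD); rewrite !mxE.
  by rewrite -(nbhs_singleton (derive1n_near k (hol_cst w 0) z0)) derive1n_zero.
split=> [j k m em|a ra|y h1 _].
- rewrite (Xg_Xb r j k rw) key; last by move: em; rewrite /eg ur subn0.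
  by rewrite (mulmxA (E w)) (fix_Tpow _ ETE (nbhs_singleton (fixV k))).
- have [->|ra'] := eqVneq a r; first exact: fix_jlb.
  by rewrite jlb_big ?mulmx0 // ltn_neqAle eq_sym ra' ra.
- apply: w2 => m; apply: mulmx_delta0 => j.
  have := h1 j 0%N (m + o j)%N; rewrite (Xg_Xb r j 0%N rw) key; last by lia.
  rewrite (_ : (m + o j - o j - 0)%N = m); last by lia.
  rewrite /V Tpow0 mul1mx !mulmxA; apply; rewrite /eg ur; lia.
Qed.

Definition pkg x (z : chart R M) (E : nat -> C -> 'M[C]_DD) := [/\ coords z, cdom z x,
  (forall i, (i <= r)%N -> pack (z x) (E i)),
  (\forall w \near (z x)^', [/\ good D c (cinv z w), cdom z (cinv z w), z (cinv z w) = w &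
     forall i, (i <= r)%N -> Sp (eg i) i (X z (cinv z w)) (E i w)]) &
  \forall w \near (z x)^', forall l, circle l -> Phi (cinv z w) l = PhiP (orthp (E r w)) l].

Lemma pkg_exists x : exists z E, pkg x z E.
Proof.
have [z [N [b [hz zx hb hN]]]] := Gr_local hD hmero hc hsm x hGr.
have hN' : \forall w \near (z x)^', (forall k : nat, c (cinv z w) k%:Z = b k w) /\ (forall k, (N < k)%N -> b k w = 0).
  by apply: filterS hN => w [h1 [h2 _]].
have hpl : \forall w \near (z x)^', pl N.+1 (fun l => l ^+ 0 *: Psi (cinv z w) l) (fun k => b k w).
  by apply: filterS hN => w [].
have hr q th : ~ D q -> pl (N * n).+1 (fun l => l ^+ 0 *: Phi q l) th -> forall k, (r < k)%N -> th k = 0.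
  move=> nD hth; apply: (phi_degree_Gr GU (hIw nD) (hGr nD) (L := (N * n).+1)).
  by apply: (pl_eq _ hth) => l hl; rewrite expr0 scale1r.
have [EW [pW hW]] := W_germ GU hD hIw hC hz zx hb hpl hr.
have sW : \forall w \near (z x)^', Sp (eg r) r (X z (cinv z w)) (EW w).
  by apply: (Wspan_Sp hz zx hb hN' pW); apply: filterS hW => w [].
have H i : exists E : C -> 'M[C]_DD, (i <= r)%N -> pack (z x) E /\
    \forall w \near (z x)^', Sp (eg i) i (X z (cinv z w)) (E w).
  have [ir|ri] := leqP i r; last by exists (fun=> 0).
  have [E hE] := Sp_germ hD hz zx hb hN' ir (eg_step i) (@eg_big i).
  by exists E.
have [E0 hE0] := choice H.
(* At i = r the idempotent must be the one known to give [Phi]; [Sp_germ] is used only below r. *)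
pose E i := if (i < r)%N then E0 i else EW.
have hE i : (i <= r)%N -> pack (z x) (E i) /\ \forall w \near (z x)^', Sp (eg i) i (X z (cinv z w)) (E i w).
  rewrite leq_eqVlt => /orP[/eqP ->|ir]; first by rewrite /E ltnn.
  by rewrite /E ir; apply: hE0; exact: ltnW.
exists z, E; split=> //.
- by move=> i /hE[].
- have n1 := regular_near hD hz zx hb hN'.
  have n2 : \forall w \near (z x)^', forall i : 'I_r.+1, Sp (eg i) i (X z (cinv z w)) (E i w).
    by apply: (filter_forall_fin (dnbhs_filter _)) => i; have [] := hE i (ltn_ord i).
  apply: filterS (near2D n1 n2) => w [rw h]; split.
  + exact: (regular_good hz rw).
  + by case: rw.
  + by case: rw.
  + by move=> i ir; exact: (h (Ordinal (ir : i < r.+1)%N)).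
- apply: filterS hW => w [_ h] l hl; rewrite /E ltnn -h //.
  by rewrite expr0 scale1r.
Qed.

(* Two local descriptions of W_i agree where both are defined, by continuity at the exceptional points. *)
Lemma pkg_unique i p z1 E1 z2 (E2 : C -> 'M[C]_DD) : (i <= r)%N -> pkg p z1 E1 -> coords z2 -> cdom z2 p ->
  pack (z2 p) E2 -> (\forall v \near z2 p, [/\ good D c (cinv z2 v), cdom z2 (cinv z2 v) & Sp (eg i) i (X z2 (cinv z2 v)) (E2 v)]) ->
  orthp (E1 i (z1 p)) = orthp (E2 (z2 p)).
Proof.
move=> ir [h1 p1 pE nE _] h2 p2 pE2 nE2.
have [hE1 pE1] := pE i ir; have [hE2 pE2'] := pack_trans h1 h2 p1 p2 pE2.
have nS : \forall w \near (z1 p)^', E2 (trans z1 z2 w) *m E1 i w = E1 i w /\ E1 i w *m E2 (trans z1 z2 w) = E2 (trans z1 z2 w).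
  have n2 := dnbhs_of_nbhs (nearI (trans_near h1 h2 p1 p2 nE2) (trans_inv h1 h2 p1 p2)).
  apply: filterS (near2D nE n2) => w [[gw cw _ sw] [[_ cw' sw'] ew]].
  rewrite ew in cw' sw'.
  have s1 := Sp_chart (@eg_mono i) gw h2 h1 cw' cw sw'.
  by split; apply: Sp_le; [exact: sw i ir | exact: s1 | | | exact: s1 | exact: sw i ir | |].
have a1 := mhol_eq (mholM hE2 hE1) hE1; have a2 := mhol_eq (mholM hE1 hE2) hE2.
have b1 : E2 (trans z1 z2 (z1 p)) *m E1 i (z1 p) = E1 i (z1 p).
  by apply: (nbhs_singleton (a1 _)); apply: filterS nS => w [].
have b2 : E1 i (z1 p) *m E2 (trans z1 z2 (z1 p)) = E2 (trans z1 z2 (z1 p)).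
  by apply: (nbhs_singleton (a2 _)); apply: filterS nS => w [].
have [EE1 _ _ _] := nbhs_singleton pE1; have [EE2 _ _ _] := nbhs_singleton pE2'.
by rewrite -(trans_p z2 h1 p1); exact: orthp_eq.
Qed.

(** Q is defined pointwise, each x using its own chosen chart and idempotents at x. Near x the
    choices made at other points agree with those of x by [pkg_unique]. *)
Lemma filtration : exists Q : nat -> M -> 'M[C]_DD, forall x, exists z E, pkg x z E /\
  forall i, (i <= r)%N -> \forall w \near z x, Q i (cinv z w) = orthp (E i w).
Proof.
have H x : exists zE : chart R M * (nat -> C -> 'M[C]_DD), pkg x zE.1 zE.2.
  by have [z [E h]] := pkg_exists x; exists (z, E).
have [f hf] := choice H.
exists (fun i x => orthp ((f x).2 i ((f x).1 x))) => x; exists (f x).1, (f x).2; split=> // i ir.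
have [hz zx pE nE _] := hf x; apply: near_of_dnbhs; last by rewrite (chartK hz zx).
have n2 := dnbhs_of_nbhs (near_near (nearI (mhol_mcdiff (pE i ir).1) (pE i ir).2)).
have n3 : \forall w \near (((f x).1 x)^'), mhol w ((f x).2 i).
  apply: filterS n2 => w nw a b; apply: hol_of_near; apply: filterS nw => v [h _]; exact: h.
apply: filterS (near2D (near2D (near_dnbhs_near nE) n2) n3) => w [[nw np] hw].
have [gw cw ew _] := nbhs_singleton nw.
rewrite (pkg_unique ir (hf (cinv (f x).1 w)) hz cw (E2 := (f x).2 i)) ?ew //.
  by split=> //; apply: filterS np => v [].
by apply: filterS nw => v [h1 h2 _ h3]; split=> //; exact: h3.
Qed.

End Filtration.

Lemma sum_trunc (V : zmodType) (F : nat -> V) i r : (i <= r)%N -> (forall s, (i < s)%N -> F s = 0) ->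
  \sum_(s < r.+1) F s = \sum_(s < i.+1) F s.
Proof.
move=> ir F0; rewrite -(big_mkord xpredT F) (big_cat_nat (n := i.+1)) //= big_mkord.
rewrite [X in _ + X]big1_seq ?addr0 // => s /andP[_].
by rewrite mem_index_iota => /andP[lt _]; exact: F0.
Qed.

Lemma invmx_unitary (R : realType) m (A : 'M[cplx R]_m) : A *m A^t* = 1%:M -> invmx A = A^t*.
Proof. by move=> h; rewrite -[LHS]mulmx1 -h mulmxA mulVmx ?mul1mx // (mulmx1_unit h).1. Qed.

Lemma unitary_groupV (R : realType) m (A : 'M[cplx R]_m) : @unitary_group R m A -> @unitary_group R m (invmx A).
Proof.
move/unitary_groupP => h; apply/unitary_groupP; rewrite (invmx_unitary h) hadjK.
exact: unitary_left.
Qed.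

Lemma unit_near_det (R : realType) m (A B : 'M[cplx R]_m) : \det B = 1 -> nrm (\det A - \det B) < 1 -> A \in unitmx.
Proof.
move=> ->; rewrite unitmxE unitfE => h; apply/eqP => A0.
by move: h; rewrite A0 sub0r nrmN nrm1 ltxx.
Qed.

(* [K q K p + (1 - K q)(1 - K p)] intertwines [K p] and [K q], and is the identity at [q = p]. *)
Lemma fixv_transport (R : realType) m (K L : 'M[cplx R]_m) (B : seq 'cV[cplx R]_m) : K *m K = K -> L *m L = L ->
  K *m L + (1%:M - K) *m (1%:M - L) \in unitmx -> basis_of (fixv L) B ->
  basis_of (fixv K) [seq (K *m L + (1%:M - K) *m (1%:M - L)) *m v | v <- B].
Proof.
move=> KK LL; set U := K *m L + _ => uU hB.
have KU : K *m (1%:M - K) = 0 by rewrite mulmxBr mulmx1 KK subrr.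
have LU : (1%:M - L) *m L = 0 by rewrite mulmxBl mul1mx LL subrr.
have e1 : K *m U = K *m L by rewrite /U mulmxDr (mulmxA K K L) KK (mulmxA K (1%:M - K)) KU mul0mx addr0.
have e2 : U *m L = K *m L by rewrite /U mulmxDl -(mulmxA K L L) LL -(mulmxA (1%:M - K)) LU mulmx0 addr0.
pose f : 'Hom('cV[cplx R]_m, 'cV[cplx R]_m) := linfun (mulmx U).
have fE v : f v = U *m v by rewrite lfunE.
clearbody f.
have -> : [seq U *m v | v <- B] = map f B by apply: eq_map => v; rewrite fE.
have -> : fixv K = (f @: fixv L)%VS.
  apply/vspaceP => v; apply/idP/idP => [/fixvP hv|/memv_imgP[y /fixvP hy ->]].
    have -> : v = f (invmx U *m v) by rewrite fE mulKVmx.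
    apply: memv_img; apply/fixvP.
    have e3 : L *m invmx U = invmx U *m K.
      by rewrite -[LHS](mulKmx uU) (mulmxA U) e2 -e1 -mulmxA mulmxV ?mulmx1.
    by rewrite mulmxA e3 -mulmxA hv.
  by apply/fixvP; rewrite fE -hy mulmxA e1 (mulmxA U) e2 -!mulmxA !hy.
apply: limg_basis_of hB; apply/eqP; rewrite -subv0; apply/subvP => v.
rewrite memv_cap => /andP[_]; rewrite memv_ker fE => /eqP hv.
by rewrite memv0 -(mulKmx uU v) hv mulmx0.
Qed.

Section MatrixContinuity.
Variables (R : realType) (w0 : cplx R) (m p : nat).
Implicit Types F : cplx R -> 'M[cplx R]_(m, p).

Lemma mcont_near F H : (\forall w \near w0, F w = H w) -> mcont w0 F -> mcont w0 H.
Proof.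
move=> e h i j; have e0 := nbhs_singleton e; apply: (cvgCP (nbhs_filter w0) _ _).2 => d d0.
apply: filterS (nearI e ((cvgCP (nbhs_filter w0) _ _).1 (h i j) d d0)) => w [<-].
by rewrite -e0.
Qed.

Lemma mcont_cst (A : 'M[cplx R]_(m, p)) : mcont w0 (fun=> A).
Proof. by move=> i j; exact: (@cst_continuous (cplx R) (cplx R) (A i j) w0). Qed.

Lemma mcontD F H : mcont w0 F -> mcont w0 H -> mcont w0 (fun w => F w + H w).
Proof.
move=> hF hH i j; rewrite (_ : (fun w => _) = fun w => F w i j + H w i j); first exact: (cvgD (hF i j) (hH i j)).
by apply/funext => w; rewrite mxE.
Qed.

End MatrixContinuity.

(** * The unitons as subbundles *)

Section Unitons.
Variables (R : realType) (n : nat) (M : riemann_surface R).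
Local Notation C := (cplx R).
Variables (D : set M) (G S : set 'M[C]_n) (Psi Phi : M -> loop R n) (c : M -> int -> 'M[C]_n).
Hypothesis hG : compact_subgroup G.
Hypothesis hD : discrete_subset D.
Hypothesis hIw : forall p, ~ D p -> iwasawa_unitary_part G (Psi p) (Phi p).
Hypothesis hC : forall z p, coords z -> cdom z p -> ~ D p ->
  Lambda_plus S (fun l => l *: (invmx (Psi p l) *m zderiv z 1 (fun q => Psi q l) p)).
Hypothesis hmero : meromorphic_family D Psi.
Hypothesis hholo : holomorphic_family (~` D) Psi.
Hypothesis hc : forall p, ~ D p -> laurent_expansion (Psi p) (c p).
Hypothesis hsm : forall p, ~ D p -> smooth_loop (Psi p).
Variables (r : nat) (u : nat -> nat).
Hypothesis hGr : forall p, ~ D p -> Gr r (Wspace (Psi p)).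
Hypothesis ur : u r = 0%N.
Hypothesis hu : forall i, (i < r)%N -> (u i.+1 <= u i <= (u i.+1).+1)%N.
Local Notation DD := (r.+1 * n)%N.
Local Notation T := (Tsh R n r).
Local Notation o := (column_order D c).
Local Notation X z p := (@Xg R n r M D c z p).
Local Notation eg := (eg D c u).
Variable Q : nat -> M -> 'M[C]_DD.
Hypothesis hQ : forall x, exists z E, pkg D Phi c u x z E /\
  forall i, (i <= r)%N -> \forall w \near z x, Q i (cinv z w) = orthp (E i w).

Lemma Q_at x : exists z E, [/\ pkg D Phi c u x z E, (forall i, (i <= r)%N -> \forall w \near z x, Q i (cinv z w) = orthp (E i w)) &
  forall i, (i <= r)%N -> Q i x = orthp (E i (z x)) /\ packat (E i) (z x)].
Proof.
have [z [E [pE e]]] := hQ x; exists z, E; split=> // i ir.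
have [hz zx hp _ _] := pE; split; last exact: nbhs_singleton (hp i ir).2.
by have := nbhs_singleton (e i ir); rewrite (chartK hz zx).
Qed.

Lemma Q_inv i x : (i <= r)%N -> inv_proj (Q i x).
Proof.
by move=> ir; have [z [E [_ _ /(_ i ir)[-> pE]]]] := Q_at x; exact: pack_proj.
Qed.

Lemma Q_sub i x : (i < r)%N -> Q i x *m Q i.+1 x = Q i.+1 x.
Proof.
move=> ir; have [z [E [[hz zx hp nE _] _ h]]] := Q_at x.
have [-> [EE _ _ _]] := h i (ltnW ir); have [-> [EE1 _ _ _]] := h i.+1 ir.
have [p1 _] := hp i (ltnW ir); have [p2 _] := hp i.+1 ir.
apply: orthp_sub => //; apply: (nbhs_singleton (mhol_eq (mholM p1 p2) p2 _)).
apply: filterS nE => w [_ _ _ sw].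
by apply: Sp_le (sw i.+1 ir) (sw i (ltnW ir)) _ (leqnSn i) => j k; exact: (eg_le D c hu).
Qed.

Lemma Q_Tsub i x : (i < r)%N -> Q i.+1 x *m T *m Q i x = T *m Q i x.
Proof.
move=> ir; have [z [E [[hz zx hp nE _] _ h]]] := Q_at x.
have [-> [EE _ _ _]] := h i (ltnW ir); have [-> [EE1 _ _ _]] := h i.+1 ir.
have [p1 _] := hp i (ltnW ir); have [p2 _] := hp i.+1 ir.
have p3 := mholM (mhol_cst (z x) T) p1.
apply: orthp_Tsub => //; apply: (nbhs_singleton (mhol_eq (mholM p2 p3) p3 _)).
apply: filterS nE => w [_ _ _ sw].
by apply: Sp_T (sw i.+1 ir) (sw i (ltnW ir)) _ (leqnn _) => j k; exact: (eg_leS D c hu).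
Qed.

Lemma Q_jlb i x a : (i <= r)%N -> (i <= a)%N -> Q i x *m jlb R n r a = jlb R n r a.
Proof.
move=> ir ia; have [z [E [[hz zx hp nE _] _ h]]] := Q_at x.
have [-> [EE _ _ _]] := h i ir; have [p1 _] := hp i ir.
apply/(orthp_fix _ EE); have p2 := mhol_cst (z x) (jlb R n r a).
apply: (nbhs_singleton (mhol_eq (mholM p1 p2) p2 _)).
by apply: filterS nE => w [_ _ _ /(_ i ir)[_ f _]]; exact: f.
Qed.

Lemma Q_0 x : Q 0 x = 1%:M.
Proof.
rewrite -[LHS]mulmx1 -(sum_jlb_blk R n r) mulmx_sumr; apply: eq_bigr => a _.
by rewrite mulmxA Q_jlb.
Qed.

(** Successive subspaces W_(i-1) and W_i differ by one uniton factor, whose projection is [Q0];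
    index 0 is a placeholder. *)
Definition al i x : {vspace 'cV[C]_n} := if i is i'.+1 then fixv (Q0 (Q i' x) (Q i x)) else 0%VS.

Lemma oproj_al i x : (i < r)%N -> oproj (al i.+1 x) = Q0 (Q i x) (Q i.+1 x).
Proof.
move=> ir.
have [h1 h2] := Q0_proj (Q_inv x (ltnW ir)) (Q_inv x ir) (Q_sub x ir) (Q_Tsub x ir).
exact: oproj_fixv.
Qed.

Lemma partial_productE i p l : (i <= r)%N -> circle l -> partial_product al i p l = PhiP (Q i p) l.
Proof.
move=> + hl; elim: i => [_|i IH ir]; first by rewrite Q_0 PhiP_id.
rewrite [LHS]/= (IH (ltnW ir)) /uniton_factor oproj_al //.
rewrite -(two_PhiP (Q_inv p (ltnW ir)) (Q_inv p ir) (Q_sub p ir) (Q_Tsub p ir) hl) mulmxA.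
by rewrite (PhiP_unitary (Q_inv p (ltnW ir)) hl) mul1mx.
Qed.

Lemma inv_partial_product i p l : (i < r)%N -> circle l ->
  invmx (partial_product al i p l) = \sum_(s < i.+1) l ^- s *: Scoef (Q i p) s.
Proof.
move=> ir hl; have iQ := Q_inv p (ltnW ir).
rewrite (partial_productE p (ltnW ir) hl) (invmx_unitary (PhiP_unitary iQ hl)) (PhiP_adj_expand iQ).
rewrite (sum_trunc (F := fun s => (l^*) ^+ s *: Scoef (Q i p) s) (ltnW ir)).
  by apply: eq_bigr => s _; rewrite conj_circle // exprVn.
by case=> // s lt; rewrite (Scoef0 iQ) ?scaler0 // Q_jlb // ltnW.
Qed.

Lemma partial_local i x : (i <= r)%N -> exists z (E : C -> 'M[C]_DD), local_form (partial_product al i) x z 0 E.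
Proof.
move=> ir; have [z [E [[hz zx hp _ _] e _]]] := Q_at x; exists z, (E i); split=> //; first exact: hp.
apply: filterS (e i ir) => w ew l hl.
by rewrite expr0 scale1r (partial_productE _ ir hl) ew.
Qed.

Lemma partial_ES i : (i <= r)%N -> extended_solution (@unitary_group R n) (partial_product al i).
Proof.
move=> ir; apply: (extended_solution_of_local _ (@unitary_group1 R n) (@unitary_groupM R n) (@unitary_groupV R n) (@unitary_group_closed R n)).
- by [].
- by move=> x; have [z [E h]] := partial_local x ir; exists z, 0%N, r, E.
- by move=> p l hl; rewrite (partial_productE _ ir hl); apply/unitary_groupP; exact: (PhiP_unitary (Q_inv p ir) hl).
Qed.

Lemma product_solution (Phi' : M -> loop R n) : locES Phi' -> (forall p l, ~ D p -> circle l -> Phi' p l = Phi p l) ->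
  forall p l, circle l -> Phi' p l = partial_product al r p l.
Proof.
move=> loc eq p l hl; have [z1 [N1 [r1 [E1 h1]]]] := loc p.
have [z2 [E2 h2]] := partial_local p (leqnn r).
apply: (local_form_eq h1 h2 _ hl).
have [z [E [[hz zp _ nE nPhi] e _]]] := Q_at p.
apply: (dnear_chart hz zp); apply: filterS (near2D (near2D nE nPhi) (dnbhs_of_nbhs (e r (leqnn r)))).
move=> w [[[[nD _] _ _ _] h] ew] l' hl'.
by rewrite (eq _ _ nD hl') (h l' hl') (partial_productE _ (leqnn r) hl') ew.
Qed.

Section Smooth.
Variable i : nat.
Hypothesis ir : (i < r)%N.
Let K x := Q0 (Q i x) (Q i.+1 x).

Lemma K_idem x : K x *m K x = K x.
Proof. exact: (Q0_proj (Q_inv x (ltnW ir)) (Q_inv x ir) (Q_sub x ir) (Q_Tsub x ir)).2. Qed.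

(** At l = -1 the factor pi + l pi^perp is 2 pi - 1, which expresses the projection through loops
    already known to be continuous. *)
Lemma K_two x : K x = 2^-1 *: (1%:M + (PhiP (Q i x) (-1))^t* *m PhiP (Q i.+1 x) (-1)).
Proof.
have cm1 : circle (-1 : C) by apply/circleE; rewrite nrmN nrm1.
rewrite (two_PhiP (Q_inv x (ltnW ir)) (Q_inv x ir) (Q_sub x ir) (Q_Tsub x ir) cm1) -/(K x).
by apply/matrixP => a b; rewrite !mxE; field.
Qed.

Lemma K_cont p z (E : nat -> C -> 'M[C]_DD) : coords z -> cdom z p -> pack (z p) (E i) -> pack (z p) (E i.+1) ->
  (\forall w \near z p, Q i (cinv z w) = orthp (E i w)) -> (\forall w \near z p, Q i.+1 (cinv z w) = orthp (E i.+1 w)) ->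
  mcont (z p) (fun w => K (cinv z w)).
Proof.
move=> hz zp p1 p2 e1 e2.
have cm1 : circle (-1 : C) by apply/circleE; rewrite nrmN nrm1.
have c0 : mcont (z p) (fun w => (PhiP (orthp (E i w)) (-1))^t* *m PhiP (orthp (E i.+1 w)) (-1)).
  by apply: mcontM; [apply: mcont_adj|]; exact: mcont_PhiP.
have c1 := mcontZ (c := 2^-1) (mcontD (@mcont_cst R (z p) n n 1%:M) c0).
by apply: mcont_near c1 => //; apply: filterS (nearI e1 e2) => w [h1 h2]; rewrite K_two h1 h2.
Qed.

Lemma K_smooth z x : coords z -> chart_image z setT (mkC x.1 x.2) ->
  exists O : set (R * R)%type, [/\ open O, O x & smoothM O (fun x => K (cinv z (mkC x.1 x.2)))].
Proof.
move=> hz [p [zp _] zpx]; pose l (x : R * R) : C := mkC x.1 x.2.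
have lD (h : R) (y v : R * R) : l (h *: v + y) = toC h * l v + l y.
  by apply: cplxP; rewrite ?reD ?imD ?reM ?imM /l /toC /re /im /= ?mul0r ?subr0 ?addr0.
have cl : continuous l by exact: continuous_mkC.
have [z' [E [[hz' zp' hp _ _] e _]]] := Q_at p.
have H m : (m <= r)%N -> \forall w \near z p, (mcdiff (fun w => E m (trans z z' w)) w /\
    E m (trans z z' w) *m E m (trans z z' w) = E m (trans z z' w)) /\ Q m (cinv z w) = orthp (E m (trans z z' w)).
  move=> mr; have [hE nE] := pack_trans hz hz' zp zp' (hp m mr).
  have n1 := nearI (trans_near hz hz' zp zp' (e m mr)) (trans_inv hz hz' zp zp').
  apply: filterS (nearI (nearI (mhol_mcdiff hE) nE) n1) => w [[h1 [h2 _ _ _]] [h3 h4]].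
  by split=> //; rewrite -h4.
have [d d0 Hd] := (nbhsCP _ _).1 (nearI (H i (ltnW ir)) (H i.+1 ir)).
rewrite zpx -/(l x) in Hd.
pose O : set C := [set u | nrm (u - l x) < d].
have oO : open O.
  rewrite openE => y Oy; apply/nbhsCP; exists (d - nrm (y - l x)); first by rewrite subr_gt0.
  move=> v; rewrite ltrBrDr => hv; apply: le_lt_trans hv.
  by rewrite -{1}(subrK y v) -addrA; exact: nrmD.
have oU : open (l @^-1` O) by move/continuousP: cl; exact.
exists (l @^-1` O); split=> //; first by rewrite /O /= subrr nrm0.
have sm1 : smoothM (l @^-1` O) (fun x => orthp (E i (trans z z' (l x)))).
  by apply: (smoothM_orthp (E := fun w => E i (trans z z' w)) lD cl oO) => w /Hd[[h _] _].
have sm2 : smoothM (l @^-1` O) (fun x => orthp (E i.+1 (trans z z' (l x)))).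
  by apply: (smoothM_orthp (E := fun w => E i.+1 (trans z z' w)) lD cl oO) => w /Hd[_ [h _]].
have sW (P : R * R -> 'M[C]_DD) : smoothM (l @^-1` O) P -> smoothM (l @^-1` O) (fun x => wandering (P x)).
  move=> sP; have sP' : smoothM (l @^-1` O) (fun x => P x - T *m P x *m T^t*).
    apply: smoothMB => //; apply: smoothM_mul => //; last exact: smoothM_cst.
    by apply: smoothM_mul => //; exact: smoothM_cst.
  by apply: smoothM_ext sP' => // y _; rewrite wanderingE.
have cst q m (A : 'M[C]_(q, m)) : smoothM (l @^-1` O) (fun=> A) by exact: smoothM_cst.
have s0 := smoothM_mul oU (smoothM_mul oU (smoothM_mul oU (cst _ _ (ev n r 1)) (sW _ sm1)) (sW _ sm2)) (cst _ _ ((ev n r 1)^t*)).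
by apply: (smoothM_ext oU _ s0) => y /Hd[[_ h1] [_ h2]]; rewrite -h1 -h2; exact: erefl.
Qed.

Lemma al_subbundle : subbundle (al i.+1).
Proof.
move=> p; have [z [E [[hz zp hp _ _] e _]]] := Q_at p.
pose U q := K q *m K p + (1%:M - K q) *m (1%:M - K p).
have cK := K_cont hz zp (hp i (ltnW ir)) (hp i.+1 ir) (e i (ltnW ir)) (e i.+1 ir).
have cU : mcont (z p) (fun w => U (cinv z w)).
  have c1 := mcontM cK (@mcont_cst R (z p) n n (K p)).
  have c2 := mcontM cK (@mcont_cst R (z p) n n (1%:M - K p)).
  have c3 := mcontD c1 (mcontD (@mcont_cst R (z p) n n (1%:M - K p)) (mcontZ (c := -1) c2)).
  by apply: mcont_near c3; apply: nearWC => w; rewrite /U mulmxBl mul1mx scaleN1r.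
have nU : \forall q \near p, U q \in unitmx.
  apply: (near_chart_inv hz zp).
  have U1 : \det (U (cinv z (z p))) = 1.
    by rewrite (chartK hz zp) /U K_idem mulmxBl mul1mx mulmxBr mulmx1 K_idem subrr subr0 addrC subrK det1.
  have := (cvgCP (nbhs_filter (z p)) _ _).1 (cont_det cU) 1 ltr01; apply: filterS => w hw.
  exact: unit_near_det U1 hw.
have : nbhs p [set q | U q \in unitmx] := nU; rewrite nbhsE => -[V [oV Vp] VU].
pose B := vbasis (al i.+1 p).
exists V, (\dim (al i.+1 p)), (fun a q => U q *m tnth B a); split=> //.
- move=> a z' hz'; apply/smooth_onP => a' b' k.
  suff L (x : R * R) : chart_image z' V (mkC x.1 x.2) -> exists2 O, O x &
      smoothM O (fun x => U (cinv z' (mkC x.1 x.2)) *m tnth B a).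
    by split; apply: Ck_local => x /L[]O Ox sO; exists O => //; case: (sO a' b' k).
  move=> [q [z'q _] zqx]; have [W [oO Ox sO]] := K_smooth hz' (ex_intro2 _ _ q (conj z'q I) zqx).
  exists W => //; apply: smoothM_mul => //; last exact: smoothM_cst.
  have c1 (A : 'M[C]_n) : smoothM W (fun=> A) by exact: smoothM_cst.
  exact: (smoothMD oO (smoothM_mul oO sO (c1 (K p))) (smoothM_mul oO (smoothMB oO (c1 1%:M) sO) (c1 (1%:M - K p)))).
- move=> q Vq; have := fixv_transport (K_idem q) (K_idem p) (VU q Vq) (vbasisP (al i.+1 p)).
  suff -> : [seq U q *m tnth B a | a <- enum 'I_(\dim (al i.+1 p))] = [seq U q *m v | v <- vbasis (al i.+1 p)] by [].
  transitivity [seq U q *m v | v <- [seq tnth B a | a <- enum 'I_(\dim (al i.+1 p))]]; last by rewrite map_tnth_enum.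
  exact: (map_comp (fun v => U q *m v) (tnth B) _).
Qed.

Lemma al_uniton : uniton (partial_product al i) (al i.+1).
Proof. by split; [exact: partial_ES (ltnW ir) | exact: al_subbundle | exact: partial_ES ir]. Qed.

End Smooth.
End Unitons.

(** * The exceptional set and the formula for one step *)

Section Formulas.
Variables (R : realType) (n : nat) (M : riemann_surface R).
Local Notation C := (cplx R).
Variables (D : set M) (G S : set 'M[C]_n) (Psi Phi : M -> loop R n) (c : M -> int -> 'M[C]_n).
Hypothesis hG : compact_subgroup G.
Hypothesis hD : discrete_subset D.
Hypothesis hIw : forall p, ~ D p -> iwasawa_unitary_part G (Psi p) (Phi p).
Hypothesis hC : forall z p, coords z -> cdom z p -> ~ D p ->
  Lambda_plus S (fun l => l *: (invmx (Psi p l) *m zderiv z 1 (fun q => Psi q l) p)).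
Hypothesis hmero : meromorphic_family D Psi.
Hypothesis hholo : holomorphic_family (~` D) Psi.
Hypothesis hc : forall p, ~ D p -> laurent_expansion (Psi p) (c p).
Hypothesis hsm : forall p, ~ D p -> smooth_loop (Psi p).
Variables (r : nat) (u : nat -> nat).
Hypothesis hGr : forall p, ~ D p -> Gr r (Wspace (Psi p)).
Hypothesis ur : u r = 0%N.
Hypothesis hu : forall i, (i < r)%N -> (u i.+1 <= u i <= (u i.+1).+1)%N.
Local Notation DD := (r.+1 * n)%N.
Local Notation Tp := (Tpow R n r).
Local Notation o := (column_order D c).
Local Notation X z p := (@Xg R n r M D c z p).
Local Notation eg := (eg D c u).

Variable Q : nat -> M -> 'M[C]_DD.
Hypothesis hQ : forall x, exists z E, pkg D Phi c u x z E /\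
  forall i, (i <= r)%N -> \forall w \near z x, Q i (cinv z w) = orthp (E i w).

(** Outside this set one chart shows all the W_i as spans of generators. It need not be the chart of
    the formula, so [step_formula] passes between them by [Sp_chart]. *)
Definition exceptional : set M := [set p | ~ (good D c p /\ exists z (E : nat -> 'M[C]_DD), [/\ coords z, cdom z p &
  forall i, (i <= r)%N -> [/\ E i *m E i = E i, Q i p = orthp (E i) & Sp (eg i) i (X z p) (E i)]])].

Lemma exceptional_discrete : discrete_subset exceptional.
Proof.
move=> x; have [z [E [[hz zx hp nE _] e]]] := hQ x.
apply: (dnear_chart hz zx).
have n1 : \forall w \near (z x)^', forall i : 'I_r.+1, Q i (cinv z w) = orthp (E i w) /\ E i w *m E i w = E i w.
  apply: (filter_forall_fin (dnbhs_filter _)) => i; apply: dnbhs_of_nbhs.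
  have ir : (i <= r)%N := ltn_ord i.
  by apply: filterS (nearI (e i ir) (hp i ir).2) => w [h [h' _ _ _]].
apply: filterS (near2D nE n1) => w [[gw cw ew sw] h]; apply; split=> //.
exists z, (fun i => E i w); split=> // i ir; have [h1 h2] := h (Ordinal (ir : i < r.+1)%N).
by split=> //; exact: sw.
Qed.

Lemma Lder_low j (i : int) k z p : ~ D p -> coords z -> cdom z p -> i < (o j)%:Z -> Lder c j i k z p = 0.
Proof.
move=> nD hz zp lt; apply/matrixP => a b; rewrite !mxE.
have z0 : \forall w \near z p, 0 = col j (c (cinv z w) i) a b.
  apply: filterS (chart_inv_near hz zp (notD_near hD nD)) => w nw.
  suff -> : col j (c (cinv z w) i) = 0 by rewrite mxE.
  case: i lt => i lt; first exact: column_orderP nw.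
  have -> : c (cinv z w) (Negz i) = 0 by apply: (Gr_noneg (hsm nw) (hGr nw) (hc nw)).
  by apply/matrixP => a' b'; rewrite !mxE.
by rewrite -(nbhs_singleton (derive1n_near k (hol_cst (z p) 0) z0)) derive1n_zero.
Qed.

Section Step.
Variables (i : nat) (z : chart R M) (p : M).
Hypotheses (ir : (i < r)%N) (hz : coords z) (zp : cdom z p) (nDp : ~ D p) (nEp : ~ exceptional p).

Definition fterm j k : 'cV[C]_n := \sum_(s < i.+1) Scoef (Q i p) s *m
  (if (eg i.+1 j k <= s)%N then Lder c j (s - eg i.+1 j k + o j)%N%:Z k z p else 0).

(** All terms lie in the uniton, while those with equal exponents at most i already span it. Any
    index set between these two gives the same span, which is why formulae with different index
    ranges agree. *)
Lemma step_formula : (forall j k, fterm j k \in al Q i.+1 p) /\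
  forall B : {vspace 'cV[C]_n}, (forall j k, eg i j k = eg i.+1 j k -> (eg i.+1 j k <= i)%N -> fterm j k \in B) ->
    (al Q i.+1 p <= B)%VS.
Proof.
have [gp [z' [E [hz' zp' hE]]]] := contrapT nEp.
have [EE e1 s1] := hE i (ltnW ir); have [EE' e2 s2] := hE i.+1 ir.
have {}s1 := Sp_chart (@eg_mono R n M D c u i) gp hz' hz zp' zp s1.
have {}s2 := Sp_chart (@eg_mono R n M D c u i.+1) gp hz' hz zp' zp s2.
have i1 : inv_proj (orthp (E i)) by rewrite -e1; exact: (Q_inv hQ _ (ltnW ir)).
have i2 : inv_proj (orthp (E i.+1)) by rewrite -e2; exact: (Q_inv hQ _ ir).
have l1 j k : (eg i j k <= eg i.+1 j k)%N by exact: (eg_le D c hu).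
have l2 j k : (eg i.+1 j k <= (eg i j k).+1)%N by exact: (eg_leS D c hu).
have fE j k : fterm j k = fvec (eg i.+1) i (X z p) (E i) j k.
  rewrite /fterm /fvec e1; apply: eq_bigr => s _; congr (_ *m _).
  have sr : (s <= r)%N by apply: leq_trans (ltnW ir); rewrite -ltnS; exact: ltn_ord.
  rewrite mulmxA blk_Tpow //; case: ifP => h; last by rewrite mul0mx.
  by rewrite blk_vecp //; apply: leq_trans sr; exact: leq_subr.
have alE : al Q i.+1 p = fixv (Q0 (orthp (E i)) (orthp (E i.+1))) by rewrite /al e1 e2.
split=> [j k|B hB].
  by rewrite fE alE; exact: (fvec_mem (ltnW ir) EE EE' i1 i2 s1 s2 l1 l2).
rewrite alE; apply: (fixv_sub (ltnW ir) EE EE' i1 i2 s1 s2 l1) => j k h1 h2.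
by rewrite -fE; exact: hB.
Qed.

Lemma ftermE j k (idx : nat -> int) : (forall s : nat, idx s = s%:Z - (eg i.+1 j k)%:Z + (o j)%:Z) ->
  fterm j k = \sum_(s < i.+1) Scoef (Q i p) s *m Lder c j (idx s) k z p.
Proof.
move=> h; apply: eq_bigr => s _; congr (_ *m _); rewrite h.
case: leqP => es; first by congr (Lder _ _ _ _ _ _); lia.
by rewrite Lder_low //; lia.
Qed.

End Step.

Lemma unitons_of_formula (F : nat -> (nat -> 'M[C]_n) -> chart R M -> M -> {vspace 'cV[C]_n}) (Phi' : M -> loop R n) :
  locES Phi' -> (forall p l, ~ D p -> circle l -> Phi' p l = Phi p l) ->
  (forall i z p, (i < r)%N -> coords z -> cdom z p -> ~ D p -> ~ exceptional p ->
    al Q i.+1 p = F i.+1 (fun s => Scoef (Q i p) s) z p) ->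
  unitons_from D r F Phi'.
Proof.
move=> loc eq hF; exists (al Q), (fun i s p => Scoef (Q i p) s); split.
- by move=> i p l ir hl; exact: (inv_partial_product hu hQ).
- case=> // i /andP[_ ir]; split; first exact: (al_uniton hu hQ).
  by exists exceptional; [exact: exceptional_discrete | move=> p z nD nE hz zp; exact: hF].
- exact: (product_solution hu hQ).
Qed.

End Formulas.

Theorem theorem4p8 (R : realType) (n : nat) (M : riemann_surface R)
    (D : set M) (G : set 'M[cplx R]_n) (Psi Phi : M -> loop R n)
    (c : M -> int -> 'M[cplx R]_n)
    (hD : discrete_subset D)
    (hG : compact_subgroup G)
    (hPsi : complex_extended_solution G (~` D) Psi)
    (hPsi_alg : forall p, ~ D p -> Lambda_alg (complexification G) (Psi p))
    (hPsi_mero : meromorphic_family D Psi)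
    (hPhi : forall p, ~ D p -> iwasawa_unitary_part G (Psi p) (Phi p))
    (hc : forall p, ~ D p -> laurent_expansion (Psi p) (c p)) :
  exists Phi' : M -> loop R n,
    (forall p l, ~ D p -> circle l -> Phi' p l = Phi p l) /\
    extended_solution G Phi' /\
    columns_meromorphic_basis D Psi /\
    (forall r : nat, (forall p, ~ D p -> Gr r (Wspace (Psi p))) ->
       unitons_from D r (segal_formula c) Phi' /\
       (forall step : nat -> filtration_step,
          unitons_from D r
            (mixed_formula D c (uhlenbeck_count step r)) Phi') /\
       unitons_from D r (uhlenbeck_formula D c r) Phi') /\
    (forall d : nat, (forall p, ~ D p -> poly_loop d (Psi p)) ->
       (exists e : nat, forall p, poly_loop e (Phi' p)) /\
       ((forall p, ~ D p -> Gr d (Wspace (Psi p))) ->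
          forall p, poly_loop d (Phi' p))).
Proof.
have [hPlus hHolo hC] := hPsi.
have hC' z p : coords z -> cdom z p -> ~ D p ->
    Lambda_plus (complex_lie_algebra G) (fun l => l *: (invmx (Psi p l) *m zderiv z 1 (fun q => Psi q l) p)).
  by move=> hz zp nD; exact: hC.
have hsm p : ~ D p -> smooth_loop (Psi p) by move=> nD; have [[]] := hPsi_alg p nD.
have [Phi' [eq loc hGl]] := solution_extends hG hD hPhi hC' hPsi_mero hHolo hc.
exists Phi'; split=> //; split; first exact: (extended_solution_of_locES hG loc hGl).
split; first exact: (columns_basis hG hPhi hPsi_mero hsm).
split=> [r hGr|d hd]; last exact: (polynomial_solution hG hD hPhi loc eq hd).
(* The three formulae are one statement with different u, counting Uhlenbeck steps. What remains for
   each is an equality of spans between the two bounds of [step_formula]. *)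
have main (u : nat -> nat) F : u r = 0%N -> (forall i, (i < r)%N -> (u i.+1 <= u i <= (u i.+1).+1)%N) ->
    (forall (Q : nat -> M -> 'M[cplx R]_(r.+1 * n)) i z p, (forall j k, fterm D c u Q i z p j k \in al Q i.+1 p) ->
      (forall B : {vspace 'cV[cplx R]_n}, (forall j k, eg D c u i j k = eg D c u i.+1 j k -> (eg D c u i.+1 j k <= i)%N ->
         fterm D c u Q i z p j k \in B) -> (al Q i.+1 p <= B)%VS) ->
      (forall j k (idx : nat -> int), (forall s : nat, idx s = s%:Z - (eg D c u i.+1 j k)%:Z + (column_order D c j)%:Z) ->
         fterm D c u Q i z p j k = \sum_(s < i.+1) Scoef (Q i p) s *m Lder c j (idx s) k z p) ->
      (i < r)%N -> al Q i.+1 p = F i.+1 (fun s => Scoef (Q i p) s) z p) ->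
    unitons_from D r F Phi'.
  move=> ur hu hF.
  have [Q hQ] := filtration hG hD hPhi hC' hPsi_mero hc hsm hGr ur.
  apply: (unitons_of_formula hu hQ loc eq) => i z p ir hz zp nD nE.
  have [h1 h2] := step_formula hu hQ ir hz zp nE.
  apply: hF => // j k idx hidx; exact: (ftermE hD hc hsm hGr ur Q ir hz zp nD hidx).
split; last split.
- apply: (main (fun=> 0%N)) => // Q i z p f1 f2 f3 ir; rewrite /segal_formula.
  set Y := (Y in vspan Y); apply/eqP; rewrite eqEsubv; apply/andP; split.
    (* With u = 0 the bound reads o(j) + k <= i, whence k <= i; the formula is taken at index i + 1,
       so this is its range. *)
    apply: f2 => j k _ h; apply: (vspanP Y).1; exists j, k; split; first by move: h; rewrite /eg; lia.
    by apply: (f3 j k (fun s => s%:Z - k%:Z)) => s; rewrite /eg; lia.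
  apply: (vspanP Y).2 => v [j [k [_ ->]]]; rewrite -(f3 j k (fun s => s%:Z - k%:Z)) //.
  by move=> s; rewrite /eg; lia.
- move=> step; apply: (main (uhlenbeck_count step r)).
  + by rewrite /uhlenbeck_count big_geq.
  + move=> i ir; rewrite /uhlenbeck_count [X in (_ <= X <= _)%N]big_ltn //.
    by case: is_uhlenbeck; rewrite ?add1n ?add0n ?leqnn ?leqnSn.
  move=> Q i z p f1 f2 f3 ir; rewrite /mixed_formula.
  move: f1 f2 f3; set u := uhlenbeck_count step r => f1 f2 f3.
  set Y1 := (Y in (vspan Y + _)%VS); set Y2 := (Y in (_ + vspan Y)%VS).
  (* The truncated subtraction o(j) + k - u is either genuine, and the index is s - k + u, or zero,
     and the index is s + o(j): these are the two spans of the mixed formula. *)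
  have g1 j k : (u i.+1 <= column_order D c j + k)%N -> fterm D c u Q i z p j k =
      \sum_(s < i.+1) Scoef (Q i p) s *m Lder c j (s%:Z - k%:Z + (u i.+1)%:Z) k z p.
    by move=> h; apply: (f3 j k (fun s => s%:Z - k%:Z + (u i.+1)%:Z)) => s; rewrite /eg; lia.
  have g2 j k : (column_order D c j + k < u i.+1)%N -> fterm D c u Q i z p j k =
      \sum_(s < i.+1) Scoef (Q i p) s *m Lder c j (s%:Z + (column_order D c j)%:Z) k z p.
    by move=> h; apply: (f3 j k (fun s => s%:Z + (column_order D c j)%:Z)) => s; rewrite /eg; lia.
  apply/eqP; rewrite eqEsubv; apply/andP; split.
    apply: f2 => j k _ h; have [h'|h'] := leqP (u i.+1) (column_order D c j + k).
      apply: (subvP (addvSl _ _)); apply: (vspanP Y1).1; exists j, k; split; last exact: g1.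
      by move: h; rewrite /eg; lia.
    apply: (subvP (addvSr _ _)); apply: (vspanP Y2).1; exists j, k; split; last exact: g2.
    lia.
  rewrite subv_add; apply/andP; split.
    by apply: (vspanP Y1).2 => v [j [k [h ->]]]; rewrite -g1 //; lia.
  by apply: (vspanP Y2).2 => v [j [k [h ->]]]; rewrite -g2 //; lia.
- apply: (main (fun i => (r - i)%N)); [by rewrite subnn | by move=> i ir; lia |].
  move=> Q i z p f1 f2 f3 ir; rewrite /uhlenbeck_formula.
  have g j k : (column_order D c j + k <= r - i.+1)%N -> fterm D c (fun i => (r - i)%N) Q i z p j k =
      \sum_(s < i.+1) Scoef (Q i p) s *m Lder c j (s%:Z + (column_order D c j)%:Z) k z p.
    by move=> h; apply: (f3 j k (fun s => s%:Z + (column_order D c j)%:Z)) => s; rewrite /eg; lia.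
  set Y := (Y in vspan Y); apply/eqP; rewrite eqEsubv; apply/andP; split.
    (* Here u drops by exactly 1, so equal truncated exponents must both be 0, that is, o(j) + k <=
       r - (i + 1). *)
    apply: f2 => j k h _; have h' : (column_order D c j + k <= r - i.+1)%N by move: h; rewrite /eg; lia.
    by apply: (vspanP Y).1; exists j, k; split=> //; exact: g.
  by apply: (vspanP Y).2 => v [j [k [h ->]]]; rewrite -g.
Qed.
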